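(* Let $X=(X_t)_{t\ge 0}$ be a real L\'evy process with no Gaussian component ($\sigma^2=0$) and L\'evy measure $\Pi$, and let $1/2<\kappa<1$. For $0<y\le 1$ and $\lambda>0$ put $$W(y):=\int_0^y\int_x^1 z\,\Pi^{(-)}(dz)\,dx,\qquad J(\lambda):=\int_0^1\exp\left\{-\lambda\left(\frac{y^{\frac{2\kappa-1}{\kappa}}}{W(y)}\right)^{\frac{\kappa}{1-\kappa}}\right\}\frac{dy}{y},$$ and $\lambda_J^*:=\inf\{\lambda>0:J(\lambda)<\infty\}\in[0,\infty]$ (infimum of the empty set is $+\infty$). Then $$\limsup_{t\downarrow 0}\frac{X_t}{t^\kappa}=+\infty\quad\text{a.s.}$$ if and only if one of the following holds: (i) $\int_0^1\overline{\Pi}^{(+)}(x^\kappa)\,dx=\infty$; or (ii) $\int_0^1\overline{\Pi}^{(+)}(x^\kappa)\,dx<\infty=\int_0^1\overline{\Pi}^{(-)}(x^\kappa)\,dx$ and $\lambda_J^*=\infty$. When (i) and (ii) fail, in greater detail: suppose (iii) $\int_0^1\overline{\Pi}(x^\kappa)\,dx<\infty$; or (iv) $\int_0^1\overline{\Pi}^{(+)}(x^\kappa)\,dx<\infty=\int_0^1\overline{\Pi}^{(-)}(x^\kappa)\,dx$ and $\lambda_J^*=0$. Then $\limsup_{t\downarrow 0}X_t/t^\kappa=0$ a.s. Alternatively, suppose (v) $\int_0^1\overline{\Pi}^{(+)}(x^\kappa)\,dx<\infty=\int_0^1\overline{\Pi}^{(-)}(x^\kappa)\,dx$ and $\lambda_J^*\in(0,\infty)$.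 Then $\limsup_{t\downarrow 0}X_t/t^\kappa=c$ a.s. for some constant $c\in(0,\infty)$.
   Context: The L\'evy process $X$ ($X_0=0$) has characteristic triplet $(\gamma,\sigma^2,\Pi)$ with $\sigma^2=0$, $\gamma\in\mathbb{R}$, and the L\'evy measure $\Pi$ is carried by $[-1,1]\setminus\{0\}$ with $\int x^2\,\Pi(dx)<\infty$; that is, $E[e^{i\theta X_t}]=e^{t\Psi(\theta)}$ with $$\Psi(\theta)=i\gamma\theta+\int_{[-1,1]}(e^{i\theta x}-1-i\theta x)\,\Pi(dx),\quad \theta\in\mathbb{R}.$$ $\Pi^{(-)}$ denotes the restriction to $[0,\infty)$ of the L\'evy measure of $-X$ (the image of $\Pi|_{(-\infty,0)}$ under $x\mapsto -x$). For $x>0$: $\overline{\Pi}^{(+)}(x)=\Pi((x,\infty))$, $\overline{\Pi}^{(-)}(x)=\Pi((-\infty,-x))$, $\overline{\Pi}(x)=\overline{\Pi}^{(+)}(x)+\overline{\Pi}^{(-)}(x)$. The integrand in $J(\lambda)$ is read with $\exp(-\infty)=0$ where $W(y)=0$. *)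

(* Defs.v *)
From HB Require Import structures.
From mathcomp Require Import all_boot all_order all_algebra.
From mathcomp Require Import all_classical all_reals all_analysis.
From mathcomp Require Import complex.

Set Implicit Arguments.
Unset Strict Implicit.
Unset Printing Implicit Defensive.

Import Order.TTheory GRing.Theory Num.Theory.
Import numFieldNormedType.Exports.

Local Open Scope classical_set_scope.
Local Open Scope ring_scope.
Local Open Scope complex_scope.

Definition cexp (R : realType) (z : R[i]) : R[i] :=
  (expR (complex.Re z))%:C *
  (cos (complex.Im z) +i* sin (complex.Im z)).

Definition cintegral (R : realType) d (T : measurableType d)
    (mu : {measure set T -> \bar R}) (D : set T) (f : T -> R[i]) : R[i] :=
  (\int[mu]_(x in D) complex.Re (f x)) +i* (\int[mu]_(x in D) complex.Im (f x)).

Section levy_process.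
Context (R : realType) d (T : measurableType d) (P : probability T R).

(* The product rule over subfamilies follows by taking A i := setT. *)
Definition mutually_independent n (Y : 'I_n -> T -> R) : Prop :=
  forall A : 'I_n -> set (measurableTypeR R), (forall i, measurable (A i)) ->
    P (\bigcap_(i in [set: 'I_n]) (Y i @^-1` A i)) =
    (\prod_(i < n) P (Y i @^-1` A i))%E.

(* Only the times t >= 0 matter; the values X t for t < 0 are junk. *)
Record levy_process (X : R -> T -> R) : Prop := LevyProcess {
  levy_measurable : forall t : R, 0 <= t -> measurable_fun setT (X t);
  levy_start : {ae P, forall w, X 0 w = 0};
  levy_indep : forall (n : nat) (t : nat -> R), 0 <= t 0%N ->
    (forall i, t i <= t i.+1) ->
    mutually_independent (fun (i : 'I_n) w => X (t i.+1) w - X (t i) w);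
  levy_stationary : forall s t : R, 0 <= s -> 0 <= t ->
    forall A : set (measurableTypeR R), measurable A ->
    P [set w | A (X (s + t) w - X s w)] = P [set w | A (X t w)];
  levy_cadlag : {ae P, forall w, forall t : R, 0 <= t ->
    (X u w @[u --> t^'+] --> X t w) /\
    (0 < t -> cvg (X u w @[u --> t^'-]))} }.

(* The compensator is theta * x on the whole of [-1, 1]: this is the
   Levy-Khintchine exponent for a Levy measure carried by [-1, 1]. *)
Definition levy_exponent (gamma sigma2 : R)
    (Pi : {measure set (measurableTypeR R) -> \bar R}) (theta : R) : R[i] :=
  'i * (gamma * theta)%:C - (sigma2 * theta ^+ 2 / 2)%:C +
  cintegral Pi `[(-1), 1]
    (fun x => cexp ('i * (theta * x)%:C) - 1 - 'i * (theta * x)%:C).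

Definition has_triplet (X : R -> T -> R) (gamma sigma2 : R)
    (Pi : {measure set (measurableTypeR R) -> \bar R}) : Prop :=
  forall t theta : R, 0 <= t ->
    cintegral P setT (fun w => cexp ('i * (theta * X t w)%:C)) =
    cexp (t%:C * levy_exponent gamma sigma2 Pi theta).

End levy_process.

Section levy_measure.
Context (R : realType).
Variables (Pi : {measure set (measurableTypeR R) -> \bar R}) (kappa : R).
Local Open Scope ereal_scope.
Local Notation leb := (@lebesgue_measure R).

Definition levy_measure_on_unit : Prop :=
  Pi (~` ([set` `[(-1)%R, 1%R] ] `\ 0%R)) = 0 /\
  \int[Pi]_x (x ^+ 2)%:E < +oo.

Definition tail_pos (x : R) : \bar R := Pi [set` `]x, +oo[ ].
Definition tail_neg (x : R) : \bar R := Pi [set` `]-oo, (- x)%R[ ].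
Definition tail (x : R) : \bar R := tail_pos x + tail_neg x.

(* Levy measure of -X restricted to [0, +oo[: image of Pi on ]-oo, 0[ under
   x |-> - x. *)
Definition neg_part : set (measurableTypeR R) -> \bar R :=
  pushforward (mrestr Pi (measurable_itv `]-oo, 0%R[)) (-%R : _ -> measurableTypeR R).

Definition W (y : R) : \bar R :=
  \int[leb]_(x in `]0%R, y]) \int[neg_part]_(z in `]x, 1%R]) z%:E.

(* Extended-real arithmetic gives the integrand the value 0 where W y = 0:
   a / 0 = +oo for a > 0, and expeR -oo = 0. *)
Definition J (lambda : R) : \bar R :=
  \int[leb]_(y in `]0%R, 1%R])
    (expeR (- (lambda%:E *
       poweR ((y `^ ((2 * kappa - 1) / kappa))%:E / W y)
             (kappa / (1 - kappa)))) * (y^-1)%:E).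

Definition lambdaJ : \bar R :=
  ereal_inf [set l%:E | l in [set l : R | (0 < l)%R /\ J l < +oo]].

End levy_measure.

Definition limsup_at0 (R : realType) (T : Type) (X : R -> T -> R) (kappa : R)
    (w : T) : \bar R :=
  limf_esup (fun t : R => (X t w / t `^ kappa)%:E) (0 : R)^'+.

(* Main.v *)
Require Import Defs.
From HB Require Import structures.
From mathcomp Require Import all_boot all_order all_algebra.
From mathcomp Require Import all_classical all_reals all_analysis.
From mathcomp Require Import complex measurable_realfun.
From mathcomp Require Import ring lra zify.

(* Only the marginal laws of [X] and the independence of its increments are
   used. Let [V y = W y / y], the integral of [min (x^2 / y, |x|)] against the
   negative part of the Levy measure. Tilting the increments of [X] over a fine
   mesh so as to avoid the negative jumps larger than about [y] shows that
   [X_t >= t V(y) / 3], up to errors due to the positive jumps, with probability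
   at least [exp (- t V(y) / y) / 4]; Chernoff's bound with parameter [1 / y]
   gives an upper bound of the same form. Take [t_n = rho^n] and
   [b_n = t_n^kappa] with [b_n / t_n = 2^n]. If [V(y_k)] is about [A 2^n] for a
   dyadic [y_k = 2^-k], the probability that [X_{t_n}] reaches the order
   [A b_n] is therefore about [exp (- A b_n / y_k)], where
   [b_n = (2^n)^(- kappa / (1 - kappa))]. Since [W y = y V y], summability over
   [k] of these probabilities is finiteness of [J(lambda)] for a [lambda]
   comparable to [A^(1 / (1 - kappa))]. Similarly the integral of the positive
   tail at [x^kappa] is comparable to the sum of the [t_n Pi (b_n, oo)], and if
   it is infinite then either the jumps themselves or, when [t_n Pi (b_n, oo)]
   is unbounded, the accumulated positive jumps make the limsup infinite.
   Ottaviani's inequality, a second Borel-Cantelli argument for increments and a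
   zero-one law pass from these marginal estimates to the limsup. *)

Set Implicit Arguments.
Unset Strict Implicit.
Unset Printing Implicit Defensive.

Import Order.TTheory GRing.Theory Num.Theory.
Import numFieldNormedType.Exports.
Import HBNNSimple.

Local Open Scope classical_set_scope.
Local Open Scope ring_scope.

(** * Elementary inequalities and real-valued integrals *)

Section real_inequalities.
Variable R : realType.
Implicit Types x y u : R.

(** Jumps of paths never appear: the bridge from the exponent to [Pi] is the limit [t * int h dPi]
    of [n * E h(X_{t/n})], for continuous [h] of linear growth vanishing near 0. It is read off the
    exponent for trigonometric functions and extended by approximation in the weight [x^2], which
    the second moment of [X] controls. Tilting each increment by a weight [w] then costs, through
    the Cauchy-Schwarz inequality, the factor [exp (- t * int (w - 1)^2 dPi)], as
    [2 (w - 1) - (w^2 - 1) = - (w - 1)^2]. A weight that suppresses negative jumps beyond [y] costs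
    at most [t V(y) / y] in the exponent and gains a drift of about [t V(y) / 2].

    The condition [kappa > 1/2] enters as [rho < 1/4]: truncated second moments in units of [b_n^2]
    then obey a backward recursion with contraction [4 rho], whereas mean overshoots in units of
    [b_n] are halved forwards. In the divergent half, many [k] may select the same [n]; the
    exponents then double with [k], so that each group of terms is dominated by its first. *)

Lemma expR_le_quad u : u <= 1 / 2 -> expR u <= 1 + u + 2 * u ^+ 2.
Proof.
move=> u12; have h : 0 < 1 - u by lra.
have e1 : 1 - u <= expR (- u) by have := expR_ge1Dx (- u).
have e2 : expR u <= (1 - u)^-1.
  by rewrite -[u]opprK expRN opprK lef_pV2// ?posrE ?expR_gt0.
apply: (le_trans e2); rewrite -[leLHS]mul1r ler_pdivrMr//.
(* [(1 - u) (1 + u + 2 u^2) = 1 + u^2 (1 - 2 u)]. The bound holds for arbitrarily negative [u], so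
   large jumps in the favourable direction are harmless in exponential estimates. *)
have : 0 <= u ^+ 2 * (1 - 2 * u) by rewrite mulr_ge0// ?sqr_ge0//; lra.
by rewrite !expr2; nra.
Qed.

Lemma norm_sin_le x : `|sin x| <= `|x|.
Proof.
wlog x0 : x / 0 < x.
  move=> H; have [x0|x0|<-] := ltgtP 0 x; first exact: H.
    by have := H (- x); rewrite sinN oppr_gt0 !normrN; exact.
  by rewrite sin0.
have [c _] := @MVT R sin cos 0 x x0 (fun z _ => is_derive_sin z)
  (continuous_subspaceT (@continuous_sin R)).
rewrite sin0 !subr0 => ->; rewrite normrM -[leRHS]mul1r ler_wpM2r//.
exact: cos_max.
Qed.

Lemma one_minus_cos_le x : 1 - cos x <= x ^+ 2 / 2.
Proof.
have e : 1 - cos x = 2 * sin (x / 2) ^+ 2.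
  have := cos_mulr2n (x / 2); rewrite cos2sin2.
  by rewrite (_ : x / 2 *+ 2 = x) ?mulr2n; [lra|rewrite -mulr2n; field].
have s2 : sin (x / 2) ^+ 2 <= (x / 2) ^+ 2.
  rewrite -[leLHS]real_normK ?num_real// -[leRHS]real_normK ?num_real//.
  by rewrite lerXn2r ?nnegrE// norm_sin_le.
by rewrite e; rewrite !expr2 in s2 *; lra.
Qed.

(** For [x > 0] the mean value theorem gives [sin x - x = - (1 - cos c) x] with [0 < c < x], and
    [1 - cos c <= min (c^2 / 2, 2) <= x]. A quadratic bound is the form wanted, because [Pi]
    integrates [x^2]. *)
Lemma sin_sub_le x : `|sin x - x| <= x ^+ 2.
Proof.
wlog x0 : x / 0 < x.
  move=> H; have [x0|x0|<-] := ltgtP 0 x; first exact: H.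
    have := H (- x); rewrite sinN sqrrN oppr_gt0 -opprD normrN; exact.
  by rewrite sin0 subrr normr0 expr2 mul0r.
have [c /[!in_itv]/= /andP[c0 cx]] := @MVT R sin cos 0 x x0
  (fun z _ => is_derive_sin z) (continuous_subspaceT (@continuous_sin R)).
rewrite sin0 !subr0 => ->.
rewrite (_ : cos c * x - x = - ((1 - cos c) * x)) ?normrN; last by ring.
have := cos_le1 c; have := one_minus_cos_le c; have := cos_geN1 c => h1 h2 h3.
rewrite ger0_norm; last by rewrite mulr_ge0//; lra.
have [x2|x2] := leP x 2.
  have c2 : c ^+ 2 / 2 <= x by rewrite expr2; nra.
  by rewrite [leRHS]expr2 ler_wpM2r ?(ltW x0)//; lra.
by rewrite [leRHS]expr2 ler_wpM2r ?(ltW x0)//; lra.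
Qed.

(* From [1 - v <= exp (- v)] at [v = u / (1 + u)]. *)
Lemma expR_div_le u : - 1 < u -> expR (u / (1 + u)) <= 1 + u.
Proof.
move=> u1; have h : 0 < 1 + u by lra.
have := expR_ge1Dx (- (u / (1 + u))).
have -> : 1 + - (u / (1 + u)) = (1 + u)^-1 by field; rewrite gt_eqF.
by rewrite expRN lef_pV2// posrE ?expR_gt0.
Qed.

End real_inequalities.

Section sequences_of_reals.
Variable R : realType.

Lemma cvg_rate (a : nat -> R) (l C : R) :
  (forall n, `|a n - l| <= C * n.+1%:R^-1) -> a n @[n --> \oo] --> l.
Proof.
move=> h; apply/cvgrPdist_le => e e0.
have ch : C * n.+1%:R^-1 @[n --> \oo] --> C * 0.
  by apply: cvgMr; exact: cvg_harmonic.
rewrite mulr0 in ch; move/cvgrPdist_le : ch => /(_ e e0); apply: filterS => n.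
rewrite sub0r normrN => hn; rewrite distrC; apply: (le_trans (h n)).
exact: le_trans (ler_norm _) hn.
Qed.

(** A bounded approximation of [y] by trigonometric functions, whose expectations the exponent
    determines; moments of [X] are reached through it. *)
Lemma cvg_nsin (y : R) : n.+1%:R * sin (n.+1%:R^-1 * y) @[n --> \oo] --> y.
Proof.
apply: (@cvg_rate _ _ (y ^+ 2)) => n; set u := n.+1%:R^-1.
have u0 : 0 < u by rewrite invr_gt0.
have uE : n.+1%:R = u^-1 by rewrite invrK.
have -> : n.+1%:R * sin (u * y) - y = u^-1 * (sin (u * y) - u * y).
  by rewrite uE mulrBr mulrA mulVf ?mul1r ?gt_eqF.
rewrite normrM gtr0_norm ?invr_gt0// ler_pdivrMl//.
by apply: (le_trans (sin_sub_le _)); rewrite exprMn expr2 -mulrA [u * y ^+ 2]mulrC.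
Qed.

Lemma continuous_maxr (f g : R -> R) : continuous f -> continuous g ->
  continuous (fun x => Order.max (f x) (g x)).
Proof. by move=> cf cg x; exact: (@continuous_max _ _ f g x (cf x) (cg x)). Qed.

Lemma continuous_minr (f g : R -> R) : continuous f -> continuous g ->
  continuous (fun x => Order.min (f x) (g x)).
Proof. by move=> cf cg x; exact: (@continuous_min _ _ f g x (cf x) (cg x)). Qed.

End sequences_of_reals.

Section real_integrals.
Context d (T : measurableType d) (R : realType) (mu : {measure set T -> \bar R}).
Implicit Types f g : T -> R.

(** Integrals are kept real-valued, with integrability as a separate predicate, so that the
    estimates are plain arithmetic in [R]. *)
Definition itg f := mu.-integrable setT (EFin \o f).
Definition It f : R := \int[mu]_x f x.

Lemma itg_le g f : measurable_fun setT f -> itg g ->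
  (forall x, `|f x| <= g x) -> itg f.
Proof.
move=> mf ig fg; apply: (le_integrable measurableT _ _ ig).
  exact/measurable_EFinP.
by move=> x _; rewrite /= lee_fin (le_trans (fg x))// ler_norm.
Qed.

Lemma itg_meas f : itg f -> measurable_fun setT f.
Proof. by move=> /measurable_int/measurable_EFinP. Qed.

Lemma itgD f g : itg f -> itg g -> itg (fun x => f x + g x).
Proof. by move=> h1 h2; have := integrableD measurableT h1 h2. Qed.

Lemma itgB f g : itg f -> itg g -> itg (fun x => f x - g x).
Proof. by move=> h1 h2; have := integrableB measurableT h1 h2. Qed.

Lemma itgZ k f : itg f -> itg (fun x => k * f x).
Proof. by move=> h1; have := integrableZl measurableT k h1. Qed.

Lemma It_le f g : itg f -> itg g -> (forall x, f x <= g x) -> It f <= It g.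
Proof. by move=> h1 h2 h; apply: le_Rintegral => // x _; exact: h. Qed.

Lemma It_ge0 f : (forall x, 0 <= f x) -> 0 <= It f.
Proof. by move=> h; apply: Rintegral_ge0. Qed.

Lemma ItD f g : itg f -> itg g -> It (fun x => f x + g x) = It f + It g.
Proof. by move=> h1 h2; rewrite /It RintegralD. Qed.

Lemma ItB f g : itg f -> itg g -> It (fun x => f x - g x) = It f - It g.
Proof. by move=> h1 h2; rewrite /It RintegralB. Qed.

Lemma ItZ k f : itg f -> It (fun x => k * f x) = k * It f.
Proof. by move=> h1; rewrite /It RintegralZl. Qed.

Lemma It_eq f g : (forall x, f x = g x) -> It f = It g.
Proof. by move=> h; congr It; apply/funext. Qed.

Lemma It0 : It (fun=> 0) = 0.
Proof. by rewrite /It Rintegral_cst// mul0r. Qed.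

Lemma itg0 : itg (fun=> 0).
Proof. exact: integrable0. Qed.

Lemma It_norm f : itg f -> `|It f| <= It (fun x => `|f x|).
Proof. by move=> h; exact: le_normr_Rintegral. Qed.

Lemma ItE f : itg f -> (\int[mu]_x (f x)%:E)%E = (It f)%:E.
Proof. by move=> h; rewrite /It /Rintegral fineK//; exact: integrable_fin_num. Qed.

Lemma It_sum (I : eqType) (s : seq I) (F : I -> T -> R) : (forall i, itg (F i)) ->
  itg (fun x => \sum_(i <- s) F i x) /\
  It (fun x => \sum_(i <- s) F i x) = \sum_(i <- s) It (F i).
Proof.
move=> h; elim: s => [|i s [h1 h2]].
  rewrite big_nil; split; last by under It_eq do rewrite big_nil; rewrite It0.
  by rewrite (_ : (fun=> _) = fun=> 0) ?itg0//; apply/funext => x; rewrite big_nil.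
have e : (fun x => \sum_(j <- i :: s) F j x) = fun x => F i x + \sum_(j <- s) F j x.
  by apply/funext => x; rewrite big_cons.
by rewrite e big_cons; split; [exact: itgD|rewrite ItD// h2].
Qed.

Lemma It_cvg (f_ : nat -> T -> R) f g : (forall n, measurable_fun setT (f_ n)) ->
  measurable_fun setT f -> itg g -> (forall n x, `|f_ n x| <= g x) ->
  (forall x, f_ ^~ x @ \oo --> f x) -> It (f_ n) @[n --> \oo] --> It f.
Proof.
move=> mf_ mf ig fg cf.
have h1 : {ae mu, forall x, setT x -> (fun n => (f_ n x)%:E) @ \oo --> (f x)%:E}.
  by apply: aeW => x _; apply: cvg_EFin; [exact: nearW|exact: cf].
have h2 : {ae mu, forall x n, setT x -> (`|(f_ n x)%:E| <= (EFin \o g) x)%E}.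
  by apply: aeW => x n _; rewrite /= lee_fin.
have [i1 _ c] := @dominated_convergence _ T R mu setT measurableT _ (EFin \o f)
  (EFin \o g) (fun n => proj2 (measurable_EFinP _ _) (mf_ n))
  (proj2 (measurable_EFinP _ _) mf) h1 ig h2.
rewrite (ItE i1) in c; move/fine_cvg : c; apply: cvg_trans; apply: near_eq_cvg.
by near=> n.
Unshelve. all: by end_near. Qed.

End real_integrals.

(** * The Weierstrass theorem by Bernstein polynomials *)

Section bernstein.
Variable R : realType.

(* The Bernstein polynomial of [f], written through the first step of a
   Bernoulli walk. *)
Fixpoint bern n (f : nat -> R) : {poly R} :=
  if n is m.+1 then 'X * bern m (f \o succn) + (1 - 'X) * bern m f
  else (f 0%N)%:P.

Lemma bernS n f x : (bern n.+1 f).[x] =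
  x * (bern n (f \o succn)).[x] + (1 - x) * (bern n f).[x].
Proof. by rewrite /= !hornerE. Qed.

(** The second moment of a binomial variable about [- c]. The shift [c] is general because the first
    step of the walk turns it into [1 + c]. *)
Lemma bern_quad n (a b c x : R) : (bern n (fun k => a + b * (k%:R + c) ^+ 2)).[x] =
  a + b * ((n%:R * x + c) ^+ 2 + n%:R * x * (1 - x)).
Proof.
elim: n c => [|n IH] c; first by rewrite /= hornerC !mul0r addr0 mulr0n.
rewrite bernS IH.
have -> : (fun k : nat => a + b * (k%:R + c) ^+ 2) \o succn =
    (fun k => a + b * (k%:R + (1 + c)) ^+ 2).
  by apply/funext => k /=; rewrite -natr1 addrA.
by rewrite IH -natr1; ring.
Qed.

(** [bern] is a positive operator that fixes constants, so a bound at the nodes passes to the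
    polynomial. *)
Lemma bern_le n f h (g x : R) : 0 <= x <= 1 ->
  (forall k, (k <= n)%N -> `|f k - g| <= h k) ->
  `|(bern n f).[x] - g| <= (bern n h).[x].
Proof.
move=> /andP[x0 x1]; elim: n f h => [|n IH] f h fh; first by rewrite /= !hornerC; exact: fh.
rewrite !bernS.
have -> : x * (bern n (f \o succn)).[x] + (1 - x) * (bern n f).[x] - g =
  x * ((bern n (f \o succn)).[x] - g) + (1 - x) * ((bern n f).[x] - g) by ring.
apply: (le_trans (ler_normD _ _)); rewrite !normrM ger0_norm// (@ger0_norm _ (1 - x)); last lra.
apply: lerD; apply: ler_wpM2l => //; [|lra|].
  by apply: IH => k kn; exact: fh.
by apply: IH => k kn; apply: fh; exact: leqW.
Qed.

(** Uniform continuity in the shape to which [bern_quad] applies: pairs closer than [1 / (n + 1)]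
    are absorbed by [e], the others by [2 B <= 2 B (n + 1)^2 (x - y)^2]. *)
Lemma continuous_modulus (G : R -> R) (e : R) : continuous G -> 0 < e ->
  exists2 K, 0 <= K & forall x y, 0 <= x <= 1 -> 0 <= y <= 1 ->
    `|G x - G y| <= e + K * (x - y) ^+ 2.
Proof.
move=> cG e0.
have cK := @segment_compact R 0 1.
have [B B0 HB] : exists2 B : R, 0 <= B & forall x, 0 <= x <= 1 -> `|G x| <= B.
  have : bounded_set (G @` `[0, 1]).
    by apply: compact_bounded; apply: continuous_compact => //; exact: continuous_subspaceT.
  move=> [M [_ HM]]; exists (`|M| + 1); first by rewrite addr_ge0.
  move=> x x01; apply: (HM (`|M| + 1)); first by rewrite (le_lt_trans (ler_norm _))// ltrDl.
  by exists x => //=; rewrite in_itv.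
pose Pr := fun (n : nat) (x : R) => forall y, `|x - y| < n.+1%:R^-1 -> `|G x - G y| <= e.
have nc := proj1 (compact_near_coveringP _) cK nat \oo Pr _.
have {}nc : \forall n \near \oo, `[(0:R), 1]%classic `<=` Pr n.
  apply: nc => x _; have /cvgrPdist_lt/(_ (e / 2)) := cG x.
  move=> /(_ (divr_gt0 e0 (ltr0n _ 2))) /nbhs_ballP[r /= r0 Hr].
  have r2 : 0 < r / 2 by rewrite divr_gt0.
  near=> x' n; move=> y; rewrite /= => xy.
  have n2 : n.+1%:R^-1 < r / 2 by near: n; exact: near_infty_natSinv_lt (PosNum r2).
  have bx : `|x - x'| < r / 2 by near: x'; exact: (nbhsx_ballx x (r / 2) r2).
  have h1 := Hr x' _; have h2 := Hr y _.
  have {}h1 : `|G x - G x'| < e / 2 by apply: h1; rewrite /ball/= (lt_trans bx)//; lra.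
  have {}h2 : `|G x - G y| < e / 2.
    apply: h2; rewrite /ball/= (_ : x - y = (x - x') + (x' - y)); last by ring.
    apply: (le_lt_trans (ler_normD _ _)); rewrite [ltRHS]splitr.
    by apply: ltrD => //; exact: lt_trans xy n2.
  rewrite (_ : G x' - G y = (G x - G y) - (G x - G x')); last by ring.
  by apply: (le_trans (ler_normB _ _)); lra.
have [n Hn] := filter_ex nc; exists (2 * B * n.+1%:R ^+ 2); first by rewrite !mulr_ge0.
move=> x y x01 y01; have [xy|xy] := ltP `|x - y| n.+1%:R^-1.
  apply: (le_trans (Hn x _ y xy)); first by rewrite /= in_itv.
  by rewrite lerDl mulr_ge0 ?sqr_ge0// !mulr_ge0.
apply: (le_trans (ler_normB _ _)); apply: (@le_trans _ _ (2 * B)).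
  by have := HB _ x01; have := HB _ y01; lra.
apply: (@le_trans _ _ (2 * B * n.+1%:R ^+ 2 * (x - y) ^+ 2)); last by rewrite lerDr ltW.
rewrite -mulrA ler_peMr ?mulr_ge0// -exprMn -real_normK ?num_real// exprn_ege1//.
by rewrite normrM ger0_norm// mulrC -ler_pdivrMr// div1r.
Unshelve. all: by end_near. Qed.

Lemma weierstrass (G : R -> R) (e : R) : continuous G -> 0 < e ->
  exists p : {poly R}, forall z, -1 <= z <= 1 -> `|G z - p.[z]| <= e.
Proof.
move=> cG e0; pose H (x : R) := G (2 * x - 1).
have cH : continuous H.
  move=> x; apply: continuous_comp; last exact: cG.
  by apply: cvgB; [apply: cvgM; [exact: cvg_cst|exact: cvg_id]|exact: cvg_cst].
have [K K0 HK] := continuous_modulus cH (divr_gt0 e0 (ltr0n _ 2)).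
(* The binomial variance contributes at most [K x (1 - x) / m <= K / m] with [m = n + 1]. *)
have [n n0] : exists n : nat, K / n.+1%:R <= e / 2.
  exists (Num.truncn (2 * K / e)); rewrite ler_pdivrMr//.
  have := truncnS_gt (2 * K / e); rewrite ltr_pdivrMr// => h; lra.
pose m := n.+1; exists (bern m (fun k => H (k%:R / m%:R)) \Po ((1 / 2)%:P * ('X + 1))).
move=> z /andP[z1 z2]; rewrite horner_comp.
set x := 1 / 2 * (z + 1); have -> : ((1 / 2)%:P * ('X + 1)).[z] = x by rewrite !hornerE /x mul1r.
have x01 : 0 <= x <= 1 by rewrite /x; lra.
have -> : G z = H x by congr G; rewrite /x; field.
rewrite distrC.
have m0 : (0 : R) < m%:R by rewrite ltr0n.
have := @bern_le m (fun k => H (k%:R / m%:R))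
  (fun k => e / 2 + K / m%:R ^+ 2 * (k%:R + - (m%:R * x)) ^+ 2) (H x) x x01.
rewrite bern_quad subrr expr0n add0r => hh; apply: (le_trans (hh _)).
  move=> k km; apply: (le_trans (HK _ _ _ x01)).
    by rewrite divr_ge0//= ler_pdivrMr// mul1r ler_nat.
  rewrite lerD2l (_ : K * _ = K / m%:R ^+ 2 * (k%:R - m%:R * x) ^+ 2)//.
  by field; rewrite gt_eqF.
apply: (@le_trans _ _ (e / 2 + K / m%:R)); last by move: n0; rewrite -/m; lra.
rewrite lerD2l (_ : K / m%:R ^+ 2 * _ = K / m%:R * (x * (1 - x))); last first.
  by field; rewrite gt_eqF.
rewrite -[leRHS]mulr1 ler_wpM2l ?divr_ge0//.
by case/andP: x01 => ? ?; nra.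
Qed.

End bernstein.

(** * Marginal laws and the generator *)

Section levy_marginals.
Context (R : realType) d (T : measurableType d) (P : probability T R)
  (X : R -> T -> R) (gamma : R) (Pi : {measure set (measurableTypeR R) -> \bar R}).
Hypotheses (HX : levy_process P X) (HPi : levy_measure_on_unit Pi)
  (Htr : has_triplet P X gamma 0 Pi).

Definition Ex (s : R) (h : R -> R) : R := It P (fun w => h (X s w)).
Definition IP (h : R -> R) : R := @It _ (measurableTypeR R) R Pi h.
Definition V2 : R := IP (fun x => x ^+ 2).

Lemma measurable_X s : 0 <= s -> measurable_fun setT (X s).
Proof. exact: levy_measurable HX s. Qed.

Lemma measurable_hX s (h : R -> R) : 0 <= s -> measurable_fun setT h ->
  measurable_fun setT (fun w => h (X s w)).
Proof. by move=> s0 mh; apply: measurableT_comp => //; exact: measurable_X. Qed.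

Lemma itg_sqr : @itg _ (measurableTypeR R) R Pi (fun x => x ^+ 2).
Proof.
apply/integrableP; split.
  by apply/measurable_EFinP; exact: exprn_measurable.
case: HPi => _; apply: le_lt_trans; apply: ge0_le_integral => //=.
- by apply/measurable_EFinP; apply: measurableT_comp => //; exact: exprn_measurable.
- by apply/measurable_EFinP; exact: exprn_measurable.
- by move=> x _; rewrite lee_fin ger0_norm ?sqr_ge0.
Qed.

Lemma itg_Pi (C : R) (h : R -> R) : measurable_fun setT h ->
  (forall x, `|h x| <= C * x ^+ 2) -> @itg _ (measurableTypeR R) R Pi h.
Proof. move=> mh hC; apply: (@itg_le _ (measurableTypeR R) R Pi (fun x => C * x ^+ 2)) => //.
by apply: itgZ; exact: itg_sqr. Qed.

Lemma V2_ge0 : 0 <= V2. Proof. by apply: It_ge0 => x; exact: sqr_ge0. Qed.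

Lemma IP_le (C : R) (h : R -> R) : measurable_fun setT h -> (forall x, `|h x| <= C * x ^+ 2) ->
  `|IP h| <= C * V2.
Proof.
move=> mh hC; have ih := itg_Pi mh hC.
rewrite -ItZ; last exact: itg_sqr.
apply: (le_trans (It_norm ih)); apply: It_le => //; last by apply: itgZ; exact: itg_sqr.
exact: integrable_norm.
Qed.

Lemma itg_bnd (f : T -> R) (C : R) : measurable_fun setT f -> (forall w, `|f w| <= C) -> itg P f.
Proof.
move=> mf fC; apply: (@itg_le _ _ _ _ (fun=> C)) => //.
exact: finite_measure_integrable_cst.
Qed.

Lemma It_cst (c : R) : It P (fun=> c) = c.
Proof. by rewrite /It Rintegral_cst// /= probability_setT mulr1. Qed.

(** [- apart u] and [bpart u] are the real and imaginary parts of the exponent at [u]. *)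
Definition apart (u : R) : R := IP (fun x => 1 - cos (u * x)).
Definition bpart (u : R) : R := gamma * u + IP (fun x => sin (u * x) - u * x).

Lemma measurable_cosZ (u : R) : measurable_fun setT (fun x : R => cos (u * x)).
Proof.
apply: measurableT_comp; last exact: mulrl_measurable.
by apply: continuous_measurable_fun; exact: continuous_cos.
Qed.

Lemma measurable_sinZ (u : R) : measurable_fun setT (fun x : R => sin (u * x)).
Proof.
apply: measurableT_comp; last exact: mulrl_measurable.
by apply: continuous_measurable_fun; exact: continuous_sin.
Qed.

Lemma cos_dom (u x : R) : `|1 - cos (u * x)| <= u ^+ 2 / 2 * x ^+ 2.
Proof.
rewrite ger0_norm ?subr_ge0 ?cos_le1//; apply: (le_trans (one_minus_cos_le _)).
by rewrite exprMn mulrAC.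
Qed.

Lemma sin_dom (u x : R) : `|sin (u * x) - u * x| <= u ^+ 2 * x ^+ 2.
Proof. by rewrite -exprMn; exact: sin_sub_le. Qed.

(** The exponent integrates over [[-1, 1]], whose complement is [Pi]-null; this allows integrals
    over the whole line everywhere else. *)
Lemma Rintegral_unit (f : R -> R) : @itg _ (measurableTypeR R) R Pi f ->
  (\int[Pi]_(x in `[(-1)%R, 1%R]) f x)%R = IP f.
Proof.
move=> fi; have [P0 _] := HPi; have mD : measurable [set` `[(-1 : R), 1]] by [].
have mN : measurable (~` ([set` `[(-1 : R), 1]] `\ 0) : set (measurableTypeR R)).
  by apply: measurableC; apply: measurableD => //; exact: measurable_set1.
rewrite /IP /It /Rintegral; congr fine.
rewrite (negligible_integral mN _ _ P0)//; last exact: integrableS fi.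
rewrite [RHS](negligible_integral mN _ _ P0)//; congr (integral _ _ _).
by rewrite !setDE setCK setTI setIA setIid.
Qed.

Lemma itg_apart (u : R) : @itg _ (measurableTypeR R) R Pi (fun x => 1 - cos (u * x)).
Proof.
apply: (itg_Pi _ (cos_dom u)); apply: measurable_funB => //; exact: measurable_cosZ.
Qed.

Lemma itg_bpart (u : R) : @itg _ (measurableTypeR R) R Pi (fun x => sin (u * x) - u * x).
Proof.
apply: (itg_Pi _ (sin_dom u)); apply: measurable_funB; first exact: measurable_sinZ.
exact: mulrl_measurable.
Qed.

Lemma Re_exponent (u : R) : complex.Re (levy_exponent gamma 0 Pi u) = - apart u.
Proof.
rewrite /levy_exponent /cintegral /= !(mul0r, mulr0, mul1r, mulr1, add0r, addr0, subr0, sub0r, oppr0, subrr, expR0).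
rewrite -[RHS]mulN1r -ItZ; last exact: itg_apart.
rewrite -[It _ _]/(IP _) -Rintegral_unit; last by apply: itgZ; exact: itg_apart.
congr fine; apply: eq_integral => x _; congr EFin.
by rewrite /= !(mul0r, mulr0, mul1r, mulr1, add0r, addr0, subr0, sub0r, oppr0, subrr, expR0) mulN1r opprB.
Qed.

Lemma Im_exponent (u : R) : complex.Im (levy_exponent gamma 0 Pi u) = bpart u.
Proof.
rewrite /levy_exponent /cintegral /= !(mul0r, mulr0, mul1r, mulr1, add0r, addr0, subr0, sub0r, oppr0, subrr, expR0).
rewrite /bpart -Rintegral_unit; last exact: itg_bpart.
congr (_ + fine _); apply: eq_integral => x _; congr EFin.
by rewrite /= !(mul0r, mulr0, mul1r, mulr1, add0r, addr0, subr0, sub0r, oppr0, subrr, expR0) ?opprB.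
Qed.

Lemma cexp_scale (s : R) (z : R[i]) : cexp (s%:C%C * z) =
  ((expR (s * complex.Re z) * cos (s * complex.Im z)) +i*
   (expR (s * complex.Re z) * sin (s * complex.Im z)))%C.
Proof.
case: z => a b; rewrite /cexp /=.
rewrite !(mul0r, mulr0, mul1r, mulr1, add0r, addr0, subr0, sub0r, oppr0, subrr, expR0)//.
by congr (_ +i* _)%C; ring.
Qed.

Lemma Ex_cos s (u : R) : 0 <= s ->
  Ex s (fun x => cos (u * x)) = expR (- (s * apart u)) * cos (s * bpart u).
Proof.
move=> s0; have := congr1 (@complex.Re R) (Htr u s0).
rewrite cexp_scale Re_exponent Im_exponent /= mulrN => <-.
by congr fine; apply: eq_integral => w _; rewrite !(mul0r, mulr0, mul1r, mulr1, add0r, addr0, subr0, sub0r, oppr0, subrr, expR0).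
Qed.

Lemma Ex_sin s (u : R) : 0 <= s ->
  Ex s (fun x => sin (u * x)) = expR (- (s * apart u)) * sin (s * bpart u).
Proof.
move=> s0; have := congr1 (@complex.Im R) (Htr u s0).
rewrite cexp_scale Re_exponent Im_exponent /= mulrN => <-.
by congr fine; apply: eq_integral => w _; rewrite !(mul0r, mulr0, mul1r, mulr1, add0r, addr0, subr0, sub0r, oppr0, subrr, expR0).
Qed.

Lemma apart_ge0 u : 0 <= apart u.
Proof. by apply: It_ge0 => x; rewrite subr_ge0 cos_le1. Qed.

Lemma apart_le u : apart u <= u ^+ 2 / 2 * V2.
Proof.
have := IP_le _ (cos_dom u); rewrite -/(apart u) => h.
apply: (le_trans (ler_norm _)); apply: h.
apply: measurable_funB => //; exact: measurable_cosZ.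
Qed.

Lemma bpart_le u : `|bpart u - gamma * u| <= u ^+ 2 * V2.
Proof.
rewrite /bpart addrAC subrr add0r; apply: IP_le (sin_dom u).
by apply: measurable_funB; [exact: measurable_sinZ|exact: mulrl_measurable].
Qed.

Lemma bpart_norm u : 0 < u -> u <= 1 -> `|bpart u| <= u * (`|gamma| + V2).
Proof.
move=> u0 u1; rewrite -(subrK (gamma * u) (bpart u)); apply: (le_trans (ler_normD _ _)).
rewrite normrM (gtr0_norm u0); have := bpart_le u; have := V2_ge0 => v0.
have : u ^+ 2 * V2 <= u * V2 by rewrite ler_wpM2r// expr2 ler_piMl// ltW.
move=> h1 h2; rewrite mulrDr [u * `|gamma|]mulrC; lra.
Qed.

(* First-order expansion of [exp (- A + iB)]. *)
Lemma damped_cos_le (A B : R) : 0 <= A ->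
  1 - expR (- A) * cos B <= A + B ^+ 2 / 2 /\
  `|expR (- A) * cos B - 1 + A| <= 2 * A ^+ 2 + B ^+ 2.
Proof.
move=> A0; have e1 : 1 - A <= expR (- A) by have := expR_ge1Dx (- A).
have e2 : expR (- A) <= 1 by rewrite -expR0 ler_expR; lra.
have e3 : expR (- A) <= 1 - A + 2 * A ^+ 2.
  by have := @expR_le_quad _ (- A); rewrite sqrrN; apply; lra.
have e0 := expR_ge0 (- A); have c1 := one_minus_cos_le B; have c2 := cos_le1 B.
have p0 := sqr_ge0 B; have p1 := sqr_ge0 A.
have l : 1 - A - B ^+ 2 / 2 <= expR (- A) * cos B.
  rewrite (_ : expR (- A) * cos B = expR (- A) - expR (- A) * (1 - cos B)); last by ring.
  have : expR (- A) * (1 - cos B) <= 1 * (1 - cos B) by rewrite ler_wpM2r//; lra.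
  lra.
have r : expR (- A) * cos B <= expR (- A) by rewrite -[leRHS]mulr1 ler_wpM2l.
by split; [lra|rewrite ler_norml; apply/andP; split; lra].
Qed.

Lemma damped_sin_le (A B : R) : 0 <= A -> `|expR (- A) * sin B - B| <= A * `|B| + B ^+ 2.
Proof.
move=> A0; have e1 : 1 - A <= expR (- A) by have := expR_ge1Dx (- A).
have e2 : expR (- A) <= 1 by rewrite -expR0 ler_expR; lra.
rewrite (_ : _ - B = (expR (- A) - 1) * sin B + (sin B - B)); last by ring.
apply: (le_trans (ler_normD _ _)); apply: lerD; last exact: sin_sub_le.
rewrite normrM ler_pM// ?norm_sin_le// ler_norml; apply/andP; split; lra.
Qed.

Lemma Ex_sin_expand s u : 0 <= s ->
  `|Ex s (fun x => sin (u * x)) - s * bpart u| <=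
  s ^+ 2 * (apart u * `|bpart u| + bpart u ^+ 2).
Proof.
move=> s0; rewrite Ex_sin//.
apply: (le_trans (damped_sin_le (s * bpart u) (mulr_ge0 s0 (apart_ge0 u)))).
by rewrite normrM (ger0_norm s0) le_eqVlt; apply/orP; left; apply/eqP; ring.
Qed.

Lemma Ex_cos_expand s u : 0 <= s ->
  `|Ex s (fun x => cos (u * x)) - 1 + s * apart u| <=
  s ^+ 2 * (2 * apart u ^+ 2 + bpart u ^+ 2).
Proof.
move=> s0; rewrite Ex_cos//.
have [_ h] := damped_cos_le (s * bpart u) (mulr_ge0 s0 (apart_ge0 u)).
by apply: (le_trans h); rewrite le_eqVlt; apply/orP; left; apply/eqP; ring.
Qed.

(** [(2 n sin (x / 2n))^2 = 2 n^2 (1 - cos (x / n))] tends to [x^2], and its expectation is bounded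
    uniformly in [n] through the exponent; Fatou's lemma concludes. The order [s] of the bound
    matters: summed over a mesh it stays bounded. *)
Lemma Ex_sqr_bound s : 0 <= s ->
  itg P (fun w => X s w ^+ 2) /\
  Ex s (fun x => x ^+ 2) <= s * V2 + s ^+ 2 * (`|gamma| + V2) ^+ 2.
Proof.
move=> s0; set C := (X in _ <= X).
have mX2 : measurable_fun setT (fun w => X s w ^+ 2).
  by apply: (measurable_hX s0 (h := fun x => x ^+ 2)); exact: exprn_measurable.
pose f_ n w := (2 * (n.+1%:R * sin (n.+1%:R^-1 * (X s w / 2)))) ^+ 2.
have f_E n w : f_ n w = 2 * n.+1%:R ^+ 2 * (1 - cos (n.+1%:R^-1 * X s w)).
  rewrite /f_; set x := _ * (X s w / 2).
  have -> : n.+1%:R^-1 * X s w = x *+ 2 by rewrite /x mulr2n; field.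
  by rewrite cos_mulr2n cos2sin2 mulr2n; ring.
have mf n : measurable_fun setT (f_ n).
  rewrite (funext (f_E n)).
  apply: (measurable_hX s0 (h := fun x => 2 * n.+1%:R ^+ 2 * (1 - cos (n.+1%:R^-1 * x)))).
  apply: measurable_funM => //; apply: measurable_funB => //; exact: measurable_cosZ.
have f0 n w : 0 <= f_ n w by exact: sqr_ge0.
have fC n : It P (f_ n) <= C.
  rewrite (It_eq P (f_E n)).
  have ci : itg P (fun w => cos (n.+1%:R^-1 * X s w)).
    apply: (@itg_bnd _ 1) => [|w]; last exact: cos_max.
    by apply: (measurable_hX s0 (h := fun x => cos (n.+1%:R^-1 * x))); exact: measurable_cosZ.
  have c1 : itg P (fun=> 1) by apply: (@itg_bnd _ 1) => // w; rewrite normr1.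
  rewrite ItZ; last exact: itgB.
  rewrite ItB// It_cst -/(Ex s (fun x => cos (n.+1%:R^-1 * x))) Ex_cos//.
  set u := n.+1%:R^-1; have u0 : 0 < u by rewrite invr_gt0.
  have u1 : u <= 1 by rewrite invf_le1// ler1n.
  have [h _] := damped_cos_le (s * bpart u) (mulr_ge0 s0 (apart_ge0 u)).
  have uE : n.+1%:R = u^-1 by rewrite invrK.
  rewrite uE; apply: (@le_trans _ _ (2 * u^-1 ^+ 2 * (s * (u ^+ 2 / 2 * V2) + (s * bpart u) ^+ 2 / 2))).
    apply: ler_wpM2l; first by rewrite mulr_ge0 ?sqr_ge0.
    apply: (le_trans h); by rewrite lerD2r ler_wpM2l// apart_le.
  have hb := bpart_norm u0 u1.
  have hb2 : bpart u ^+ 2 <= u ^+ 2 * (`|gamma| + V2) ^+ 2.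
    by rewrite -exprMn -real_normK ?num_real// lerXn2r ?nnegrE// (le_trans _ hb).
  rewrite exprMn; apply: (@le_trans _ _ (2 * u^-1 ^+ 2 * (s * (u ^+ 2 / 2 * V2) + s ^+ 2 * (u ^+ 2 * (`|gamma| + V2) ^+ 2) / 2))).
    apply: ler_wpM2l; first by rewrite mulr_ge0 ?sqr_ge0.
    by rewrite lerD2l ler_pM2r ?invr_gt0// ler_wpM2l ?sqr_ge0.
  by rewrite le_eqVlt; apply/orP; left; apply/eqP; rewrite /C; field; rewrite gt_eqF.
have fi n : itg P (f_ n).
  apply: (@itg_bnd _ (4 * n.+1%:R ^+ 2)) => // w; rewrite ger0_norm// f_E.
  by have := cos_geN1 (n.+1%:R^-1 * X s w); have := sqr_ge0 (n.+1%:R : R); nra.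
have cv w : f_ ^~ w @ \oo --> X s w ^+ 2.
  have c1 : 2 * (n.+1%:R * sin (n.+1%:R^-1 * (X s w / 2))) @[n --> \oo] --> 2 * (X s w / 2).
    by apply: cvgMr; exact: cvg_nsin.
  rewrite [2 * _ in X in _ --> X]mulrC divfK// in c1.
  by rewrite expr2; apply: cvgM.
have I2 : (\int[P]_w (X s w ^+ 2)%:E <= C%:E)%E.
  have := @fatou _ T R P setT measurableT (fun n w => (f_ n w)%:E) _ _.
  move=> /(_ (fun n => proj2 (measurable_EFinP _ _) (mf n))) /(_ (fun n w _ => f0 n w)).
  have -> : (fun w => limn_einf (fun n => (f_ n w)%:E)) = (fun w => (X s w ^+ 2)%:E).
    apply/funext => w.
    have : (f_ n w)%:E @[n --> \oo] --> (X s w ^+ 2)%:E.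
      by apply: cvg_EFin; [exact: nearW|exact: cv].
    by move/cvg_limn_einf_sup => -[].
  move=> /le_trans; apply.
  rewrite limn_einf_lim; apply: lime_le; first exact: is_cvg_einfs.
  apply: nearW => n; apply: ereal_inf_le; exists (\int[P]_w (f_ n w)%:E)%E.
    by exists n => //=.
  by rewrite ItE// lee_fin.
have iX : itg P (fun w => X s w ^+ 2).
  apply/integrableP; split; first exact/measurable_EFinP.
  apply: (@le_lt_trans _ _ C%:E); last exact: ltry.
  by apply: le_trans I2; apply: ge0_le_integral => //= [||w _];
    [apply/measurable_EFinP; apply: measurableT_comp|apply/measurable_EFinP|rewrite lee_fin ger0_norm ?sqr_ge0].
by split => //; rewrite -lee_fin -ItE.
Qed.

Lemma itg_X2 s : 0 <= s -> itg P (fun w => X s w ^+ 2).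
Proof. by move=> /Ex_sqr_bound[]. Qed.

Lemma itg_hX s (h : R -> R) (C : R) : 0 <= s -> measurable_fun setT h ->
  (forall x, `|h x| <= C * (1 + x ^+ 2)) -> itg P (fun w => h (X s w)).
Proof.
move=> s0 mh hC; apply: (@itg_le _ _ _ P (fun w => C * (1 + X s w ^+ 2))) => //.
  exact: measurable_hX.
apply: itgZ; apply: itgD; last exact: itg_X2.
by apply: (@itg_bnd _ 1) => // w; rewrite normr1.
Qed.

Lemma itg_X s : 0 <= s -> itg P (X s).
Proof.
move=> s0; apply: (@itg_hX s id 1) => // x; rewrite mul1r.
by rewrite -[x ^+ 2]real_normK ?num_real// expr2; have := normr_ge0 x; nra.
Qed.

(** The compensator is [theta x] on all of [[-1, 1]], so [gamma] is exactly the mean per unit time.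
    The limit of [E n sin (X_s / n)] is computed twice: by dominated convergence, and from the
    exponent. *)
Lemma Ex_id s : 0 <= s -> It P (X s) = gamma * s.
Proof.
move=> s0; pose f_ n w := n.+1%:R * sin (n.+1%:R^-1 * X s w).
have ci n : itg P (fun w => sin (n.+1%:R^-1 * X s w)).
  apply: (@itg_bnd _ 1) => [|w]; last exact: sin_max.
  by apply: (measurable_hX s0 (h := fun x => sin (n.+1%:R^-1 * x))); exact: measurable_sinZ.
have c1 : It P (f_ n) @[n --> \oo] --> It P (X s).
  apply: (@It_cvg _ _ _ _ _ _ (fun w => `|X s w|)).
  - by move=> n; exact: itg_meas (itgZ _ (ci n)).
  - exact: measurable_X.
  - exact: integrable_norm (itg_X s0).
  - move=> n w; rewrite /f_ normrM ger0_norm// -ler_pdivlMl//.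
    by apply: (le_trans (norm_sin_le _)); rewrite normrM ger0_norm.
  - by move=> w; exact: cvg_nsin.
have c2 : It P (f_ n) @[n --> \oo] --> gamma * s.
  pose K := `|gamma| + V2; have K0 : 0 <= K by rewrite addr_ge0// V2_ge0.
  apply: (@cvg_rate _ _ _ (s ^+ 2 * (V2 * K + K ^+ 2) + s * V2)) => n.
  rewrite ItZ// -/(Ex s (fun x => sin (n.+1%:R^-1 * x))).
  set u := n.+1%:R^-1; have u0 : 0 < u by rewrite invr_gt0.
  have u1 : u <= 1 by rewrite invf_le1// ler1n.
  have uE : n.+1%:R = u^-1 by rewrite invrK.
  have hb := bpart_norm u0 u1; rewrite -/K in hb.
  have ha := apart_le u; have ha0 := apart_ge0 u; have v0 := V2_ge0.
  have := Ex_sin_expand u s0; set Z := Ex _ _ => hZ.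
  have -> : n.+1%:R * Z - gamma * s = u^-1 * ((Z - s * bpart u) + s * (bpart u - gamma * u)).
    by rewrite uE; field; rewrite gt_eqF.
  rewrite normrM gtr0_norm ?invr_gt0// ler_pdivrMl//.
  apply: (le_trans (ler_normD _ _)); rewrite [`|s * _|]normrM (ger0_norm s0).
  have h1 : apart u * `|bpart u| <= u ^+ 2 * (V2 * K).
    apply: (@le_trans _ _ ((u ^+ 2 * V2) * K)); last by rewrite mulrA.
    apply: ler_pM => //; last first.
      by apply: (le_trans hb); rewrite ler_piMl.
    by apply: (le_trans ha); have := mulr_ge0 (sqr_ge0 u) v0; lra.
  have h2 : bpart u ^+ 2 <= u ^+ 2 * K ^+ 2.
    by rewrite -exprMn -real_normK ?num_real// lerXn2r ?nnegrE// (le_trans _ hb).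
  have h3 : s ^+ 2 * (apart u * `|bpart u| + bpart u ^+ 2) <= s ^+ 2 * (u ^+ 2 * (V2 * K) + u ^+ 2 * K ^+ 2).
    by apply: ler_wpM2l; [exact: sqr_ge0|exact: lerD].
  have h4 := ler_wpM2l s0 (bpart_le u).
  have -> : u * ((s ^+ 2 * (V2 * K + K ^+ 2) + s * V2) * u) =
    s ^+ 2 * (u ^+ 2 * (V2 * K) + u ^+ 2 * K ^+ 2) + s * (u ^+ 2 * V2) by ring.
  by apply: lerD => //; exact: le_trans h3.
exact: (cvg_unique _ c1 c2).
Qed.

Section small_time_generator.
Variable t : R.
Hypothesis t0 : 0 <= t.

Definition mesh n := t / n.+1%:R.

Lemma mesh_ge0 n : 0 <= mesh n. Proof. by rewrite divr_ge0. Qed.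

Lemma meshE n : n.+1%:R * mesh n = t.
Proof. by rewrite /mesh mulrC divfK// pnatr_eq0. Qed.

(** The sum over the mesh of the expectations of [h] at the increments. When [h 0 = 0], its limit is
    [t] times the generator of [X] applied to [h] at 0. *)
Definition conv (h : R -> R) (l : R) : Prop :=
  n.+1%:R * Ex (mesh n) h @[n --> \oo] --> l.

Lemma conv_lin (c e : R) h g l m :
  (forall n, itg P (fun w => h (X (mesh n) w))) ->
  (forall n, itg P (fun w => g (X (mesh n) w))) ->
  conv h l -> conv g m -> conv (fun x => c * h x + e * g x) (c * l + e * m).
Proof.
move=> ih ig ch cg; rewrite /conv.
have -> : (fun n => n.+1%:R * Ex (mesh n) (fun x => c * h x + e * g x)) =
    (fun n => c * (n.+1%:R * Ex (mesh n) h) + e * (n.+1%:R * Ex (mesh n) g)).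
  apply/funext => n; rewrite /Ex.
  have i1 := itgZ c (ih n); have i2 := itgZ e (ig n).
  by rewrite (ItD i1 i2) !ItZ//; ring.
by apply: cvgD; apply: cvgMr.
Qed.

Lemma conv_sin u : conv (fun x => sin (u * x)) (t * bpart u).
Proof.
apply: (@cvg_rate _ _ _ (t ^+ 2 * (apart u * `|bpart u| + bpart u ^+ 2))) => n.
have := Ex_sin_expand u (mesh_ge0 n); set Z := Ex _ _ => hZ.
have n0 : (0 : R) < n.+1%:R by [].
rewrite -[in t * bpart u](meshE n) -mulrA -mulrBr normrM gtr0_norm// mulrC -ler_pdivlMr//.
apply: (le_trans hZ); rewrite /mesh le_eqVlt; apply/orP; left; apply/eqP; field.
by rewrite gt_eqF.
Qed.

Lemma conv_cos u : conv (fun x => cos (u * x) - 1) (- (t * apart u)).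
Proof.
apply: (@cvg_rate _ _ _ (t ^+ 2 * (2 * apart u ^+ 2 + bpart u ^+ 2))) => n.
have := Ex_cos_expand u (mesh_ge0 n).
have i1 : itg P (fun w => cos (u * X (mesh n) w)).
  apply: (@itg_bnd _ 1) => [|w]; last exact: cos_max.
  by apply: (measurable_hX (mesh_ge0 n) (h := fun x => cos (u * x))); exact: measurable_cosZ.
have i2 : itg P (fun=> 1) by apply: (@itg_bnd _ 1) => // w; rewrite normr1.
rewrite /Ex (ItB i1 i2) It_cst; set Z := It _ _ => hZ.
have n0 : (0 : R) < n.+1%:R by [].
rewrite -[in t * apart u](meshE n) -mulrA opprK -mulrDr normrM gtr0_norm// mulrC -ler_pdivlMr//.
apply: (le_trans hZ); rewrite /mesh le_eqVlt; apply/orP; left; apply/eqP; field.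
by rewrite gt_eqF.
Qed.

(* [h] is bounded and [h x = h 0 + al x + O(x^2)], and the generator of [X] at
   [0] applied to [h] is the derivative of [E h (X_s)] at [s = 0]. *)
Definition has_gen (h : R -> R) (al : R) : Prop :=
  [/\ measurable_fun setT h, (exists C, forall x, `|h x| <= C),
   (exists C, forall x, `|h x - h 0 - al * x| <= C * x ^+ 2) &
   conv (fun x => h x - h 0) (t * (gamma * al + IP (fun x => h x - h 0 - al * x)))].

Lemma itg_bndX s (h : R -> R) (C : R) : 0 <= s -> measurable_fun setT h ->
  (forall x, `|h x| <= C) -> itg P (fun w => h (X s w)).
Proof. by move=> s0 mh hC; apply: (@itg_bnd _ C) => //; exact: measurable_hX. Qed.

Lemma measurable_rem (h : R -> R) al : measurable_fun setT h ->
  measurable_fun setT (fun x => h x - h 0 - al * x).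
Proof.
move=> mh; apply: measurable_funB; last exact: mulrl_measurable.
by apply: measurable_funB.
Qed.

Lemma has_gen_lin (c e : R) h g a b : has_gen h a -> has_gen g b ->
  has_gen (fun x => c * h x + e * g x) (c * a + e * b).
Proof.
move=> [mh [Ch hC] [Dh hD] ch] [mg [Cg gC] [Dg gD] cg]; split.
- by apply: measurable_funD; apply: measurable_funM.
- exists (`|c| * Ch + `|e| * Cg) => x; apply: (le_trans (ler_normD _ _)).
  by rewrite !normrM; apply: lerD; apply: ler_wpM2l.
- exists (`|c| * Dh + `|e| * Dg) => x.
  rewrite (_ : _ - _ = c * (h x - h 0 - a * x) + e * (g x - g 0 - b * x)); last by ring.
  apply: (le_trans (ler_normD _ _)); rewrite !normrM mulrDl -!mulrA.
  by apply: lerD; apply: ler_wpM2l.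
- have -> : (fun x => c * h x + e * g x - (c * h 0 + e * g 0)) =
      (fun x => c * (h x - h 0) + e * (g x - g 0)) by apply/funext => x; ring.
  have -> : IP (fun x => c * h x + e * g x - (c * h 0 + e * g 0) - (c * a + e * b) * x) =
      c * IP (fun x => h x - h 0 - a * x) + e * IP (fun x => g x - g 0 - b * x).
    have i1 := itg_Pi (measurable_rem a mh) hD; have i2 := itg_Pi (measurable_rem b mg) gD.
    rewrite /IP -(ItZ c i1) -(ItZ e i2) -(ItD (itgZ c i1) (itgZ e i2)).
    by apply: It_eq => x; ring.
  have -> : t * (gamma * (c * a + e * b) + (c * IP (fun x => h x - h 0 - a * x) +
      e * IP (fun x => g x - g 0 - b * x))) =
    c * (t * (gamma * a + IP (fun x => h x - h 0 - a * x))) +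
    e * (t * (gamma * b + IP (fun x => g x - g 0 - b * x))) by ring.
  apply: conv_lin ch cg => n.
    apply: (@itg_bndX _ (fun x => h x - h 0) (Ch + Ch)) => //; first exact: mesh_ge0.
      exact: measurable_funB.
    by move=> x; apply: (le_trans (ler_normB _ _)); apply: lerD.
  apply: (@itg_bndX _ (fun x => g x - g 0) (Cg + Cg)) => //; first exact: mesh_ge0.
    exact: measurable_funB.
  by move=> x; apply: (le_trans (ler_normB _ _)); apply: lerD.
Qed.

Lemma has_gen_cos v : has_gen (fun x => cos (v * x)) 0.
Proof.
split; first exact: measurable_cosZ.
- by exists 1 => x; exact: cos_max.
- exists (v ^+ 2 / 2) => x; rewrite mulr0 cos0 mul0r subr0 distrC; exact: cos_dom.
- rewrite mulr0 cos0 mulr0 add0r.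
  have -> : IP (fun x => cos (v * x) - 1 - 0 * x) = - apart v.
    rewrite -[RHS]mulN1r -[RHS](ItZ (-1) (itg_apart v)); apply: It_eq => x; ring.
  by rewrite mulrN; exact: conv_cos.
Qed.

Lemma has_gen_sin v : has_gen (fun x => sin (v * x)) v.
Proof.
split; first exact: measurable_sinZ.
- by exists 1 => x; exact: sin_max.
- by exists (v ^+ 2) => x; rewrite mulr0 sin0 subr0; exact: sin_dom.
- rewrite mulr0 sin0; under eq_fun do rewrite subr0.
  have -> : gamma * v + IP (fun x => sin (v * x) - 0 - v * x) = bpart v.
    by congr (_ + _); apply: It_eq => x; rewrite subr0.
  exact: conv_sin.
Qed.

Lemma has_gen_ext h g a : (forall x, h x = g x) -> has_gen h a -> has_gen g a.
Proof. by move=> e; rewrite (_ : h = g)//; apply/funext. Qed.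

(** Multiplication by [sin (u x)] turns [cos (v x)] and [sin (v x)] into combinations of the
    frequencies [v + u] and [v - u]; hence the induction on [p] for all [v] at once. *)
Lemma has_gen_horner (u : R) (p : {poly R}) v :
  (exists a, has_gen (fun x => p.[sin (u * x)] * cos (v * x)) a) /\
  (exists a, has_gen (fun x => p.[sin (u * x)] * sin (v * x)) a).
Proof.
elim/poly_ind: p v => [|p c IH] v.
  have z := has_gen_lin 0 0 (has_gen_cos v) (has_gen_cos v).
  by split; eexists; apply: has_gen_ext z => x; rewrite horner0 !mul0r addr0.
have [[a1 c1] [b1 s1]] := IH (u + v); have [[a2 c2] [b2 s2]] := IH (v - u).
split; eexists.
  have h := has_gen_lin (1 / 2) (- (1 / 2)) s1 s2.
  apply: (has_gen_ext _ (has_gen_lin 1 c h (has_gen_cos v))) => x /=.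
  rewrite hornerMXaddC (mulrDl u v x) (mulrBl x v u) sinD sinB; by field.
have h := has_gen_lin (1 / 2) (- (1 / 2)) c2 c1.
apply: (has_gen_ext _ (has_gen_lin 1 c h (has_gen_sin v))) => x /=.
rewrite hornerMXaddC (mulrDl u v x) (mulrBl x v u) cosB cosD; by field.
Qed.

(** The factor [sin^2] makes the function [O(x^2)], so its slope at 0 vanishes, and with it the
    drift and the compensator in the limit. *)
Lemma conv_sin2_horner (u : R) (p : {poly R}) :
  [/\ measurable_fun setT (fun x => sin (u * x) ^+ 2 * p.[sin (u * x)]),
   exists C, forall x, `|sin (u * x) ^+ 2 * p.[sin (u * x)]| <= C &
   conv (fun x => sin (u * x) ^+ 2 * p.[sin (u * x)])
     (t * IP (fun x => sin (u * x) ^+ 2 * p.[sin (u * x)]))].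
Proof.
have [[a0 g0] _] := has_gen_horner u p 0; have [[a g] _] := has_gen_horner u (p * 'X^2) 0.
have e q : (fun x => q.[sin (u * x)] * cos (0 * x)) = (fun x => q.[sin (u * x)]).
  by apply/funext => x; rewrite mul0r cos0 mulr1.
rewrite !e in g0 g; have [_ [Cp hCp] _ _] := g0; move: g.
have -> : (fun x => (p * 'X^2).[sin (u * x)]) = (fun x => sin (u * x) ^+ 2 * p.[sin (u * x)]).
  by apply/funext => x; rewrite hornerM hornerXn mulrC.
set h := (fun x => _); have h0 : h 0 = 0 by rewrite /h mulr0 sin0 expr0n mul0r.
case=> mh bh [C hC] ch.
have hp x : `|h x| <= u ^+ 2 * Cp * x ^+ 2.
  rewrite /h normrM mulrAC; apply: ler_pM => //.
  by rewrite -exprMn normrX -[leRHS]real_normK ?num_real// lerXn2r ?nnegrE// norm_sin_le.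
suff a00 : a = 0.
  split => //; move: ch; rewrite h0 a00 mulr0 add0r.
  have -> : (fun x => h x - 0) = h by apply/funext => x; rewrite subr0.
  by have -> : (fun x => h x - 0 - 0 * x) = h by apply/funext => x; rewrite mul0r !subr0.
apply/eqP; rewrite -normr_le0 leNgt; apply/negP => ap.
pose K := u ^+ 2 * Cp + C.
have hK x : `|a| * `|x| <= K * x ^+ 2.
  have := hC x; rewrite h0 subr0 => h1; rewrite -normrM.
  rewrite (_ : a * x = h x - (h x - a * x)); last by ring.
  by apply: (le_trans (ler_normB _ _)); rewrite mulrDl; apply: lerD.
have K0 : 0 <= K by have := hK 1; rewrite normr1 expr1n !mulr1; apply: le_trans.
(* At this [x], the inequality [|a| |x| <= K x^2] fails unless [a = 0]. *)
have := hK (`|a| / (2 * (K + 1))); set y := _ / _.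
have y0 : 0 < y by rewrite divr_gt0// mulr_gt0//; lra.
rewrite (gtr0_norm y0) expr2 (mulrA K) ler_pM2r// => h1.
have : `|a| = y * (2 * (K + 1)) by rewrite /y divfK// gt_eqF// mulr_gt0//; lra.
by nra.
Qed.

Lemma mesh_sqr_le n :
  n.+1%:R * Ex (mesh n) (fun x => x ^+ 2) <=
  t * V2 + t ^+ 2 * (`|gamma| + V2) ^+ 2 * n.+1%:R^-1.
Proof.
have [_ h] := Ex_sqr_bound (mesh_ge0 n).
apply: (le_trans (ler_wpM2l _ h)) => //; rewrite /mesh le_eqVlt.
by apply/orP; left; apply/eqP; field; rewrite gt_eqF.
Qed.

(** For [u] small, [[-L, L]] lies where [asin] inverts [sin (u x)]; there [h] is a continuous
    function [F] of [z = sin (u x)], and [F z / z^2] is continuous because [F] vanishes near 0, so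
    Weierstrass applies to the quotient. Outside [[-L, L]], linear growth is small against
    [e x^2]. *)
Lemma trig_approx (h : R -> R) (del C e : R) : continuous h -> 0 < del ->
  (forall x, `|x| <= del -> h x = 0) -> (forall x, `|h x| <= C * `|x|) -> 0 < e ->
  exists u (p : {poly R}), forall x,
    `|h x - sin (u * x) ^+ 2 * p.[sin (u * x)]| <= e * x ^+ 2.
Proof.
move=> ch del0 hdel hC e0.
have C0 : 0 <= C by have := hC 1; rewrite normr1 mulr1; apply: le_trans.
(* For [|x| > L], [|h x|] and the values of [F] add up to at most [5 C |x|], which is at most
   [e x^2 / 2] since [10 C <= e L]. *)
pose L := 1 + 10 * C / e; have L1 : 1 <= L by rewrite /L lerDl divr_ge0// ?mulr_ge0// ltW.
have L0 : 0 < L by lra.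
have hL : 10 * C <= e * L.
  by rewrite /L mulrDr mulr1 mulrCA divff ?gt_eqF// mulr1; lra.
pose u := (2 * L)^-1; have u0 : 0 < u by rewrite invr_gt0 mulr_gt0.
have uL : u * L = 1 / 2 by rewrite /u; field; rewrite gt_eqF.
have u1 : u <= 1 by rewrite invf_le1 ?mulr_gt0//; lra.
(* Clipping to [[-1/2, 1/2]] keeps [asin] continuous and makes [F] a continuous function on the
   whole line. *)
pose clip (z : R) := Order.max (- (1 / 2)) (Order.min (1 / 2) z).
have clipP z : -(1 / 2) <= clip z <= 1 / 2.
  rewrite /clip le_max lexx /= ge_max ge_min lexx /= andbT; lra.
pose F z := h (asin (clip z) / u).
have cclip : continuous clip.
  apply: continuous_maxr; first exact: cst_continuous.
  by apply: continuous_minr; [exact: cst_continuous|move=> z; exact: cvg_id].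
have cac : continuous (asin \o clip).
  move=> z; apply: continuous_comp; first exact: cclip.
  by apply: continuous_asin; have := clipP z; lra.
have cF : continuous F.
  move=> z; apply: (@continuous_comp _ _ _ (fun z => asin (clip z) / u) h); last exact: ch.
  by apply: cvgM; [exact: cac|exact: cvg_cst].
have [eta eta0 Heta] : exists2 eta, 0 < eta & forall z, `|z| < eta -> F z = 0.
  have /cvgrPdist_lt/(_ _ (mulr_gt0 u0 del0)) := cac 0.
  have -> : (asin \o clip) 0 = 0.
    have c0 : clip 0 = 0 by rewrite /clip min_r ?max_r; lra.
    by rewrite /= c0 -[in LHS](@sin0 R) sinK// in_itv/= oppr_le0 divr_ge0 ?pi_ge0.
  move=> /nbhs_ballP[r /= r0 Hr]; exists r => // z zr.
  have := Hr z; rewrite /ball /= !sub0r !normrN => /(_ zr) h1.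
  by apply: hdel; rewrite normrM normfV (gtr0_norm u0) ler_pdivrMr// mulrC ltW.
(* The maximum with [eta^2] removes the singularity at 0 and preserves [F z = z^2 G z], as [F] is 0
   for [|z| < eta]. *)
pose G z := F z / Order.max (z ^+ 2) (eta ^+ 2).
have m0 z : 0 < Order.max (z ^+ 2) (eta ^+ 2) by rewrite lt_max (exprn_gt0 2 eta0) orbT.
have cG : continuous G.
  move=> z; apply: cvgM; first exact: cF.
  apply: cvgV; first by rewrite gt_eqF.
  by move: z; apply: continuous_maxr; [exact: exprn_continuous|exact: cst_continuous].
have FG z : F z = z ^+ 2 * G z.
  rewrite /G; have [ze|ze] := ltP `|z| eta; first by rewrite Heta// mul0r mulr0.
  have z2 : eta ^+ 2 <= z ^+ 2.
    by rewrite -[leRHS]real_normK ?num_real// lerXn2r ?nnegrE// ltW.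
  rewrite max_l// mulrCA divff ?mulr1// gt_eqF// (lt_le_trans _ z2)//.
  exact: exprn_gt0.
have [p hp] := weierstrass cG (divr_gt0 e0 (ltr0n _ 2)).
exists u, p => x; set z := sin (u * x).
have z1 : -1 <= z <= 1 by rewrite sin_geN1 sin_le1.
have hz : `|F z - z ^+ 2 * p.[z]| <= e / 2 * x ^+ 2.
  rewrite FG -mulrBr normrM mulrC; apply: ler_pM => //; first exact: hp.
  rewrite normrX -[leRHS]real_normK ?num_real// lerXn2r ?nnegrE//.
  by apply: (le_trans (norm_sin_le _)); rewrite normrM (gtr0_norm u0) ler_piMl.
have [xL|xL] := leP `|x| L.
  have ux : `|u * x| <= 1 / 2 by rewrite normrM (gtr0_norm u0) -uL ler_wpM2l// ltW.
  have : `|z| <= 1 / 2 by apply: le_trans ux; exact: norm_sin_le.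
  rewrite ler_norml => /andP[za zb].
  have cz : clip z = z by rewrite /clip min_r// max_r.
  have Fz : F z = h x.
    rewrite /F cz sinK; last first.
      by rewrite in_itv/=; have := @pihalf_ge1 R; move: ux; rewrite ler_norml; lra.
    by rewrite mulrC mulrA mulVf ?mul1r// gt_eqF.
  rewrite -Fz; apply: (le_trans hz); rewrite ler_wpM2r ?sqr_ge0//; lra.
have x2 : L * `|x| <= x ^+ 2.
  by rewrite -[leRHS]real_normK ?num_real// expr2 ler_wpM2r// ltW.
have hF : `|F z| <= C * (4 * L).
  apply: (le_trans (hC _)); apply: ler_wpM2l => //.
  rewrite normrM normfV (gtr0_norm u0) /u invrK.
  have h2 : `|asin (clip z)| <= 2.
    have cc := clipP z; have c1 : -1 <= clip z <= 1 by lra.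
    have := asin_geNpi2 c1; have := asin_lepi2 c1; have := @pihalf_lt2 R.
    by rewrite ler_norml; lra.
  by nra.
rewrite (_ : h x - _ = h x - F z + (F z - z ^+ 2 * p.[z])); last by ring.
apply: (le_trans (ler_normD _ _)); have := ler_normB (h x) (F z).
have h1 := hC x.
suff : C * `|x| + C * (4 * L) <= e / 2 * x ^+ 2 by lra.
have : C * (4 * L) <= C * (4 * `|x|) by rewrite ler_wpM2l// ler_wpM2l// ltW.
have : 10 * C * `|x| <= e * L * `|x| by rewrite ler_wpM2r.
have : e * (L * `|x|) <= e * x ^+ 2 by rewrite ler_wpM2l// ltW.
lra.
Qed.

Lemma dom_sqr (h : R -> R) (del C : R) : 0 < del ->
  (forall x, `|x| <= del -> h x = 0) -> (forall x, `|h x| <= C * `|x|) ->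
  forall x, `|h x| <= C / del * x ^+ 2.
Proof.
move=> del0 hdel hC x.
have C0 : 0 <= C by have := hC 1; rewrite normr1 mulr1; apply: le_trans.
have [xd|xd] := leP `|x| del.
  by rewrite hdel// normr0 mulr_ge0 ?sqr_ge0// divr_ge0// ltW.
apply: (le_trans (hC x)); rewrite -mulrA ler_wpM2l// ler_pdivlMl//.
by rewrite -[leRHS]real_normK ?num_real// expr2 ler_wpM2r// ltW.
Qed.

(** Approximate [h] within [e x^2] by functions covered by [conv_sin2_horner]: the error is at most
    [e V2] under [Pi] and, summed over the mesh, at most [e] times the quantity bounded in
    [mesh_sqr_le]. *)
Lemma conv_gen (h : R -> R) (del C : R) : continuous h -> 0 < del ->
  (forall x, `|x| <= del -> h x = 0) -> (forall x, `|h x| <= C * `|x|) ->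
  conv h (t * IP h).
Proof.
move=> ch del0 hdel hC; have hD := dom_sqr del0 hdel hC.
have mh : measurable_fun setT h by exact: continuous_measurable_fun.
have C0 : 0 <= C by have := hC 1; rewrite normr1 mulr1; apply: le_trans.
pose M := t * V2 + t ^+ 2 * (`|gamma| + V2) ^+ 2 + t * V2.
have v0 := V2_ge0.
have M0 : 0 <= M.
  have := mulr_ge0 t0 v0; have := mulr_ge0 (sqr_ge0 t) (sqr_ge0 (`|gamma| + V2)).
  by rewrite /M; lra.
apply/cvgrPdist_le => e e0; pose e1 := e / (2 * (M + 1)).
have e10 : 0 < e1 by rewrite divr_gt0// mulr_gt0//; lra.
have [u [p hp]] := trig_approx ch del0 hdel hC e10.
have [mg [D hgD] cg] := conv_sin2_horner u p.
set g := (fun x => _) in mg hgD cg hp.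
have dg x : `|g x| <= (C / del + e1) * x ^+ 2.
  rewrite (_ : g x = h x - (h x - g x)); last by ring.
  by apply: (le_trans (ler_normB _ _)); rewrite mulrDl lerD.
have mhg : measurable_fun setT (fun x => h x - g x) by exact: measurable_funB.
have b1 : `|IP h - IP g| <= e1 * V2.
  by rewrite /IP -(ItB (itg_Pi mh hD) (itg_Pi mg dg)); exact: IP_le.
have /cvgrPdist_le/(_ (e / 2)) := cg; rewrite divr_gt0// => /(_ isT).
apply: filterS => n hn.
have ih : itg P (fun w => h (X (mesh n) w)).
  apply: (@itg_hX _ _ C) => //; first exact: mesh_ge0.
  move=> x; apply: (le_trans (hC x)); apply: ler_wpM2l => //.
  by rewrite -[x ^+ 2]real_normK ?num_real// expr2; have := normr_ge0 x; nra.
have ig : itg P (fun w => g (X (mesh n) w)) by exact: itg_bndX (mesh_ge0 n) mg hgD.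
have b2 : n.+1%:R * `|Ex (mesh n) h - Ex (mesh n) g| <= e1 * (t * V2 + t ^+ 2 * (`|gamma| + V2) ^+ 2).
  have : `|Ex (mesh n) h - Ex (mesh n) g| <= e1 * Ex (mesh n) (fun x => x ^+ 2).
    rewrite /Ex -(ItB ih ig) -(ItZ e1 (itg_X2 (mesh_ge0 n))).
    apply: (le_trans (It_norm (itgB ih ig))); apply: It_le => [||w]; last exact: hp.
      by apply: integrable_norm; exact: itgB.
    by apply: itgZ; exact: itg_X2 (mesh_ge0 n).
  move=> h1; apply: (@le_trans _ _ (n.+1%:R * (e1 * Ex (mesh n) (fun x => x ^+ 2)))).
    by rewrite ler_wpM2l.
  rewrite mulrCA ler_wpM2l ?(ltW e10)//; apply: (le_trans (mesh_sqr_le n)).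
  rewrite lerD2l ler_piMr//; first by rewrite mulr_ge0// sqr_ge0.
  by rewrite invf_le1// ler1n.
have -> : t * IP h - n.+1%:R * Ex (mesh n) h = t * (IP h - IP g) +
  (t * IP g - n.+1%:R * Ex (mesh n) g) - n.+1%:R * (Ex (mesh n) h - Ex (mesh n) g) by ring.
apply: (le_trans (ler_normB _ _)); rewrite [`|n.+1%:R * _|]normrM (@ger0_norm _ n.+1%:R)//.
have := ler_normD (t * (IP h - IP g)) (t * IP g - n.+1%:R * Ex (mesh n) g).
rewrite [`|t * (_ - _)|]normrM (ger0_norm t0) => h1.
have h2 : t * `|IP h - IP g| <= t * (e1 * V2) by rewrite ler_wpM2l.
have h3 : e1 * (M + 1) = e / 2 by rewrite /e1; field; rewrite gt_eqF//; lra.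
have h4 : t * (e1 * V2) + e1 * (t * V2 + t ^+ 2 * (`|gamma| + V2) ^+ 2) = e1 * M.
  by rewrite /M; ring.
lra.
Qed.

End small_time_generator.

End levy_marginals.

(** * Expectations of products and independent families *)

Section expectation_of_products.
Context (R : realType) d (T : measurableType d) (P : probability T R).

Definition Pr (A : set T) : R := fine (P A).

Lemma PrE (A : set T) : measurable A -> P A = (Pr A)%:E.
Proof. by move=> mA; rewrite /Pr fineK//; exact: fin_num_measure. Qed.

Lemma Pr_ge0 (A : set T) : 0 <= Pr A.
Proof. exact: fine_ge0. Qed.

Lemma Pr_le (A B : set T) : measurable A -> measurable B -> A `<=` B -> Pr A <= Pr B.
Proof.
by move=> mA mB AB; rewrite -lee_fin -!PrE//; apply: le_measure; rewrite ?inE.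
Qed.

Lemma Pr_le1 (A : set T) : measurable A -> Pr A <= 1.
Proof. by move=> mA; rewrite -lee_fin -PrE//; exact: probability_le1. Qed.

Lemma Pr_setT : Pr setT = 1.
Proof. by rewrite /Pr probability_setT. Qed.

Lemma Pr_setC (A : set T) : measurable A -> Pr (~` A) = 1 - Pr A.
Proof.
move=> mA; apply: EFin_inj; rewrite -PrE; last exact: measurableC.
by rewrite probability_setC// PrE.
Qed.

Lemma Pr_setU (A B : set T) : measurable A -> measurable B -> Pr (A `|` B) <= Pr A + Pr B.
Proof.
move=> mA mB; rewrite -lee_fin EFinD -!PrE//; last exact: measurableU.
exact: measureU2.
Qed.

Lemma It_indic (A : set T) : measurable A -> It P (\1_A) = Pr A.
Proof. by move=> mA; rewrite /It /Rintegral integral_indic// setIT. Qed.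

Lemma itg_bounded (f : T -> R) (C : R) : measurable_fun setT f ->
  (forall w, `|f w| <= C) -> itg P f.
Proof.
move=> mf fC; apply: (@itg_le _ _ _ _ (fun=> C)) => //.
exact: finite_measure_integrable_cst.
Qed.

Lemma It_const (c : R) : It P (fun=> c) = c.
Proof. by rewrite /It Rintegral_cst// /= probability_setT mulr1. Qed.

Lemma measurable_indic_comp (Y : T -> R) (A : set (measurableTypeR R)) :
  measurable_fun setT Y -> measurable A -> measurable_fun setT (fun w => \1_A (Y w) : R).
Proof.
by move=> mY mA; exact: (measurableT_comp (f := \1_A : measurableTypeR R -> R)).
Qed.

Lemma indic_norm (U : Type) (A : set U) (x : U) : `|\1_A x : R| <= 1.
Proof. by rewrite indicE; case: (_ \in _); rewrite ?normr1 ?normr0. Qed.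

(** Both sides are linear in [f] and stable under bounded limits, so indicators suffice, by simple
    approximation. The free factors [g], [g'] and [c] serve both for equality in law and for
    replacing one indicator at a time in [It_prod]. *)
Lemma It_ext (g g' Y Y' : T -> R) (c C : R) (f : R -> R) (K : R) :
  measurable_fun setT g -> measurable_fun setT g' ->
  measurable_fun setT Y -> measurable_fun setT Y' ->
  (forall w, `|g w| <= C) -> (forall w, `|g' w| <= C) ->
  (forall A : set (measurableTypeR R), measurable A ->
    It P (fun w => g w * \1_A (Y w)) = c * It P (fun w => g' w * \1_A (Y' w))) ->
  measurable_fun setT f -> (forall x, 0 <= f x <= K) ->
  It P (fun w => g w * f (Y w)) = c * It P (fun w => g' w * f (Y' w)).
Proof.
move=> mg mg' mY mY' gC gC' H mf fK.
have mEf : measurable_fun (setT : set (measurableTypeR R)) (EFin \o f) by exact/measurable_EFinP.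
pose phi n : measurableTypeR R -> R := nnsfun_approx measurableT mEf n.
have f0 x : setT x -> (0 <= (EFin \o f) x)%E by move=> _; rewrite /= lee_fin; case/andP: (fK x).
have phi_ge0 n x : 0 <= phi n x by [].
have cphi x : phi n x @[n --> \oo] --> f x.
  have := cvg_nnsfun_approx measurableT mEf f0 (x := x) I.
  by move/fine_cvg.
have phi_le n x : phi n x <= f x.
  have nd : nondecreasing_seq (phi ^~ x).
    by move=> m k mk; apply/lefP; exact: nd_nnsfun_approx.
  rewrite -(cvg_lim _ (cphi x))//; apply: nondecreasing_cvgn_le => //.
  by apply/cvg_ex; eexists; exact: cphi.
have mphi n : measurable_fun setT (phi n) by [].
have dom (h Z : T -> R) n w : (forall w, `|h w| <= C) -> `|h w * phi n (Z w)| <= C * K.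
  move=> hC; rewrite normrM; apply: ler_pM => //.
  by rewrite ger0_norm// (le_trans (phi_le _ _))//; case/andP: (fK (Z w)).
have iCK : itg P (fun=> C * K) by exact: finite_measure_integrable_cst.
have lim (h Z : T -> R) : measurable_fun setT h -> measurable_fun setT Z -> (forall w, `|h w| <= C) ->
    It P (fun w => h w * phi n (Z w)) @[n --> \oo] --> It P (fun w => h w * f (Z w)).
  move=> mh mZ hC; apply: (@It_cvg _ _ _ _ _ _ (fun=> C * K)) => //.
  - move=> n; apply: measurable_funM => //.
    exact: (measurableT_comp (f := phi n : measurableTypeR R -> R)).
  - by apply: measurable_funM => //; exact: (measurableT_comp (f := f : measurableTypeR R -> R)).
  - by move=> n x; exact: dom.
  - by move=> x; apply: cvgMr; exact: cphi.
have eqn n : It P (fun w => g w * phi n (Y w)) = c * It P (fun w => g' w * phi n (Y' w)).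
  have [m [s e]] : exists m (s : seq R), forall x,
      phi n x = \sum_(i < m) (s`_i * \1_(phi n @^-1` [set s`_i]) x).
    by eexists; eexists => x; exact: (fimfunEord (nnsfun_approx measurableT mEf n)).
  have mA i : measurable (phi n @^-1` [set s`_i]).
    by rewrite -[X in measurable X]setTI; apply: mphi => //; exact: measurable_set1.
  have step (h Z : T -> R) : measurable_fun setT h -> measurable_fun setT Z -> (forall w, `|h w| <= C) ->
      It P (fun w => h w * phi n (Z w)) =
      \sum_(i < m) s`_i * It P (fun w => h w * \1_(phi n @^-1` [set s`_i]) (Z w)).
    move=> mh mZ hC.
    have ii i : itg P (fun w => h w * \1_(phi n @^-1` [set s`_i]) (Z w)).
      apply: (@itg_bounded _ (C * 1)).
        by apply: measurable_funM => //; exact: measurable_indic_comp.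
      by move=> w; rewrite normrM; apply: ler_pM => //; exact: indic_norm.
    have [_ eS] := @It_sum _ _ _ P _ (index_enum 'I_m)
      (fun i w => s`_i * (h w * \1_(phi n @^-1` [set s`_i]) (Z w))) (fun i => itgZ _ (ii i)).
    under [RHS]eq_bigr => i _ do rewrite -ItZ//.
    rewrite -eS; apply: It_eq => w; rewrite e big_distrr; apply: eq_bigr => i _ /=; ring.
  rewrite (step g)// (step g')// big_distrr /=; apply: eq_bigr => i _.
  by rewrite H//; ring.
have c1 := lim g Y mg mY gC; have c2 := lim g' Y' mg' mY' gC'.
rewrite (_ : (fun n => It P (fun w => g w * phi n (Y w))) =
  fun n => c * It P (fun w => g' w * phi n (Y' w))) in c1; last exact/funext.
have c3 : c * It P (fun w => g' w * phi n (Y' w)) @[n --> \oo] -->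
    c * It P (fun w => g' w * f (Y' w)) by apply: cvgMr.
exact: (cvg_unique _ c1 c3).
Qed.

Lemma It_eq_law (Y Y' : T -> R) (f : R -> R) (K : R) :
  measurable_fun setT Y -> measurable_fun setT Y' ->
  (forall A : set (measurableTypeR R), measurable A -> P (Y @^-1` A) = P (Y' @^-1` A)) ->
  measurable_fun setT f -> (forall x, 0 <= f x <= K) ->
  It P (fun w => f (Y w)) = It P (fun w => f (Y' w)).
Proof.
move=> mY mY' H mf fK.
have one (w : T) : `|1 : R| <= 1 by rewrite normr1.
have := @It_ext (fun=> 1) (fun=> 1) Y Y' 1 1 f K _ _ mY mY' one one _ mf fK.
have e1 (g : R -> R) (Z : T -> R) : (fun w => 1 * g (Z w)) = (fun w => g (Z w)).
  by apply/funext => w; rewrite mul1r.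
rewrite !e1 mul1r; apply => // A mA; rewrite !(e1 \1_A) mul1r.
have e (Z : T -> R) : (fun w => \1_A (Z w)) = \1_(Z @^-1` A) :> (T -> R) by apply/funext.
have mp (Z : T -> R) : measurable_fun setT Z -> measurable (Z @^-1` A).
  by move=> mZ; rewrite -[X in measurable X]setTI; exact: mZ.
by rewrite !e !It_indic; [rewrite /Pr H|exact: mp|exact: mp].
Qed.

Lemma measurable_prodr (I : eqType) (s : seq I) (Q : pred I) (h : I -> T -> R) :
  (forall i, measurable_fun setT (h i)) ->
  measurable_fun setT (fun w => \prod_(i <- s | Q i) h i w).
Proof.
move=> mh; elim: s => [|i s IH].
  by rewrite (_ : (fun w => _) = fun=> 1)//; apply/funext => w; rewrite big_nil.
rewrite (_ : (fun w => _) = fun w => (if Q i then h i w else 1) * \prod_(j <- s | Q j) h j w).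
  by apply: measurable_funM => //; case: (Q i).
by apply/funext => w; rewrite big_cons; case: (Q i); rewrite ?mul1r.
Qed.

Lemma prodr_bound (I : eqType) (s : seq I) (Q : pred I) (h : I -> R) (K : R) :
  1 <= K -> (forall i, 0 <= h i <= K) -> 0 <= \prod_(i <- s | Q i) h i <= K ^+ size s.
Proof.
move=> K1 hK; have K0 : 0 <= K by lra.
elim: s => [|i s /andP[l u]]; first by rewrite big_nil expr0 lexx ler01.
rewrite big_cons /= exprS; have /andP[h0 h1] := hK i.
have e0 : 0 <= K ^+ size s by exact: exprn_ge0.
case: (Q i); apply/andP; split=> //; [exact: mulr_ge0|exact: ler_pM|].
by apply: (le_trans u); rewrite ler_peMl.
Qed.

(** Independence gives the case of indicators. The functions are then freed one coordinate at a
    time, by induction on the number [k] of leading coordinates carrying a general function. *)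
Lemma It_prod n (Y : 'I_n -> T -> R) (f : 'I_n -> R -> R) (K : R) :
  (forall i, measurable_fun setT (Y i)) -> mutually_independent P Y ->
  (forall i, measurable_fun setT (f i)) -> (forall i x, 0 <= f i x <= K) ->
  It P (fun w => \prod_i f i (Y i w)) = \prod_i It P (fun w => f i (Y i w)).
Proof.
move=> mY indY mf fK; pose K1 := Order.max 1 K.
have K11 : 1 <= K1 by rewrite le_max lexx.
have {}fK i x : 0 <= f i x <= K1.
  by have /andP[-> h] := fK i x; rewrite le_max h orbT.
have mfY (g : R -> R) i : measurable_fun setT g -> measurable_fun setT (fun w => g (Y i w)).
  by move=> mg; apply: (measurableT_comp (f := g : measurableTypeR R -> R)) => //; exact: mY.
suff H k : (k <= n)%N -> forall g : 'I_n -> R -> R, (forall i, measurable_fun setT (g i)) ->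
    (forall i x, 0 <= g i x <= K1) ->
    (forall i : 'I_n, (k <= i)%N -> exists2 A : set (measurableTypeR R), measurable A & g i = \1_A) ->
    It P (fun w => \prod_i g i (Y i w)) = \prod_i It P (fun w => g i (Y i w)).
  by apply: (H n) => // i; rewrite leqNgt ltn_ord.
elim: k => [_ g mg gK gA|k IH kn g mg gK gA].
  have {gA} : forall i, exists A : set (measurableTypeR R), measurable A /\ g i = \1_A.
    by move=> i; have [//|A mA gi] := gA i; exists A.
  move=> /choice[A HA].
  have mp i : measurable (Y i @^-1` A i).
    by rewrite -[X in measurable X]setTI; apply: mY => //; case: (HA i).
  have e1 : (fun w => \prod_i g i (Y i w)) = \1_(\bigcap_(i in [set: 'I_n]) (Y i @^-1` A i)) :> (T -> R).
    apply/funext => w; have [h|h] := pselect ((\bigcap_(i in [set: 'I_n]) (Y i @^-1` A i)) w).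
      rewrite indicE mem_set//; apply: big1 => i _; have [_ ->] := HA i.
      by rewrite indicE mem_set//; exact: h.
    rewrite indicE memNset//=.
    have [i hi] : exists i, ~ A i (Y i w).
      by apply: contrapT => /forallNP h'; apply: h => i _; apply: contrapT; exact: h'.
    rewrite (bigD1 i)//=; have [_ ->] := HA i.
    by rewrite indicE memNset ?mul0r.
  rewrite e1 It_indic; last first.
    by apply: fin_bigcap_measurable => // i _; exact: mp.
  apply: EFin_inj; rewrite -PrE; last by apply: fin_bigcap_measurable => // i _; exact: mp.
  rewrite indY; last by move=> i; case: (HA i).
  rewrite -prodEFin; apply: eq_bigr => i _; have [_ ->] := HA i.
  by rewrite PrE// -[Pr _]It_indic.
pose i0 := Ordinal kn.
have gKn i x : `|g i x| <= K1 by have /andP[? ?] := gK i x; rewrite ger0_norm.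
pose G w := \prod_(i | i != i0) g i (Y i w).
have mG : measurable_fun setT G by apply: measurable_prodr => i; exact: mfY.
have GB w : `|G w| <= K1 ^+ size (index_enum 'I_n).
  have /andP[h0 h1] := @prodr_bound _ (index_enum 'I_n) (fun i => i != i0) (fun i => g i (Y i w)) _ K11 (fun i => gK i _).
  by rewrite ger0_norm.
have one (w : T) : `|1 : R| <= K1 ^+ size (index_enum 'I_n) by rewrite normr1 exprn_ege1.
pose c := \prod_(i | i != i0) It P (fun w => g i (Y i w)).
have := @It_ext G (fun=> 1) (Y i0) (Y i0) c _ (g i0) K1 mG _ (mY i0) (mY i0) GB one.
have -> : (fun w => G w * g i0 (Y i0 w)) = (fun w => \prod_i g i (Y i w)).
  by apply/funext => w; rewrite [RHS](bigD1 i0)//= mulrC.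
have -> : \prod_i It P (fun w => g i (Y i w)) = c * It P (fun w => 1 * g i0 (Y i0 w)).
  by rewrite (bigD1 i0)//= mulrC; congr (_ * _); apply: It_eq => w; rewrite mul1r.
apply => //; move=> A mA; pose g' i := if i == i0 then \1_A else g i.
have g'i0 : g' i0 = \1_A by rewrite /g' eqxx.
have g'i i : i != i0 -> g' i = g i by rewrite /g' => /negbTE ->.
have := IH (ltnW kn) g' _ _ _.
have -> : (fun w => \prod_i g' i (Y i w)) = (fun w => G w * \1_A (Y i0 w)).
  apply/funext => w; rewrite (bigD1 i0)//= g'i0 mulrC; congr (_ * _).
  by apply: eq_bigr => i /g'i ->.
have -> : \prod_i It P (fun w => g' i (Y i w)) = c * It P (fun w => 1 * \1_A (Y i0 w)).
  rewrite (bigD1 i0)//= g'i0 mulrC; congr (_ * _).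
    by apply: eq_bigr => i /g'i ->.
  by apply: It_eq => w; rewrite mul1r.
apply.
- move=> i; rewrite /g'; case: eqP => // _; exact: measurable_indic.
- move=> i x; rewrite /g'; case: eqP => // _; rewrite indicE; case: (_ \in _) => /=; [by rewrite ler01 K11|by rewrite lexx (le_trans ler01 K11)].
- move=> i ki; rewrite /g'; case: eqP => [_|/eqP ni]; first by exists A.
  by apply: gA; rewrite ltn_neqAle ki andbT eq_sym; apply: contra ni => /eqP h; apply/eqP/val_inj.
Qed.

(** The measures [P (A & G)] and [P G * P A] of [A] agree on a pi-system containing the whole space,
    hence on the sigma-algebra that it generates. *)
Lemma pi_indep (C : set (set T)) (G : set T) : C `<=` measurable ->
  setI_closed C -> C setT -> measurable G ->
  (forall A, C A -> Pr (A `&` G) = Pr A * Pr G) ->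
  forall A, <<s C >> A -> Pr (A `&` G) = Pr A * Pr G.
Proof.
move=> Cm CI CT mG H A sA.
have mA : measurable A by exact: (smallest_sub (@sigma_algebra_measurable _ T) Cm).
pose r : {nonneg R} := NngNum (Pr_ge0 G).
suff h : P (A `&` G) = ((Pr G)%:E * P A)%E.
  apply: EFin_inj; rewrite -(PrE (measurableI _ _ mA mG)) h (PrE mA).
  by rewrite -EFinM mulrC.
apply: (@g_sigma_algebra_measure_unique _ R T C Cm (fun=> setT) (fun=> CT) _
  (mrestr P mG) (mscale r P) CI _ _ A sA).
- by apply/seteqP; split => // x _; exists 0%N.
- move=> B CB; change (P (B `&` G) = ((Pr G)%:E * P B)%E).
  rewrite (PrE (Cm _ CB)) (PrE (measurableI _ _ (Cm _ CB) mG)).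
  by rewrite -EFinM H// mulrC.
- move=> _; change (P (setT `&` G) < +oo)%E; rewrite setTI; exact: (le_lt_trans (probability_le1 _ mG) (ltry _)).
Qed.

Section grouping.
Variables (n : nat) (Y : 'I_n -> T -> R).
Hypotheses (mY : forall i, measurable_fun setT (Y i)) (indY : mutually_independent P Y).

Lemma measurable_coord i (A : set (measurableTypeR R)) : measurable A ->
  measurable (Y i @^-1` A).
Proof. by move=> mA; rewrite -[X in measurable X]setTI; exact: mY. Qed.

(** A pi-system generating the sigma-algebra of the coordinates in [J]. *)
Definition rects (J : pred 'I_n) : set (set T) :=
  [set B | exists A : 'I_n -> set (measurableTypeR R), (forall i, measurable (A i)) /\
    B = [set w | forall i, J i -> A i (Y i w)]].

(** [T] with the smaller sigma-algebra: being determined by the coordinates in [J] becomes ordinary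
    measurability on this type. *)
Definition rect_type (J : pred 'I_n) := g_sigma_algebraType (rects J).

Lemma rect_bigcap (J : pred 'I_n) (A : 'I_n -> set (measurableTypeR R)) :
  [set w | forall i, J i -> A i (Y i w)] =
  \bigcap_(i in [set: 'I_n]) (Y i @^-1` (if J i then A i else setT)).
Proof.
apply/seteqP; split=> w /= h i.
  by move=> _ /=; case: ifP => // /h.
by move=> Ji; have := h i I; rewrite Ji.
Qed.

Lemma rect_measurable (J : pred 'I_n) (A : 'I_n -> set (measurableTypeR R)) :
  (forall i, measurable (A i)) -> measurable [set w | forall i, J i -> A i (Y i w)].
Proof.
move=> mA; rewrite rect_bigcap; apply: fin_bigcap_measurable => // i _.
by apply: measurable_coord; case: (J i).
Qed.

Lemma rects_measurable J : rects J `<=` measurable.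
Proof. by move=> B [A [mA ->]]; exact: rect_measurable. Qed.

Lemma sig_measurable J B : <<s rects J >> B -> measurable B.
Proof.
exact: (smallest_sub (@sigma_algebra_measurable _ T) (@rects_measurable J)).
Qed.

Lemma rects_setI J : setI_closed (rects J).
Proof.
move=> _ _ [A [mA ->]] [B [mB ->]]; exists (fun i => A i `&` B i); split.
  by move=> i; exact: measurableI.
apply/seteqP; split => w /=; first by move=> [h1 h2] i Ji; split; [exact: h1|exact: h2].
by move=> h; split => i Ji; case: (h i Ji).
Qed.

Lemma rects_setT J : rects J setT.
Proof. by exists (fun=> setT); split => //; apply/seteqP; split. Qed.

Lemma Pr_rect (J : pred 'I_n) (A : 'I_n -> set (measurableTypeR R)) :
  (forall i, measurable (A i)) ->
  Pr [set w | forall i, J i -> A i (Y i w)] = \prod_(i | J i) Pr (Y i @^-1` A i).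
Proof.
move=> mA; apply: EFin_inj; rewrite -PrE; last exact: rect_measurable.
rewrite rect_bigcap indY; last by move=> i; case: (J i).
rewrite [X in _ = X%:E]big_mkcond/= -prodEFin; apply: eq_bigr => i _.
case: (J i); first by rewrite PrE//; exact: measurable_coord.
by rewrite preimage_setT probability_setT.
Qed.

(** Two applications of [pi_indep], one for each family, from the product rule on rectangles. *)
Lemma group_indep (J : pred 'I_n) (B1 B2 : set T) : <<s rects J >> B1 ->
  <<s rects (fun i => ~~ J i) >> B2 -> Pr (B1 `&` B2) = Pr B1 * Pr B2.
Proof.
move=> s1 s2.
have CC A1 A2 : rects J A1 -> rects (fun i => ~~ J i) A2 -> Pr (A1 `&` A2) = Pr A1 * Pr A2.
  move=> [A [mA ->]] [B [mB ->]]; pose AB i := if J i then A i else B i.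
  have mAB i : measurable (AB i) by rewrite /AB; case: (J i).
  have -> : [set w | forall i, J i -> A i (Y i w)] `&`
      [set w | forall i, ~~ J i -> B i (Y i w)] = [set w | forall i, xpredT i -> AB i (Y i w)].
    apply/seteqP; split => w /=.
      move=> [h1 h2] i _; rewrite /AB; case: (boolP (J i)) => Ji; [exact: h1|exact: h2].
    by move=> h; split => i Ji; have := h i isT; rewrite /AB; [rewrite Ji|rewrite (negbTE Ji)].
  rewrite !Pr_rect//= (bigID J)/=; congr (_ * _); apply: eq_bigr => i Ji; rewrite /AB.
    by rewrite Ji.
  by rewrite (negbTE Ji).
apply: (pi_indep (C := rects J)) => //.
- exact: rects_measurable.
- exact: rects_setI.
- exact: rects_setT.
- exact: sig_measurable s2.
- move=> A1 cA1; rewrite setIC mulrC.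
  apply: (pi_indep (C := rects (fun i => ~~ J i))) => //.
  + exact: rects_measurable.
  + exact: rects_setI.
  + exact: rects_setT.
  + exact: rects_measurable cA1.
  + by move=> A2 cA2; rewrite setIC mulrC; exact: CC.
Qed.

Lemma measurable_rect_coord (J : pred 'I_n) i : J i ->
  measurable_fun (setT : set (rect_type J)) (Y i : rect_type J -> R).
Proof.
move=> Ji _ B mB; rewrite setTI; apply: sub_sigma_algebra.
exists (fun j => if j == i then B else setT); split; first by move=> j; case: eqP.
apply/seteqP; split => w /=; first by move=> h j _; case: eqP => [->|].
by move=> /(_ i Ji); rewrite eqxx.
Qed.

End grouping.

End expectation_of_products.

Section second_moments.
Context (R : realType) d (T : measurableType d) (P : probability T R).

(** [E (f - l 1_A)^2 >= 0] at [l = E (f 1_A) / P A]; boundedness of [f] covers the case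
    [P A = 0]. *)
Lemma It_cauchy_schwarz (f : T -> R) (A : set T) (C : R) : measurable_fun setT f ->
  measurable A -> (forall w, 0 <= f w <= C) ->
  It P (fun w => f w * \1_A w) ^+ 2 <= It P (fun w => f w ^+ 2) * Pr P A.
Proof.
move=> mf mA fC; have fn w : `|f w| <= C by have /andP[? ?] := fC w; rewrite ger0_norm.
have f0 w : 0 <= f w by case/andP: (fC w).
have mi : measurable_fun setT (\1_A : T -> R) by exact: measurable_indic.
have ii : itg P (\1_A : T -> R) by apply: (@itg_bounded _ _ _ P _ 1) => // w; exact: indic_norm.
have i1 : itg P (fun w => f w * \1_A w).
  apply: (@itg_bounded _ _ _ P _ (C * 1)); first exact: measurable_funM.
  by move=> w; rewrite normrM; apply: ler_pM => //; exact: indic_norm.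
have i2 : itg P (fun w => f w ^+ 2).
  apply: (@itg_bounded _ _ _ P _ (C ^+ 2)); first by apply: measurable_funX.
  by move=> w; rewrite normrX lerXn2r ?nnegrE// (le_trans _ (fn w)).
set e := It P _; set q := It P _; have p0 := Pr_ge0 P A; set p := Pr P A in p0 *.
have H l : 0 <= q - 2 * l * e + l ^+ 2 * p.
  have -> : q - 2 * l * e + l ^+ 2 * p = It P (fun w => (f w - l * \1_A w) ^+ 2).
    rewrite /q /e /p -(It_indic P mA) -(ItZ (2 * l) i1) -(ItZ (l ^+ 2) ii).
    rewrite -(ItB i2 (itgZ _ i1)) -(ItD (itgB i2 (itgZ _ i1)) (itgZ _ ii)).
    apply: It_eq => w; rewrite indicE; case: (_ \in _) => /=; ring.
  by apply: It_ge0 => w; exact: sqr_ge0.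
have e0 : 0 <= e by apply: It_ge0 => w; rewrite mulr_ge0.
have eC : e <= C * p.
  rewrite /p -(It_indic P mA) -(ItZ C ii); apply: It_le => //; first exact: itgZ.
  by move=> w; apply: ler_wpM2r => //; case/andP: (fC w).
have q0 : 0 <= q by apply: It_ge0 => w; exact: sqr_ge0.
have [pz|pn] := eqVneq p 0.
  have ez : e = 0 by apply/eqP; rewrite eq_le e0 andbT (le_trans eC)// pz mulr0.
  by rewrite ez pz expr0n /= mulr0.
have pp : 0 < p by rewrite lt_def pn.
have := H (e / p); rewrite (_ : q - _ + _ = (q * p - e ^+ 2) / p); last by field.
by rewrite pmulr_lge0 ?invr_gt0// subr_ge0.
Qed.

End second_moments.

(** * Increments over a regular mesh *)

Section discretization.
Context (R : realType) d (T : measurableType d) (P : probability T R)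
  (X : R -> T -> R).
Hypothesis HX : levy_process P X.
Variable t : R.
Hypothesis t0 : 0 <= t.
Variable n : nat.

Let mX s : 0 <= s -> measurable_fun setT (X s) := @levy_measurable _ _ _ _ _ HX s.
Let h := mesh t n.
Let h0 : 0 <= h := mesh_ge0 t0 n.

Definition xi (i : 'I_n.+1) (w : T) : R := X (i.+1%:R * h) w - X (i%:R * h) w.

Lemma measurable_xi i : measurable_fun setT (xi i).
Proof. by apply: measurable_funB; apply: mX; rewrite mulr_ge0. Qed.

Lemma indep_xi : mutually_independent P xi.
Proof.
have := @levy_indep _ _ _ _ _ HX n.+1 (fun i => i%:R * h).
apply; first by rewrite mul0r.
by move=> i; rewrite ler_wpM2r// ler_nat.
Qed.

Lemma increment_law s u (A : set (measurableTypeR R)) : 0 <= s -> 0 <= u -> measurable A ->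
  P ((fun w => X (s + u) w - X s w) @^-1` A) = P (X u @^-1` A).
Proof. by move=> s0 u0 mA; exact: (levy_stationary HX s0 u0 mA). Qed.

Lemma xi_law i (A : set (measurableTypeR R)) : measurable A ->
  P (xi i @^-1` A) = P (X h @^-1` A).
Proof.
move=> mA; rewrite -(increment_law (s := i%:R * h) _ h0 mA) ?mulr_ge0//.
by congr (P _); apply/seteqP; split => w; rewrite /xi /= -natr1 mulrDl mul1r.
Qed.

Lemma sum_xi w : \sum_i xi i w = X t w - X 0 w.
Proof.
have := telescope_sumr (fun i => X (i%:R * h) w) (leq0n n.+1).
by rewrite big_mkord mul0r (meshE t n).
Qed.

Lemma It_xi i (f : R -> R) (K : R) : measurable_fun setT f -> (forall x, 0 <= f x <= K) ->
  It P (fun w => f (xi i w)) = Ex P X h f.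
Proof.
move=> mf fK; apply: (It_eq_law (K := K)) => //; first exact: measurable_xi.
  exact: mX.
by move=> A mA; exact: xi_law.
Qed.

Lemma It_xi_bounded i (f : R -> R) (K : R) : measurable_fun setT f ->
  (forall x, `|f x| <= K) -> It P (fun w => f (xi i w)) = Ex P X h f.
Proof.
move=> mf fK.
have i1 : itg P (fun w => f (xi i w)).
  apply: (@itg_bounded _ _ _ P _ K) => //.
  apply: (measurableT_comp (f := f : measurableTypeR R -> R)) => //; exact: measurable_xi.
have i2 : itg P (fun w => f (X h w)).
  apply: (@itg_bounded _ _ _ P _ K) => //.
  by apply: (measurableT_comp (f := f : measurableTypeR R -> R)) => //; exact: mX.
have ik : itg P (fun=> K) by exact: finite_measure_integrable_cst.
have := @It_xi i (fun x => f x + K) (K + K) _ _.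
rewrite /Ex (ItD i1 ik) (ItD i2 ik) => H; apply: (addIr (It P (fun=> K))); apply: H.
  exact: measurable_funD.
by move=> x; have := fK x; rewrite ler_norml => /andP[? ?]; rewrite lerD2r; apply/andP; split=> //; lra.
Qed.

Lemma It_prod_xi (f : R -> R) (K : R) : measurable_fun setT f -> (forall x, 0 <= f x <= K) ->
  It P (fun w => \prod_i f (xi i w)) = Ex P X h f ^+ n.+1.
Proof.
move=> mf fK.
rewrite (@It_prod _ _ _ _ n.+1 xi (fun=> f) K)//; [|exact: measurable_xi|exact: indep_xi].
under eq_bigr do rewrite (It_xi _ mf fK).
by rewrite prodr_const card_ord.
Qed.

Lemma It_pair_xi i j (f g : R -> R) (K : R) : i != j -> measurable_fun setT f ->
  measurable_fun setT g -> (forall x, 0 <= f x <= K) -> (forall x, 0 <= g x <= K) ->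
  It P (fun w => f (xi i w) * g (xi j w)) = Ex P X h f * Ex P X h g.
Proof.
move=> ij mf mg fK gK; pose K1 := Order.max 1 K.
pose F k := if k == i then f else if k == j then g else fun=> 1.
have Fi : F i = f by rewrite /F eqxx.
have Fj : F j = g by rewrite /F eq_sym (negbTE ij) eqxx.
have Fk k : (k != i) && (k != j) -> F k = fun=> 1.
  by move=> /andP[/negbTE ki /negbTE kj]; rewrite /F ki kj.
have e : Ex P X h f * Ex P X h g = \prod_i It P (fun w => F i (xi i w)).
  rewrite (bigD1 i)//= (bigD1 j) 1?eq_sym//= Fi Fj (It_xi _ mf fK) (It_xi _ mg gK).
  by rewrite big1 ?mulr1// => k /Fk ->; rewrite It_const.
rewrite e -(@It_prod _ _ _ P n.+1 xi F K1 measurable_xi indep_xi).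
- apply: It_eq => w; rewrite (bigD1 i)//= (bigD1 j) 1?eq_sym//= Fi Fj.
  by rewrite big1 ?mulr1// => k /Fk ->.
- by move=> k; rewrite /F; case: eqP => // _; case: eqP.
- move=> k x; have /andP[f0 f1] := fK x; have /andP[g0 g1] := gK x; rewrite /F.
  case: eqP => _; first by rewrite f0 le_max f1 orbT.
  by case: eqP => _; [rewrite g0 le_max g1 orbT|rewrite ler01 le_max lexx].
Qed.

(** The variance of each term is bounded by its second moment, which loses nothing in order on a
    fine mesh. *)
Lemma chebyshev_xi (f : R -> R) (K a : R) : measurable_fun setT f ->
  (forall x, `|f x| <= K) -> 0 < a ->
  Pr P [set w | n.+1%:R * Ex P X h f + a <= \sum_i f (xi i w)] <=
  n.+1%:R * Ex P X h (fun x => f x ^+ 2) / a ^+ 2.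
Proof.
move=> mf fK a0; set mu := n.+1%:R * _.
have K0 : 0 <= K by exact: le_trans (normr_ge0 _) (fK 0).
have mfx i : measurable_fun setT (fun w => f (xi i w)).
  apply: (measurableT_comp (f := f : measurableTypeR R -> R)) => //; exact: measurable_xi.
have mS : measurable_fun setT (fun w => \sum_i f (xi i w)) by exact: measurable_sum.
have SK w : `|\sum_i f (xi i w)| <= n.+1%:R * K.
  apply: (le_trans (ler_norm_sum _ _ _)).
  apply: (le_trans (ler_sum _ (fun i _ => fK (xi i w)))).
  by rewrite sumr_const card_ord mulr_natl.
pose q := Ex P X h (fun x => f x ^+ 2); pose m := Ex P X h f.
have bnd (g : T -> R) (C : R) : measurable_fun setT g -> (forall w, `|g w| <= C) -> itg P g.
  by move=> mg gC; exact: (itg_bounded _ mg gC).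
have im i : itg P (fun w => f (xi i w)) by exact: bnd _ K (mfx i) (fun w => fK _).
have imm i j : itg P (fun w => f (xi i w) * f (xi j w)).
  apply: (bnd _ (K * K)); first exact: measurable_funM.
  by move=> w; rewrite normrM; apply: ler_pM.
have m2 : measurable_fun setT (fun x : R => f x ^+ 2) by exact: measurable_funX.
have Eii i : It P (fun w => f (xi i w) * f (xi i w)) = q.
  rewrite /q -(It_xi_bounded i (f := fun x => f x ^+ 2) (K := K ^+ 2))//.
  by move=> x; rewrite normrX lerXn2r ?nnegrE.
have Eij i j : i != j -> It P (fun w => f (xi i w) * f (xi j w)) = m * m.
  (* [It_pair_xi] is stated for nonnegative functions, so the product rule is taken for [f + K] and
     expanded. *)
  move=> ij; have mK : measurable_fun setT (fun x => f x + K) by exact: measurable_funD.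
  have fKK x : 0 <= f x + K <= K + K.
    by have := fK x; rewrite ler_norml => /andP[? ?]; rewrite lerD2r; apply/andP; split=> //; lra.
  have ik : itg P (fun=> K * K) by exact: finite_measure_integrable_cst.
  have := It_pair_xi ij mK mK fKK fKK.
  have -> : Ex P X h (fun x => f x + K) = m + K.
    rewrite /Ex ItD; [|by apply: (bnd _ K) => //; apply: (measurableT_comp (f := f : measurableTypeR R -> R)) => //; exact: mX|exact: finite_measure_integrable_cst].
    by rewrite It_const.
  have -> : (fun w => (f (xi i w) + K) * (f (xi j w) + K)) =
      (fun w => f (xi i w) * f (xi j w) + (K * f (xi i w) + (K * f (xi j w) + K * K))).
    by apply/funext => w; ring.
  have i1 := itgZ K (im i); have i2 := itgZ K (im j).
  rewrite (ItD (imm i j) (itgD i1 (itgD i2 ik))) (ItD i1 (itgD i2 ik)) (ItD i2 ik).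
  rewrite (ItZ K (im i)) (ItZ K (im j)) It_const (It_xi_bounded i mf fK) (It_xi_bounded j mf fK) -/m; lra.
pose S w := \sum_i f (xi i w).
have iS : itg P S by exact: bnd _ _ mS SK.
have ES : It P S = mu.
  have [_ ->] := It_sum (index_enum _) im.
  under eq_bigr do rewrite (It_xi_bounded _ mf fK).
  by rewrite sumr_const card_ord /mu mulr_natl.
have iS2 : itg P (fun w => S w ^+ 2).
  apply: (bnd _ ((n.+1%:R * K) ^+ 2)); first exact: measurable_funX.
  by move=> w; rewrite normrX lerXn2r ?nnegrE ?mulr_ge0//; exact: SK.
have ES2 : It P (fun w => S w ^+ 2) <= n.+1%:R * q + mu ^+ 2.
  have -> : (fun w => S w ^+ 2) = (fun w => \sum_i \sum_j f (xi i w) * f (xi j w)).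
    by apply/funext => w; rewrite expr2 /S big_distrlr.
  have isum i : itg P (fun w => \sum_j f (xi i w) * f (xi j w)).
    by have [] := It_sum (index_enum _) (imm i).
  have [_ ->] := It_sum (index_enum _) isum.
  have rowE i : It P (fun w => \sum_j f (xi i w) * f (xi j w)) = q - m * m + n.+1%:R * (m * m).
    have [_ ->] := It_sum (index_enum _) (imm i).
    rewrite (bigD1 i)//= Eii (eq_bigr (fun=> m * m)); last by move=> j ji; rewrite Eij// eq_sym.
    have : \sum_(j < n.+1) m * m = n.+1%:R * (m * m) by rewrite sumr_const card_ord mulr_natl.
    by rewrite (bigD1 i)//=; lra.
  rewrite (eq_bigr _ (fun i _ => rowE i)) sumr_const card_ord -mulr_natl /mu -/m.
  have : 0 <= n.+1%:R * (m * m) by rewrite mulr_ge0// -expr2 sqr_ge0.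
  rewrite (_ : (n.+1%:R * m) ^+ 2 = n.+1%:R * (n.+1%:R * (m * m))); last by ring.
  by lra.
have icst : itg P (fun=> mu ^+ 2) by exact: finite_measure_integrable_cst.
have var : It P (fun w => (S w - mu) ^+ 2) <= n.+1%:R * q.
  have -> : (fun w => (S w - mu) ^+ 2) = (fun w => S w ^+ 2 - (2 * mu) * S w + mu ^+ 2).
    by apply/funext => w; ring.
  rewrite (ItD (itgB iS2 (itgZ _ iS)) icst) (ItB iS2 (itgZ _ iS)) (ItZ _ iS) ES It_const.
  by move: ES2; rewrite !expr2; lra.
set A := [set w | _].
have mA : measurable A.
  rewrite (_ : A = S @^-1` `[mu + a, +oo[); last by apply/seteqP; split=> w; rewrite /A /= in_itv/= andbT.
  by rewrite -[X in measurable X]setTI; apply: mS => //; exact: measurable_itv.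
have iA : itg P (\1_A : T -> R).
  by apply: (bnd _ 1) => [|w]; [exact: measurable_indic|exact: indic_norm].
have ivar : itg P (fun w => (S w - mu) ^+ 2).
  apply: (bnd _ ((n.+1%:R * K + `|mu|) ^+ 2)); first by apply: measurable_funX; apply: measurable_funB.
  move=> w; rewrite normrX lerXn2r ?nnegrE ?addr_ge0 ?mulr_ge0//.
  by apply: (le_trans (ler_normB _ _)); rewrite lerD2r; exact: SK.
rewrite ler_pdivlMr ?exprn_gt0// mulrC -(It_indic P mA) -(ItZ _ iA); apply: le_trans var.
apply: It_le => //; first exact: itgZ.
move=> w; rewrite indicE; case: (boolP (w \in A)) => [|_] /=; last by rewrite mulr0 sqr_ge0.
rewrite inE /A /= -/(S w) => hS; rewrite mulr1 lerXn2r ?nnegrE//; lra.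
Qed.

End discretization.

Lemma continuous_sqr (R : realType) (f : R -> R) : continuous f ->
  continuous (fun x => f x ^+ 2).
Proof.
move=> cf x; apply: (@continuous_comp _ _ _ f (fun z : R => z ^+ 2)); first exact: cf.
exact: exprn_continuous.
Qed.

Lemma near_le (R : realType) (u : nat -> R) (l e : R) : u n @[n --> \oo] --> l -> 0 < e ->
  \forall n \near \oo, u n <= l + e.
Proof.
move=> /cvgrPdist_le h e0; apply: filterS (h e e0) => n; rewrite ler_distlC => /andP[]; lra.
Qed.

Lemma near_ge (R : realType) (u : nat -> R) (l e : R) : u n @[n --> \oo] --> l -> 0 < e ->
  \forall n \near \oo, l - e <= u n.
Proof.
move=> /cvgrPdist_le h e0; apply: filterS (h e e0) => n; rewrite ler_distlC => /andP[]; lra.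
Qed.

Lemma pow_le_expR (R : realType) (x : R) n : 0 <= x -> x ^+ n <= expR (n%:R * (x - 1)).
Proof.
move=> x0; rewrite mulrC expRM_natr lerXn2r ?nnegrE ?expR_ge0//.
by have := expR_ge1Dx (x - 1); rewrite addrC subrK.
Qed.

Lemma pow_ge_expR (R : realType) (x : R) n : 0 < x -> expR (n%:R * ((x - 1) / x)) <= x ^+ n.
Proof.
move=> x0; rewrite mulrC expRM_natr lerXn2r ?nnegrE ?expR_ge0 ?(ltW x0)//.
have := @expR_div_le _ (x - 1); rewrite (addrC 1) subrK; apply; lra.
Qed.

(** [p], [q], [r] stand for the one-step expectations of [w], [w^2] and [w exp (- eta g)]. Up to
    1/40 in the exponent, [p^n] is at least [exp al] and [q^n] at most [exp be], while the Markov
    term is at most [exp (al - 19/10)]. Numerically [9/10 - 35/100 = 55/100] and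
    [(55/100)^2 / (11/10) > 1/4]. *)
Lemma tilt_arith (R : realType) n (p q r al be Y Q : R) : 0 < p -> 0 <= r -> 0 <= q -> 0 <= Q ->
  al - 1 / 40 <= n%:R * ((p - 1) / p) -> n%:R * (q - 1) <= be + 1 / 40 ->
  Y + n%:R * (r - 1) <= al - 19 / 10 ->
  (forall L, 0 <= L -> L <= p ^+ n - expR Y * r ^+ n -> L ^+ 2 <= q ^+ n * Q) ->
  1 / 4 * expR (2 * al - be) <= Q.
Proof.
move=> p0 r0 q0 Q0 hp hq hr H.
have e1 : expR (al - 1 / 40) <= p ^+ n.
  by apply: le_trans (pow_ge_expR _ p0); rewrite ler_expR.
have e2 : expR Y * r ^+ n <= expR (al - 19 / 10).
  apply: (@le_trans _ _ (expR Y * expR (n%:R * (r - 1)))).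
    by rewrite ler_wpM2l ?expR_ge0// pow_le_expR.
  by rewrite -expRD ler_expR.
have e3 : (9 / 10 : R) <= expR (- (1 / 40)) by have := @expR_ge1Dx R (- (1 / 40)); lra.
have e4 : expR (- (19 / 10)) <= (35 / 100 : R).
  have : (29 / 10 : R) <= expR (19 / 10) by have := @expR_ge1Dx R (19 / 10); lra.
  rewrite expRN => h; rewrite -[leRHS]invrK lef_pV2 ?posrE ?expR_gt0//; lra.
have e5 := expR_gt0 al.
rewrite (expRD al (- (1 / 40))) in e1; rewrite (expRD al (- (19 / 10))) in e2.
have L1 : expR al * (55 / 100) <= p ^+ n - expR Y * r ^+ n.
  have := ler_wpM2l (ltW e5) e3; have := ler_wpM2l (ltW e5) e4; lra.
have L2 := H _ (mulr_ge0 (ltW e5) (divr_ge0 (ler0n R 55) (ler0n R 100))) L1.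
have Q1 : q ^+ n <= expR (be + 1 / 40).
  by apply: (le_trans (pow_le_expR _ q0)); rewrite ler_expR.
have {}L2 := le_trans L2 (ler_wpM2r Q0 Q1).
have e6 : expR (1 / 40) <= (11 / 10 : R) by have := @expR_le_quad R (1 / 40); lra.
have e7 : expR (2 * al - be) * expR be = expR al ^+ 2.
  by rewrite -expRD expr2 -expRD; congr expR; ring.
rewrite expRD exprMn -e7 in L2.
have b0 := expR_gt0 be; have ab0 := expR_gt0 (2 * al - be).
have h1 : expR (2 * al - be) * (55 / 100) ^+ 2 <= expR (1 / 40) * Q.
  rewrite -(ler_pM2l b0); move: L2; rewrite !mulrA (mulrC (expR be) (expR (2 * al - be))); exact.
have h2 : expR (1 / 40) * Q <= 11 / 10 * Q by rewrite ler_wpM2r.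
move: h1; rewrite expr2; lra.
Qed.

(** The second-order expansion of [r], multiplied by the number [N] of steps; three errors of 1/40
    fit into 1/10. *)
Lemma tilt_arith_rate (R : realType) (N p r e G H al m v : R) :
  N * r <= N * (p - e * G + 2 * e ^+ 2 * H) -> N * (p - 1) <= al + 1 / 40 ->
  2 * e ^+ 2 * (N * H) <= 2 * e ^+ 2 * v + 1 / 40 -> e * m - 1 / 40 <= e * (N * G) ->
  N * (r - 1) <= al - e * m + 2 * e ^+ 2 * v + 1 / 10.
Proof. lra. Qed.

Lemma tilt_arith_shift (R : realType) (e m a v al x : R) : 2 + 2 * e ^+ 2 * v <= e * a ->
  x <= al - e * m + 2 * e ^+ 2 * v + 1 / 10 -> e * (m - a) + x <= al - 19 / 10.
Proof. lra. Qed.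

(** * Change of measure for the increments *)

Section master_bounds.
Context (R : realType) d (T : measurableType d) (P : probability T R)
  (X : R -> T -> R) (gamma : R) (Pi : {measure set (measurableTypeR R) -> \bar R}).
Hypotheses (HX : levy_process P X) (HPi : levy_measure_on_unit Pi)
  (Htr : has_triplet P X gamma 0 Pi).

Local Notation IP := (IP Pi).
Local Notation Ex := (Ex P X).
Local Notation Pr := (Pr P).

Let mX s : 0 <= s -> measurable_fun setT (X s) := @levy_measurable _ _ _ _ _ HX s.

Lemma measurable_ge (Y : T -> R) (a : R) : measurable_fun setT Y -> measurable [set w | a <= Y w].
Proof.
move=> mY; rewrite (_ : [set w | _] = Y @^-1` `[a, +oo[).
  by rewrite -[X in measurable X]setTI; apply: mY => //; exact: measurable_itv.
by apply/seteqP; split=> w; rewrite /= in_itv/= andbT.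
Qed.

Lemma measurable_gt (Y : T -> R) (a : R) : measurable_fun setT Y -> measurable [set w | a < Y w].
Proof.
move=> mY; rewrite (_ : [set w | _] = Y @^-1` `]a, +oo[).
  by rewrite -[X in measurable X]setTI; apply: mY => //; exact: measurable_itv.
by apply/seteqP; split=> w; rewrite /= in_itv/= andbT.
Qed.

(** [X 0] vanishes only almost surely, while the increments add up to [X t - X 0]; stationarity from
    time 0 identifies the two laws. *)
Lemma Pr_sub0_ge t a : 0 <= t -> Pr [set w | a <= X t w - X 0 w] = Pr [set w | a <= X t w].
Proof.
move=> t0; congr fine.
have := increment_law HX (lexx 0) t0 (measurable_itv `[a, +oo[).
rewrite add0r => h; apply: (etrans _ (etrans h _)); congr (P _); apply/seteqP; split=> w /=;
  by rewrite in_itv/= andbT.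
Qed.

Lemma Pr_sub0_gt t a : 0 <= t -> Pr [set w | a < X t w - X 0 w] = Pr [set w | a < X t w].
Proof.
move=> t0; congr fine.
have := increment_law HX (lexx 0) t0 (measurable_itv `]a, +oo[).
rewrite add0r => h; apply: (etrans _ (etrans h _)); congr (P _); apply/seteqP; split=> w /=;
  by rewrite in_itv/= andbT.
Qed.

Lemma IP_unit (f g : R -> R) : @itg _ (measurableTypeR R) R Pi f ->
  @itg _ (measurableTypeR R) R Pi g -> (forall x, -1 <= x <= 1 -> f x = g x) -> IP f = IP g.
Proof.
move=> fi gi fg; rewrite -(Rintegral_unit HPi fi) -(Rintegral_unit HPi gi).
by apply: eq_Rintegral => x; rewrite inE /= in_itv /=; exact: fg.
Qed.

Section fixed_time.
Variable t : R.
Hypothesis t0 : 0 <= t.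

Local Notation conv := (conv P X t).
Local Notation mesh := (mesh t).
Let mesh0 n : 0 <= mesh n := mesh_ge0 t0 n.

Lemma itg_lin s (h : R -> R) (C : R) : 0 <= s -> continuous h ->
  (forall x, `|h x| <= C * `|x|) -> itg P (fun w => h (X s w)).
Proof.
move=> s0 ch hC; apply: (itg_hX HX HPi Htr (C := C)) => //.
  exact: continuous_measurable_fun.
have C0 : 0 <= C by have := hC 1; rewrite normr1 mulr1; apply: le_trans.
move=> x; apply: (le_trans (hC x)); apply: ler_wpM2l => //.
by rewrite -[x ^+ 2]real_normK ?num_real// expr2; have := normr_ge0 x; nra.
Qed.

(** Split [f] into the identity, whose mean is exactly [gamma s], and a function vanishing near 0,
    to which [conv_gen] applies. *)
Lemma conv_near_id (f : R -> R) (del C : R) : continuous f -> 0 < del ->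
  (forall x, `|x| <= del -> f x = x) -> (forall x, `|f x - x| <= C * `|x|) ->
  conv f (t * (gamma + IP (fun x => f x - x))).
Proof.
move=> cf d0 fd fC.
have ck : continuous (fun x => f x - x) by move=> x; apply: cvgB; [exact: cf|exact: cvg_id].
have k0 x : `|x| <= del -> f x - x = 0 by move=> /fd ->; rewrite subrr.
have h1 := conv_gen HX HPi Htr t0 ck d0 k0 fC.
have h2 : conv id (t * gamma).
  apply: (@cvg_rate _ _ _ 0) => n; rewrite mul0r.
  rewrite /Ex (Ex_id HX HPi Htr (mesh0 n)) mulrCA (meshE t n) mulrC subrr normr0 //.
have := conv_lin (c := 1) (e := 1) (fun n => itg_X HX HPi Htr (mesh0 n)) (fun n => itg_lin (mesh0 n) ck fC) h2 h1.
rewrite !mul1r -mulrDr; rewrite (_ : (fun x => _) = f)//.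
by apply/funext => x; rewrite !mul1r addrC subrK.
Qed.

Lemma sqr_le_norm (x : R) : -1 <= x <= 1 -> x ^+ 2 <= `|x|.
Proof.
move=> x1; rewrite -[leLHS]real_normK ?num_real// expr2 ler_piMl//.
by rewrite ler_norml.
Qed.

(* Only an upper bound is available because [E X_s^2] need not be smaller than
   [s * V2]; the deficit [x^2 - f x] is truncated from above to keep it
   integrable against the generator. *)
Lemma sqr_near_le (f : R -> R) (del C e : R) : continuous f -> 0 < del -> 0 <= C ->
  (forall x, `|x| <= del -> f x = x ^+ 2) ->
  (forall x, 0 <= f x <= x ^+ 2 + C * `|x|) -> 0 < e ->
  \forall n \near \oo, n.+1%:R * Ex (mesh n) f <= t * IP f + e.
Proof.
move=> cf d0 C0 fd fC e0.
pose k x : R := Order.min (x ^+ 2 - f x) `|x|.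
have csq : continuous (fun x : R => x ^+ 2) by exact: exprn_continuous.
have ck : continuous k.
  apply: continuous_minr; first by move=> x; apply: cvgB; [exact: csq|exact: cf].
  by move=> x; exact: norm_continuous.
have k0 x : `|x| <= del -> k x = 0 by move=> h; rewrite /k fd// subrr min_l.
have kC x : `|k x| <= (C + 1) * `|x|.
  have /andP[f0 f1] := fC x; have n0 := normr_ge0 x; have h1 := mulr_ge0 C0 n0.
  rewrite ler_norml /k; apply/andP; split.
    by rewrite le_min; apply/andP; split; lra.
  by rewrite ge_min; apply/orP; right; lra.
have ck1 := conv_gen HX HPi Htr t0 ck d0 k0 kC.
have kD := dom_sqr d0 k0 kC.
have mk := continuous_measurable_fun ck; have mf := continuous_measurable_fun cf.
have ik := itg_Pi HPi mk kD.
have fD x : `|f x| <= (1 + (C / del)) * x ^+ 2.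
  have /andP[f0 f1] := fC x; rewrite ger0_norm//.
  have dC : 0 <= C / del by rewrite divr_ge0// ltW.
  have x2 := sqr_ge0 x.
  have [h|h] := leP `|x| del; first by rewrite fd// mulrDl mul1r lerDl mulr_ge0.
  apply: (le_trans f1); rewrite mulrDl mul1r lerD2l -mulrA ler_wpM2l// ler_pdivlMl//.
  by rewrite -[leRHS]real_normK ?num_real// expr2 ler_wpM2r// ltW.
have if_ := itg_Pi HPi mf fD.
have IPk : IP k = V2 Pi - IP f.
  rewrite /V2 /IP -(ItB (itg_sqr HPi) if_); apply: IP_unit => //.
    exact: itgB (itg_sqr HPi) if_.
  move=> x x1; rewrite /k min_l//; have /andP[f0 f1] := fC x.
  by apply: le_trans (sqr_le_norm x1); lra.
have lim : (t * V2 Pi + t ^+ 2 * (`|gamma| + V2 Pi) ^+ 2 * n.+1%:R^-1) -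
    n.+1%:R * Ex (mesh n) k @[n --> \oo] -->
    (t * V2 Pi + t ^+ 2 * (`|gamma| + V2 Pi) ^+ 2 * 0) - t * IP k.
  apply: cvgB => //; apply: cvgD; first exact: cvg_cst.
  by apply: cvgMr; exact: cvg_harmonic.
apply: filterS (near_le lim e0) => n; rewrite mulr0 addr0 IPk => hn.
apply: (@le_trans _ _ (n.+1%:R * Ex (mesh n) (fun x => x ^+ 2) - n.+1%:R * Ex (mesh n) k)).
  rewrite -mulrBr ler_wpM2l// /Ex.
  have i2 := itg_X2 HX HPi Htr (mesh0 n); have i3 := itg_lin (mesh0 n) ck kC.
  rewrite -(ItB i2 i3); apply: It_le; last 1 first.
  - move=> w; set x := X _ w.
    have : k x <= x ^+ 2 - f x by rewrite /k ge_min lexx.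
    lra.
  - apply: (itg_hX HX HPi Htr (C := 1 + C / del)) => // x.
    apply: (le_trans (fD x)); apply: ler_wpM2l; last by lra.
    by rewrite addr_ge0// divr_ge0// ltW.
  - exact: itgB.
have hm := mesh_sqr_le HX HPi Htr t0 n; rewrite mulrBr in hn.
by apply: (le_trans (lerB hm (lexx _))); apply: (le_trans hn); lra.
Qed.

Lemma sum_norm_le_sqr (x : R) : `|x| <= 1 + x ^+ 2.
Proof.
by rewrite -[x ^+ 2]real_normK ?num_real// expr2; have := normr_ge0 x; nra.
Qed.

(** On the complement of the event, [sum g(xi_i) < a], so [exp (eta (a - sum g(xi_i))) >= 1] and the
    tilted mass there is at most the subtracted term. The Cauchy-Schwarz inequality is applied to
    what remains. *)
Lemma tilt_at_mesh n (w g : R -> R) (B eta a : R) : measurable_fun setT w ->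
  measurable_fun setT g -> 0 < eta -> 1 <= B ->
  (forall x, 0 <= w x <= B) -> (forall x, g x <= x) ->
  (forall x, w x != 0 -> - (eta * g x) <= 1 / 2) ->
  forall L, 0 <= L ->
  L <= Ex (mesh n) w ^+ n.+1 -
    expR (eta * a) * Ex (mesh n) (fun x => w x * expR (- (eta * g x))) ^+ n.+1 ->
  L ^+ 2 <= Ex (mesh n) (fun x => w x ^+ 2) ^+ n.+1 *
    Pr [set om | a <= X t om - X 0 om].
Proof.
move=> mw mg eta0 B1 wB gx wneg L L0 LL.
pose A := [set om | a <= X t om - X 0 om]; rewrite -/A.
have mA : measurable A by apply: measurable_ge; apply: measurable_funB; exact: mX.
have w2B x : 0 <= w x ^+ 2 <= B ^+ 2.
  have /andP[w0 w1] := wB x; rewrite sqr_ge0 lerXn2r ?nnegrE//.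
  exact: le_trans w1.
have mw2 : measurable_fun setT (fun x => w x ^+ 2) by exact: measurable_funX.
have mwe : measurable_fun setT (fun x => w x * expR (- (eta * g x))).
  apply: measurable_funM => //; apply: measurableT_comp => //.
  by apply: measurableT_comp => //; exact: measurable_funM.
have e12 : 1 <= expR (1 / 2) :> R by rewrite -[leLHS]expR0 ler_expR divr_ge0.
have weB x : 0 <= w x * expR (- (eta * g x)) <= B * expR (1 / 2).
  have /andP[w0 w1] := wB x; rewrite mulr_ge0 ?expR_ge0//=.
  have [->|wn] := eqVneq (w x) 0.
    by rewrite mul0r mulr_ge0 ?expR_ge0// (le_trans _ B1).
  by apply: ler_pM; rewrite ?expR_ge0// ?ler_expR ?wneg.
pose M om := \prod_i w (xi X t (n:=n) i om).
have mwx i : measurable_fun setT (fun om => w (xi X t (n:=n) i om)).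
  by apply: (measurableT_comp (f := w : measurableTypeR R -> R)) => //; exact: (measurable_xi HX t0).
have mM : measurable_fun setT M by exact: measurable_prodr.
have MB om : 0 <= M om <= B ^+ size (index_enum 'I_n.+1).
  by apply: prodr_bound => // i; exact: wB.
have EM : It P M = Ex (mesh n) w ^+ n.+1 by exact: (It_prod_xi HX t0 n mw wB).
have EM2 : It P (fun om => M om ^+ 2) = Ex (mesh n) (fun x => w x ^+ 2) ^+ n.+1.
  rewrite -(It_prod_xi HX t0 n mw2 w2B); apply: It_eq => om.
  by rewrite /M -prodrXl.
have iM : itg P M.
  apply: (itg_bounded (C := B ^+ size (index_enum 'I_n.+1)) P mM) => om.
  by have /andP[? ?] := MB om; rewrite ger0_norm.
have mi D : measurable D -> measurable_fun setT (\1_D : T -> R) by exact: measurable_indic.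
have iMA D : measurable D -> itg P (fun om => M om * \1_D om).
  move=> mD; apply: (itg_bounded (C := B ^+ size (index_enum 'I_n.+1) * 1) P).
    by apply: measurable_funM => //; exact: mi.
  move=> om; rewrite normrM; apply: ler_pM => //; last exact: indic_norm.
  by have /andP[? ?] := MB om; rewrite ger0_norm.
have mC := measurableC mA.
have MC : It P (fun om => M om * \1_(~` A) om) <= expR (eta * a) * Ex (mesh n) (fun x => w x * expR (- (eta * g x))) ^+ n.+1.
  rewrite -(It_prod_xi HX t0 n mwe weB).
  have ip : itg P (fun om => \prod_i (w (xi X t (n:=n) i om) * expR (- (eta * g (xi X t (n:=n) i om))))).
    have B1' : 1 <= B * expR (1 / 2).
      by rewrite -[leLHS]mulr1; apply: ler_pM.
    apply: (itg_bounded (C := (B * expR (1 / 2)) ^+ size (index_enum 'I_n.+1)) P).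
      apply: measurable_prodr => i.
      apply: (measurableT_comp (f := (fun x => w x * expR (- (eta * g x))) : measurableTypeR R -> R)) => //.
      exact: (measurable_xi HX t0).
    move=> om; have /andP[? ?] := @prodr_bound R _ (index_enum 'I_n.+1) xpredT
      (fun i => w (xi X t (n:=n) i om) * expR (- (eta * g (xi X t (n:=n) i om)))) _ B1' (fun i => weB _).
    by rewrite ger0_norm.
  rewrite -(ItZ _ ip); apply: It_le; [exact: iMA|exact: itgZ|move=> om].
  rewrite indicE; case: (boolP (om \in ~` A)) => [|_] /=; last first.
    by rewrite mulr0 mulr_ge0 ?expR_ge0//; apply: prodr_ge0 => i _; case/andP: (weB (xi X t (n:=n) i om)).
  rewrite inE /A /= => /negP; rewrite -ltNge => hlt; rewrite mulr1 big_split /= -/(M om).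
  rewrite mulrCA ler_peMr//; first by case/andP: (MB om).
  rewrite -expR_sum -expRD -[leLHS]expR0 ler_expR sumrN -mulr_sumr.
  have : \sum_i g (xi X t (n:=n) i om) <= X t om - X 0 om.
    by rewrite -(sum_xi X t n om); apply: ler_sum => i _; exact: gx.
  by nra.
have MAE : It P (fun om => M om * \1_A om) = Ex (mesh n) w ^+ n.+1 - It P (fun om => M om * \1_(~` A) om).
  rewrite -EM -(ItB iM (iMA _ mC)); apply: It_eq => om.
  by rewrite !indicE in_setC; case: (om \in A) => /=; ring.
have := It_cauchy_schwarz P mM mA MB; rewrite EM2; apply: le_trans.
have LM : L <= It P (fun om => M om * \1_A om).
  by rewrite MAE; apply: (le_trans LL); rewrite lerD2l lerN2.
by rewrite lerXn2r ?nnegrE// (le_trans _ LM).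
Qed.

(* [P(A) >= (E[M 1_A])^2 / E[M^2]] for [M = prod w(xi_i)], the tilt of the law
   of the increments by [w]; under the tilted law [sum g(xi_i)] has mean close
   to [m] and is bounded below by the exponential Markov inequality. *)
Lemma tilted_lower_bound (w g : R -> R) (del B C eta a : R) :
  continuous w -> continuous g -> 0 < del -> 0 < eta -> 0 <= C ->
  (forall x, `|x| <= del -> w x = 1 /\ g x = x) ->
  (forall x, 0 <= w x <= B) -> (forall x, g x <= x) ->
  (forall x, w x != 0 -> - (eta * g x) <= 1 / 2) ->
  (forall x, `|w x * g x - x| <= C * `|x|) ->
  (forall x, w x * g x ^+ 2 <= x ^+ 2 + C * `|x|) ->
  2 + 2 * eta ^+ 2 * (t * IP (fun x => w x * g x ^+ 2)) <= eta * a ->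
  1 / 4 * expR (- (t * IP (fun x => (w x - 1) ^+ 2))) <=
  Pr [set om | t * (gamma + IP (fun x => w x * g x - x)) - a <= X t om].
Proof.
move=> cw cg d0 eta0 C0 wgd wB gx wneg wgC wg2C Ha.
have w0 x : 0 <= w x by case/andP: (wB x).
have B1 : 1 <= B.
  have z0 : `|0 : R| <= del by rewrite normr0 ltW.
  by have [<- _] := wgd 0 z0; case/andP: (wB 0).
set v := t * IP _ in Ha; set m := t * (gamma + _).
pose A := [set om | m - a <= X t om - X 0 om].
rewrite -Pr_sub0_ge// -/A.
have mA : measurable A by apply: measurable_ge; apply: measurable_funB; exact: mX.
have cwg : continuous (fun x => w x * g x) by move=> x; apply: cvgM; [exact: cw|exact: cg].
have cwg2 : continuous (fun x => w x * g x ^+ 2).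
  by move=> x; apply: cvgM; [exact: cw|exact: (continuous_sqr cg)].
have cw2 := continuous_sqr cw.
have lin (k : R -> R) (D : R) : 0 <= D -> (forall x, `|x| <= del -> k x = 0) ->
    (forall x, `|k x| <= D) -> forall x, `|k x| <= (D / del) * `|x|.
  move=> D0 kd kD x; have [h|h] := leP `|x| del.
    by rewrite kd// normr0 mulr_ge0// divr_ge0// ltW.
  by apply: (le_trans (kD x)); rewrite -mulrA ler_peMr// ler_pdivlMl// mulr1 ltW.
pose k1 x := w x - 1; pose k2 x := w x ^+ 2 - 1.
have ck1 : continuous k1 by move=> x; apply: cvgB; [exact: cw|exact: cvg_cst].
have ck2 : continuous k2 by move=> x; apply: cvgB; [exact: cw2|exact: cvg_cst].
have k10 x : `|x| <= del -> k1 x = 0 by move=> /wgd[h _]; rewrite /k1 h subrr.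
have k20 x : `|x| <= del -> k2 x = 0 by move=> /wgd[h _]; rewrite /k2 h expr1n subrr.
have k1B x : `|k1 x| <= B ^+ 2.
  have /andP[? ?] := wB x; have : B <= B ^+ 2 by rewrite expr2 ler_peMl//; lra.
  by rewrite /k1 ler_norml => ?; apply/andP; split; lra.
have w2B x : 0 <= w x ^+ 2 <= B ^+ 2.
  by have /andP[? ?] := wB x; rewrite sqr_ge0 lerXn2r ?nnegrE//; lra.
have k2B x : `|k2 x| <= B ^+ 2.
  have := w2B x; have : B <= B ^+ 2 by rewrite expr2 ler_peMl//; lra.
  by rewrite /k2 ler_norml => ? /andP[? ?]; apply/andP; split; lra.
have k1L := lin _ _ (sqr_ge0 B) k10 k1B; have k2L := lin _ _ (sqr_ge0 B) k20 k2B.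
have c1 := conv_gen HX HPi Htr t0 ck1 d0 k10 k1L.
have c2 := conv_gen HX HPi Htr t0 ck2 d0 k20 k2L.
have wgd' x : `|x| <= del -> w x * g x = x by move=> /wgd[-> ->]; rewrite mul1r.
have c3 := conv_near_id cwg d0 wgd' wgC; rewrite -/m in c3.
have wg2d x : `|x| <= del -> w x * g x ^+ 2 = x ^+ 2 by move=> /wgd[-> ->]; rewrite mul1r.
have wg20 x : 0 <= w x * g x ^+ 2 <= x ^+ 2 + C * `|x|.
  by rewrite wg2C andbT mulr_ge0// sqr_ge0.
set al := t * IP k1 in c1; set be := t * IP k2 in c2.
have abE : - (t * IP (fun x => (w x - 1) ^+ 2)) = 2 * al - be.
  have i1 := itg_Pi HPi (continuous_measurable_fun ck1) (dom_sqr d0 k10 k1L).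
  have i2 := itg_Pi HPi (continuous_measurable_fun ck2) (dom_sqr d0 k20 k2L).
  have -> : IP (fun x => (w x - 1) ^+ 2) = IP k2 - 2 * IP k1.
    rewrite /IP -(ItZ 2 i1) -(ItB i2 (itgZ 2 i1)); apply: It_eq => x.
    by rewrite /k1 /k2; ring.
  by rewrite /al /be; ring.
rewrite abE.
pose p n := Ex (mesh n) w; pose q n := Ex (mesh n) (fun x => w x ^+ 2).
pose r n := Ex (mesh n) (fun x => w x * expR (- (eta * g x))).
have mw := continuous_measurable_fun cw; have mw2 := continuous_measurable_fun cw2.
have cwe : continuous (fun x => w x * expR (- (eta * g x))).
  move=> x; apply: cvgM; first exact: cw.
  apply: (@continuous_comp _ _ _ (fun x => - (eta * g x)) expR); last exact: continuous_expR.
  by apply: cvgN; apply: cvgMr; exact: cg.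
have mwe := continuous_measurable_fun cwe.
have weB x : 0 <= w x * expR (- (eta * g x)) <= B * expR (1 / 2).
  rewrite mulr_ge0 ?expR_ge0//=; have [->|wn] := eqVneq (w x) 0.
    by rewrite mul0r mulr_ge0 ?expR_ge0//; lra.
  by apply: ler_pM; rewrite ?expR_ge0// ?ler_expR ?wneg//; case/andP: (wB x).
have iw n : itg P (fun om => w (X (mesh n) om)).
  apply: (itg_bndX HX (C := B)) => // x; have /andP[? ?] := wB x; by rewrite ger0_norm.
have ig1 : itg P (fun=> 1 : R) by exact: finite_measure_integrable_cst.
have pE n : n.+1%:R * (p n - 1) = n.+1%:R * Ex (mesh n) k1.
  by congr (_ * _); rewrite /p /Ex /k1 (ItB (iw n) ig1) It_const.
have iw2 n : itg P (fun om => w (X (mesh n) om) ^+ 2).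
  apply: (itg_bndX HX (C := B ^+ 2) (h := fun x => w x ^+ 2)) => // x.
  by have /andP[? ?] := w2B x; rewrite ger0_norm.
have qE n : n.+1%:R * (q n - 1) = n.+1%:R * Ex (mesh n) k2.
  by congr (_ * _); rewrite /q /Ex /k2 (ItB (iw2 n) ig1) It_const.
have cp : n.+1%:R * (p n - 1) @[n --> \oo] --> al.
  by rewrite (_ : (fun n => _) = fun n => n.+1%:R * Ex (mesh n) k1)//; exact/funext.
have cq : n.+1%:R * (q n - 1) @[n --> \oo] --> be.
  by rewrite (_ : (fun n => _) = fun n => n.+1%:R * Ex (mesh n) k2)//; exact/funext.
have cp1 : p n @[n --> \oo] --> (1 : R).
  have -> : p = fun n => 1 + (n.+1%:R * (p n - 1)) * n.+1%:R^-1.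
    by apply/funext => n; field; rewrite gt_eqF.
  rewrite -[X in _ --> X]addr0 -(mulr0 al); apply: cvgD; first exact: cvg_cst.
  by apply: cvgM => //; exact: cvg_harmonic.
have cpp : n.+1%:R * ((p n - 1) / p n) @[n --> \oo] --> al.
  rewrite -[X in _ --> X]divr1 (_ : (fun n => _) = fun n => n.+1%:R * (p n - 1) / p n).
    by apply: cvgM => //; apply: cvgV => //; exact: oner_neq0.
  by apply/funext => n; rewrite mulrA.
have e40 : (0 : R) < 1 / 40 by lra.
(* Tolerances such that each error becomes 1/40 after multiplication by [eta] or [2 eta^2]. *)
have s0 : 0 < 1 / (80 * eta ^+ 2) by rewrite divr_gt0// mulr_gt0// exprn_gt0.
have n1 := near_ge cpp e40; have n2 := near_le cp e40; have n3 := near_le cq e40.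
have n4 := sqr_near_le cwg2 d0 C0 wg2d wg20 s0; rewrite -/v in n4.
have n5 := near_ge c3 (divr_gt0 e40 eta0).
have e12 : (0 : R) < 1 / 2 by lra.
have n6 := near_ge cp1 e12.
have [n [[h1 h2] [[h3 h4] [h5 h6]]]] :=
  filter_ex (filterI (filterI n1 n2) (filterI (filterI n3 n4) (filterI n5 n6))).
have igw : itg P (fun om => w (X (mesh n) om) * g (X (mesh n) om)).
  apply: (itg_lin (h := fun x => w x * g x) (C := C + 1)) => // x.
  rewrite (_ : w x * g x = w x * g x - x + x); last by ring.
  by apply: (le_trans (ler_normD _ _)); rewrite mulrDl mul1r lerD2r.
have igw2 : itg P (fun om => w (X (mesh n) om) * g (X (mesh n) om) ^+ 2).
  apply: (itg_hX HX HPi Htr (h := fun x => w x * g x ^+ 2) (C := C + 1)) => //.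
    exact: continuous_measurable_fun.
  move=> x; rewrite ger0_norm; last by case/andP: (wg20 x).
  apply: (le_trans (wg2C x)); have x1 : `|x| <= 1 + x ^+ 2.
    exact: sum_norm_le_sqr.
  apply: (le_trans (lerD (lexx _) (ler_wpM2l C0 x1))).
  by rewrite mulrDl mul1r addrC lerD2l lerDr.
have rle : n.+1%:R * (r n - 1) <= al - eta * m + 2 * eta ^+ 2 * v + 1 / 10.
  have rp : r n <= p n - eta * Ex (mesh n) (fun x => w x * g x) +
      2 * eta ^+ 2 * Ex (mesh n) (fun x => w x * g x ^+ 2).
    have j1 := itgZ eta igw; have j2 := itgZ (2 * eta ^+ 2) igw2.
    rewrite /r /p /Ex -(ItZ eta igw) -(ItZ (2 * eta ^+ 2) igw2).
    rewrite -(ItB (iw n) j1) -(ItD (itgB (iw n) j1) j2); apply: It_le.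
    - apply: (itg_bndX HX (C := B * expR (1 / 2)) (h := fun x => w x * expR (- (eta * g x)))) => // x.
      by have /andP[? ?] := weB x; rewrite ger0_norm.
    - exact: itgD (itgB (iw n) j1) j2.
    - move=> om; set x := X _ om; have [->|wn] := eqVneq (w x) 0; first by rewrite !mul0r !mulr0 subr0 addr0.
      apply: (le_trans (ler_wpM2l (w0 x) (expR_le_quad (wneg x wn)))).
      by rewrite le_eqVlt; apply/orP; left; apply/eqP; ring.
  have t1 := ler_wpM2l (ler0n _ n.+1) rp.
  have t4 := ler_wpM2l (ltW (mulr_gt0 (ltr0n _ 2) (exprn_gt0 2 eta0))) h4.
  have t5 := ler_wpM2l (ltW eta0) h5.
  rewrite (_ : 2 * eta ^+ 2 * (v + _) = 2 * eta ^+ 2 * v + 1 / 40) in t4; last first.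
    by field; rewrite gt_eqF.
  rewrite (_ : eta * (m - _) = eta * m - 1 / 40) in t5; last by field; rewrite gt_eqF.
  exact: tilt_arith_rate t1 h2 t4 t5.
have pp : 0 < p n by apply: lt_le_trans h6; rewrite {1}[1]splitr addrK.
have rge0 : 0 <= r n by apply: It_ge0 => om; case/andP: (weB (X (mesh n) om)).
have qge0 : 0 <= q n by apply: It_ge0 => om; exact: sqr_ge0.
apply: (tilt_arith (n := n.+1) (Y := eta * (m - a)) pp rge0 qge0 (Pr_ge0 P A) h1 h3).
  exact: tilt_arith_shift Ha rle.
move=> L L0 LL; exact: (tilt_at_mesh (B := B) mw (continuous_measurable_fun cg) eta0 B1 wB gx wneg L0 LL).
Qed.

End fixed_time.

End master_bounds.

(** * Truncations and tilting weights *)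

Section parts.
Variable R : realType.
Implicit Types x y b del z : R.

Definition npart x : R := Order.max 0 (- x).
Definition ppart x : R := Order.max 0 x.

Lemma npart_pos x : 0 <= x -> npart x = 0.
Proof. by move=> h; rewrite /npart max_l// oppr_le0. Qed.
Lemma npart_neg x : x <= 0 -> npart x = - x.
Proof. by move=> h; rewrite /npart max_r// oppr_ge0. Qed.
Lemma ppart_pos x : 0 <= x -> ppart x = x.
Proof. by move=> h; rewrite /ppart max_r. Qed.
Lemma ppart_neg x : x <= 0 -> ppart x = 0.
Proof. by move=> h; rewrite /ppart max_l. Qed.

Lemma npart_bound x : 0 <= npart x <= `|x|.
Proof. by rewrite /npart le_max lexx /= ge_max normr_ge0 /= -normrN ler_norm. Qed.
Lemma ppart_bound x : 0 <= ppart x <= `|x|.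
Proof. by rewrite /ppart le_max lexx /= ge_max normr_ge0 /= ler_norm. Qed.

Lemma continuous_npart : continuous npart.
Proof.
apply: continuous_maxr; first exact: cst_continuous.
by move=> x; apply: cvgN; exact: cvg_id.
Qed.
Lemma continuous_ppart : continuous ppart.
Proof. by apply: continuous_maxr; [exact: cst_continuous|move=> x; exact: cvg_id]. Qed.

(** The integrand of [V y]: quadratic for negative jumps up to size [y], linear beyond. *)
Definition vfun y x : R := Order.min (npart x ^+ 2 / y) (npart x).
(** Integrands of the truncated second moment and, in [lfun], of the mean overshoot; [u] will be the
    positive part, the negative part or the absolute value. *)
Definition sfun (u : R -> R) b x : R := Order.min (u x) b ^+ 2.
Definition lfun (u : R -> R) b x : R := Order.max 0 (u x - b).

Lemma vfun_pos y x : 0 < y -> 0 <= x -> vfun y x = 0.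
Proof. by move=> y0 h; rewrite /vfun npart_pos// expr0n /= mul0r min_l. Qed.

Lemma vfun_ge0 y x : 0 < y -> 0 <= vfun y x.
Proof.
by move=> y0; rewrite /vfun le_min; have /andP[-> _] := npart_bound x;
  rewrite andbT divr_ge0 ?sqr_ge0// ltW.
Qed.

Lemma vfun_dom y x : 0 < y -> `|vfun y x| <= y^-1 * x ^+ 2.
Proof.
move=> y0; rewrite ger0_norm ?vfun_ge0// /vfun ge_min; apply/orP; left.
rewrite mulrC ler_wpM2l ?invr_ge0 ?(ltW y0)//; have /andP[n0 n1] := npart_bound x.
by rewrite -[leRHS]real_normK ?num_real// lerXn2r ?nnegrE.
Qed.

Section generic_part.
Variable u : R -> R.
Hypothesis ub : forall x, 0 <= u x <= `|x|.

Lemma sfun_dom b x : 0 <= b -> `|sfun u b x| <= 1 * x ^+ 2.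
Proof.
move=> b0; rewrite mul1r ger0_norm ?sqr_ge0// /sfun -[leRHS]real_normK ?num_real//.
have /andP[u0 u1] := ub x; rewrite lerXn2r ?nnegrE ?le_min ?u0//.
by rewrite ge_min u1.
Qed.

Lemma lfun_ge0 b x : 0 <= lfun u b x.
Proof. by rewrite /lfun le_max lexx. Qed.

Lemma lfun_dom b x : 0 < b -> `|lfun u b x| <= b^-1 * x ^+ 2.
Proof.
move=> b0; rewrite ger0_norm ?lfun_ge0// /lfun ler_pdivlMl//; have /andP[u0 u1] := ub x.
have x2 : u x ^+ 2 <= x ^+ 2 by rewrite -[leRHS]real_normK ?num_real// lerXn2r ?nnegrE.
apply: le_trans x2; case: (leP 0 (u x - b)) => h; last by rewrite mulr0 sqr_ge0.
by rewrite expr2; nra.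
Qed.

End generic_part.

(** The tilting weights. [wneg] is 1 down to [- del] and falls linearly to 0 at [- (y + del)];
    [wpos] grows with the positive jumps so as to favour them. The dead zone of width [del] keeps
    both trivial near 0, where [Pi] may have infinite mass. *)
Definition wneg del y x : R := Order.max 0 (1 - Order.max 0 (- x - del) / y).
Definition wpos del b x : R := Order.min (Order.max 0 (x - del)) b.

Lemma wneg_pos del y x : 0 < del -> - del <= x -> wneg del y x = 1.
Proof.
move=> d0 h; rewrite /wneg (_ : Order.max 0 (- x - del) = 0); last by apply/max_l; lra.
by rewrite mul0r subr0 max_r.
Qed.

Lemma wneg_bound del y x : 0 < y -> 0 <= wneg del y x <= 1.
Proof.
move=> y0; rewrite /wneg le_max lexx /= ge_max ler01 /= lerBlDr lerDl.
by rewrite divr_ge0 ?(ltW y0)// le_max lexx.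
Qed.

Lemma wneg_eq0 del y x : 0 < y -> wneg del y x != 0 -> - (y + del) <= x.
Proof.
move=> y0; apply: contraNT; rewrite -ltNge => h; rewrite /wneg.
have h1 : Order.max 0 (- x - del) = - x - del by apply: max_r; lra.
rewrite h1 max_l// subr_le0 ler_pdivlMr//; lra.
Qed.

(** With [v = min (a^2 / y, a)]: the drift gained is about [v / 2], the second moment left at most
    [2 y v], the cost at most [v / y]. The three ranges of [a] are where the weight is 1, linear and
    0. The gain may fall below [v / 2] only for [a <= 2 del], which the subtracted term absorbs. *)
Lemma wneg_small_opp del y a : 0 < del -> del <= y -> 0 < a ->
  [/\ Order.min (a ^+ 2 / y) a / 2 - y^-1 * Order.min a (2 * del) ^+ 2 <= wneg del y (- a) * - a + a,
   wneg del y (- a) * a ^+ 2 <= 2 * y * Order.min (a ^+ 2 / y) a &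
   (wneg del y (- a) - 1) ^+ 2 <= Order.min (a ^+ 2 / y) a / y].
Proof.
move=> d0 dy a0; have y0 : 0 < y by lra.
have yi : 0 < y^-1 by rewrite invr_gt0.
have yy : y * y^-1 = 1 by rewrite divff// gt_eqF.
have va : Order.min (a ^+ 2 / y) a = if a <= y then a ^+ 2 / y else a.
  case: (leP a y) => h; first by rewrite min_l// ler_pdivrMr// expr2 ler_pM2l.
  by rewrite min_r// ler_pdivlMr// expr2 ler_pM2l// ltW.
have [ad|ad] := leP a del.
  rewrite wneg_pos//; last by lra.
  have ay : a <= y by lra.
  rewrite va ay subrr expr0n /= min_l; last by lra.
  split; first by rewrite mul1r addNr; have := mulr_gt0 yi (exprn_gt0 2 a0); lra.
  - by rewrite mul1r (_ : 2 * y * (a ^+ 2 / y) = 2 * a ^+ 2); [have := sqr_ge0 a; lra|field; rewrite gt_eqF].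
  - by rewrite !divr_ge0 ?sqr_ge0 ?(ltW y0).
have wE : wneg del y (- a) = Order.max 0 (1 - (a - del) / y).
  by rewrite /wneg opprK (@max_r _ _ 0 (a - del))//; lra.
have [aw|aw] := leP (a - del) y.
  have wE2 : wneg del y (- a) = 1 - (a - del) / y.
    by rewrite wE max_r// subr_ge0 ler_pdivrMr// mul1r.
  have w1 : (a - del) / y <= 1 by rewrite ler_pdivrMr// mul1r.
  have w0 : 0 <= (a - del) / y by rewrite divr_ge0//; lra.
  have vle : Order.min (a ^+ 2 / y) a <= a ^+ 2 / y by rewrite ge_min lexx.
  have v0 : 0 <= Order.min (a ^+ 2 / y) a by rewrite le_min divr_ge0 ?sqr_ge0//= ltW.
  rewrite wE2; split.
  - rewrite (_ : _ * - a + a = a * (a - del) / y); last by ring.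
    have [a2|a2] := leP a (2 * del).
      have : 0 <= a * (a - del) / y by rewrite divr_ge0// ?mulr_ge0//; lra.
      have := mulr_gt0 yi (exprn_gt0 2 a0); move: vle; rewrite mulrC; lra.
    have h1 : a ^+ 2 / 2 <= a * (a - del) by rewrite expr2; nra.
    have h2 := ler_wpM2r (ltW yi) h1.
    have h3 : 0 <= y^-1 * (2 * del) ^+ 2 by rewrite mulr_ge0 ?sqr_ge0// ltW.
    lra.
  - have h0 : (1 - (a - del) / y) * a ^+ 2 <= a ^+ 2 by rewrite ler_piMl ?sqr_ge0//; lra.
    rewrite va; case: (leP a y) => ay.
      by rewrite (_ : 2 * y * (a ^+ 2 / y) = 2 * a ^+ 2); [have := sqr_ge0 a; lra|field; rewrite gt_eqF].
    by apply: (le_trans h0); rewrite expr2; nra.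
  - rewrite (_ : _ - 1 = - ((a - del) / y)); last by ring.
    rewrite sqrrN va; case: (leP a y) => ay.
      rewrite exprMn exprVn (_ : a ^+ 2 / y / y = a ^+ 2 / y ^+ 2); last by field; rewrite gt_eqF.
      by rewrite ler_wpM2r ?invr_ge0 ?sqr_ge0// lerXn2r ?nnegrE//; lra.
    apply: (@le_trans _ _ 1); first by rewrite expr2 mulr_ile1.
    by rewrite ler_pdivlMr// mul1r ltW.
have ay : y < a by lra.
have wE2 : wneg del y (- a) = 0.
  by rewrite wE max_l// subr_le0 ler_pdivlMr// mul1r ltW.
rewrite wE2 va (leNgt a y) ay /= !mul0r sub0r add0r sqrrN expr1n; split.
- have : 0 <= y^-1 * Order.min a (2 * del) ^+ 2 by rewrite mulr_ge0 ?sqr_ge0// ltW.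
  lra.
- by rewrite mulr_ge0// ?mulr_ge0// ltW.
- by rewrite ler_pdivlMr// mul1r ltW.
Qed.

Lemma wneg_small del y x : 0 < del -> del <= y -> x < 0 ->
  [/\ vfun y x / 2 - y^-1 * Order.min `|x| (2 * del) ^+ 2 <= wneg del y x * x - x,
   wneg del y x * x ^+ 2 <= 2 * y * vfun y x &
   (wneg del y x - 1) ^+ 2 <= vfun y x / y].
Proof.
move=> d0 dy x0; have a0 : 0 < - x by lra.
have := wneg_small_opp d0 dy a0.
by rewrite /vfun npart_neg ?(ltW x0)// sqrrN ltr0_norm// opprK.
Qed.

Lemma wpos_bound del b x : 0 < del -> 0 < b -> 0 <= wpos del b x <= b.
Proof.
by move=> d0 b0; rewrite /wpos le_min le_max lexx /= ge_min lexx orbT andbT ltW.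
Qed.

(** For [x > 2 del] one has [x - del >= x / 2], so the weight is at least half of [min x b]; smaller
    [x] go into the error. *)
Lemma wpos_small del b x : 0 < del -> 0 < b -> 0 <= x ->
  Order.min x b ^+ 2 / 2 - Order.min `|x| (2 * del) ^+ 2 <= wpos del b x * Order.min x b /\
  wpos del b x ^+ 2 <= Order.min x b ^+ 2.
Proof.
move=> d0 b0 x0; have /andP[w0 w1] := wpos_bound x d0 b0.
have m0 : 0 <= Order.min x b by rewrite le_min x0 ltW.
have wm : wpos del b x <= Order.min x b.
  rewrite le_min w1 andbT /wpos ge_min; apply/orP; left.
  by rewrite ge_max x0 /=; lra.
split; last by rewrite lerXn2r ?nnegrE.
rewrite (ger0_norm x0); have [xd|xd] := leP x (2 * del).
  have mx : Order.min x b <= x by rewrite ge_min lexx.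
  have : Order.min x b ^+ 2 <= x ^+ 2 by rewrite lerXn2r ?nnegrE.
  have := mulr_ge0 w0 m0; have := sqr_ge0 x; lra.
have h : Order.min x b / 2 <= wpos del b x.
  rewrite /wpos le_min; apply/andP; split.
    rewrite le_max; apply/orP; right.
    have : Order.min x b <= x by rewrite ge_min lexx.
    lra.
  have : Order.min x b <= b by rewrite ge_min lexx orbT.
  lra.
have := ler_wpM2r m0 h; have := sqr_ge0 (2 * del); rewrite !expr2; lra.
Qed.

Lemma continuous_wneg del y : continuous (wneg del y).
Proof.
apply: continuous_maxr; first exact: cst_continuous.
move=> x; apply: cvgB; first exact: cvg_cst.
apply: cvgM; last exact: cvg_cst.
apply: (@continuous_maxr R (fun=> 0) (fun x => - x - del)); first exact: cst_continuous.
by move=> z; apply: cvgB; [apply: cvgN; exact: cvg_id|exact: cvg_cst].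
Qed.

Lemma continuous_wpos del b : continuous (wpos del b).
Proof.
apply: continuous_minr; last exact: cst_continuous.
apply: continuous_maxr; first exact: cst_continuous.
by move=> x; apply: cvgB; [exact: cvg_id|exact: cvg_cst].
Qed.

Lemma measurable_vfun y : measurable_fun setT (vfun y).
Proof.
apply: continuous_measurable_fun; apply: continuous_minr; last exact: continuous_npart.
move=> x; apply: cvgM; last exact: cvg_cst.
exact: (continuous_sqr continuous_npart).
Qed.

Lemma measurable_sfun u b : continuous u -> measurable_fun setT (sfun u b).
Proof.
move=> cu; apply: continuous_measurable_fun; apply: continuous_sqr.
by apply: continuous_minr => //; exact: cst_continuous.
Qed.

Lemma continuous_lfun u b : continuous u -> continuous (lfun u b).
Proof.
move=> cu; apply: continuous_maxr; first exact: cst_continuous.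
by move=> x; apply: cvgB; [exact: cu|exact: cvg_cst].
Qed.

Lemma measurable_lfun u b : continuous u -> measurable_fun setT (lfun u b).
Proof. by move=> cu; apply: continuous_measurable_fun; exact: continuous_lfun. Qed.

End parts.

(** * The second moment method for finitely many events *)

Section finite_unions.
Context (R : realType) d (T : measurableType d) (P : probability T R).
Local Notation Pr := (Pr P).

Lemma measurable_exists (I : finType) (A : I -> set T) : (forall i, measurable (A i)) ->
  measurable [set w | exists i, A i w].
Proof.
move=> mA; rewrite (_ : [set w | _] = \bigcup_(i in [set: I]) A i).
  by apply: fin_bigcup_measurable => [|i _]; [exact: finite_finset|exact: mA].
by apply/seteqP; split => w; [move=> [i h]; exists i|move=> [i _ h]; exists i].
Qed.

Lemma itg_indic (A : set T) : measurable A -> itg P (\1_A : T -> R).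
Proof.
move=> mA; apply: (@itg_bounded _ _ _ P _ 1) => [|w]; last exact: indic_norm.
exact: measurable_indic.
Qed.

Lemma Pr_exists_le (I : finType) (A : I -> set T) : (forall i, measurable (A i)) ->
  Pr [set w | exists i, A i w] <= \sum_i Pr (A i).
Proof.
move=> mA; have mU := measurable_exists mA.
have [h1 h2] := It_sum (index_enum I) (fun i => itg_indic (mA i)).
rewrite -(It_indic P mU); apply: (@le_trans _ _ (\sum_i It P (\1_(A i)))); last first.
  by apply: ler_sum => i _; rewrite It_indic.
rewrite -h2; apply: It_le => [||w]; [exact: itg_indic|exact: h1|].
rewrite indicE; case: (boolP (w \in _)) => [|_]; last by apply: sumr_ge0 => i _; rewrite indicE.
rewrite inE => -[i Ai]; rewrite (bigD1 i)//= [X in _ <= X + _](_ : _ = 1) ?lerDl.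
  by apply: sumr_ge0 => j _; rewrite indicE.
by rewrite indicE mem_set.
Qed.

(* Paley-Zygmund bound for the number of indices [i] with [A i /\ B i]. *)
Lemma second_moment (I : finType) (A B : I -> set T) (del la : R) : 0 <= del ->
  (forall i, measurable (A i)) -> (forall i, measurable (B i)) ->
  (forall i j, i != j -> Pr (A i `&` A j) <= Pr (A i) * Pr (A j)) ->
  (forall i, del * Pr (A i) <= Pr (A i `&` B i)) ->
  la = \sum_i Pr (A i) ->
  del ^+ 2 * la ^+ 2 <= (la + la ^+ 2) * Pr [set w | exists i, A i w /\ B i w].
Proof.
move=> del0 mA mB hAA hAB laE.
pose C i := A i `&` B i; have mC i : measurable (C i) by exact: measurableI.
have mU : measurable [set w | exists i, C i w] by exact: measurable_exists.
set U := [set w | _] in mU; rewrite -/U.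
pose Z w : R := \sum_i \1_(C i) w.
have i1 i : itg P (\1_(C i) : T -> R) by exact: itg_indic.
have [h1 h2] := It_sum (index_enum I) i1.
have Zb w : 0 <= Z w <= #|I|%:R.
  rewrite sumr_ge0 => [|i _]; last by rewrite indicE.
  rewrite (@le_trans _ _ (\sum_(i : I) 1))//; last by rewrite sumr_const.
  by apply: ler_sum => i _; rewrite indicE; case: (_ \in _).
have cs := @It_cauchy_schwarz _ _ _ P Z U _ (itg_meas h1) mU Zb.
have ZU w : Z w * \1_U w = Z w.
  rewrite [\1_U w]indicE; case: (boolP (w \in U)) => [_|]; first by rewrite mulr1.
  rewrite notin_setE => h; rewrite mulr0 /Z big1// => i _; rewrite indicE memNset// => ?.
  by apply: h; exists i.
have EZ : del * la <= It P Z.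
  rewrite /Z h2 laE mulr_sumr; apply: ler_sum => i _; rewrite It_indic//; exact: hAB.
have EZ2 : It P (fun w => Z w ^+ 2) <= la + la ^+ 2.
  have CC i j : measurable (C i `&` C j) by exact: measurableI.
  have j1 i j : itg P (\1_(C i `&` C j) : T -> R) by exact: itg_indic.
  have k i := It_sum (index_enum I) (j1 i).
  have [g1 g2] := It_sum (index_enum I) (fun i => (k i).1).
  rewrite (@It_eq _ _ _ P _ (fun w => \sum_i \sum_j \1_(C i `&` C j) w)); last first.
    move=> w; rewrite /Z expr2 mulr_suml; apply: eq_bigr => i _.
    by rewrite mulr_sumr; apply: eq_bigr => j _; rewrite indicI.
  rewrite g2 laE expr2 mulr_suml -big_split /=; apply: ler_sum => i _.
  rewrite (k i).2 mulr_sumr (bigD1 i)//= [X in _ <= _ + X](bigD1 i)//= addrA; apply: lerD.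
    rewrite setIid It_indic//; apply: (@le_trans _ _ (Pr (A i))).
      by apply: Pr_le => // w [].
    by rewrite lerDl mulr_ge0// Pr_ge0.
  apply: ler_sum => j ji; rewrite It_indic//; apply: le_trans (hAA i j _); last by rewrite eq_sym.
  by apply: Pr_le => //; [exact: measurableI|move=> w [[? _] [? _]]].
rewrite -exprMn (le_trans _ (le_trans cs _))//.
  rewrite (It_eq P ZU) lerXn2r ?nnegrE// ?mulr_ge0// ?laE.
    by apply: sumr_ge0 => i _; exact: Pr_ge0.
  by apply: It_ge0 => w; case/andP: (Zb w).
by rewrite ler_wpM2r// Pr_ge0.
Qed.

End finite_unions.

Section three_increments.
Context (R : realType) d (T : measurableType d) (P : probability T R)
  (X : R -> T -> R).
Hypothesis HX : levy_process P X.
Local Notation Pr := (Pr P).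
Let mX s : 0 <= s -> measurable_fun setT (X s) := @levy_measurable _ _ _ _ _ HX s.

Lemma Pr_increment r s (A : set (measurableTypeR R)) : 0 <= r -> r <= s -> measurable A ->
  Pr [set w | A (X s w - X r w)] = Pr [set w | A (X (s - r) w)].
Proof.
move=> r0 rs mA; rewrite /Pr -(levy_stationary HX r0 _ mA); last by rewrite subr_ge0.
by rewrite addrC subrK.
Qed.

(** Gaps between two intervals of interest are covered by taking [setT] as one of the three
    constraints. *)
Lemma indep3 (s0 s1 s2 s3 : R) (A B C : set (measurableTypeR R)) : 0 <= s0 -> s0 <= s1 ->
  s1 <= s2 -> s2 <= s3 -> measurable A -> measurable B -> measurable C ->
  Pr [set w | [/\ A (X s1 w - X s0 w), B (X s2 w - X s1 w) & C (X s3 w - X s2 w)]] =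
  Pr [set w | A (X (s1 - s0) w)] * Pr [set w | B (X (s2 - s1) w)] * Pr [set w | C (X (s3 - s2) w)].
Proof.
move=> h0 h01 h12 h23 mA mB mC.
pose t (i : nat) := if i is i'.+1 then (if i' is i''.+1 then (if i'' is _.+1 then s3 else s2) else s1) else s0.
have tm i : t i <= t i.+1 by case: i => [|[|[|i]]] /=.
have s10 : 0 <= s1 by lra. have s20 : 0 <= s2 by lra. have s30 : 0 <= s3 by lra.
have ind := levy_indep HX (n := 3) h0 tm.
pose F (i : 'I_3) := if val i is i'.+1 then (if i' is _.+1 then C else B) else A.
have mF i : measurable (F i) by rewrite /F; case: (val i) => [|[|?]].
have mY (i : 'I_3) : measurable_fun setT (fun w => X (t i.+1) w - X (t i) w).
  by case: i => -[|[|[|i]]] //= _; apply: measurable_funB; exact: mX.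
have := Pr_rect mY ind (fun _ => true) mF.
rewrite !big_ord_recl big_ord0 mulr1 mulrA.
rewrite -!Pr_increment// => <-; congr Pr; apply/seteqP; split => w /=.
  by move=> [a b c] -[[|[|[|i]]] //= hi] _; rewrite /F.
by move=> h; split; [exact: (h ord0 isT)|exact: (h (lift ord0 ord0) isT)|exact: (h (lift ord0 (lift ord0 ord0)) isT)].
Qed.

End three_increments.

Section tilt_weights.
Variable R : realType.
Implicit Types (del y b s ze x : R).

(** The weight removes large negative jumps and enhances positive ones with intensity [ze]. The
    three inequalities are, before integration, the drift gained, the second moment under the tilt
    and the cost; [m] collects the errors that disappear with [del]. *)
Lemma lower_bound_pointwise (del y b ze x : R) : 0 < del -> del <= y -> del <= b -> 0 <= ze ->
  let w := wneg del y x + ze * wpos del b x in let g := Order.min x b in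
  let m := sfun (fun x => `|x|) (2 * del) x in
  [/\ vfun y x / 2 - y^-1 * m - lfun (@ppart R) b x + ze * (sfun (@ppart R) b x / 2 - m) <= w * g - x,
   w * g ^+ 2 <= 2 * y * vfun y x + (1 + ze * b) * sfun (@ppart R) b x &
   (w - 1) ^+ 2 <= vfun y x / y + ze ^+ 2 * sfun (@ppart R) b x].
Proof.
move=> d0 dy db ze0 w g m; have y0 : 0 < y by lra. have b0 : 0 < b by lra.
have [x0|x0] := ltP x 0.
  have [h1 h2 h3] := wneg_small d0 dy x0.
  have wp : wpos del b x = 0.
    by rewrite /wpos (@max_l _ _ 0 (x - del)) ?min_l ?(ltW b0)//; lra.
  have pp : ppart x = 0 by rewrite ppart_neg// ltW.
  have sf : sfun (@ppart R) b x = 0 by rewrite /sfun pp min_l ?(ltW b0)// expr0n.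
  have lf : lfun (@ppart R) b x = 0 by rewrite /lfun pp max_l//; lra.
  have gE : g = x by rewrite /g min_l//; lra.
  rewrite /w wp mulr0 addr0 gE sf lf !mulr0 !addr0 !subr0 mul0r sub0r; split => //.
  have : 0 <= ze * m by rewrite mulr_ge0// sqr_ge0.
  by move: h1; rewrite -/(m); rewrite /m /sfun; lra.
have [h1 h2] := wpos_small d0 b0 x0.
have wn : wneg del y x = 1 by apply: wneg_pos => //; lra.
have vf : vfun y x = 0 by exact: vfun_pos.
have sf : sfun (@ppart R) b x = g ^+ 2 by rewrite /sfun ppart_pos.
have lf : lfun (@ppart R) b x = x - g.
  rewrite /lfun ppart_pos// /g; case: (leP x b) => xb; first by rewrite max_l; lra.
  by rewrite max_r; lra.
have /andP[w0 w1] := wpos_bound x d0 b0.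
have m0 : 0 <= m by exact: sqr_ge0.
rewrite /w wn vf sf lf !mulr0 !mul0r !add0r; split.
- have : 0 <= y^-1 * m by rewrite mulr_ge0// invr_ge0 ltW.
  have := ler_wpM2l ze0 h1; rewrite -/g -/(sfun (fun x => `|x|) (2 * del) x) -/m; lra.
- rewrite ler_wpM2r ?sqr_ge0// lerD2l; exact: ler_wpM2l.
- by rewrite (addrC 1) addrK exprMn ler_wpM2l ?sqr_ge0.
Qed.

(** The hypotheses of [tilted_lower_bound] for the exponential parameter [1 / s]: where the weight
    is not 0, [g >= - 2 y], and [2 y / s <= 1/2]. *)
Lemma tilt_pointwise del y b s ze : 0 < del -> del <= y -> del <= b -> 0 <= ze -> 4 * y <= s ->
  let w x := wneg del y x + ze * wpos del b x in let g x := Order.min x b in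
  let C := 2 + ze * b + ze * b * b in
  [/\ forall x, 0 <= w x <= 1 + ze * b, forall x, `|x| <= del -> w x = 1 /\ g x = x,
   forall x, g x <= x, forall x, w x != 0 -> - (1 / s * g x) <= 1 / 2 &
   (forall x, `|w x * g x - x| <= C * `|x|) /\ (forall x, w x * g x ^+ 2 <= x ^+ 2 + C * `|x|)].
Proof.
move=> d0 dy db ze0 ys w g C; have y0 : 0 < y by lra.
have b0 : 0 < b by lra.
have s0 : 0 < s by lra.
have zb0 : 0 <= ze * b by rewrite mulr_ge0// ltW.
have zbb : 0 <= ze * b * b by rewrite mulr_ge0// ltW.
have wp0 x : x <= del -> wpos del b x = 0.
  by move=> xd; rewrite /wpos (@max_l _ _ 0 (x - del)) ?min_l ?(ltW b0)//; lra.
have wB x : 0 <= w x <= 1 + ze * b.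
  have /andP[a1 a2] := wneg_bound del x y0; have /andP[c1 c2] := wpos_bound x d0 b0.
  by rewrite addr_ge0 ?mulr_ge0//= lerD// ler_wpM2l.
have gabs x : `|g x| <= `|x|.
  by rewrite /g; case: (leP x b) => // bx; rewrite !gtr0_norm//; lra.
have Cx c x : c <= C -> c * `|x| <= C * `|x| by move=> ?; rewrite ler_wpM2r.
split => //.
- move=> x; rewrite ler_norml => /andP[x1 x2]; split; last by rewrite /g min_l//; lra.
  by rewrite /w wneg_pos// wp0// mulr0 addr0.
- by move=> x; rewrite /g ge_min lexx.
- move=> x wn; have gy : - (2 * y) <= g x.
    have [x0|x0] := leP x 0; last first.
      by apply: (@le_trans _ _ 0); [lra|rewrite /g le_min !ltW].
    have xd : x <= del by lra.
    have wn' : wneg del y x != 0 by move: wn; rewrite /w wp0// mulr0 addr0.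
    have xb : x <= b by lra.
    by have := wneg_eq0 y0 wn'; rewrite /g (min_l xb); clear -dy d0; lra.
  rewrite -mulrN mul1r mulrC ler_pdivrMr//; clear -gy ys; lra.
split=> x.
  have /andP[a1 a2] := wB x; apply: (le_trans (ler_normB _ _)); rewrite normrM (ger0_norm a1).
  have h := ler_pM a1 (normr_ge0 _) a2 (gabs x).
  have : (2 + ze * b) * `|x| <= C * `|x| by apply: Cx; rewrite /C lerDl.
  apply: le_trans; clear -h; lra.
apply: (@le_trans _ _ (x ^+ 2 + ze * b * b * `|x|)); last first.
  by rewrite lerD2l; apply: Cx; rewrite /C lerDr addr_ge0.
have gle : g x ^+ 2 <= x ^+ 2.
  by rewrite -[leLHS]real_normK ?num_real// -[leRHS]real_normK ?num_real// lerXn2r ?nnegrE.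
rewrite /w mulrDl; apply: lerD.
  apply: le_trans gle; have /andP[a1 a2] := wneg_bound del x y0.
  by rewrite ler_piMl ?sqr_ge0.
have [x0|x0] := leP x 0.
  by rewrite wp0 ?mulr0 ?mul0r ?mulr_ge0//; lra.
have /andP[c1 c2] := wpos_bound x d0 b0.
have g0 : 0 <= g x by rewrite /g le_min !ltW.
have gb : g x <= b by rewrite /g ge_min lexx orbT.
have gx : g x <= `|x| by rewrite (gtr0_norm x0) /g ge_min lexx.
by rewrite -!mulrA ler_wpM2l// ler_pM ?sqr_ge0// expr2 ler_pM.
Qed.

Lemma tilt_arith_var s (q : R) : 0 < s -> q <= s ^+ 2 ->
  2 + 2 * (1 / s) ^+ 2 * q <= 1 / s * (4 * s).
Proof.
move=> s0 qs; rewrite (_ : 1 / s * _ = 4); last by field; rewrite gt_eqF.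
have : (1 / s) ^+ 2 * q <= 1.
  rewrite expr_div_n expr1n mul1r mulrC ler_pdivrMr ?exprn_gt0// mul1r //.
lra.
Qed.

Lemma tilt_arith_pointwise y z (v f m l W : R) : v / 2 - y^-1 * m - l + z * (f / 2 - m) <= W ->
  1 / 2 * v + z / 2 * f + - (y^-1 + z) * m + - 1 * l <= W.
Proof. by move=> h; apply: le_trans h; lra. Qed.

Lemma upper_arith (A e a Q q : R) : 0 < a -> q <= Q + e * a ^+ 2 / 8 ->
  A + e / 2 + q / (a / 2) ^+ 2 <= A + 4 * Q / a ^+ 2 + e.
Proof.
move=> a0 h; have a2 : 0 < a ^+ 2 by rewrite exprn_gt0.
have : q / (a / 2) ^+ 2 <= 4 * Q / a ^+ 2 + e / 2.
  rewrite ler_pdivrMr; last by rewrite exprn_gt0// divr_gt0.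
  apply: (le_trans h); rewrite le_eqVlt; apply/orP; left; apply/eqP; field.
  by rewrite gt_eqF.
lra.
Qed.

Lemma upper_arith_rate t (N th r l q I K g V : R) : 0 < th -> 0 <= t -> 0 <= N ->
  r <= 1 + th * l + 2 * th ^+ 2 * q -> N * l <= t * (g - K) + 1 / (6 * th) ->
  N * q <= t * I + 1 / (12 * th ^+ 2) -> I <= th^-1 * V + 1 / (12 * th ^+ 2 * (t + 1)) ->
  N * (r - 1) <= t * (g * th + 2 * th * V) - th * (t * K) + 1 / 2.
Proof.
move=> th0 t0 N0 h1 h2 h3 h4; have t1 : 0 < t + 1 by lra.
have k1 : N * (r - 1) <= th * (N * l) + 2 * th ^+ 2 * (N * q).
  apply: (@le_trans _ _ (N * (th * l + 2 * th ^+ 2 * q))); last by lra.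
  by apply: ler_wpM2l => //; lra.
have k2 := ler_wpM2l (ltW th0) h2.
have k3 : 2 * th ^+ 2 * (N * q) <= 2 * th ^+ 2 * (t * I + 1 / (12 * th ^+ 2)).
  by apply: ler_wpM2l => //; rewrite mulr_ge0// sqr_ge0.
have k4 : 2 * th ^+ 2 * (t * I) <= 2 * th ^+ 2 * (t * (th^-1 * V + 1 / (12 * th ^+ 2 * (t + 1)))).
  by apply: ler_wpM2l; [rewrite mulr_ge0// sqr_ge0|apply: ler_wpM2l].
have e2 : th * (t * (g - K) + 1 / (6 * th)) = t * (g * th) - th * (t * K) + 1 / 6.
  by field; rewrite gt_eqF.
have e3 : 2 * th ^+ 2 * (t * I + 1 / (12 * th ^+ 2)) = 2 * th ^+ 2 * (t * I) + 1 / 6.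
  by field; rewrite gt_eqF.
have e4 : 2 * th ^+ 2 * (t * (th^-1 * V + 1 / (12 * th ^+ 2 * (t + 1)))) =
    t * (2 * th * V) + t / (t + 1) / 6 by field; rewrite !gt_eqF.
have : t / (t + 1) <= 1 by rewrite ler_pdivrMr// mul1r lerDl.
lra.
Qed.

Lemma expR_half_le2 : expR (1 / 2) <= 2 :> R.
Proof. by have := @expR_le_quad R (1 / 2) (lexx _); rewrite expr2; lra. Qed.

Lemma upper_arith_exp (A e a Q q D k m th : R) : 0 < a -> q <= Q + e * a ^+ 2 / 8 ->
  A + e / 2 + expR (D - th * m + 1 / 2 - th * (k - m)) + q / (a / 2) ^+ 2 <=
  A + 2 * expR (D - th * k) + 4 * Q / a ^+ 2 + e.
Proof.
move=> a0 h; have := @upper_arith 0 e a Q q a0 h.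
have -> : D - th * m + 1 / 2 - th * (k - m) = 1 / 2 + (D - th * k) by ring.
set z := D - th * k; rewrite (expRD (1 / 2) z).
have := ler_wpM2r (expR_ge0 z) expR_half_le2; lra.
Qed.

(** Monotonicity of [la / (1 + la)] in a division-free form, where an error [e] in the lower bound
    for [la] costs at most [e]. *)
Lemma jump_arith (p Q L e la : R) : 0 <= p -> p <= 1 -> 0 <= Q -> Q <= 1 -> 0 <= L -> 0 < e ->
  L - e <= la -> p * la ^+ 2 <= (la + la ^+ 2) * Q -> p * L <= (1 + L) * Q + e.
Proof.
move=> p0 p1 Q0 Q1 L0 e0 h1 h2; have [la0|la0] := leP la 0.
  have : L <= e by lra.
  have : p * L <= L by rewrite ler_piMl.
  have : 0 <= (1 + L) * Q by rewrite mulr_ge0//; lra.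
  lra.
have h3 : p * la <= (1 + la) * Q.
  rewrite -(ler_pM2l la0) (_ : la * (p * la) = p * la ^+ 2); last by ring.
  by rewrite (_ : la * _ = (la + la ^+ 2) * Q); last by ring.
have [lL|lL] := leP la L.
  have : (1 + la) * Q <= (1 + L) * Q by rewrite ler_wpM2r// lerD2l.
  have := ler_wpM2l p0 h1; have : p * e <= e by rewrite ler_piMl// ltW.
  lra.
have [pQ|pQ] := leP Q p.
  have : L * (p - Q) <= la * (p - Q) by apply: ler_wpM2r; lra.
  lra.
have : p * L <= Q * L by apply: ler_wpM2r; lra.
lra.
Qed.

Lemma count_arith (X Y Z a1 a2 K W E : R) : X <= Y + Z -> a1 + a2 < X -> Y < a1 - K -> W <= K ->
  E <= W + a2 / 2 -> E + a2 / 2 <= Z.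
Proof. lra. Qed.

Lemma tilt_arith_drift t s (g V z S y m L I : R) : 0 <= t ->
  1 / 2 * V + z / 2 * S - (y + z) * m - L <= I -> t * ((y + z) * m) <= s ->
  t * g + t / 2 * V + z / 2 * t * S - t * L - 5 * s <= t * (g + I) - 4 * s.
Proof. by move=> t0 h h2; have := ler_wpM2l t0 h; lra. Qed.

End tilt_weights.

(** * Bounds on the tails of the marginals *)

Section clip.
Variable R : realType.
Implicit Types b x : R.

Definition clip b x : R := Order.max (Order.min x b) (- b).

Lemma continuous_clip b : continuous (clip b).
Proof.
apply: (@continuous_maxr R (fun x => Order.min x b) (fun=> - b)); last exact: cst_continuous.
by apply: (@continuous_minr R id (fun=> b)); [move=> x; exact: cvg_id|exact: cst_continuous].
Qed.

Lemma clip_norm b x : 0 < b -> `|clip b x| <= b.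
Proof.
move=> b0; rewrite ler_norml /clip le_max lexx orbT ge_max ge_min lexx orbT /=.
by apply: (@le_trans _ _ 0); rewrite ?oppr_le0 ltW.
Qed.

Lemma clip_id b x : `|x| <= b -> clip b x = x.
Proof. by rewrite ler_norml => /andP[h1 h2]; rewrite /clip (min_l h2) max_l. Qed.

Lemma le_clip b x : x <= b -> x <= clip b x.
Proof. by move=> xb; rewrite /clip (min_l xb) le_max lexx. Qed.

Lemma clipE b x : 0 < b -> clip b x = if x < - b then - b else if b < x then b else x.
Proof.
move=> b0; rewrite /clip; case: ifPn => [h1|].
  have xb : x <= b by lra.
  by rewrite (min_l xb) max_r// ltW.
rewrite -leNgt => h1; case: ifPn => [h2|].
  by rewrite (min_r (ltW h2)) max_l//; lra.
by rewrite -leNgt => h2; rewrite (min_l h2) max_l.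
Qed.

Lemma clip_sub b x : 0 < b -> `|clip b x - x| <= 1 * `|x|.
Proof.
move=> b0; rewrite mul1r clipE//; case: ifPn => h1.
  by rewrite (@ltr0_norm _ x) ?gtr0_norm; lra.
case: ifPn => h2; last by rewrite subrr normr0.
by rewrite (@ltr0_norm _ (b - x)) ?gtr0_norm; lra.
Qed.

Lemma clip_lfun b x : 0 < b -> clip b x - x <= lfun (@npart R) b x.
Proof.
move=> b0; rewrite clipE// /lfun; case: ifPn => h1.
  have xb : 0 <= - x - b by lra.
  rewrite npart_neg ?(max_r xb); lra.
by rewrite le_max; case: ifPn => h2; apply/orP; left; lra.
Qed.

Lemma clip_sqr b x : 0 < b -> clip b x ^+ 2 = sfun (@ppart R) b x + sfun (@npart R) b x.
Proof.
move=> b0; rewrite clipE// /sfun; have [x0|x0] := leP 0 x.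
  rewrite ppart_pos// npart_pos// (min_l (ltW b0)) [0 ^+ 2]expr0n addr0.
  case: ifPn => h1; first by lra.
  by case: ifPn => h2; [rewrite min_r//; lra|rewrite min_l// leNgt].
rewrite ppart_neg ?(ltW x0)// npart_neg ?(ltW x0)// (min_l (ltW b0)) [0 ^+ 2]expr0n add0r.
case: ifPn => h1; first by rewrite min_r ?sqrrN//; lra.
by case: ifPn => h2; [lra|rewrite min_l ?sqrrN//; lra].
Qed.

Lemma clip_sqr_le b x : 0 < b -> clip b x ^+ 2 <= x ^+ 2.
Proof.
move=> b0; rewrite -[leLHS]real_normK ?num_real// -[leRHS]real_normK ?num_real//.
rewrite lerXn2r ?nnegrE// clipE//; case: ifPn => h1.
  have x0 : x < 0 by lra.
  by rewrite normrN (gtr0_norm b0) (ltr0_norm x0); lra.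
by case: ifPn => h2//; rewrite !gtr0_norm; lra.
Qed.

(** Replaces [u^2], for [u = min x b], in the expansion of [exp (th u)]: for large negative [u] a
    linear term suffices. This is what puts [Vn (1 / th)] into the exponent instead of a full second
    moment. *)
Definition qlow th b x : R := Order.min (Order.min x b ^+ 2) (`|Order.min x b| / th).

Lemma qlow_bound th b x : 0 < th -> 0 < b -> 0 <= qlow th b x <= x ^+ 2.
Proof.
move=> th0 b0; rewrite /qlow le_min sqr_ge0 divr_ge0 ?(ltW th0)//= ge_min; apply/orP; left.
have [xb|xb] := leP x b => //.
by rewrite lerXn2r ?nnegrE ?(ltW xb) ?(ltW b0)// (le_trans (ltW b0) (ltW xb)).
Qed.

Lemma qlow_near th b x : 0 < th -> th * b <= 1 / 2 -> `|x| <= b -> qlow th b x = x ^+ 2.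
Proof.
move=> th0 tb xb; rewrite /qlow (min_l (le_trans (ler_norm x) xb)) min_l//.
rewrite ler_pdivlMr// -[x ^+ 2]real_normK ?num_real// expr2 -mulrA ler_piMr// mulrC.
by have := ler_wpM2l (ltW th0) xb; lra.
Qed.

Lemma qlow_le th b x : 0 < th -> 0 < b ->
  qlow th b x <= th^-1 * vfun th^-1 x + sfun (fun x => `|x|) (2 * b) x.
Proof.
move=> th0 b0; have ti0 : 0 < th^-1 by rewrite invr_gt0.
have [x0|x0] := ltP x 0.
  have xb : x <= b by lra.
  rewrite /qlow (min_l xb) /vfun npart_neg ?(ltW x0)// sqrrN invrK ltr0_norm//.
  apply: (@le_trans _ _ (th^-1 * Order.min (x ^+ 2 * th) (- x))); last by rewrite lerDl sqr_ge0.
  case: (leP (x ^+ 2 * th) (- x)) => h; rewrite ge_min; apply/orP; [left|right].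
    by rewrite mulrC mulfK ?gt_eqF.
  by rewrite mulrC.
rewrite vfun_pos// mulr0 add0r /qlow ge_min; apply/orP; left.
rewrite /sfun ger0_norm// lerXn2r ?nnegrE ?le_min ?x0 ?ge_min ?lexx//=; lra.
Qed.

(** If [|u| / th < u^2] then [u < 0], as [th u <= 1/2]; then [exp (th u) <= 1], and [2 th |u|] more
    than compensates [th u]. *)
Lemma expR_low th b x : 0 < th -> th * b <= 1 / 2 ->
  expR (th * Order.min x b) <= 1 + th * Order.min x b + 2 * th ^+ 2 * qlow th b x.
Proof.
move=> th0 tb; set u := Order.min x b.
have ub : th * u <= 1 / 2.
  by apply: le_trans tb; rewrite ler_wpM2l ?(ltW th0)// /u ge_min lexx orbT.
have e1 := expR_le_quad ub.
have e2 : 2 * th ^+ 2 * u ^+ 2 = 2 * (th * u) ^+ 2 by ring.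
rewrite /qlow -/u; case: (leP (u ^+ 2) (`|u| / th)) => h; first by lra.
have e3 : 2 * th ^+ 2 * (`|u| / th) = 2 * th * `|u| by field; rewrite gt_eqF.
rewrite e3; have [u0|u0] := leP 0 u.
  have : u / th < u ^+ 2 by move: h; rewrite ger0_norm.
  rewrite ltr_pdivrMr// => h2; have : u * (1 - u * th) < 0 by lra.
  by rewrite ltNge mulr_ge0//; lra.
have : expR (th * u) <= 1 by rewrite expR_le1 pmulr_rle0// ltW.
by rewrite (ltr0_norm u0); have := mulr_gt0 th0 (_ : 0 < - u); lra.
Qed.

Lemma wpos_sfun del b x : 0 < del -> 0 < b -> wpos del b x ^+ 2 <= sfun (@ppart R) b x.
Proof.
move=> d0 b0; have [x0|x0] := ltP x 0; last first.
  by case: (wpos_small d0 b0 x0) => _; rewrite /sfun ppart_pos.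
by rewrite /wpos (@max_l _ _ 0 (x - del)) ?min_l ?(ltW b0)// ?expr0n ?sqr_ge0//; lra.
Qed.

Lemma wpos_lfun del b x : 0 < del -> 0 < b -> wpos del b x <= lfun (@ppart R) del x.
Proof.
move=> d0 b0; rewrite /wpos /lfun ge_min; apply/orP; left; have [x0|x0] := ltP x 0.
  rewrite ppart_neg ?(ltW x0)// !max_l//; lra.
by rewrite ppart_pos.
Qed.

Lemma min_lfun del x : 0 < del -> Order.min x del - x = - lfun (@ppart R) del x.
Proof.
move=> d0; rewrite /lfun /ppart; case: (leP x del) => h.
  by rewrite subrr max_l ?oppr0// lerBlDr add0r ge_max h (ltW d0).
by rewrite (@max_r _ _ 0 x) ?max_r ?opprB//; lra.
Qed.

Lemma le_min_wpos del b x : 0 < del -> 0 < b -> x <= b -> x <= Order.min x del + wpos del b x.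
Proof.
move=> d0 b0 xb; case: (leP x del) => h.
  by rewrite lerDl; case/andP: (wpos_bound x d0 b0).
rewrite /wpos (@max_r _ _ 0 (x - del)) ?min_l; lra.
Qed.

End clip.

Lemma measurable_ray_gt (R : realType) (b : R) :
  measurable ([set x | b < x] : set (measurableTypeR R)).
Proof. by rewrite -set_itvoy; exact: measurable_itv. Qed.

Lemma measurable_ray_ge (R : realType) (b : R) :
  measurable ([set x | b <= x] : set (measurableTypeR R)).
Proof. by rewrite -set_itvcy; exact: measurable_itv. Qed.

Section marginal_bounds.
Context (R : realType) d (T : measurableType d) (P : probability T R)
  (X : R -> T -> R) (gamma : R) (Pi : {measure set (measurableTypeR R) -> \bar R}).
Hypotheses (HX : levy_process P X) (HPi : levy_measure_on_unit Pi)
  (Htr : has_triplet P X gamma 0 Pi).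

Local Notation IP := (IP Pi).
Local Notation Ex := (Ex P X).
Local Notation Pr := (Pr P).

Let mX s : 0 <= s -> measurable_fun setT (X s) := @levy_measurable _ _ _ _ _ HX s.

(* [y * Vn y] is the double integral [W y], see [W_Vn]. *)
Definition Vn y : R := IP (vfun y).
Definition Sn (u : R -> R) b : R := IP (sfun u b).
Definition Ln (u : R -> R) b : R := IP (lfun u b).

Lemma itg_vfun y : 0 < y -> @itg _ (measurableTypeR R) R Pi (vfun y).
Proof.
by move=> y0; apply: (itg_Pi HPi (C := y^-1)) => [|x]; [exact: measurable_vfun|exact: vfun_dom].
Qed.

Lemma itg_sfun (u : R -> R) b : continuous u -> (forall x, 0 <= u x <= `|x|) -> 0 <= b ->
  @itg _ (measurableTypeR R) R Pi (sfun u b).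
Proof.
by move=> cu ub b0; apply: (itg_Pi HPi (C := 1)) => [|x]; [exact: measurable_sfun|exact: sfun_dom].
Qed.

Lemma itg_lfun (u : R -> R) b : continuous u -> (forall x, 0 <= u x <= `|x|) -> 0 < b ->
  @itg _ (measurableTypeR R) R Pi (lfun u b).
Proof.
by move=> cu ub b0; apply: (itg_Pi HPi (C := b^-1)) => [|x]; [exact: measurable_lfun|exact: lfun_dom].
Qed.

Lemma continuous_abs : continuous (fun x : R => `|x|).
Proof. by move=> x; apply: cvg_norm; exact: cvg_id. Qed.

Lemma abs_bound (x : R) : 0 <= `|x| <= `|x|.
Proof. by rewrite normr_ge0 lexx. Qed.

(** Lets the dead zone of the weights be as narrow as desired: truncated squares vanish in the limit
    by dominated convergence. *)
Lemma small_square (e d0 : R) : 0 < e -> 0 < d0 ->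
  exists del, [/\ 0 < del, del <= d0 & Sn (fun x => `|x|) (2 * del) <= e].
Proof.
move=> e0 d00.
have c : Sn (fun x => `|x|) n.+1%:R^-1 @[n --> \oo] --> @It _ (measurableTypeR R) R Pi (fun=> 0).
  apply: (@It_cvg _ (measurableTypeR R) R Pi _ _ (fun x => x ^+ 2)).
  - by move=> n; apply: measurable_sfun; exact: continuous_abs.
  - exact: measurable_cst.
  - exact: (itg_sqr HPi).
  - by move=> n x; rewrite -[leRHS]mul1r; apply: sfun_dom => //; exact: abs_bound.
  move=> x; have h : Order.min `|x| (n.+1%:R^-1 : R) @[n --> \oo] --> Order.min `|x| 0.
    apply: (@cvg_comp _ _ _ (fun n : nat => n.+1%:R^-1 : R) (fun z => Order.min `|x| z) \oo (nbhs 0)).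
      exact: cvg_harmonic.
    by apply: (@continuous_minr R (fun=> `|x|) id); [exact: cst_continuous|move=> z; exact: cvg_id].
  rewrite min_r ?normr_ge0// in h.
  rewrite -(mulr0 0); rewrite /sfun; rewrite (_ : (fun n => _ ^+ 2) = fun n => Order.min `|x| (n.+1%:R^-1) * Order.min `|x| (n.+1%:R^-1)); first exact: cvgM.
  by apply/funext => n; rewrite expr2.
rewrite It0 in c; have h1 := near_le c e0.
have hd : n.+1%:R^-1 @[n --> \oo] --> (0 : R) by exact: cvg_harmonic.
have h2 := near_le hd d00.
have [n [k1 k2]] := filter_ex (filterI h1 h2).
exists (n.+1%:R^-1 / 2); split; first by rewrite divr_gt0.
  have i0 : 0 < (n.+1%:R^-1 : R) by [].
  have k3 : n.+1%:R^-1 <= d0 by rewrite -[d0]add0r.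
  by apply: (le_trans _ k3); apply: ler_piMr => //; rewrite invf_le1// ler1n.
by rewrite (_ : 2 * _ = n.+1%:R^-1); [lra|field; rewrite gt_eqF].
Qed.

Lemma Vn_ge0 y : 0 < y -> 0 <= Vn y.
Proof. by move=> y0; apply: It_ge0 => x; exact: vfun_ge0. Qed.
Lemma Sn_ge0 u b : 0 <= Sn u b.
Proof. by apply: It_ge0 => x; exact: sqr_ge0. Qed.
Lemma Ln_ge0 u b : 0 <= Ln u b.
Proof. by apply: It_ge0 => x; exact: lfun_ge0. Qed.

Let mp := @continuous_ppart R.
Let mn := @continuous_npart R.
Let bp := @ppart_bound R.
Let bn := @npart_bound R.

Lemma IP_mono (f g : R -> R) : @itg _ (measurableTypeR R) R Pi f ->
  @itg _ (measurableTypeR R) R Pi g -> (forall x, f x <= g x) -> IP f <= IP g.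
Proof. exact: It_le. Qed.

Lemma itg_lin4 (f g h k : R -> R) (a b c e : R) :
  @itg _ (measurableTypeR R) R Pi f -> @itg _ (measurableTypeR R) R Pi g ->
  @itg _ (measurableTypeR R) R Pi h -> @itg _ (measurableTypeR R) R Pi k ->
  @itg _ (measurableTypeR R) R Pi (fun x => a * f x + b * g x + c * h x + e * k x) /\
  IP (fun x => a * f x + b * g x + c * h x + e * k x) = a * IP f + b * IP g + c * IP h + e * IP k.
Proof.
move=> jf jg jh jk.
have h1 := itgZ a jf; have h2 := itgZ b jg; have h3 := itgZ c jh; have h4 := itgZ e jk.
have h12 := itgD h1 h2; have h123 := itgD h12 h3; have h1234 := itgD h123 h4.
split => //; rewrite /IP -(ItZ a jf) -(ItZ b jg) -(ItZ c jh) -(ItZ e jk).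
by rewrite -(ItD h1 h2) -(ItD h12 h3) -(ItD h123 h4).
Qed.

(** [tilted_lower_bound] for the combined weight with [eta = 1 / s] and [a = 4 s]; a fifth [s] pays
    for the dead zone. The slack [s] dominates both [4 y] and the fluctuations under the tilt. *)
Lemma lower_bound t y b s ze : 0 <= t -> 0 < y -> 0 < b -> 0 <= ze -> 4 * y <= s ->
  t * (2 * y * Vn y + (1 + ze * b) * Sn (@ppart R) b) <= s ^+ 2 ->
  1 / 4 * expR (- (t * (Vn y / y + ze ^+ 2 * Sn (@ppart R) b))) <=
  Pr [set om | t * gamma + t / 2 * Vn y + ze / 2 * t * Sn (@ppart R) b
               - t * Ln (@ppart R) b - 5 * s <= X t om].
Proof.
move=> t0 y0 b0 ze0 ys hs; have s0 : 0 < s by lra.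
have yz0 : 0 < y^-1 + ze by rewrite ltr_wpDr ?invr_gt0.
(* The tolerance that makes [t (1 / y + ze)] times the dead-zone integral at most [s]; [t + 1]
   replaces [t], which may be 0. *)
have e0 : 0 < s / ((t + 1) * (y^-1 + ze)) by rewrite divr_gt0// mulr_gt0//; lra.
have yb0 : 0 < Order.min y b by rewrite lt_min y0.
have [del [d0 dyb hm]] := small_square e0 yb0.
have [dy db] : del <= y /\ del <= b by move: dyb; rewrite le_min => /andP[].
pose w x : R := wneg del y x + ze * wpos del b x; pose g x : R := Order.min x b.
pose m := sfun (fun x : R => `|x|) (2 * del).
have im : @itg _ (measurableTypeR R) R Pi m.
  by apply: itg_sfun; [exact: continuous_abs|exact: abs_bound|lra].
have iv := itg_vfun y0; have is_ := itg_sfun mp bp (ltW b0); have il := itg_lfun mp bp b0.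
have pw x := lower_bound_pointwise x d0 dy db ze0.
have cw : continuous w.
  move=> x; apply: cvgD; first exact: continuous_wneg.
  by apply: cvgMr; exact: continuous_wpos.
have cg : continuous g by apply: continuous_minr; [move=> x; exact: cvg_id|exact: cst_continuous].
have [wB near0 gx side [wg1 wg2]] := @tilt_pointwise _ del y b s ze d0 dy db ze0 ys.
have si0 : 0 < 1 / s by rewrite divr_gt0.
have C0 : 0 <= 2 + ze * b + ze * b * b by rewrite !addr_ge0 ?mulr_ge0 ?(ltW b0).
have [j1 j2] := itg_lin4 (2 * y) (1 + ze * b) 0 0 iv is_ iv iv.
have [k1 k2] := itg_lin4 (y^-1) (ze ^+ 2) 0 0 iv is_ iv iv.
have [l1 l2] := itg_lin4 (1 / 2) (ze / 2) (- (y^-1 + ze)) (- 1) iv is_ im il.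
have cwg2 : continuous (fun x => w x * g x ^+ 2).
  by move=> x; apply: cvgM; [exact: cw|exact: (continuous_sqr cg)].
have cwg : continuous (fun x => w x * g x - x).
  by move=> x; apply: cvgB; [apply: cvgM; [exact: cw|exact: cg]|exact: cvg_id].
have cw1 : continuous (fun x => (w x - 1) ^+ 2).
  by apply: continuous_sqr => x; apply: cvgB; [exact: cw|exact: cvg_cst].
have i1 : @itg _ (measurableTypeR R) R Pi (fun x => w x * g x ^+ 2).
  apply: (itg_le _ j1); first exact: continuous_measurable_fun.
  move=> x; rewrite ger0_norm; last by rewrite mulr_ge0 ?sqr_ge0//; case/andP: (wB x).
  by case: (pw x) => _ + _; rewrite !mul0r !addr0.
have i2 : @itg _ (measurableTypeR R) R Pi (fun x => (w x - 1) ^+ 2).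
  apply: (itg_le _ k1); first exact: continuous_measurable_fun.
  move=> x; rewrite ger0_norm ?sqr_ge0//.
  by case: (pw x) => _ _; rewrite !mul0r !addr0 [_ / y]mulrC.
have i3 : @itg _ (measurableTypeR R) R Pi (fun x => w x * g x - x).
  apply: (itg_Pi HPi (continuous_measurable_fun cwg)); apply: (dom_sqr d0).
    by move=> x /near0[wx gx']; rewrite /w wx /g gx' mul1r subrr.
  exact: wg1.
have b1 : t * IP (fun x => w x * g x ^+ 2) <= s ^+ 2.
  apply: le_trans hs; rewrite ler_wpM2l//; apply: (le_trans (IP_mono i1 j1 _)) => [x|].
    by case: (pw x) => _ + _; rewrite !mul0r !addr0.
  by rewrite j2 !mul0r !addr0.
have b2 : IP (fun x => (w x - 1) ^+ 2) <= Vn y / y + ze ^+ 2 * Sn (@ppart R) b.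
  apply: (le_trans (IP_mono i2 k1 _)) => [x|]; last by rewrite k2 !mul0r !addr0 [_ / y]mulrC.
  by case: (pw x) => _ _; rewrite !mul0r !addr0 [_ / y]mulrC.
have b3 : 1 / 2 * Vn y + ze / 2 * Sn (@ppart R) b - (y^-1 + ze) * IP m - Ln (@ppart R) b <=
    IP (fun x => w x * g x - x).
  apply: (le_trans _ (IP_mono l1 i3 _)) => [|x]; first by rewrite l2 mulN1r mulNr lerD2r lerD2l.
  case: (pw x) => + _ _; rewrite -/(m x) -/(w x) -/(g x); exact: tilt_arith_pointwise.
have b4 : t * ((y^-1 + ze) * IP m) <= s.
  move: hm; rewrite ler_pdivlMr; last by rewrite mulr_gt0// ltr_pwDr.
  rewrite -/(Sn _ _) -/(IP _) -/m => hm; apply: le_trans hm.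
  have m0 : 0 <= (y^-1 + ze) * IP m by rewrite mulr_ge0 ?(ltW yz0)//; exact: Sn_ge0.
  by rewrite /Sn -/m [leRHS]mulrC -mulrA ler_wpM2r// lerDl.
have H := @tilted_lower_bound _ _ _ _ _ _ _ HX HPi Htr t t0 w g del (1 + ze * b)
  (2 + ze * b + ze * b * b) (1 / s) (4 * s) cw cg d0 si0 C0 near0 wB gx side wg1 wg2 (tilt_arith_var s0 b1).
apply: le_trans (le_trans H _).
  by rewrite ler_wpM2l// ler_expR lerN2 ler_wpM2l.
apply: Pr_le; [exact: measurable_ge (mX t0)|exact: measurable_ge (mX t0)|].
move=> om /= h; apply: le_trans h; have k := tilt_arith_drift gamma t0 b3 b4.
exact: k.
Qed.

Definition Tn b : R := IP (\1_[set x | b < x]).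

Lemma itg_tail b : 0 < b -> @itg _ (measurableTypeR R) R Pi (\1_[set x : R | b < x]).
Proof.
move=> b0; apply: (itg_Pi HPi (C := b^-1 ^+ 2)) => [|x].
  by apply: measurable_indic; exact: measurable_ray_gt.
rewrite indicE; case: (boolP (x \in _)) => [|_]; last by rewrite normr0 mulr_ge0 ?sqr_ge0.
rewrite inE /= => bx; rewrite normr1 -exprMn -[1](expr1n _ 2) lerXn2r ?nnegrE//.
  by rewrite mulr_ge0 ?invr_ge0; lra.
by rewrite mulrC ler_pdivlMr// mul1r ltW.
Qed.

(* A continuous substitute for the indicator of ]a + b, +oo[. *)
Definition ramp a b (x : R) : R := Order.min 1 (Order.max 0 ((x - a) / b)).

Lemma ramp01 a b x : 0 <= ramp a b x <= 1.
Proof. by rewrite /ramp le_min ler01 le_max lexx /= ge_min lexx. Qed.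

Lemma ramp0 a b x : 0 < b -> x <= a -> ramp a b x = 0.
Proof.
move=> b0 xa; have h : (x - a) / b <= 0 by rewrite ler_pdivrMr// mul0r subr_le0.
by rewrite /ramp (max_l h) min_r.
Qed.

Lemma ramp1 a b x : 0 < b -> a + b <= x -> ramp a b x = 1.
Proof.
move=> b0 xa; have h : 1 <= (x - a) / b by rewrite ler_pdivlMr// mul1r; lra.
by rewrite /ramp (@max_r _ _ 0) ?min_l// (le_trans _ h).
Qed.

Lemma continuous_ramp a b : continuous (ramp a b).
Proof.
apply: (@continuous_minr R (fun=> 1)); first exact: cst_continuous.
apply: (@continuous_maxr R (fun=> 0) (fun x => (x - a) / b)); first exact: cst_continuous.
by move=> x; apply: cvgM; [apply: cvgB; [exact: cvg_id|exact: cvg_cst]|exact: cvg_cst].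
Qed.

Lemma ramp_lin a b x : 0 < a -> 0 < b -> `|ramp a b x| <= a^-1 * `|x|.
Proof.
move=> a0 b0; have /andP[h0 h1] := ramp01 a b x; rewrite ger0_norm//.
have [xa|xa] := leP x a; first by rewrite ramp0// mulr_ge0 ?invr_ge0 ?(ltW a0).
by apply: (le_trans h1); rewrite ler_pdivlMl// mulr1 (le_trans (ltW xa))// ler_norm.
Qed.

Lemma conv_ramp t a b : 0 <= t -> 0 < a -> 0 < b -> conv P X t (ramp a b) (t * IP (ramp a b)).
Proof.
move=> t0 a0 b0; apply: (conv_gen HX HPi Htr t0 (@continuous_ramp a b) a0 _ (fun x => ramp_lin x a0 b0)).
by move=> x xa; apply: ramp0 => //; apply: le_trans xa; exact: ler_norm.
Qed.

Lemma itg_ramp a b : 0 < a -> 0 < b -> @itg _ (measurableTypeR R) R Pi (ramp a b).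
Proof.
move=> a0 b0; apply: (itg_Pi HPi (continuous_measurable_fun (@continuous_ramp a b))).
apply: (dom_sqr a0) (fun x => ramp_lin x a0 b0) => x xa.
by apply: ramp0 => //; apply: le_trans xa; exact: ler_norm.
Qed.

Lemma ramp_le_tail a b : 0 < a -> 0 < b -> IP (ramp a b) <= Tn a.
Proof.
move=> a0 b0; apply: IP_mono (itg_ramp a0 b0) (itg_tail a0) _ => x; rewrite indicE.
case: (boolP (x \in _)) => [_|]; first by case/andP: (ramp01 a b x).
by rewrite notin_setE /= => /negP; rewrite -leNgt => xa; rewrite ramp0.
Qed.

Lemma tail_le_ramp a b : 0 < a -> 0 < b -> Tn (a + b) <= IP (ramp a b).
Proof.
move=> a0 b0; apply: IP_mono (itg_tail _) (itg_ramp a0 b0) _ => [|x]; first by rewrite addr_gt0.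
rewrite indicE; case: (boolP (x \in _)) => [|_]; last by case/andP: (ramp01 a b x).
by rewrite inE /= => xa; rewrite ramp1// ltW.
Qed.

Lemma Pr_le_ramp h b : 0 <= h -> 0 < b -> Pr [set w | b <= X h w] <= Ex h (ramp (b / 2) (b / 2)).
Proof.
move=> h0 b0; have mA : measurable [set w | b <= X h w] by exact: measurable_ge (mX h0).
have b2 : 0 < b / 2 by rewrite divr_gt0.
rewrite -(It_indic P mA); apply: It_le => [||w]; first exact: itg_indic.
  apply: (itg_bndX HX (C := 1)) => // [|x].
    exact: (continuous_measurable_fun (@continuous_ramp _ _)).
  by have /andP[? ?] := ramp01 (b / 2) (b / 2) x; rewrite ger0_norm.
rewrite indicE; case: (boolP (w \in _)) => [|_]; last by case/andP: (ramp01 (b / 2) (b / 2) (X h w)).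
by rewrite inE /= => bx; rewrite ramp1// -splitr.
Qed.

(** A union bound over the increments. The level [b / 2] comes from dominating the indicator of [[b,
    oo[] by a continuous ramp that starts there. *)
Lemma big_jump t b e : 0 <= t -> 0 < b -> 0 < e ->
  \forall n \near \oo, Pr [set w | exists i : 'I_n.+1, b <= xi X t i w] <= t * Tn (b / 2) + e.
Proof.
move=> t0 b0 e0; have b2 : 0 < b / 2 by rewrite divr_gt0.
apply: filterS (near_le (conv_ramp t0 b2 b2) e0) => n /= hn.
have mi (i : 'I_n.+1) : measurable [set w | b <= xi X t i w].
  by apply: measurable_ge; exact: (measurable_xi HX t0).
apply: (le_trans (Pr_exists_le P mi)).
apply: (@le_trans _ _ (n.+1%:R * Ex (mesh t n) (ramp (b / 2) (b / 2)))); last first.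
  apply: (le_trans hn); rewrite lerD2r ler_wpM2l//; exact: ramp_le_tail.
rewrite mulr_natl -[X in _ *+ X](card_ord n.+1) -sumr_const; apply: ler_sum => i _.
apply: le_trans (Pr_le_ramp (mesh_ge0 t0 n) b0).
rewrite /Pr le_eqVlt; apply/orP; left; apply/eqP; congr fine.
have mI : measurable ([set x | b <= x] : set (measurableTypeR R)).
  exact: measurable_ray_ge.
exact: (xi_law HX t0 i mI).
Qed.

(** Unless some increment reaches [b], [X_t - X_0] is at most the sum of the increments clipped to
    [[- b, b]], which Chebyshev's inequality controls. [Ln npart b] bounds the mean added by
    clipping negative jumps. It serves when both tails are integrable. *)
Lemma upper_bound2 t a b : 0 <= t -> 0 < a -> 0 < b ->
  Pr [set w | a + t * (gamma + Ln (@npart R) b) < X t w] <=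
  t * Tn (b / 2) + 4 * (t * (Sn (@ppart R) b + Sn (@npart R) b)) / a ^+ 2.
Proof.
move=> t0 a0 b0; set K := t * (gamma + _).
pose f := clip b; have cf : continuous f by exact: continuous_clip.
have fb x : `|f x| <= b by exact: clip_norm.
have fn x : `|x| <= b -> f x = x by exact: clip_id.
have fd x : `|f x - x| <= 1 * `|x| by exact: clip_sub.
have c1 := conv_near_id HX HPi Htr t0 cf b0 fn fd.
have a20 : 0 < a / 2 by rewrite divr_gt0.
have ea e : 0 < e -> 0 < e * a ^+ 2 / 8 by move=> e0; rewrite divr_gt0// mulr_gt0// exprn_gt0.
have f2n x : `|x| <= b -> f x ^+ 2 = x ^+ 2 by move=> /fn ->.
have f2d x : 0 <= f x ^+ 2 <= x ^+ 2 + 0 * `|x|.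
  by rewrite sqr_ge0 mul0r addr0; exact: clip_sqr_le.
have ip : IP (fun x => f x - x) <= Ln (@npart R) b.
  apply: (IP_mono _ (itg_lfun mn bn b0) (fun x => clip_lfun x b0)).
  have cfx : continuous (fun x => f x - x) by move=> x; apply: cvgB; [exact: cf|exact: cvg_id].
  apply: (itg_Pi HPi (continuous_measurable_fun cfx)); apply: (dom_sqr b0) fd.
  by move=> x /fn ->; rewrite subrr.
have ip2 : IP (fun x => f x ^+ 2) = Sn (@ppart R) b + Sn (@npart R) b.
  have i1 := itg_sfun mp bp (ltW b0); have i2 := itg_sfun mn bn (ltW b0).
  have [_] := itg_lin4 1 1 0 0 i1 i2 i1 i1; rewrite !mul0r !addr0 !mul1r => <-.
  by apply: It_eq => x; rewrite !mul0r !addr0 !mul1r; exact: clip_sqr.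
apply/ler_addgt0Pr => e e0; have e2 : 0 < e / 2 by rewrite divr_gt0.
have n1 := big_jump t0 b0 e2; have n2 := near_le c1 a20.
have n3 := sqr_near_le HX HPi Htr t0 (continuous_sqr cf) b0 (lexx 0) f2n f2d (ea _ e0).
have [n [h1 [h2 h3]]] := filter_ex (filterI n1 (filterI n2 n3)).
have mf := continuous_measurable_fun cf.
have ch := chebyshev_xi HX t0 n mf fb a20.
rewrite -(Pr_sub0_gt HX _ t0).
have mA : measurable [set w | exists i : 'I_n.+1, b <= xi X t i w].
  by apply: measurable_exists => i; apply: measurable_ge; exact: (measurable_xi HX t0).
have mS : measurable_fun setT (fun w => \sum_(i < n.+1) f (xi X t i w)).
  apply: measurable_sum => i; apply: (measurableT_comp (f := f : measurableTypeR R -> R)) => //.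
  exact: (measurable_xi HX t0).
have mB := measurable_ge (n.+1%:R * Ex (mesh t n) f + a / 2) mS.
apply: (@le_trans _ _ (t * Tn (b / 2) + e / 2 +
    n.+1%:R * Ex (mesh t n) (fun x => f x ^+ 2) / (a / 2) ^+ 2)); last first.
  rewrite ip2 in h3; exact: upper_arith h3.
apply: le_trans (lerD h1 ch); apply: le_trans (Pr_setU P mA mB); apply: Pr_le.
- by apply: measurable_gt; apply: measurable_funB; exact: mX.
- exact: measurableU.
move=> w /=; rewrite -(sum_xi X t n w) => hw.
have [[i hi]|hn] := pselect (exists i : 'I_n.+1, b <= xi X t i w); [left; by exists i|right].
have hs : \sum_(i < n.+1) xi X t i w <= \sum_(i < n.+1) f (xi X t i w).
  apply: ler_sum => i _; have : xi X t i w < b.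
    by rewrite ltNge; apply/negP => hi; apply: hn; exists i.
  by move=> /ltW; exact: le_clip.
apply: le_trans hs; apply: ltW; apply: le_lt_trans hw.
apply: (le_trans (lerD h2 (lexx _))); rewrite -addrA -splitr addrC lerD2l /K ler_wpM2l// lerD2l//.
Qed.

Lemma chernoff_xi t n (th b r K : R) : 0 <= t -> 0 < th -> th * b <= 1 / 2 ->
  n.+1%:R * (Ex (mesh t n) (fun x => expR (th * Order.min x b)) - 1) <= K ->
  Pr [set w | r <= \sum_(i < n.+1) Order.min (xi X t i w) b] <= expR (K - th * r).
Proof.
move=> t0 th0 tb hK; pose f x := expR (th * Order.min x b).
have cm : continuous (fun x : R => Order.min x b).
  by apply: (@continuous_minr R id (fun=> b)); [move=> x; exact: cvg_id|exact: cst_continuous].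
have cf : continuous f.
  move=> x; apply: (@continuous_comp _ _ _ (fun x => th * Order.min x b) expR); last exact: continuous_expR.
  by apply: cvgMr; exact: cm.
have mf := continuous_measurable_fun cf.
have fb x : 0 <= f x <= expR (1 / 2).
  rewrite expR_ge0 ler_expR (le_trans _ tb)// ler_wpM2l ?(ltW th0)//.
  by rewrite ge_min lexx orbT.
have fx0 w (i : 'I_n.+1) : 0 <= f (xi X t i w) <= expR (1 / 2) by exact: fb.
have e1 : (1 : R) <= expR (1 / 2) by have := expR_ge1Dx (1 / 2 : R); lra.
have mfx i : measurable_fun setT (fun w => f (@xi _ _ _ X t n i w)).
  apply: (measurableT_comp (f := f : measurableTypeR R -> R)) => //; exact: (measurable_xi HX t0).
have ip : itg P (fun w => \prod_(i < n.+1) f (xi X t i w)).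
  apply: (@itg_bounded _ _ _ P _ (expR (1 / 2) ^+ size (index_enum 'I_n.+1))).
    exact: measurable_prodr.
  move=> w; have := @prodr_bound _ _ (index_enum 'I_n.+1) (fun=> true) (fun i => f (xi X t i w)) _ e1 (fx0 w).
  by move=> /andP[h1 h2]; rewrite ger0_norm.
have mS : measurable_fun setT (fun w => \sum_(i < n.+1) Order.min (xi X t i w) b).
  apply: measurable_sum => i.
  apply: (measurableT_comp (f := (fun x => Order.min x b) : measurableTypeR R -> R)).
    exact: (continuous_measurable_fun cm).
  exact: (measurable_xi HX t0).
have mA := measurable_ge r mS.
have h1 : expR (th * r) * Pr [set w | r <= \sum_(i < n.+1) Order.min (xi X t i w) b] <=
    It P (fun w => \prod_(i < n.+1) f (xi X t i w)).
  rewrite -(It_indic P mA) -ItZ; last exact: itg_indic.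
  apply: It_le ip _; first by apply: itgZ; exact: itg_indic.
  move=> w; rewrite indicE; case: (boolP (w \in _)) => [|_].
    rewrite inE /= mulr1 => h; rewrite /f -expR_sum ler_expR -mulr_sumr.
    by rewrite ler_wpM2l// ltW.
  by rewrite mulr0; apply: prodr_ge0 => i _; exact: expR_ge0.
rewrite (It_prod_xi HX t0 n mf fb) in h1.
have h2 := @pow_le_expR _ (Ex (mesh t n) f) n.+1 (It_ge0 _ (fun w => expR_ge0 _)).
rewrite expRD expRN ler_pdivlMr ?expR_gt0// mulrC.
apply: (le_trans h1); apply: (le_trans h2); by rewrite ler_expR.
Qed.

(** An increment [x] below [b] is at most [min x del + wpos del b x]. The first sum is treated by
    Chernoff's bound with parameter [th], the second by Chebyshev's, the increments above [b] by a
    union bound. The compensation [Ln ppart del] may explode as [del] shrinks, but enters the first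
    two with opposite signs and cancels. *)
Lemma upper_bound t th b a1 a2 : 0 <= t -> 0 < th -> 0 < b -> 0 < a2 ->
  Pr [set w | a1 + a2 < X t w] <= t * Tn (b / 2) +
    2 * expR (t * (gamma * th + 2 * th * Vn th^-1) - th * a1) +
    4 * (t * Sn (@ppart R) b) / a2 ^+ 2.
Proof.
move=> t0 th0 b0 a20; have ti0 : 0 < th^-1 by rewrite invr_gt0.
have dd0 : 0 < Order.min b (th^-1 / 2) by rewrite lt_min b0 divr_gt0.
have t10 : 0 < t + 1 by lra.
have e10 : 0 < 1 / (12 * th ^+ 2 * (t + 1)) by rewrite divr_gt0// !mulr_gt0// exprn_gt0.
have [del [d0 ddb hm]] := small_square e10 dd0.
have [db dth] : del <= b /\ th * del <= 1 / 2.
  move: ddb; rewrite le_min => /andP[-> h]; split => //.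
  by have := ler_wpM2l (ltW th0) h; rewrite mulrA divff ?gt_eqF.
pose lo x : R := Order.min x del; pose q := qlow th del.
have clo : continuous lo.
  by apply: (@continuous_minr R id (fun=> del)); [move=> x; exact: cvg_id|exact: cst_continuous].
have cq : continuous q.
  apply: (@continuous_minr R (fun x => lo x ^+ 2) (fun x => `|lo x| / th)); first exact: continuous_sqr.
  by move=> x; apply: cvgM; [apply: cvg_norm; exact: clo|exact: cvg_cst].
have cwp := @continuous_wpos R del b; have cwp2 := continuous_sqr cwp.
have lod x : `|x| <= del -> lo x = x by move=> h; rewrite /lo min_l// (le_trans (ler_norm x)).
have loB x : `|lo x - x| <= 1 * `|x|.
  rewrite mul1r /lo; case: (leP x del) => h; first by rewrite subrr normr0.
  by rewrite ltr0_norm ?gtr0_norm; lra.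
have c1 := conv_near_id HX HPi Htr t0 clo d0 lod loB.
have e20 : 0 < 1 / (6 * th) by rewrite divr_gt0// mulr_gt0.
have e30 : 0 < 1 / (12 * th ^+ 2) by rewrite divr_gt0// mulr_gt0// exprn_gt0.
have q2d x : 0 <= q x <= x ^+ 2 + 0 * `|x| by rewrite mul0r addr0; exact: qlow_bound.
have n2 := near_le c1 e20.
have n3 := sqr_near_le HX HPi Htr t0 cq d0 (lexx 0) (fun x => qlow_near th0 dth) q2d e30.
have wp0 x : `|x| <= del -> wpos del b x = 0.
  move=> h; rewrite /wpos (@max_l _ _ 0 (x - del)) ?min_l ?(ltW b0)//.
  by rewrite subr_le0 (le_trans (ler_norm x)).
have wpB x : `|wpos del b x| <= 1 * `|x|.
  have /andP[h1 h2] := wpos_bound x d0 b0; rewrite ger0_norm// mul1r.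
  rewrite /wpos ge_min; apply/orP; left; rewrite ge_max normr_ge0 /=.
  by rewrite (le_trans _ (ler_norm x))// gerBl ltW.
have wp20 x : `|x| <= del -> wpos del b x ^+ 2 = 0 by move=> /wp0 ->; rewrite expr0n.
have wp2B x : `|wpos del b x ^+ 2| <= b * `|x|.
  have /andP[h1 h2] := wpos_bound x d0 b0; have := wpB x.
  by rewrite mul1r (ger0_norm h1) => h3; rewrite ger0_norm ?sqr_ge0// expr2 ler_pM.
have c4 := conv_gen HX HPi Htr t0 cwp d0 wp0 wpB.
have c5 := conv_gen HX HPi Htr t0 cwp2 d0 wp20 wp2B.
have a22 : 0 < a2 / 2 by rewrite divr_gt0.
have n4 := near_le c4 a22.
have iq : @itg _ (measurableTypeR R) R Pi q.
  apply: (itg_Pi HPi (C := 1) (continuous_measurable_fun cq)) => x.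
  by have /andP[? ?] := qlow_bound x th0 d0; rewrite mul1r ger0_norm.
have ii := itg_lfun mp bp d0; have iv := itg_vfun ti0.
have im : @itg _ (measurableTypeR R) R Pi (sfun (fun x : R => `|x|) (2 * del)).
  by apply: itg_sfun; [exact: continuous_abs|exact: abs_bound|lra].
set K := Ln (@ppart R) del.
have loI : IP (fun x => lo x - x) = - K.
  rewrite -[- K]mulN1r /K /Ln -ItZ//; apply: It_eq => x; rewrite mulN1r; exact: min_lfun.
have qI : IP q <= th^-1 * Vn th^-1 + 1 / (12 * th ^+ 2 * (t + 1)).
  have [j1 j2] := itg_lin4 th^-1 1 0 0 iv im iv iv.
  apply: (le_trans (IP_mono iq j1 _)) => [x|].
    by rewrite !mul0r !addr0 mul1r; exact: qlow_le.
  by rewrite j2 !mul0r !addr0 mul1r lerD2l.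
have wI : IP (wpos del b) <= K.
  apply: IP_mono ii _ => [|x]; last exact: wpos_lfun.
  exact: (itg_Pi HPi (continuous_measurable_fun cwp) (dom_sqr d0 wp0 wpB)).
have w2I : IP (fun x => wpos del b x ^+ 2) <= Sn (@ppart R) b.
  apply: IP_mono (itg_sfun mp bp (ltW b0)) _ => [|x]; last exact: wpos_sfun.
  exact: (itg_Pi HPi (continuous_measurable_fun cwp2) (dom_sqr d0 wp20 wp2B)).
apply/ler_addgt0Pr => e e0; have e2 : 0 < e / 2 by rewrite divr_gt0.
have ea : 0 < e * a2 ^+ 2 / 8 by rewrite divr_gt0// mulr_gt0// exprn_gt0.
have n1 := big_jump t0 b0 e2; have n5 := near_le c5 ea.
have [n [[h1 h2] [h3 [h4 h5]]]] := filter_ex (filterI (filterI n1 n2) (filterI n3 (filterI n4 n5))).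
rewrite loI in h2.
have mwp := continuous_measurable_fun cwp.
have wpb x : `|wpos del b x| <= b.
  by have /andP[? ?] := wpos_bound x d0 b0; rewrite ger0_norm.
have ch := chebyshev_xi HX t0 n mwp wpb a22.
have rle : n.+1%:R * (Ex (mesh t n) (fun x => expR (th * lo x)) - 1) <=
    t * (gamma * th + 2 * th * Vn th^-1) - th * (t * K) + 1 / 2.
  have cel : continuous (fun x => expR (th * lo x)).
    move=> x; apply: (@continuous_comp _ _ _ (fun x => th * lo x) expR); last exact: continuous_expR.
    by apply: cvgMr; exact: clo.
  have m0 := mesh_ge0 t0 n.
  have i1 : itg P (fun w => expR (th * lo (X (mesh t n) w))).
    apply: (itg_bndX HX (C := expR (1 / 2)) (h := fun x => expR (th * lo x))) => // [|x].
      exact: continuous_measurable_fun.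
    rewrite ger0_norm ?expR_ge0// ler_expR (le_trans _ dth)// ler_wpM2l ?(ltW th0)//.
    by rewrite /lo ge_min lexx orbT.
  have i2 : itg P (fun w => lo (X (mesh t n) w)).
    apply: (itg_lin HX HPi Htr (h := lo) (C := 2)) => // x.
    rewrite (_ : lo x = lo x - x + x); last by ring.
    apply: (le_trans (ler_normD _ _)); rewrite (_ : 2 = 1 + 1)// mulrDl [X in _ <= _ + X]mul1r.
    by rewrite lerD2r; exact: loB.
  have i3 : itg P (fun w => q (X (mesh t n) w)).
    apply: (itg_hX HX HPi Htr (C := 1)) => // [|x]; first exact: continuous_measurable_fun.
    by have /andP[? ?] := qlow_bound x th0 d0; rewrite mul1r ger0_norm// (le_trans (y := x ^+ 2))// lerDr.
  have i4 : itg P (fun=> 1 : R) by exact: finite_measure_integrable_cst.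
  have rp : Ex (mesh t n) (fun x => expR (th * lo x)) <=
      1 + th * Ex (mesh t n) lo + 2 * th ^+ 2 * Ex (mesh t n) q.
    have j1 := itgZ th i2; have j2 := itgZ (2 * th ^+ 2) i3.
    rewrite /Ex -(ItZ th i2) -(ItZ (2 * th ^+ 2) i3) -[X in X + _ + _](It_const P 1).
    rewrite -(ItD i4 j1) -(ItD (itgD i4 j1) j2); apply: It_le i1 (itgD (itgD i4 j1) j2) _ => w.
    exact: expR_low.
  exact: (upper_arith_rate th0 t0 (ler0n _ _) rp h2 h3 qI).
have cf := chernoff_xi (a1 - t * K) t0 th0 dth rle.
rewrite -(Pr_sub0_gt HX _ t0).
have mA : measurable [set w | exists i : 'I_n.+1, b <= xi X t i w].
  by apply: measurable_exists => i; apply: measurable_ge; exact: (measurable_xi HX t0).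
have mS (f : R -> R) : continuous f -> measurable_fun setT (fun w => \sum_(i < n.+1) f (xi X t i w)).
  move=> cf'; apply: measurable_sum => i; apply: (measurableT_comp (f := f : measurableTypeR R -> R)).
    exact: continuous_measurable_fun.
  exact: (measurable_xi HX t0).
have mB := measurable_ge (a1 - t * K) (mS _ clo).
have mC := measurable_ge (n.+1%:R * Ex (mesh t n) (wpos del b) + a2 / 2) (mS _ cwp).
apply: (@le_trans _ _ (t * Tn (b / 2) + e / 2 +
    expR (t * (gamma * th + 2 * th * Vn th^-1) - th * (t * K) + 1 / 2 - th * (a1 - t * K)) +
    n.+1%:R * Ex (mesh t n) (fun x => wpos del b x ^+ 2) / (a2 / 2) ^+ 2)); last first.
  by apply: upper_arith_exp a20 (le_trans h5 _); rewrite lerD2r ler_wpM2l.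
apply: le_trans (lerD (lerD h1 cf) ch); apply: (le_trans _ (lerD (Pr_setU P mA mB) (lexx _))).
apply: le_trans (Pr_setU P (measurableU _ _ mA mB) mC); apply: Pr_le.
- by apply: measurable_gt; apply: measurable_funB; exact: mX.
- by apply: measurableU => //; exact: measurableU.
move=> w /=; rewrite -(sum_xi X t n w) => hw.
have [hi|hn] := pselect (exists i : 'I_n.+1, b <= xi X t i w); [by left; left|].
have [hl|hl] := leP (a1 - t * K) (\sum_(i < n.+1) Order.min (xi X t i w) del).
  by left; right.
right; have hs : \sum_(i < n.+1) xi X t i w <=
    \sum_(i < n.+1) Order.min (xi X t i w) del + \sum_(i < n.+1) wpos del b (xi X t i w).
  rewrite -big_split /=; apply: ler_sum => i _; apply: le_min_wpos => //.
  by rewrite leNgt; apply/negP => hi; apply: hn; exists i; exact: ltW.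
exact: (count_arith hs hw hl (ler_wpM2l t0 wI) h4).
Qed.

(** Look for an increment of at least [2 a] such that the parts of the path before and after it each
    contribute at least [- a / 2]. These two side conditions have probability at least [p0] each, so
    [second_moment] applies with [p0^2], whose square is the power 4. *)
Lemma jump_count t a p0 n la : 0 <= t -> 0 < a -> 0 <= p0 ->
  (forall s, 0 <= s -> s <= t -> p0 <= Pr [set w | - (a / 2) <= X s w]) ->
  la = n.+1%:R * Pr [set w | 2 * a <= X (mesh t n) w] ->
  p0 ^+ 4 * la ^+ 2 <= (la + la ^+ 2) * Pr [set w | a <= X t w].
Proof.
move=> t0 a0 p00 hp la_def.
have m0 := mesh_ge0 t0 n.
pose h := mesh t n; have hE : n.+1%:R * h = t by exact: meshE.
have ih (i : 'I_n.+1) : i%:R * h <= t by rewrite -hE ler_wpM2r// ler_nat ltnW.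
have ih1 (i : 'I_n.+1) : i.+1%:R * h <= t by rewrite -hE ler_wpM2r// ler_nat.
have i0 i : 0 <= i%:R * h by rewrite mulr_ge0.
have iS i : i%:R * h <= i.+1%:R * h by rewrite ler_wpM2r// ler_nat.
have iD i : i.+1%:R * h - i%:R * h = h by rewrite -mulrBl -natr1 addrAC subrr add0r mul1r.
pose A (i : 'I_n.+1) := [set w | 2 * a <= xi X t i w].
pose B (i : 'I_n.+1) := [set w | - (a / 2) <= X (i%:R * h) w - X 0 w /\
                                 - (a / 2) <= X t w - X (i.+1%:R * h) w].
have mr c : measurable ([set x | c <= x] : set (measurableTypeR R)) by exact: measurable_ray_ge.
have mA i : measurable (A i) by apply: measurable_ge; exact: (measurable_xi HX t0).
have mB i : measurable (B i).
  by apply: measurableI; apply: measurable_ge; apply: measurable_funB; exact: mX.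
have PA i : Pr (A i) = Pr [set w | 2 * a <= X h w].
  by rewrite -[in RHS](iD i) -(Pr_increment HX (i0 i) (iS i) (mr _)).
have laE : la = \sum_i Pr (A i).
  by under eq_bigr do rewrite PA; rewrite sumr_const card_ord la_def mulr_natl.
have hAA i j : i != j -> Pr (A i `&` A j) <= Pr (A i) * Pr (A j).
  move=> ij; rewrite !PA; wlog lij : i j ij / (i < j)%N.
    move=> H; case: (ltngtP i j) => [lij|lij|/val_inj/eqP]; [exact: H| |by rewrite (negbTE ij)].
    by rewrite setIC; apply: H => //; rewrite eq_sym.
  have ij1 : i.+1%:R * h <= j%:R * h by rewrite ler_wpM2r// ler_nat.
  have := @indep3 _ _ _ P X HX _ _ _ _ _ setT _ (i0 i) (iS i) ij1 (iS j) (mr (2 * a)) measurableT (mr (2 * a)).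
  rewrite !iD (_ : [set w | setT (X _ w)] = setT); last by apply/seteqP; split.
  rewrite Pr_setT mulr1 => <-; rewrite le_eqVlt; apply/orP; left; apply/eqP; congr Pr.
  by apply/seteqP; split => w /= [] // x y; split.
have hAB i : p0 ^+ 2 * Pr (A i) <= Pr (A i `&` B i).
  have := @indep3 _ _ _ P X HX _ _ _ _ _ _ _ (lexx 0) (i0 i) (iS i) (ih1 i) (mr (- (a / 2))) (mr (2 * a)) (mr (- (a / 2))).
  rewrite iD subr0 => e.
  have -> : A i `&` B i = [set w | [/\ - (a / 2) <= X (i%:R * h) w - X 0 w,
       2 * a <= X (i.+1%:R * h) w - X (i%:R * h) w & - (a / 2) <= X t w - X (i.+1%:R * h) w]].
    by apply/seteqP; split => w /= [] // ? []; split.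
  rewrite e PA [leRHS]mulrAC expr2 ler_wpM2r ?Pr_ge0// ler_pM//; apply: hp => //.
  - by rewrite subr_ge0.
  - by rewrite gerBl.
rewrite -[4%N]/(2 * 2)%N exprM.
apply: (le_trans (second_moment (sqr_ge0 p0) mA mB hAA hAB laE)).
rewrite ler_wpM2l//.
  by rewrite addr_ge0 ?sqr_ge0// laE; apply: sumr_ge0 => i _; exact: Pr_ge0.
rewrite -(Pr_sub0_ge HX _ t0); apply: Pr_le.
- by apply: measurable_exists => i; exact: measurableI.
- by apply: measurable_ge; apply: measurable_funB; exact: mX.
move=> w /= [i [h1 [h2 h3]]]; move: h1; rewrite /A /= /xi -/h; lra.
Qed.

(** [jump_count] in the limit of a fine mesh, where the expected number of increments of at least
    [2 a] is asymptotically at least [t Pi (3 a, oo)]. *)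
Lemma jump_bound t a p0 : 0 < t -> 0 < a -> 0 <= p0 ->
  (forall s, 0 <= s -> s <= t -> p0 <= Pr [set w | - (a / 2) <= X s w]) ->
  p0 ^+ 4 * (t * Tn (3 * a)) <= (1 + t * Tn (3 * a)) * Pr [set w | a <= X t w].
Proof.
move=> t0 a0 p00 hp; have a2 : 0 < 2 * a by lra.
set L := t * Tn _; have T0 : 0 <= L.
  by rewrite mulr_ge0 ?(ltW t0)//; apply: It_ge0 => x; rewrite indicE.
set Q := Pr _; have Q0 : 0 <= Q by exact: Pr_ge0.
have p40 : 0 <= p0 ^+ 4 by exact: exprn_ge0.
have Q1 : p0 ^+ 4 <= 1.
  rewrite exprn_ile1//; apply: (le_trans (hp 0 (lexx _) (ltW t0))); apply: Pr_le1.
  by apply: measurable_ge; exact: mX.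
apply/ler_addgt0Pr => e e0.
have n1 := near_ge (conv_ramp (ltW t0) a2 a0) e0.
have [n hn] := filter_ex n1.
pose la := n.+1%:R * Pr [set w | 2 * a <= X (mesh t n) w].
have hc : p0 ^+ 4 * la ^+ 2 <= (la + la ^+ 2) * Q := jump_count (ltW t0) a0 p00 hp erefl.
have h1 : L - e <= la.
  apply: (@le_trans _ _ (n.+1%:R * Ex (mesh t n) (ramp (2 * a) a))).
    apply: le_trans hn; rewrite lerD2r /L ler_wpM2l ?(ltW t0)//.
    by have := tail_le_ramp a2 a0; rewrite (_ : 2 * a + a = 3 * a); [|ring].
  rewrite /la ler_wpM2l//; have m0 := mesh_ge0 (ltW t0) n.
  have mA : measurable [set w | 2 * a <= X (mesh t n) w] by exact: measurable_ge (mX m0).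
  rewrite -(It_indic P mA); apply: It_le => [||w]; [|exact: itg_indic|].
    apply: (itg_bndX HX (C := 1)) => // [|x].
      exact: (continuous_measurable_fun (@continuous_ramp _ _)).
    by have /andP[? ?] := ramp01 (2 * a) a x; rewrite ger0_norm.
  rewrite indicE; case: (boolP (w \in _)) => [_|]; first by case/andP: (ramp01 (2 * a) a (X (mesh t n) w)).
  by rewrite notin_setE /= => /negP; rewrite -ltNge => h; rewrite ramp0// ltW.
exact: (jump_arith p40 Q1 Q0 (Pr_le1 P (measurable_ge _ (mX (ltW t0)))) T0 e0 h1 hc).
Qed.

End marginal_bounds.

(** * Ottaviani's maximal inequality *)

Section past_and_future.
Context (R : realType) d (T : measurableType d) (P : probability T R)
  (X : R -> T -> R).
Hypothesis HX : levy_process P X.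
Local Notation Pr := (Pr P).
Let mX s : 0 <= s -> measurable_fun setT (X s) := @levy_measurable _ _ _ _ _ HX s.

Variable th : nat -> R.
Hypotheses (th0 : 0 <= th 0%N) (thS : forall i, th i <= th i.+1).
Variable n : nat.

Definition incr (i : 'I_n) (w : T) : R := X (th i.+1) w - X (th i) w.

Let th_ge0 i : 0 <= th i.
Proof. by elim: i => // i; move/le_trans; apply. Qed.

Lemma measurable_incr i : measurable_fun setT (incr i).
Proof. by apply: measurable_funB; exact: mX. Qed.

Lemma indep_incr : mutually_independent P incr.
Proof. exact: levy_indep HX n th th0 thS. Qed.

(** Copies of the sample space with the sigma-algebras of the first [k] increments and, in [future],
    of the remaining ones. *)
Definition past k := rect_type incr (fun i => (i < k)%N).
Definition future k := rect_type incr (fun i => ~~ (i < k)%N).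

Lemma past_measurable k j : (j <= k)%N -> (k <= n)%N ->
  measurable_fun (setT : set (past k)) (fun w : past k => X (th j) w - X (th 0%N) w : R).
Proof.
move=> jk kn; elim: j jk => [|j IH] jk.
  rewrite [X in measurable_fun _ X](_ : _ = cst 0); last by apply/funext => w; rewrite subrr.
  exact: measurable_cst.
have jn : (j < n)%N by exact: leq_trans kn.
have := @measurable_rect_coord _ _ _ _ incr (fun i => (i < k)%N) (Ordinal jn) jk.
move=> /(measurable_funD (IH (ltnW jk))); rewrite (_ : (_ \+ _) = fun w => X (th j.+1) w - X (th 0%N) w)//.
by apply/funext => w; rewrite /= /incr /= addrC addrA subrK.
Qed.

Lemma future_measurable k j : (k <= j)%N -> (j <= n)%N ->
  measurable_fun (setT : set (future k)) (fun w : future k => X (th j) w - X (th k) w : R).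
Proof.
move=> kj; rewrite -(subnK kj); elim: (j - k)%N => [|m IH] jn.
  rewrite [X in measurable_fun _ X](_ : _ = cst 0); last by apply/funext => w; rewrite add0n subrr.
  exact: measurable_cst.
have jn' : (m + k < n)%N by move: jn; rewrite addSn.
have mk : ~~ (Ordinal jn' < k)%N by rewrite -leqNgt /= leq_addl.
have := @measurable_rect_coord _ _ _ _ incr (fun i => ~~ (i < k)%N) (Ordinal jn') mk.
move=> /(measurable_funD (IH (ltnW jn'))).
rewrite (_ : (_ \+ _) = fun w => X (th (m.+1 + k)%N) w - X (th k) w)//.
by apply/funext => w; rewrite /= /incr /= addrC addrA subrK addSn.
Qed.

Lemma past_future_indep k (A B : set T) : @measurable _ (past k) A -> @measurable _ (future k) B ->
  [/\ measurable A, measurable B & Pr (A `&` B) = Pr A * Pr B].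
Proof.
move=> mA mB; split.
- exact: (sig_measurable measurable_incr mA).
- exact: (sig_measurable measurable_incr mB).
- exact: (group_indep measurable_incr indep_incr mA mB).
Qed.

(** Decompose by the first index [j] beyond [a + b]: [F j] belongs to the past of [j], and [G j],
    which bounds the remaining increment below by [- b], to its future. On [F j] and [G j] together
    the endpoint exceeds [a], and the [F j] are disjoint. *)
Lemma ottaviani a b p0 : 0 <= p0 ->
  (forall j, (j <= n)%N -> p0 <= Pr [set w | - b <= X (th n) w - X (th j) w]) ->
  p0 * Pr [set w | exists j : 'I_n.+1, a + b < X (th j) w - X (th 0%N) w] <=
  Pr [set w | a < X (th n) w - X (th 0%N) w].
Proof.
move=> p00 hp; pose Z (j : nat) w := X (th j) w - X (th 0%N) w.
have mZ j : measurable_fun setT (Z j) by apply: measurable_funB; exact: mX.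
pose F (j : 'I_n.+1) := [set w | a + b < Z j w /\ forall i : 'I_n.+1, (i < j)%N -> Z i w <= a + b].
pose G (j : 'I_n.+1) := [set w | - b <= X (th n) w - X (th j) w].
have pF (j : 'I_n.+1) : @measurable _ (past j) (F j).
  have jn : (j <= n)%N by rewrite -ltnS.
  have pZ i : (i <= j)%N -> measurable_fun (setT : set (past j)) (Z i : past j -> R).
    by move=> ij; exact: past_measurable.
  apply: measurableI.
    have := pZ j (leqnn j) measurableT _ (measurable_ray_gt (a + b)).
    by rewrite setTI.
  rewrite [X in measurable X](_ : _ = \bigcap_(i in [set: 'I_n.+1])
    if (i < j)%N then [set w | Z i w <= a + b] else setT); last first.
    apply/seteqP; split => w /= h i.
      by move=> _; case: ifP => // /h.
    by move=> ij; have := h i I; rewrite ij.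
  apply: fin_bigcap_measurable => [|i _]; first exact: finite_finset.
  case: ifPn => // ij.
  have := pZ i (ltnW ij) measurableT _ (measurable_itv `]-oo, (a + b)]).
  by rewrite setTI set_itvNyc.
have fG (j : 'I_n.+1) : @measurable _ (future j) (G j).
  have jn : (j <= n)%N by rewrite -ltnS.
  have fm : measurable_fun (setT : set (future j)) (fun w : future j => X (th n) w - X (th j) w : R).
    exact: future_measurable.
  have := fm measurableT _ (measurable_ray_ge (- b)).
  by rewrite setTI.
have ind j := past_future_indep (pF j) (fG j).
have mF j : measurable (F j) by case: (ind j).
have mG j : measurable (G j) by case: (ind j).
have mFG j : measurable (F j `&` G j) by exact: measurableI.
have FU : [set w | exists j : 'I_n.+1, a + b < X (th j) w - X (th 0%N) w] `<=`
    [set w | exists j, F j w].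
  move=> w [j hj]; pose Q k := (k <= n)%N && (a + b < Z k w).
  have exQ : exists k, Q k by exists j; rewrite /Q -ltnS ltn_ord.
  case: (ex_minnP exQ) => k /andP[kn hk] kmin.
  exists (inord k); rewrite /F /= inordK ?ltnS//; split => // i ik.
  rewrite leNgt; apply/negP => hi; have := kmin i; rewrite /Q -ltnS ltn_ord hi leqNgt ik.
  by move=> /(_ isT).
have mE : measurable [set w | a < Z n w] by exact: measurable_gt.
apply: (@le_trans _ _ (p0 * Pr [set w | exists j, F j w])).
  apply: ler_wpM2l => //; apply: Pr_le => //; first apply: measurable_exists => j.
    exact: (measurable_gt (a + b) (mZ j)).
  exact: measurable_exists.
apply: (le_trans (ler_wpM2l p00 (Pr_exists_le P mF))); rewrite mulr_sumr.
apply: (@le_trans _ _ (\sum_j Pr (F j `&` G j))).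
  apply: ler_sum => j _; case: (ind j) => _ _ ->; rewrite mulrC ler_wpM2l ?Pr_ge0//.
  by apply: hp; rewrite -ltnS.
have [h1 h2] := It_sum (index_enum 'I_n.+1) (fun j => itg_indic P (mFG j)).
rewrite -(It_indic P mE) (eq_bigr (fun j => It P (\1_(F j `&` G j)))); last by move=> j _; rewrite It_indic.
rewrite -h2; apply: It_le => [||w]; [exact: h1|exact: itg_indic|].
have [[j [Fj Gj]]|hn] := pselect (exists j, (F j `&` G j) w); last first.
  by rewrite big1 ?indicE// => j _; rewrite indicE memNset// => ?; apply: hn; exists j.
have wE : w \in [set w | a < Z n w].
  rewrite inE /=; move: Fj Gj; rewrite /F /G /= /Z => -[h _] h'; lra.
rewrite (bigD1 j)//= big1 ?addr0 ?[\1__ w]indicE ?wE ?mem_set// => i ij.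
rewrite indicE memNset// => -[[hi hi'] _]; case: Fj => hj hj'.
case: (ltngtP i j) => [lij|lij|/val_inj/eqP]; last by rewrite (negbTE ij).
  by have := hj' i lij; rewrite leNgt hi.
by have := hi' j lij; rewrite leNgt hj.
Qed.

End past_and_future.

Section continuity_from_below.
Context (R : realType) d (T : measurableType d) (P : probability T R).
Local Notation Pr := (Pr P).

Lemma Pr_bigcup_approx (F : nat -> set T) e : (forall n, measurable (F n)) ->
  (forall n m, (n <= m)%N -> F n `<=` F m) -> 0 < e ->
  exists N, forall n, (N <= n)%N -> Pr (\bigcup_n F n) <= Pr (F n) + e.
Proof.
move=> mF ndF e0; have mU : measurable (\bigcup_n F n) by exact: bigcupT_measurable.
have nd : nondecreasing_seq F by move=> n m nm; apply/subsetPset; exact: ndF.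
have : P \o F @ \oo --> P (\bigcup_n F n) := nondecreasing_cvg_mu mF mU nd.
rewrite (PrE P mU) (_ : P \o F = EFin \o (fun n => Pr (F n))); last first.
  by apply/funext => n /=; rewrite PrE.
move=> /fine_cvgP[_]; rewrite (_ : fine \o _ = fun n => Pr (F n)) => [|]; last exact/funext.
move=> /near_ge/(_ e0)[N _ h]; exists N => n nN; have := h n nN; rewrite /=; lra.
Qed.

Lemma Pr_bigcup_le (F : nat -> set T) K : (forall n, measurable (F n)) ->
  (forall n m, (n <= m)%N -> F n `<=` F m) -> (forall n, Pr (F n) <= K) ->
  Pr (\bigcup_n F n) <= K.
Proof.
move=> mF ndF hK; apply/ler_addgt0Pr => e e0.
have [N h] := Pr_bigcup_approx mF ndF e0; apply: (le_trans (h N (leqnn _))).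
by rewrite lerD2r.
Qed.

Lemma measurable_and (p : Prop) (A : set T) : (p -> measurable A) -> measurable [set w | p /\ A w].
Proof.
move=> mA; have [hp|hp] := pselect p.
  rewrite (_ : [set w | _] = A); first exact: mA.
  by apply/seteqP; split => w /=; [case|].
rewrite (_ : [set w | _] = set0)//; by apply/seteqP; split => w //= [].
Qed.

Lemma ae_of_Pr (A : set T) : measurable A -> Pr A = 0 -> {ae P, forall w, ~ A w}.
Proof.
move=> mA A0; exists A; split => //; first by rewrite (PrE P mA) A0.
by move=> w /= /contrapT.
Qed.

End continuity_from_below.

(** * From marginals to the limsup *)

Section dyadic_excursions.
Context (R : realType) d (T : measurableType d) (P : probability T R)
  (X : R -> T -> R).
Hypothesis HX : levy_process P X.
Local Notation Pr := (Pr P).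
Let mX s : 0 <= s -> measurable_fun setT (X s) := @levy_measurable _ _ _ _ _ HX s.

(** Path events are expressed through dyadic times, so that they are countable unions and hence
    measurable; right-continuity recovers the other times. *)
Definition dy N (j : nat) : R := j%:R / 2 ^+ N.

Lemma dy_ge0 N j : 0 <= dy N j.
Proof. by rewrite divr_ge0. Qed.

Lemma dy_gt0 N j : (0 < j)%N -> 0 < dy N j.
Proof. by move=> j0; rewrite divr_gt0 ?ltr0n ?exprn_gt0. Qed.

Lemma dyD N M j : dy (N + M) (j * 2 ^ M) = dy N j.
Proof.
by rewrite /dy natrM natrX exprD invfM mulrACA divff ?mulr1// expf_neq0// pnatr_eq0.
Qed.

Lemma dyM N M j : (N <= M)%N -> dy M (j * 2 ^ (M - N)) = dy N j.
Proof. by move=> NM; rewrite -(dyD N (M - N) j) subnKC. Qed.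

Lemma dy_lt N i j : (dy N i < dy N j) = (i < j)%N.
Proof. by rewrite ltr_pM2r ?invr_gt0 ?exprn_gt0// ltr_nat. Qed.

Lemma dy_le N i j : (dy N i <= dy N j) = (i <= j)%N.
Proof. by rewrite ler_pM2r ?invr_gt0 ?exprn_gt0// ler_nat. Qed.

Lemma dy1 N : dy N (2 ^ N) = 1.
Proof. by rewrite /dy natrX divff// expf_neq0// pnatr_eq0. Qed.

Variable kappa : R.

(* The grid indices are bounded by [2 ^ N] because only times below 1 occur. *)
Definition exc_at c m N : set T := [set w | exists j : 'I_(2 ^ N),
  ((0 < j)%N /\ dy N j < dy m 1) /\ c * dy N j `^ kappa < X (dy N j) w - X 0 w].
Definition exc c m : set T := \bigcup_N exc_at c m N.

Lemma measurable_exc_at c m N : measurable (exc_at c m N).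
Proof.
apply: measurable_exists => j; apply: measurable_and => _.
apply: measurable_gt; apply: measurable_funB; apply: mX => //; exact: dy_ge0.
Qed.

Lemma measurable_exc c m : measurable (exc c m).
Proof. by apply: bigcupT_measurable => N; exact: measurable_exc_at. Qed.

Lemma exc_at_mono c m N M : (N <= M)%N -> exc_at c m N `<=` exc_at c m M.
Proof.
move=> NM w [j [[j0 jm] hj]].
have h : (j * 2 ^ (M - N) < 2 ^ M)%N.
  by rewrite -[in X in (_ < X)%N](subnKC NM) expnD ltn_pmul2r ?expn_gt0.
have e := dyM j NM.
by exists (Ordinal h); rewrite /= e muln_gt0 j0 expn_gt0.
Qed.

Lemma exc_atP c m N j w : (0 < j)%N -> dy N j < dy m 1 ->
  c * dy N j `^ kappa < X (dy N j) w - X 0 w -> exc c m w.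
Proof.
move=> j0 jm h; exists N => //.
have j1 : (j < 2 ^ N)%N.
  rewrite -(dy_lt N) dy1 (lt_le_trans jm)// /dy mul1r invf_le1 ?exprn_gt0//.
  by rewrite exprn_ege1// ler1n.
by exists (Ordinal j1).
Qed.

Lemma exc_dec c c' m m' : c' <= c -> (m' <= m)%N -> exc c m `<=` exc c' m'.
Proof.
move=> cc mm w [N _ [j [[j0 jm] hj]]]; apply: (exc_atP (N := N) (j := j)) => //.
  apply: (lt_le_trans jm); rewrite /dy !mul1r lef_pV2 ?posrE ?exprn_gt0//.
  by rewrite ler_weXn2l// ler1n.
by apply: le_lt_trans hj; rewrite ler_wpM2r// powR_ge0.
Qed.

Definition cont_in_prob := forall e eta : R, 0 < e -> 0 < eta ->
  exists s0 : R, 0 < s0 /\ forall s, 0 <= s -> s <= s0 -> Pr [set w | eta < `|X s w - X 0 w|] <= e.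

(** A quantitative zero-one law. Up to [e], an excursion above level [c] is seen on a finite grid;
    for a much smaller time [ep] it can be measured from [X ep] instead of [X 0], at the price of
    lowering [c], and is then independent of the path up to [ep]. The absence of excursions thus has
    probability at most that of absence before [ep] times [1 - del], up to errors. *)
Lemma zero_one_step c c1 del m e : cont_in_prob -> 0 <= kappa -> c1 < c ->
  (forall m, del <= Pr (exc c m)) -> 0 < e ->
  exists M, Pr (~` exc c1 m) <= (Pr (~` exc c1 M) + e) * (1 - del + 2 * e) + e.
Proof.
move=> cip k0 cc hdel e0.
have [N hN] := Pr_bigcup_approx P (@measurable_exc_at c m) (@exc_at_mono c m) e0.
(* [c2] halves the gap, since [X 0] and [X ep] are exchanged twice, once between [c] and [c2], once
   between [c2] and [c1]; [eta] is the half gap at the earliest time of the grid. *)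
pose c2 := (c1 + c) / 2; pose eta := (c - c1) / 2 * dy N 1 `^ kappa.
have eta0 : 0 < eta by rewrite mulr_gt0 ?divr_gt0 ?powR_gt0 ?subr_gt0// dy_gt0.
have [s0 [s00 hs]] := cip e eta e0 eta0.
have [M [NM mM' Ms0]] : exists M, [/\ (N <= M)%N, (m <= M)%N & dy M 1 <= s0].
  have h : 2^-1 ^+ n @[n --> \oo] --> (0 : R) by apply: cvg_expr; rewrite ger0_norm; lra.
  have [M0 _ hM] := near_le h s00; exists (maxn (maxn N m) M0).
  rewrite !leq_max !leqnn !orbT; split => //.
  by have := hM (maxn (maxn N m) M0) (leq_maxr _ _); rewrite /dy mul1r exprVn /= add0r.
exists M; pose ep := dy M 1; have ep0 : 0 <= ep by exact: dy_ge0.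
have [N1 hN1] := Pr_bigcup_approx P (@measurable_exc_at c1 M) (@exc_at_mono c1 M) e0.
pose N2 := maxn M N1; have MN2 : (M <= N2)%N by exact: leq_maxl.
have NN2 : (N <= N2)%N by exact: leq_trans NM MN2.
pose k := (2 ^ (N2 - M))%N.
have dk : dy N2 k = ep by rewrite /ep -(dyM 1 MN2) mul1n.
have d0 : dy N2 0 = 0 by rewrite /dy mul0r.
have th0 : 0 <= dy N2 0 by rewrite d0.
have thS i : dy N2 i <= dy N2 i.+1 by rewrite dy_le.
have kn : (k <= 2 ^ N2)%N by rewrite leq_exp2l// leq_subr.
pose E1 := ~` exc_at c1 M N2.
pose E2 : set T := [set w | forall j : 'I_(2 ^ N), (0 < j)%N /\ dy N j < dy m 1 ->
  X (dy N j) w - X ep w <= c2 * dy N j `^ kappa].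
have mE1 : @measurable _ (past X (dy N2) (2 ^ N2) k) E1.
  rewrite /E1 (_ : ~` _ = \bigcap_(j in [set: 'I_(2 ^ N2)])
      if ((0 < j) && (j < k))%N then [set w | X (dy N2 j) w - X (dy N2 0) w <= c1 * dy N2 j `^ kappa]
      else setT); last first.
    apply/seteqP; split => w /= h j.
      move=> _; case: ifPn => // /andP[j0 jk] /=; rewrite leNgt; apply/negP => hj; apply: h.
      by exists j; split; [split => //; rewrite -/ep -dk dy_lt|rewrite -d0].
    case: j => j [[j0]]; rewrite -/ep -dk dy_lt => jk hj.
    by have := h j I; rewrite j0 jk /= d0 leNgt hj.
  apply: fin_bigcap_measurable => [|j _]; first exact: finite_finset.
  case: ifPn => // /andP[j0 jk].
  have fm : measurable_fun (setT : set (past X (dy N2) (2 ^ N2) k))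
      (fun w : past X (dy N2) (2 ^ N2) k => X (dy N2 j) w - X (dy N2 0) w : R).
    by apply: past_measurable => //; exact: ltnW.
  have := fm measurableT _ (measurable_itv `]-oo, (c1 * dy N2 j `^ kappa)]).
  by rewrite setTI set_itvNyc.
have mE2 : @measurable _ (future X (dy N2) (2 ^ N2) k) E2.
  rewrite /E2 [X in measurable X](_ : _ = \bigcap_(j in [set: 'I_(2 ^ N)])
      [set w | (0 < j)%N /\ dy N j < dy m 1 -> X (dy N j) w - X ep w <= c2 * dy N j `^ kappa]); last first.
    by apply/seteqP; split => w /= h j; [move=> _; exact: h|exact: h].
  apply: fin_bigcap_measurable => [|j _]; first exact: finite_finset.
  have [hj|hj] := pselect ((0 < j)%N /\ dy N j < dy m 1); last first.
    by rewrite [X in measurable X](_ : _ = setT); [exact: measurableT|apply/seteqP; split => w // _ /= /hj].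
  rewrite [X in measurable X](_ : _ = [set w | X (dy N j) w - X ep w <= c2 * dy N j `^ kappa]); last first.
    by apply/seteqP; split => w /=; [apply|].
  pose i := (j * 2 ^ (N2 - N))%N.
  have iE : dy N2 i = dy N j by rewrite /i dyM.
  have ki : (k <= i)%N.
    apply: (@leq_trans (2 ^ (N2 - N))); first by rewrite leq_exp2l// leq_sub2l.
    by rewrite leq_pmull//; case: hj.
  have in2 : (i <= 2 ^ N2)%N.
    by rewrite -(dy_le N2) iE dy1 -(dy1 N) dy_le ltnW.
  have fm : measurable_fun (setT : set (future X (dy N2) (2 ^ N2) k))
      (fun w : future X (dy N2) (2 ^ N2) k => X (dy N2 i) w - X (dy N2 k) w : R).
    exact: future_measurable.
  have := fm measurableT _ (measurable_itv `]-oo, (c2 * dy N j `^ kappa)]).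
  by rewrite setTI set_itvNyc iE dk.
have [mE1' mE2' ind] := past_future_indep HX th0 thS mE1 mE2.
pose H := [set w | eta < `|X ep w - X 0 w|].
have mH : measurable H.
  apply: measurable_gt; apply: measurableT_comp => //.
  by apply: measurable_funB; exact: mX.
have PH : Pr H <= e by apply: hs.
have pw j : (0 < j)%N -> eta <= (c - c1) / 2 * dy N j `^ kappa.
  move=> j0; rewrite /eta ler_wpM2l//; first by rewrite divr_ge0// subr_ge0 ltW.
  by apply: ge0_ler_powR; rewrite ?nnegrE ?dy_ge0// dy_le.
have mN := measurable_exc_at c m N; have mM := measurable_exc_at c1 M N2.
have P2 : Pr E2 <= 1 - del + 2 * e.
  apply: (@le_trans _ _ (Pr (~` exc_at c m N) + Pr H)); last first.
    rewrite (Pr_setC P mN); have := hN N (leqnn N); have := hdel m; rewrite -/(exc c m); lra.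
  apply: le_trans (Pr_setU P (measurableC mN) mH); apply: Pr_le => //.
    by apply: measurableU => //; exact: measurableC.
  move=> w hw; have [hH|hH] := pselect (H w); [by right|left].
  move=> [j [jm hj]]; have [j0 _] := jm; have := hw j jm; have := pw j j0.
  move: hH => /negP; rewrite -leNgt ler_norml => /andP[_ h1].
  move=> h2 h3; move: hj; apply/negP; rewrite -leNgt.
  by move: h1 h2 h3; rewrite /c2; lra.
have P1 : Pr E1 <= Pr (~` exc c1 M) + e.
  rewrite (Pr_setC P mM) (Pr_setC P (measurable_exc c1 M)).
  have := hN1 N2 (leq_maxr _ _); rewrite -/(exc c1 M); lra.
have mU := measurable_exc c1 m.
apply: (@le_trans _ _ (Pr (E1 `&` E2) + Pr H)); last first.
  by rewrite ind; apply: lerD => //; apply: ler_pM; rewrite ?Pr_ge0.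
apply: le_trans (Pr_setU P (measurableI _ _ mE1' mE2') mH); apply: Pr_le.
- exact: measurableC.
- by apply: measurableU => //; exact: measurableI.
move=> w hw; have [hH|hH] := pselect (H w); [by right|left].
split.
  by move=> h; apply: hw; apply: (exc_dec (lexx c1) mM'); exists N2.
move=> j [j0 jm]; rewrite leNgt; apply/negP => hj; apply: hw; apply: (exc_atP j0 jm).
have := pw j j0; move: hH => /negP; rewrite -leNgt ler_norml => /andP[h1 _] h2.
by move: hj h1 h2; rewrite /c2; lra.
Qed.

(** Let [al] be the supremum over [m] of the probabilities of absence: [zero_one_step] gives
    [al <= al (1 - del) + 6 e] for all small [e], so [al = 0]. *)
Lemma exc_null c c1 del : cont_in_prob -> 0 <= kappa -> c1 < c -> 0 < del ->
  (forall m, del <= Pr (exc c m)) -> forall m, Pr (~` exc c1 m) = 0.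
Proof.
move=> cip k0 cc del0 hdel m0.
pose a m := Pr (~` exc c1 m); have a0 m : 0 <= a m by exact: Pr_ge0.
have a1 m : a m <= 1 by apply: Pr_le1; apply: measurableC; exact: measurable_exc.
have hs : has_sup (range a).
  by split; [exists (a 0%N); exists 0%N|exists 1 => _ [m _ <-]].
pose al := sup (range a); have aal m : a m <= al by apply: ub_le_sup; [case: hs|exists m].
have al1 : al <= 1 by apply: ge_sup; [case: hs|move=> _ [m _ <-]].
have del1 : del <= 1 by apply: le_trans (hdel 0%N) _; apply: Pr_le1; exact: measurable_exc.
have hal e : 0 < e -> e <= 1 -> al <= al * (1 - del) + 6 * e.
  move=> e0 e1; apply: ge_sup; first by case: hs.
  move=> _ [m _ <-]; have [M hM] := zero_one_step m cip k0 cc hdel e0.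
  apply: (le_trans hM); rewrite -/(a M); have h := aal M.
  have : (a M + e) * (1 - del + 2 * e) <= (al + e) * (1 - del + 2 * e).
    by apply: ler_wpM2r; lra.
  have : al * e <= e by rewrite ler_piMl// ltW.
  have : e * (1 - del + 2 * e) <= e * 3 by apply: ler_wpM2l; lra.
  lra.
apply/eqP; rewrite eq_le a0 andbT leNgt; apply/negP => pos.
have alp : 0 < al by exact: lt_le_trans pos (aal m0).
have e0 : 0 < al * del / 12 by rewrite divr_gt0// mulr_gt0.
have e1 : al * del / 12 <= 1.
  by rewrite ler_pdivrMr// mul1r; have := ler_pM (ltW alp) (ltW del0) al1 del1; lra.
have := hal _ e0 e1; have := mulr_gt0 alp del0; lra.
Qed.

End dyadic_excursions.

Section limsup_at_zero.
Context (R : realType) d (T : measurableType d).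
Variables (X : R -> T -> R) (kappa : R) (w : T).

Lemma dy_dense (s r : R) : 0 <= s -> s < r -> exists N j, [/\ (0 < j)%N, s < dy R N j & dy R N j < r].
Proof.
move=> s0 sr; have rs : 0 < r - s by rewrite subr_gt0.
have h : 2^-1 ^+ n @[n --> \oo] --> (0 : R) by apply: cvg_expr; rewrite ger0_norm; lra.
have rs2 : 0 < (r - s) / 2 by rewrite divr_gt0.
have [N _ hN] := near_le h rs2; have {}hN : 2^-1 ^+ N <= 0 + (r - s) / 2 by exact: (hN N (leqnn N)).
have p0 : 0 < (2 : R) ^+ N by exact: exprn_gt0.
pose j := (Num.truncn (s * 2 ^+ N)).+1.
have /andP[t1 t2] : (Num.truncn (s * 2 ^+ N))%:R <= s * 2 ^+ N < j%:R.
  by apply: truncn_itv; rewrite mulr_ge0// ltW.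
exists N, j; split => //; rewrite /dy; first by rewrite ltr_pdivlMr.
rewrite ltr_pdivrMr// /j -natr1; rewrite exprVn in hN.
have : 1 <= (r - s) / 2 * 2 ^+ N by rewrite -ler_pdivrMr// mul1r -[leRHS]add0r.
have : 0 < (r - s) * 2 ^+ N by rewrite mulr_gt0.
lra.
Qed.

Lemma near_rightP (t : R) (Q : R -> Prop) : (\forall u \near t^'+, Q u) ->
  exists2 r, t < r & forall u, t < u -> u < r -> Q u.
Proof.
move=> /nbhs_ballP[e /= e0 h]; exists (t + e); first by rewrite ltrDl.
move=> u tu ur; apply: h => //; rewrite /ball /= distrC gtr0_norm; lra.
Qed.

(** By right-continuity a strict excursion at [t] persists just after [t], hence at a dyadic
    time. *)
Lemma exc_of_path c m (t : R) : X u w @[u --> t^'+] --> X t w -> 0 < t -> t < dy R m 1 ->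
  c * t `^ kappa < X t w - X 0 w -> exc X kappa c m w.
Proof.
move=> rc t0 tm ht.
have dp : derivable (fun z : R => z `^ kappa) t 1 by apply: derivable_powR; rewrite in_itv /= t0.
have cp : (fun z : R => z `^ kappa) @ t --> t `^ kappa.
  by move/derivable1_diffP/differentiable_continuous: dp; exact.
have cg : X u w - X 0 w - c * u `^ kappa @[u --> t^'+] --> X t w - X 0 w - c * t `^ kappa.
  apply: cvgB; first by apply: cvgB; [exact: rc|exact: cvg_cst].
  by apply: cvgMr; exact: cvg_at_right_filter.
have pos : 0 < X t w - X 0 w - c * t `^ kappa by rewrite subr_gt0.
have h1 : \forall u \near t^'+, 0 < X u w - X 0 w - c * u `^ kappa.
  exact: (cvgr_gt _ cg _ pos).
have h2 : \forall u \near t^'+, u < dy R m 1 by exact: nbhs_right_lt.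
have [r tr hr] := near_rightP (filterI h1 h2).
have [N [j [j0 j1 j2]]] := dy_dense (ltW t0) tr.
have [k1 k2] := hr _ j1 j2; apply: (exc_atP (N := N) (j := j)) => //.
by rewrite -subr_gt0.
Qed.

Hypothesis X0 : X 0 w = 0.

Lemma limsup_le c m : (forall t : R, 0 <= t -> X u w @[u --> t^'+] --> X t w) ->
  ~ exc X kappa c m w -> (limsup_at0 X kappa w <= c%:E)%E.
Proof.
move=> rc hn; pose V : set R := [set t | 0 < t < dy R m 1].
have m0 : 0 < dy R m 1 by exact: dy_gt0.
have hV : \forall t \near (0 : R)^'+, V t.
  near=> t; apply/andP; split; near: t; [exact: nbhs_right_gt|exact: nbhs_right_lt].
apply: ge_ereal_inf; exists (ereal_sup ((fun t : R => (X t w / t `^ kappa)%:E) @` V)).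
  by exists V.
apply: ge_ereal_sup => _ [t /andP[t0 tm] <-]; rewrite lee_fin ler_pdivrMr ?powR_gt0//.
rewrite leNgt; apply/negP => ht; apply: hn.
by apply: (exc_of_path (rc t (ltW t0)) t0 tm); rewrite X0 subr0.
Unshelve. all: by end_near.
Qed.

Lemma limsup_ge c : (forall m, exc X kappa c m w) -> (c%:E <= limsup_at0 X kappa w)%E.
Proof.
move=> hc; apply: le_ereal_inf_tmp => _ [V hV <-].
have [r r0 hr] := near_rightP hV.
have [N [j [j0 _ jr]]] := dy_dense (lexx 0) r0.
have [N' _ [j' [[j'0 j'1] h]]] := hc N.
have q0 : 0 < dy R N' j' by exact: dy_gt0.
apply: le_ereal_sup_tmp; exists ((X (dy R N' j') w / dy R N' j' `^ kappa)%:E).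
  exists (dy R N' j') => //; apply: hr => //; apply: (lt_trans j'1); apply: le_lt_trans jr.
  by rewrite dy_le.
by rewrite lee_fin ler_pdivlMr ?powR_gt0// ltW// -[ltRHS]subr0 -X0.
Qed.

End limsup_at_zero.

Section almost_sure.
Context (R : realType) d (T : measurableType d) (P : probability T R)
  (X : R -> T -> R).
Hypothesis HX : levy_process P X.
Local Notation Pr := (Pr P).
Let mX s : 0 <= s -> measurable_fun setT (X s) := @levy_measurable _ _ _ _ _ HX s.
Variable kappa : R.
Hypothesis k0 : 0 <= kappa.

Lemma Pr_le_exc (A : set T) c m : measurable A ->
  (forall w, A w -> exists t : R, [/\ 0 < t, t < dy R m 1 & c * t `^ kappa < X t w - X 0 w]) ->
  Pr A <= Pr (exc X kappa c m).
Proof.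
move=> mA hA; have [N [mN N0 hN]] := levy_cadlag HX.
have mE := measurable_exc HX kappa c m.
apply: (@le_trans _ _ (Pr (exc X kappa c m `|` N))).
  apply: Pr_le => //; first exact: measurableU.
  move=> w Aw; have [hw|hw] := pselect (exc X kappa c m w); [by left|right].
  apply: hN => /= rc; apply: hw; have [t [t0 tm ht]] := hA w Aw.
  by apply: (exc_of_path _ t0 tm ht); case: (rc t (ltW t0)).
by apply: (le_trans (Pr_setU P mE mN)); rewrite (_ : Pr N = 0) ?addr0// /Pr N0.
Qed.

Lemma limsup_le_as c : (forall e, 0 < e -> exists m, Pr (exc X kappa c m) <= e) ->
  {ae P, forall w, (limsup_at0 X kappa w <= c%:E)%E}.
Proof.
move=> h; pose A := \bigcap_m exc X kappa c m.
have mA : measurable A by apply: bigcapT_measurable => m; exact: (measurable_exc HX).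
have A0 : Pr A = 0.
  apply/eqP; rewrite eq_le Pr_ge0 andbT; apply/ler_addgt0Pr => e /h[m hm].
  rewrite add0r; apply: le_trans hm; apply: Pr_le => //; first exact: (measurable_exc HX).
  by move=> w; apply.
apply: filterS3 (ae_of_Pr mA A0) (levy_start HX) (levy_cadlag HX) => w hw w0 rc.
have [m hm] : exists m, ~ exc X kappa c m w.
  by apply: contra_notP hw => hw m _; apply: contra_notP hw => hw; exists m.
by apply: (limsup_le w0 _ hm) => t t0; case: (rc t t0).
Qed.

Lemma limsup_ge_as c c1 del : cont_in_prob P X -> 0 < del -> c1 < c ->
  (forall m, del <= Pr (exc X kappa c m)) ->
  {ae P, forall w, (c1%:E <= limsup_at0 X kappa w)%E}.
Proof.
move=> cip del0 cc hdel.
have hz := exc_null HX cip k0 cc del0 hdel.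
have h m : {ae P, forall w, exc X kappa c1 m w}.
  have mC : measurable (~` exc X kappa c1 m) by apply: measurableC; exact: (measurable_exc HX).
  apply: filterS (ae_of_Pr mC (hz m)) => w; exact: contrapT.
apply: filterS2 (levy_start HX) (ae_foralln h) => w w0 hw.
by apply: limsup_ge.
Qed.

(** Either excursions above [c] become improbable near 0, or their probability is bounded below and
    the zero-one law makes them certain at every smaller level. *)
Lemma limsup_dichotomy c : cont_in_prob P X ->
  {ae P, forall w, (limsup_at0 X kappa w <= c%:E)%E} \/
  forall c1, c1 < c -> {ae P, forall w, (c1%:E <= limsup_at0 X kappa w)%E}.
Proof.
move=> cip; have [h|h] := pselect (forall e, 0 < e -> exists m, Pr (exc X kappa c m) <= e).
  by left; exact: limsup_le_as.
right => c1 cc; have [e /not_implyP[e0 he]] : exists e, ~ (0 < e -> exists m, Pr (exc X kappa c m) <= e).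
  by apply: contra_notP h => h e; apply: contra_notP h => h; exists e.
apply: (limsup_ge_as cip e0 cc) => m; rewrite leNgt; apply/negP => hm; apply: he.
by exists m; exact: ltW.
Qed.

Definition hit_at (t c : R) N : set T := [set w | exists j : 'I_((Num.truncn (t * 2 ^+ N)).+1),
  dy R N j <= t /\ c < X (dy R N j) w - X 0 w].
Definition hit t c : set T := \bigcup_N hit_at t c N.

Lemma measurable_hit_at t c N : measurable (hit_at t c N).
Proof.
apply: measurable_exists => j; apply: measurable_and => _.
apply: measurable_gt; apply: measurable_funB; apply: mX => //; exact: dy_ge0.
Qed.

Lemma measurable_hit t c : measurable (hit t c).
Proof. by apply: bigcupT_measurable => N; exact: measurable_hit_at. Qed.

Lemma dy_leE (t : R) N j : 0 <= t -> dy R N j <= t -> (j < (Num.truncn (t * 2 ^+ N)).+1)%N.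
Proof.
move=> t0; rewrite /dy ler_pdivrMr ?exprn_gt0// => h.
have /andP[_ h2] := truncn_itv (mulr_ge0 t0 (exprn_ge0 N (ler0n R 2))).
by rewrite -(ltr_nat R); exact: le_lt_trans h2.
Qed.

Lemma hit_at_mono t c N M : 0 <= t -> (N <= M)%N -> hit_at t c N `<=` hit_at t c M.
Proof.
move=> t0 NM w [j [jt h]]; have e := dyM R j NM.
have jM : (j * 2 ^ (M - N) < (Num.truncn (t * 2 ^+ M)).+1)%N by apply: dy_leE => //; rewrite e.
by exists (Ordinal jM); rewrite /= e.
Qed.

(** Ottaviani's inequality on the dyadic grid capped at [t], followed by a monotone limit over the
    grids. *)
Lemma hit_bound t a b p0 : 0 <= t -> 0 <= p0 ->
  (forall s, 0 <= s -> s <= t -> p0 <= Pr [set w | - b <= X s w]) ->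
  p0 * Pr (hit t (a + b)) <= Pr [set w | a < X t w].
Proof.
move=> t0 p00 hp; have [->|pn] := eqVneq p0 0; first by rewrite mul0r Pr_ge0.
have pp : 0 < p0 by rewrite lt0r pn.
rewrite mulrC -ler_pdivlMr//; apply: Pr_bigcup_le; first exact: measurable_hit_at.
  by move=> n m; exact: hit_at_mono.
move=> N; rewrite ler_pdivlMr// mulrC.
pose n := (Num.truncn (t * 2 ^+ N)).+1; pose th i := Order.min (dy R N i) t.
have th0 : th 0%N = 0 by rewrite /th /dy mul0r min_l.
have thS i : th i <= th i.+1.
  by rewrite /th le_min !ge_min dy_le leqnSn lexx orbT.
have tht i : th i <= t by rewrite /th ge_min lexx orbT.
have tg i : 0 <= th i by rewrite /th le_min t0 dy_ge0.
have tn : th n = t.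
  rewrite /th min_r// /dy ler_pdivlMr ?exprn_gt0// ltW//.
  by have /andP[] := truncn_itv (mulr_ge0 t0 (exprn_ge0 N (ler0n R 2))).
have th00 : 0 <= th 0%N by rewrite th0.
have h := @ottaviani _ _ _ P X HX th th00 thS n a b p0 p00.
rewrite tn th0 in h; apply: le_trans (le_trans (h _) _).
- apply: ler_wpM2l => //; apply: Pr_le; first exact: measurable_hit_at.
    by apply: measurable_exists => j; apply: measurable_gt; apply: measurable_funB; exact: mX.
  move=> w [j [jt hj]]; exists (widen_ord (leqnSn _) j) => /=.
  by rewrite /th min_l.
- move=> j jn; rewrite (Pr_increment HX (tg j) (tht j) (measurable_ray_ge (- b))).
  by apply: hp; [rewrite subr_ge0|rewrite gerBl].
- by rewrite (Pr_sub0_gt HX _ t0).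
Qed.

(** An excursion at a time [q] with [t (n + 1) < q <= t n] passes the level [c * t (n + 1) ^ kappa]
    before [t n]. Lowering the boundary to the left end of the block is what brings [1 / rho] into
    the upper constants. *)
Lemma exc_sub_hit (t : nat -> R) c m n0 : (forall n, 0 < t n) -> t n @[n --> \oo] --> (0 : R) ->
  0 <= c -> dy R m 1 <= t n0 -> exc X kappa c m `<=`
  \bigcup_N [set w | exists n : 'I_N, (n0 <= n)%N /\ hit (t n) (c * t n.+1 `^ kappa) w].
Proof.
move=> tp t0 c0 hm w [N _ [j [[j0 jm] hj]]]; set q := dy R N j in jm hj.
have q0 : 0 < q by exact: dy_gt0.
have q2 : 0 < q / 2 by rewrite divr_gt0.
have [n1 _ hn1] := near_le t0 q2.
pose Q n := (n0 <= n)%N && (t n.+1 < q).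
have exQ : exists n, Q n.
  exists (maxn n0 n1); rewrite /Q leq_maxl /=.
  have := hn1 (maxn n0 n1).+1 (leqW (leq_maxr _ _)); rewrite /=; lra.
case: (ex_minnP exQ) => n /andP[nn tn] nmin.
have qn : q <= t n.
  move: nn; rewrite leq_eqVlt => /orP[/eqP<-|lt]; first by rewrite (le_trans (ltW jm)).
  rewrite leNgt; apply/negP => h; have := nmin n.-1; rewrite /Q.
  case: n lt {tn nmin} h => // n; rewrite ltnS /= => -> -> /(_ isT).
  by rewrite ltnn.
exists n.+1 => //; exists ord_max; split => //=; exists N => //.
exists (Ordinal (dy_leE (ltW (tp n)) qn)); split => //=.
apply: le_lt_trans hj; rewrite ler_wpM2l// ge0_ler_powR ?nnegrE ?(ltW q0) ?(ltW (tp _))//.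
exact: ltW.
Qed.

(* Summable marginal bounds along [t n] control the whole path, by Ottaviani's
   inequality on each block. *)
Lemma upper_criterion (t a b u : nat -> R) (c p0 : R) n1 : (forall n, 0 < t n) ->
  t n @[n --> \oo] --> (0 : R) -> 0 <= c -> 0 < p0 ->
  (forall n s, (n1 <= n)%N -> 0 <= s -> s <= t n -> p0 <= Pr [set w | - b n <= X s w]) ->
  (forall n, (n1 <= n)%N -> Pr [set w | a n < X (t n) w] <= u n) ->
  (forall n, (n1 <= n)%N -> a n + b n <= c * t n.+1 `^ kappa) ->
  (forall e, 0 < e -> exists2 n0, (n1 <= n0)%N & forall N, \sum_(n0 <= n < N) u n <= e) ->
  {ae P, forall w, (limsup_at0 X kappa w <= c%:E)%E}.
Proof.
move=> tp t0 c0 p00 hp hu hab hs; apply: limsup_le_as => e e0.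
have [n0 n10 hn0] := hs (e * p0) (mulr_gt0 e0 p00).
have [m hm] : exists m, dy R m 1 <= t n0.
  have h : 2^-1 ^+ n @[n --> \oo] --> (0 : R) by apply: cvg_expr; rewrite ger0_norm; lra.
  have [M _ hM] := near_le h (tp n0); exists M.
  by have := hM M (leqnn M); rewrite /dy mul1r exprVn /= add0r.
exists m; pose F N := [set w | exists n : 'I_N, (n0 <= n)%N /\ hit (t n) (c * t n.+1 `^ kappa) w].
have mF N : measurable (F N).
  by apply: measurable_exists => n; apply: measurable_and => _; exact: measurable_hit.
apply: (@le_trans _ _ (Pr (\bigcup_N F N))).
  apply: Pr_le; [exact: (measurable_exc HX)|exact: bigcupT_measurable|exact: exc_sub_hit].
apply: Pr_bigcup_le => // [N M NM w [n h]|N].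
  by exists (widen_ord NM n).
have hit_le n : (n0 <= n)%N -> Pr (hit (t n) (c * t n.+1 `^ kappa)) <= u n / p0.
  move=> /(leq_trans n10) nn; rewrite ler_pdivlMr// mulrC.
  apply: le_trans (hu n nn).
  apply: le_trans (hit_bound (a n) (ltW (tp n)) (ltW p00) (fun s => hp n s nn)).
  apply: ler_wpM2l; first exact: ltW.
  apply: Pr_le; [exact: measurable_hit|exact: measurable_hit|].
  by move=> w [M _ [j [h1 h2]]]; exists M => //; exists j; split => //; apply: le_lt_trans h2; exact: hab.
pose G (n : 'I_N) := [set w | (n0 <= n)%N /\ hit (t n) (c * t n.+1 `^ kappa) w].
have mG n : measurable (G n) by apply: measurable_and => _; exact: measurable_hit.
apply: (le_trans (Pr_exists_le P mG)).
apply: (@le_trans _ _ (\sum_(n < N | (n0 <= n)%N) u n / p0)).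
  rewrite [leRHS]big_mkcond /=; apply: ler_sum => n _; case: ifPn => hn.
    apply: le_trans (hit_le n hn); apply: Pr_le => //; first exact: measurable_hit.
    by move=> w [].
  rewrite (_ : G n = set0) /Pr ?measure0//; apply/seteqP; split => // w [h _].
  by rewrite h in hn.
rewrite -mulr_suml ler_pdivrMr//; apply: le_trans (hn0 N).
by rewrite big_geq_mkord.
Qed.

(** One time in each neighbourhood of 0 suffices: the zero-one law upgrades a uniform lower bound on
    the probability to certainty. *)
Lemma lower_criterion (c c1 del : R) : cont_in_prob P X -> 0 < del -> c1 < c ->
  (forall m, exists t, [/\ 0 < t, t < dy R m 1 & del <= Pr [set w | c * t `^ kappa < X t w]]) ->
  {ae P, forall w, (c1%:E <= limsup_at0 X kappa w)%E}.
Proof.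
move=> cip del0 cc h; apply: (limsup_ge_as cip del0 cc) => m.
have [t [t0 tm ht]] := h m; apply: (le_trans ht); rewrite -(Pr_sub0_gt HX _ (ltW t0)).
apply: Pr_le_exc => [|w hw]; last by exists t.
by apply: measurable_gt; apply: measurable_funB; apply: mX => //; exact: ltW.
Qed.

(* A second Borel-Cantelli argument for [X_{t_n} - X_{t_{n+1}} >= x_n], kept
   only when [X_{t_{n+1}}] is not too negative. *)
Lemma lower_criterion_series (t x y a : nat -> R) (c c1 p0 : R) n1 : cont_in_prob P X ->
  (forall n, 0 < t n) -> (forall n, t n.+1 <= t n) -> t n @[n --> \oo] --> (0 : R) ->
  0 < p0 -> c1 < c ->
  (forall n, (n1 <= n)%N -> p0 <= Pr [set w | - y n <= X (t n.+1) w]) ->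
  (forall n, (n1 <= n)%N -> a n <= Pr [set w | x n <= X (t n - t n.+1) w]) ->
  (forall n, (n1 <= n)%N -> c * t n `^ kappa < x n - y n) ->
  (forall n0, exists N, 1 <= \sum_(n0 <= n < N) a n) ->
  {ae P, forall w, (c1%:E <= limsup_at0 X kappa w)%E}.
Proof.
move=> cip tp tS t0 p00 cc hp ha hxy hs.
(* With expected number [la >= 1], [la + la^2 <= 2 la^2], and the second moment bound becomes
   [p0^2 / 2]. *)
have del0 : 0 < p0 ^+ 2 / 2 by rewrite divr_gt0// exprn_gt0.
apply: (limsup_ge_as cip del0 cc) => m.
have dm2 : 0 < dy R m 1 / 2 by rewrite divr_gt0// dy_gt0.
have [n2 _ hn2] := near_le t0 dm2.
pose n0 := maxn n1 n2; have [N hN] := hs n0.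
have mono i j : (i <= j)%N -> t j <= t i.
  by elim: j => [|j IH]; [case: i|rewrite leq_eqVlt => /predU1P[->//|/IH]; exact: le_trans].
have tg i : 0 <= t i by exact: ltW.
have n01 i : (n0 <= i)%N -> (n1 <= i)%N by apply: leq_trans; exact: leq_maxl.
pose A (i : 'I_N) := [set w | (n0 <= i)%N /\ x i <= X (t i) w - X (t i.+1) w].
pose B (i : 'I_N) := [set w | - y i <= X (t i.+1) w - X 0 w].
have mr z : measurable ([set u | z <= u] : set (measurableTypeR R)) by exact: measurable_ray_ge.
have mA i : measurable (A i).
  by apply: measurable_and => _; apply: measurable_ge; apply: measurable_funB; exact: mX.
have mB i : measurable (B i).
  by apply: measurable_ge; apply: measurable_funB; exact: mX.
have PA (i : 'I_N) : (n0 <= i)%N -> Pr (A i) = Pr [set w | x i <= X (t i - t i.+1) w].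
  move=> ni; rewrite -(Pr_increment HX (tg i.+1) (tS i) (mr _)); congr Pr.
  by apply/seteqP; split => w /=; [case|].
have A0 (i : 'I_N) : ~~ (n0 <= i)%N -> A i = set0.
  by move=> ni; apply/seteqP; split => // w [h]; rewrite h in ni.
have P0 : Pr set0 = 0 by rewrite /Pr measure0.
have hAA i j : i != j -> Pr (A i `&` A j) <= Pr (A i) * Pr (A j).
  move=> ij; wlog lij : i j ij / (i < j)%N.
    move=> H; case: (ltngtP i j) => [lij|lij|/val_inj/eqP]; [exact: H| |by rewrite (negbTE ij)].
    by rewrite setIC mulrC; apply: H => //; rewrite eq_sym.
  have [ni|ni] := boolP (n0 <= i)%N; last by rewrite (A0 i ni) set0I P0 mul0r.
  have nj : (n0 <= j)%N by rewrite (leq_trans ni)// ltnW.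
  have := @indep3 _ _ _ P X HX _ _ _ _ _ setT _ (tg j.+1) (tS j) (mono _ _ lij) (tS i) (mr (x j)) measurableT (mr (x i)).
  rewrite (_ : [set w | setT (X _ w)] = setT); last by apply/seteqP; split.
  rewrite Pr_setT mulr1 (PA i ni) (PA j nj) mulrC => <-.
  rewrite le_eqVlt; apply/orP; left; apply/eqP; congr Pr.
  apply/seteqP; split => w /=; first by move=> [[_ h1] [_ h2]].
  by move=> [h1 _ h2].
have hAB i : p0 * Pr (A i) <= Pr (A i `&` B i).
  have [ni|ni] := boolP (n0 <= i)%N; last by rewrite (A0 i ni) set0I P0 mulr0.
  have := @indep3 _ _ _ P X HX _ _ _ _ _ _ setT (lexx 0) (tg i.+1) (tS i) (lexx _) (mr (- y i)) (mr (x i)) measurableT.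
  rewrite (_ : [set w | setT (X _ w)] = setT); last by apply/seteqP; split.
  rewrite Pr_setT mulr1 subr0 => e.
  have -> : A i `&` B i = [set w | [/\ - y i <= X (t i.+1) w - X 0 w,
      x i <= X (t i) w - X (t i.+1) w & setT (X (t i) w - X (t i) w)]].
    apply/seteqP; split => w /=; first by move=> [[_ h1] h2].
    by move=> [h1 h2 _].
  by rewrite e (PA i ni) ler_wpM2r ?Pr_ge0// hp// n01.
set la := \sum_i Pr (A i).
have la1 : 1 <= la.
  apply: (le_trans hN); rewrite big_geq_mkord big_mkcond /=; apply: ler_sum => i _.
  by case: ifPn => ni; [rewrite PA// ha// n01|exact: Pr_ge0].
have mU : measurable [set w | exists i, A i w /\ B i w].
  by apply: measurable_exists => i; exact: measurableI.
have h := second_moment (ltW p00) mA mB hAA hAB (erefl la).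
apply: (@le_trans _ _ (Pr [set w | exists i, A i w /\ B i w])); last first.
  apply: Pr_le_exc => // w [i [[ni h1] h2]]; exists (t i); split => //.
    have := hn2 i (leq_trans (leq_maxr _ _) ni); rewrite /= => h3; have := dy_gt0 R m (ltnSn 0); lra.
  by apply: (lt_le_trans (hxy i (n01 _ ni))); move: h1 h2; rewrite /B /=; lra.
rewrite ler_pdivrMr//; have lap : 0 < la by lra.
rewrite -(ler_pM2r (exprn_gt0 2 lap)); apply: (le_trans h); rewrite mulrC -mulrA.
by rewrite ler_wpM2l ?Pr_ge0// mulr_natl mulr2n lerD2r expr2 ler_peMr// ltW.
Qed.

End almost_sure.

Lemma moment_arith (R : realType) (s V C : R) : 0 <= s -> s <= 1 -> 0 <= V -> 0 <= C ->
  s * V + s ^+ 2 * C <= s * (V + C + 1).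
Proof.
move=> s0 s1 V0 C0; rewrite expr2 -mulrA -mulrDr ler_wpM2l// -addrA lerD2l.
have : s * C <= C by rewrite ler_piMl.
lra.
Qed.

Section continuity_in_probability.
Context (R : realType) d (T : measurableType d) (P : probability T R)
  (X : R -> T -> R) (gamma : R) (Pi : {measure set (measurableTypeR R) -> \bar R}).
Hypotheses (HX : levy_process P X) (HPi : levy_measure_on_unit Pi)
  (Htr : has_triplet P X gamma 0 Pi).
Local Notation Pr := (Pr P).

Lemma levy_cont_in_prob : cont_in_prob P X.
Proof.
move=> e eta e0 eta0; set K := V2 Pi + (`|gamma| + V2 Pi) ^+ 2.
have K0 : 0 <= K by rewrite addr_ge0 ?sqr_ge0// V2_ge0.
pose s0 := Order.min 1 (e * eta ^+ 2 / (K + 1)).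
have K1 : 0 < K + 1 by lra.
have eta2 : 0 < eta ^+ 2 by exact: exprn_gt0.
exists s0; split; first by rewrite lt_min ltr01 divr_gt0// mulr_gt0.
move=> s sp; rewrite le_min => /andP[s1 s2].
have mX : measurable_fun setT (X s) by exact: levy_measurable HX s sp.
have mB : measurable ([set x | eta < `|x|] : set (measurableTypeR R)).
  have : measurable_fun setT (fun x : measurableTypeR R => `|x| : R).
    by apply: continuous_measurable_fun; exact: continuous_abs.
  by move=> /(_ measurableT _ (measurable_ray_gt eta)); rewrite setTI.
rewrite (Pr_increment HX (lexx 0) sp mB) subr0.
have mA : measurable [set w | eta < `|X s w|].
  by apply: measurable_gt; apply: measurableT_comp.
have [iX hX] := Ex_sqr_bound HX HPi Htr sp.
have h : eta ^+ 2 * Pr [set w | eta < `|X s w|] <= s * (K + 1).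
  rewrite -(It_indic P mA) -ItZ; last exact: itg_indic.
  apply: (@le_trans _ _ (Ex P X s (fun x => x ^+ 2))).
    apply: It_le => [||w]; [by apply: itgZ; exact: itg_indic|exact: iX|].
    rewrite indicE; case: (boolP (w \in _)) => [|_]; last by rewrite mulr0 sqr_ge0.
    rewrite inE /= mulr1 -[X s w ^+ 2]real_normK ?num_real// => h.
    by rewrite lerXn2r ?nnegrE ?(ltW eta0)// ltW.
  apply: (le_trans hX); exact: (moment_arith sp s1 (V2_ge0 Pi) (sqr_ge0 _)).
rewrite -(ler_pM2l eta2); apply: (le_trans h); move: s2; rewrite ler_pdivlMr//.
by rewrite [eta ^+ 2 * e]mulrC.
Qed.

End continuity_in_probability.

(** * Geometric scales *)

Section levy_measure_scales.
Context (R : realType) (Pi : {measure set (measurableTypeR R) -> \bar R}).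
Hypothesis HPi : levy_measure_on_unit Pi.
Implicit Types (u : R -> R) (b y e : R).

Local Notation IP := (IP Pi).
Local Notation Sn := (Sn Pi).
Local Notation Ln := (Ln Pi).
Local Notation Vn := (Vn Pi).

Definition Tg u b : R := IP (\1_[set x | b < u x]).

Lemma Tn_Tg b : 0 < b -> Tn Pi b = Tg (@ppart R) b.
Proof.
move=> b0; congr (IP (\1_ _)); apply/seteqP; split=> z /=.
  by move=> bz; rewrite ppart_pos// ltW// (lt_trans b0).
by rewrite /ppart; case: (leP 0 z) => // _; move=> /(lt_trans b0); rewrite ltxx.
Qed.

Section generic_part.
Variable u : R -> R.
Hypotheses (cu : continuous u) (ub : forall x, 0 <= u x <= `|x|).

Lemma itg_Tg b : 0 < b -> @itg _ (measurableTypeR R) R Pi (\1_[set x : R | b < u x]).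
Proof.
move=> b0; apply: (itg_Pi HPi (C := b^-1 ^+ 2)) => [|x].
  apply: measurable_indic; have := continuous_measurable_fun cu measurableT (measurable_ray_gt b).
  by rewrite setTI.
rewrite indicE; case: (boolP (x \in _)) => [|_]; last by rewrite normr0 mulr_ge0 ?sqr_ge0.
rewrite inE /= => bx; rewrite normr1 -[x ^+ 2]real_normK ?num_real// -exprMn -[1](expr1n _ 2).
rewrite lerXn2r ?nnegrE ?mulr_ge0 ?invr_ge0 ?(ltW b0)//.
rewrite mulrC ler_pdivlMr// mul1r (le_trans (ltW bx))//.
by case/andP: (ub x).
Qed.

Lemma Tg_ge0 b : 0 <= Tg u b.
Proof. by apply: It_ge0 => x; rewrite indicE. Qed.

Lemma Tg_anti b b' : 0 < b -> b <= b' -> Tg u b' <= Tg u b.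
Proof.
move=> b0 bb; apply: (IP_mono (itg_Tg _) (itg_Tg b0)) => [|x]; first exact: lt_le_trans bb.
rewrite !indicE; case: (boolP (x \in [set x | b' < u x])) => [|_]; last by case: (_ \in _).
by rewrite inE /= => h; rewrite mem_set//= (le_lt_trans bb).
Qed.

Lemma Sn_ge_Tg b : 0 < b -> b ^+ 2 * Tg u b <= Sn u b.
Proof.
move=> b0; rewrite /Tg /IP -ItZ; last exact: itg_Tg.
apply: (IP_mono (itgZ _ (itg_Tg b0)) (itg_sfun HPi cu ub (ltW b0))) => x.
rewrite indicE; case: (boolP (x \in _)) => [|_]; last by rewrite mulr0 sqr_ge0.
by rewrite inE /= mulr1 => h; rewrite /sfun min_r// ltW.
Qed.

(** Raising the truncation level from [b'] to [b] only affects the mass beyond [b']. With [Ln_rec],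
    this feeds the recursions along the scales. *)
Lemma Sn_rec b b' : 0 < b' -> b' <= b -> Sn u b <= b ^+ 2 * Tg u b' + Sn u b'.
Proof.
move=> b0 bb; have b1 : 0 < b by exact: lt_le_trans bb.
have i1 := itg_Tg b0; have i2 := itg_sfun HPi cu ub (ltW b0).
rewrite /Tg /IP -ItZ// /Sn /IP -ItD//; last exact: itgZ.
apply: (IP_mono (itg_sfun HPi cu ub (ltW b1)) (itgD (itgZ _ i1) i2)) => x.
have /andP[u0 _] := ub x; rewrite indicE; case: (boolP (x \in _)) => [_|].
  rewrite mulr1 (@le_trans _ _ (b ^+ 2))//; last by rewrite lerDl sqr_ge0.
  by rewrite /sfun lerXn2r ?nnegrE ?le_min ?u0 ?(ltW b1)//= ge_min lexx orbT.
rewrite notin_setE /= => /negP; rewrite -leNgt => h; rewrite mulr0 add0r /sfun (min_l h).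
by rewrite min_l// (le_trans h).
Qed.

Lemma Ln_rec b b' : 0 < b' -> b' <= b -> Ln u b' <= Ln u b + (b - b') * Tg u b'.
Proof.
move=> b0 bb; have b1 : 0 < b by exact: lt_le_trans bb.
have i1 := itg_Tg b0; have i2 := itg_lfun HPi cu ub b1.
rewrite /Tg /IP -ItZ// /Ln /IP -ItD//; last exact: itgZ.
apply: (IP_mono (itg_lfun HPi cu ub b0) (itgD i2 (itgZ _ i1))) => x.
rewrite indicE; case: (boolP (x \in _)) => [|].
  rewrite inE /= => h; rewrite mulr1 /lfun (@max_r _ _ 0 (u x - b')); last by rewrite subr_ge0 ltW.
  by rewrite -lerBlDr le_max; apply/orP; right; lra.
rewrite notin_setE /= => /negP; rewrite -leNgt => h; rewrite mulr0 addr0 /lfun.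
by rewrite (@max_l _ _ 0 (u x - b')) ?le_max ?lexx// subr_le0.
Qed.

Lemma Sn_small e : 0 < e -> exists2 b0, 0 < b0 & forall b, 0 < b -> b <= b0 -> Sn u b <= e.
Proof.
move=> e0; have [del [d0 _ h]] := small_square HPi e0 ltr01.
have d2 : 0 < 2 * del by lra.
exists (2 * del) => // b b0 bd; apply: le_trans h.
have i1 := itg_sfun HPi cu ub (ltW b0).
have i2 := itg_sfun HPi (@continuous_abs R) (@abs_bound R) (ltW d2).
apply: (IP_mono i1 i2) => x; have /andP[u0 u1] := ub x.
rewrite /sfun lerXn2r ?nnegrE ?le_min ?u0 ?(ltW b0) ?normr_ge0 ?(ltW d2)//=.
by rewrite !ge_min u1 bd orbT.
Qed.

End generic_part.

Lemma Vn_anti y y' : 0 < y -> y <= y' -> Vn y' <= Vn y.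
Proof.
move=> y0 yy; have y1 : 0 < y' by exact: lt_le_trans yy.
apply: (IP_mono (itg_vfun HPi y1) (itg_vfun HPi y0)) => x.
rewrite /vfun le_min !ge_min lexx orbT andbT ler_wpM2l ?sqr_ge0//.
by rewrite lef_pV2.
Qed.

(** With [Vn_anti], this makes [V] regular enough to be sampled at dyadic points. *)
Lemma Vn_half y : 0 < y -> Vn (y / 2) <= 2 * Vn y.
Proof.
move=> y0; have y2 : 0 < y / 2 by rewrite divr_gt0.
rewrite /Vn /IP -ItZ; last exact: itg_vfun.
apply: (IP_mono (itg_vfun HPi y2) (itgZ _ (itg_vfun HPi y0))) => x.
have /andP[n0 _] := npart_bound x.
have e : npart x ^+ 2 / (y / 2) = 2 * (npart x ^+ 2 / y) by field; rewrite gt_eqF.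
rewrite /vfun e; set v := npart x ^+ 2 / y.
have v0 : 0 <= v by rewrite divr_ge0 ?sqr_ge0 ?(ltW y0).
by case: (leP v (npart x)) => h; rewrite ge_min; apply/orP; [left|right; lra].
Qed.

Lemma Tg_npart_le b : 0 < b -> b * Tg (@npart R) b <= Vn b.
Proof.
move=> b0; have i1 := itg_Tg (@continuous_npart R) (@npart_bound R) b0.
rewrite /Tg /IP -ItZ//; apply: (IP_mono (itgZ _ i1) (itg_vfun HPi b0)) => x.
rewrite indicE; case: (boolP (x \in _)) => [|_]; last by rewrite mulr0 vfun_ge0.
rewrite inE /= mulr1 => h; rewrite /vfun le_min (ltW h) andbT ler_pdivlMr// expr2.
by rewrite ler_pM// ltW.
Qed.

End levy_measure_scales.

Section geometric_scales.
Context (R : realType) (Pi : {measure set (measurableTypeR R) -> \bar R}).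
Hypothesis HPi : levy_measure_on_unit Pi.
Variable rho : R.
Hypotheses (rho0 : 0 < rho) (rho1 : rho < 1 / 4).

Definition tscale n : R := rho ^+ n.
Definition bscale n : R := (2 * rho) ^+ n.

Lemma tscale_gt0 n : 0 < tscale n. Proof. exact: exprn_gt0. Qed.
Lemma bscale_gt0 n : 0 < bscale n. Proof. by apply: exprn_gt0; rewrite mulr_gt0. Qed.
Lemma tscaleS n : tscale n.+1 = rho * tscale n. Proof. exact: exprS. Qed.
Lemma bscaleS n : bscale n.+1 = 2 * rho * bscale n. Proof. exact: exprS. Qed.
Lemma bscale_tscale n : bscale n = 2 ^+ n * tscale n. Proof. exact: exprMn. Qed.
Lemma tscaleD n m : tscale (n + m) = tscale n * tscale m. Proof. exact: exprD. Qed.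
Lemma bscaleD n m : bscale (n + m) = bscale n * bscale m. Proof. exact: exprD. Qed.
Lemma tscale_decr n m : (n <= m)%N -> tscale m <= tscale n.
Proof.
have r0 := rho0; have r1 := rho1. by move=> nm; rewrite /tscale ler_wiXn2l// ?(ltW rho0)//; lra. Qed.
Lemma tscale_cvg : tscale n @[n --> \oo] --> (0 : R).
Proof.
have r0 := rho0; have r1 := rho1. by apply: cvg_expr; rewrite gtr0_norm//; lra. Qed.
Lemma bscale_cvg : bscale n @[n --> \oo] --> (0 : R).
Proof.
have r0 := rho0; have r1 := rho1. by apply: cvg_expr; rewrite gtr0_norm ?mulr_gt0//; lra. Qed.
Lemma tscale_le1 n : tscale n <= 1.
Proof.
have r0 := rho0; have r1 := rho1. by rewrite exprn_ile1 ?(ltW rho0)//; lra. Qed.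
Lemma bscale_half n : bscale n.+1 <= bscale n / 2.
Proof.
have r0 := rho0; have r1 := rho1. by rewrite bscaleS; have := bscale_gt0 n; nra. Qed.
Lemma tscale_le_bscale n : tscale n <= bscale n.
Proof. by rewrite bscale_tscale ler_peMl ?(ltW (tscale_gt0 n))// exprn_ege1// ler1n. Qed.

Section generic_part.
Variable u : R -> R.
Hypotheses (cu : continuous u) (ub : forall x, 0 <= u x <= `|x|).

(** Up to time [t_n]: the expected number of jumps beyond [b_n], then the truncated second moment in
    units of [b_n^2] and the mean overshoot in units of [b_n]. *)
Definition jump_mass n : R := tscale n * Tg Pi u (bscale n).
Definition var_ratio n : R := tscale n * Sn Pi u (bscale n) / bscale n ^+ 2.
Definition mean_ratio n : R := tscale n * Ln Pi u (bscale n) / bscale n.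

Lemma jump_mass_ge0 n : 0 <= jump_mass n.
Proof. by rewrite mulr_ge0 ?Tg_ge0 ?(ltW (tscale_gt0 n)). Qed.
Lemma var_ratio_ge0 n : 0 <= var_ratio n.
Proof. by rewrite divr_ge0 ?sqr_ge0// mulr_ge0 ?Sn_ge0 ?(ltW (tscale_gt0 n)). Qed.
Lemma mean_ratio_ge0 n : 0 <= mean_ratio n.
Proof. by rewrite divr_ge0 ?(ltW (bscale_gt0 n))// mulr_ge0 ?Ln_ge0 ?(ltW (tscale_gt0 n)). Qed.

Lemma var_ratioE n : tscale n * Sn Pi u (bscale n) = var_ratio n * bscale n ^+ 2.
Proof. by rewrite /var_ratio divfK// gt_eqF// exprn_gt0// bscale_gt0. Qed.
Lemma mean_ratioE n : tscale n * Ln Pi u (bscale n) = mean_ratio n * bscale n.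
Proof. by rewrite /mean_ratio divfK// gt_eqF// bscale_gt0. Qed.

Lemma bscale_le n : bscale n.+1 <= bscale n.
Proof.
have r0 := rho0; have r1 := rho1. by have := bscale_half n; have := bscale_gt0 n; lra. Qed.

(** [t_n / b_n^2] grows by the factor [1 / (4 rho)] from one scale to the next, so this recursion
    contracts backwards. *)
Lemma var_ratio_rec n : var_ratio n <= jump_mass n.+1 / rho + 4 * rho * var_ratio n.+1.
Proof.
have b0 := bscale_gt0 n; have t0 := tscale_gt0 n.
have h := Sn_rec HPi cu ub (bscale_gt0 n.+1) (bscale_le n).
rewrite {1}/var_ratio ler_pdivrMr ?(exprn_gt0 2 b0)//; apply: (le_trans (ler_wpM2l (ltW t0) h)).
rewrite /var_ratio /jump_mass tscaleS bscaleS le_eqVlt; apply/orP; left; apply/eqP; field.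
by rewrite !gt_eqF.
Qed.

(** [t_n / b_n] is halved from one scale to the next, so this recursion contracts forwards. *)
Lemma mean_ratio_rec n : mean_ratio n.+1 <= mean_ratio n / 2 + jump_mass n.+1 / (2 * rho).
Proof.
have b0 := bscale_gt0 n; have t0 := tscale_gt0 n.
have h := Ln_rec HPi cu ub (bscale_gt0 n.+1) (bscale_le n).
have T0 := Tg_ge0 Pi u (bscale n.+1).
rewrite /mean_ratio ler_pdivrMr ?bscale_gt0//; apply: (le_trans (ler_wpM2l (ltW (tscale_gt0 n.+1)) h)).
apply: (@le_trans _ _ (tscale n.+1 * (Ln Pi u (bscale n) + bscale n * Tg Pi u (bscale n.+1)))).
  rewrite ler_wpM2l ?(ltW (tscale_gt0 n.+1))// lerD2l ler_wpM2r//.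
  by rewrite lerBlDr lerDl ltW// bscale_gt0.
rewrite /jump_mass tscaleS bscaleS le_eqVlt; apply/orP; left; apply/eqP; field.
by rewrite !gt_eqF.
Qed.

(** The backward recursion is iterated to infinity around its fixed point [D]. The remainder
    [(4 rho)^j * var_ratio (n + j)] equals [Sn (b_{n+j}) / (4 rho)^n], which vanishes with
    [b_{n+j}], so no prior bound on [var_ratio] enters. *)
Lemma var_ratio_le n0 K : (forall n, (n0 <= n)%N -> jump_mass n <= K) ->
  forall n, (n0 <= n)%N -> var_ratio n <= K / (rho * (1 - 4 * rho)).
Proof.
have r0 := rho0; have r1 := rho1.
move=> hK n nn; have r4 : 0 < 1 - 4 * rho by lra.
set D := K / _.
have K0 : 0 <= K by apply: le_trans (hK n0 (leqnn _)); exact: jump_mass_ge0.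
have step m : (n0 <= m)%N -> var_ratio m - D <= 4 * rho * (var_ratio m.+1 - D).
  move=> nm; have h := var_ratio_rec m; have hp := hK m.+1 (leqW nm).
  have : jump_mass m.+1 / rho <= K / rho by rewrite ler_wpM2r// invr_ge0 ltW.
  have : K / rho = D * (1 - 4 * rho) by rewrite /D; field; rewrite !gt_eqF.
  lra.
have iter j : var_ratio n - D <= (4 * rho) ^+ j * (var_ratio (n + j)%N - D).
  elim: j => [|j IH]; first by rewrite expr0 mul1r addn0.
  apply: (le_trans IH); rewrite addnS exprSr -mulrA ler_wpM2l//.
    by apply: exprn_ge0; lra.
  by apply: step; rewrite (leq_trans nn)// leq_addr.
rewrite -subr_le0; apply/ler_addgt0Pr => e e0; rewrite add0r.
have D0 : 0 <= D by rewrite divr_ge0// mulr_ge0// ltW.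
have e1 : 0 < e * (4 * rho) ^+ n by rewrite mulr_gt0// exprn_gt0//; lra.
have [b1 b10 hb] := Sn_small HPi cu ub e1.
have [j0 _ hj] := near_le bscale_cvg b10.
apply: (le_trans (iter j0)).
have h := hb _ (bscale_gt0 (n + j0)) _; have {}h : Sn Pi u (bscale (n + j0)) <= e * (4 * rho) ^+ n.
  by apply: h; have := hj (n + j0)%N (leq_addl _ _); rewrite /= add0r.
have -> : var_ratio (n + j0) = Sn Pi u (bscale (n + j0)) / (4 * rho) ^+ (n + j0).
  have e2 : bscale (n + j0) ^+ 2 = (4 * rho) ^+ (n + j0) * tscale (n + j0).
    rewrite /tscale /bscale -exprM mulnC exprM -exprMn; congr (_ ^+ _); ring.
  have q1 : 0 < (4 * rho) ^+ (n + j0) by rewrite exprn_gt0// mulr_gt0.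
  rewrite /var_ratio e2; field; rewrite !gt_eqF//; exact: tscale_gt0.
have p1 : 0 < (4 * rho) ^+ n by apply: exprn_gt0; lra.
have p2 : 0 < (4 * rho) ^+ j0 by apply: exprn_gt0; lra.
have -> : (4 * rho) ^+ j0 * (Sn Pi u (bscale (n + j0)) / (4 * rho) ^+ (n + j0) - D) =
   Sn Pi u (bscale (n + j0)) / (4 * rho) ^+ n - (4 * rho) ^+ j0 * D.
  by rewrite exprD; field; rewrite !gt_eqF.
rewrite lerBlDr (@le_trans _ _ e)//; first by rewrite ler_pdivrMr.
by rewrite lerDl mulr_ge0// ltW.
Qed.

Lemma mean_ratio_le n0 K : (forall n, (n0 <= n)%N -> jump_mass n <= K) ->
  forall j, mean_ratio (n0 + j) <= (1 / 2) ^+ j * mean_ratio n0 + K / rho.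
Proof.
have r0 := rho0; have r1 := rho1.
move=> hK; have K0 : 0 <= K by apply: le_trans (hK n0 (leqnn _)); exact: jump_mass_ge0.
elim=> [|j IH].
  by rewrite addn0 expr0 mul1r lerDl divr_ge0// ltW.
have h := mean_ratio_rec (n0 + j); rewrite addnS; apply: (le_trans h).
have hp : jump_mass (n0 + j).+1 / (2 * rho) <= K / rho / 2.
  rewrite invfM mulrCA [leRHS]mulrC ler_wpM2l// ler_wpM2r ?invr_ge0 ?(ltW rho0)//.
  by apply: hK; rewrite -addnS leq_addr.
rewrite exprS; lra.
Qed.

End generic_part.
End geometric_scales.

Section tail_sums.
Variable R : realType.
Implicit Types (u v s : nat -> R).

(** Summability of a nonnegative sequence in its Cauchy form, which is how [upper_criterion]
    consumes it. *)
Definition tails u := forall e : R, 0 < e -> exists n1, forall n0 N, (n1 <= n0)%N ->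
  \sum_(n0 <= n < N) u n <= e.

Lemma sum_tail_ge0 u n0 N : (forall n, 0 <= u n) -> 0 <= \sum_(n0 <= n < N) u n.
Proof. by move=> u0; apply: sumr_ge0. Qed.

Lemma sum_cat u n0 n1 N : (n0 <= n1)%N -> (n1 <= N)%N ->
  \sum_(n0 <= n < N) u n = \sum_(n0 <= n < n1) u n + \sum_(n1 <= n < N) u n.
Proof. by move=> h1 h2; exact: big_cat_nat. Qed.

Lemma sum_tail_sub u n0 n1 N : (forall n, 0 <= u n) -> (n0 <= n1)%N ->
  \sum_(n1 <= n < N) u n <= \sum_(n0 <= n < N) u n.
Proof.
move=> u0 n01; have [nN|nN] := leqP n1 N; last by rewrite (big_geq (ltnW nN)) sum_tail_ge0.
by rewrite (sum_cat u n01 nN) lerDr sum_tail_ge0.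
Qed.

Lemma sum_tail_widen u n0 N M : (forall n, 0 <= u n) -> (N <= M)%N ->
  \sum_(n0 <= n < N) u n <= \sum_(n0 <= n < M) u n.
Proof.
move=> u0 NM; have [nN|nN] := leqP n0 N; last by rewrite (big_geq (ltnW nN)) sum_tail_ge0.
by rewrite (sum_cat u nN NM) lerDl sum_tail_ge0.
Qed.

Lemma tails_of_bounded u M : (forall n, 0 <= u n) ->
  (forall N, \sum_(0 <= n < N) u n <= M) -> tails u.
Proof.
move=> u0 hM e e0; pose S := [set \sum_(0 <= n < N) u n | N in [set: nat]].
have hs : has_sup S by split; [exists (\sum_(0 <= n < 0) u n); exists 0%N|exists M => _ [N _ <-]].
have [_ [n1 _ <-] hn1] := sup_adherent e0 hs; exists n1 => n0 N n10.
have [nN|nN] := leqP n0 N; last by rewrite (big_geq (ltnW nN)) ltW.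
have h : \sum_(0 <= n < N) u n <= sup S by apply: ub_le_sup; [case: hs|exists N].
have := sum_cat u (leq0n _) nN.
have := sum_tail_widen 0 u0 n10; lra.
Qed.

Lemma tailsD u v : tails u -> tails v -> tails (fun n => u n + v n).
Proof.
move=> tu tv e e0; have e2 : 0 < e / 2 by rewrite divr_gt0.
have [n1 h1] := tu _ e2; have [n2 h2] := tv _ e2; exists (maxn n1 n2) => n0 N.
rewrite geq_max => /andP[k1 k2]; rewrite big_split /=.
have := h1 n0 N k1; have := h2 n0 N k2; lra.
Qed.

Lemma tailsZ c u : 0 < c -> tails u -> tails (fun n => c * u n).
Proof.
move=> c0 tu e e0; have [n1 h1] := tu (e / c) (divr_gt0 e0 c0); exists n1 => n0 N h.
by rewrite -mulr_sumr mulrC -ler_pdivlMr//; exact: h1.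
Qed.

Lemma tails_succ u : tails u -> tails (fun n => u n.+1).
Proof.
move=> tu e e0; have [n1 h1] := tu e e0; exists n1 => n0 N h.
by rewrite -(big_add1 _ _ n0 N.+1 xpredT u); apply: h1; exact: leqW.
Qed.

Lemma tails_small u e : tails u -> 0 < e -> exists n1, forall n, (n1 <= n)%N -> u n <= e.
Proof.
move=> tu e0; have [n1 h] := tu e e0; exists n1 => n nn.
by have := h n n.+1 nn; rewrite big_nat1.
Qed.

(** Summing the recursion bounds [1 - th] times the tail of [s] by the tail of [v] plus a boundary
    term at [M], which is small once [M] is large. *)
Lemma tails_rec v s th : 0 <= th -> th < 1 -> (forall n, 0 <= s n) ->
  (forall n, s n <= v n + th * s n.+1) -> tails v ->
  (forall e, 0 < e -> exists n1, forall n, (n1 <= n)%N -> s n <= e) -> tails s.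
Proof.
move=> th0 th1 s0 hs tv sm e e0; pose d := e * (1 - th) / 2.
have d0 : 0 < d by rewrite divr_gt0// mulr_gt0// subr_gt0.
have [n1 h1] := tv d d0; have [n2 h2] := sm d d0; exists n1 => n0 N nn.
pose M := maxn (maxn N n2) n0.
have NM : (N <= M)%N by rewrite /M !leq_max leqnn.
have n2M : (n2 <= M)%N by rewrite /M !leq_max leqnn orbT.
have n0M : (n0 <= M)%N by rewrite /M leq_max leqnn orbT.
apply: (le_trans (sum_tail_widen n0 s0 NM)); set Sg := \sum_(_ <= _ < _) _.
have k1 : Sg <= \sum_(n0 <= n < M) v n + th * \sum_(n0 <= n < M) s n.+1.
  by rewrite mulr_sumr -big_split /=; apply: ler_sum => n _; exact: hs.
have k2 : \sum_(n0 <= n < M) s n.+1 <= Sg + s M.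
  rewrite -(big_add1 _ _ n0 M.+1 xpredT s).
  apply: (le_trans (sum_tail_sub M.+1 s0 (leqnSn n0))).
  by rewrite big_nat_recr.
have k3 := h1 n0 M nn; have k4 := h2 M n2M.
have k5 : th * \sum_(n0 <= n < M) s n.+1 <= th * Sg + d.
  apply: (le_trans (ler_wpM2l th0 k2)); rewrite mulrDr lerD2l.
  by apply: le_trans k4; rewrite ler_piMl ?s0// ltW.
have : Sg * (1 - th) <= e * (1 - th) by rewrite /d in k3 k5 *; lra.
by rewrite ler_pM2r// subr_gt0.
Qed.

Definition diverges u := forall M, exists N, M <= \sum_(0 <= n < N) u n.

Lemma diverges_tail u n0 : (forall n, 0 <= u n) -> diverges u ->
  exists N, 1 <= \sum_(n0 <= n < N) u n.
Proof.
move=> u0 du; have [N hN] := du (1 + \sum_(0 <= n < n0) u n).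
have hM := sum_tail_widen 0 u0 (leq_maxl N n0); exists (maxn N n0).
have := sum_cat u (leq0n _) (leq_maxr N n0); lra.
Qed.

End tail_sums.

(** The slack is [z / 30 + sg] with [z = t V]. The condition [60 * 30 * y <= z] is exactly
    [2 y z <= (z / 30)^2]. *)
Lemma drift_arith (R : realType) (t y sg z V B : R) : 0 <= t -> 0 < y -> 0 <= sg -> 0 < z ->
  60 * 30 * y <= z -> t * B <= sg ^+ 2 -> z = t * V ->
  4 * y <= z / 30 + sg /\ t * (2 * y * V + B) <= (z / 30 + sg) ^+ 2.
Proof.
move=> t0 y0 sg0 z0 hz hs zE; split; first by lra.
rewrite mulrDr (_ : t * (2 * y * V) = 2 * y * z); last by rewrite zE; ring.
have h1 : 2 * y * z <= (z / 30) * (z / 30).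
  rewrite (_ : z / 30 * (z / 30) = z / (30 * 30) * z); last by field.
  by rewrite ler_wpM2r ?(ltW z0)//; lra.
have : 0 <= z * sg by rewrite mulr_ge0// ltW.
rewrite sqrrD -[(z / 30) ^+ 2]/(z / 30 * (z / 30)) mulr2n; lra.
Qed.

Lemma drift_arith2 (R : realType) (g t z S L s V : R) : t * V = z ->
  t * g + z / 3 + S - L - 5 * s <= t * g + t / 2 * V + S - L - 5 * (z / 30 + s).
Proof. by move=> e; rewrite (_ : t / 2 * V = z / 2); [lra|rewrite -e; ring]. Qed.

Lemma low_arith (R : realType) (t y sg V B : R) : 0 < y -> 0 < sg ->
  y <= sg / 40 -> t * V <= 60 * 30 * y -> t * B <= sg ^+ 2 ->
  t * (2 * y * V + B) <= (2 * sg) ^+ 2.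
Proof.
move=> y0 sg0 hy hV hs; rewrite mulrDr (_ : t * (2 * y * V) = 2 * y * (t * V)); last by ring.
have : 2 * y * (t * V) <= 2 * y * (60 * 30 * y) by rewrite ler_wpM2l//; lra.
have : y * y <= sg / 40 * (sg / 40) by apply: ler_pM => //; exact: ltW.
rewrite exprMn -[sg ^+ 2]/(sg * sg) in hs *; rewrite -[2 ^+ 2]/(2 * 2).
have := mulr_gt0 sg0 sg0; lra.
Qed.

Section deviations.
Context (R : realType) d (T : measurableType d) (P : probability T R)
  (X : R -> T -> R) (gamma : R) (Pi : {measure set (measurableTypeR R) -> \bar R}).
Hypotheses (HX : levy_process P X) (HPi : levy_measure_on_unit Pi)
  (Htr : has_triplet P X gamma 0 Pi).
Local Notation Pr := (Pr P).
Local Notation Vn := (Vn Pi).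
Local Notation Sp := (Sn Pi (@ppart R)).
Local Notation Lp := (Ln Pi (@ppart R)).
Let mX s : 0 <= s -> measurable_fun setT (X s) := @levy_measurable _ _ _ _ _ HX s.

Lemma Pr_ge_mono t a b : 0 <= t -> a <= b -> Pr [set w | b <= X t w] <= Pr [set w | a <= X t w].
Proof.
move=> t0 ab; have mXt := mX t0; apply: Pr_le; [exact: measurable_ge|exact: measurable_ge|].
by move=> w /=; exact: le_trans.
Qed.

(* Kept as a product, here and in [80 * 30] below, because numerals of a ring
   unfold to iterated sums. *)
Definition U1 : R := 60 * 30.

Lemma U1E : U1 = 60 * 30. Proof. by []. Qed.
Lemma U1_gt0 : 0 < U1. Proof. by rewrite mulr_gt0. Qed.

(** The slack [z / 30 + sg] in [lower_bound] costs [5 s = z / 6 + 5 sg], which leaves [z / 3] of the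
    gain [z / 2]. *)
Lemma drift_bound t y b ze sg : 0 <= t -> 0 < y -> 0 < b -> 0 <= ze -> 0 <= sg ->
  U1 * y <= t * Vn y -> t * ((1 + ze * b) * Sp b) <= sg ^+ 2 ->
  1 / 4 * expR (- (t * (Vn y / y + ze ^+ 2 * Sp b))) <=
  Pr [set w | t * gamma + t * Vn y / 3 + ze / 2 * t * Sp b - t * Lp b - 5 * sg <= X t w].
Proof.
move=> t0 y0 b0 ze0 sg0 hz hs; set z := t * Vn y in hz *.
have z0 : 0 < z by apply: lt_le_trans hz; rewrite mulr_gt0// U1_gt0.
have hz' : 60 * 30 * y <= z by [].
have [h4 h5] := drift_arith t0 y0 sg0 z0 hz' hs (erefl z).
apply: (le_trans (lower_bound HX HPi Htr t0 y0 b0 ze0 h4 h5)); apply: Pr_ge_mono => //.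
exact: drift_arith2.
Qed.

(* [delta0] bounds the probability of not being pushed down by the negative
   jumps: the scale [y] is tuned so that [t * Vn y / y] is of order 1. *)
Definition delta0 : R := 1 / 4 * expR (- (4 * U1)).

Lemma delta0_gt0 : 0 < delta0.
Proof. by rewrite mulr_gt0 ?expR_gt0// divr_gt0. Qed.

Lemma delta0_le A z : A <= 4 * U1 + z -> delta0 * expR (- z) <= 1 / 4 * expR (- A).
Proof.
move=> h; have e : expR (- (4 * U1)) * expR (- z) = expR (- (4 * U1 + z)) by rewrite -expRD opprD.
by rewrite /delta0 -(mulrA (1 / 4)) e; apply: ler_wpM2l; [rewrite divr_ge0|rewrite ler_expR lerN2].
Qed.

(** Take the largest dyadic [y] with [U1 y <= t V(y)]. It is not 1, and failure at [2 y] gives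
    [t V(y) <= 4 U1 y] by [Vn_half]: the tilt costs a constant. If there is no such [y], then
    [t V(y) / y < U1] for all dyadic [y], and one that is small compared to [sg] is used. *)
Lemma low_deviation t b ze sg : 0 <= t -> t * Vn 1 < U1 -> 0 < b -> 0 <= ze -> 0 < sg ->
  t * ((1 + ze * b) * Sp b) <= sg ^+ 2 ->
  delta0 * expR (- (ze ^+ 2 * (t * Sp b))) <=
  Pr [set w | t * gamma + ze / 2 * t * Sp b - t * Lp b - 10 * sg <= X t w].
Proof.
move=> t0 tV b0 ze0 sg0 hs.
have y_gt0 k : (0 : R) < 2^-1 ^+ k by exact: exprn_gt0.
have yS k : (2^-1 ^+ k.+1 : R) = 2^-1 ^+ k / 2 by rewrite exprS mulrC.
have [[k hk]|hn] := pselect (exists k : nat, U1 * 2^-1 ^+ k <= t * Vn (2^-1 ^+ k)).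
  pose Q k := U1 * 2^-1 ^+ k <= t * Vn (2^-1 ^+ k).
  have exQ : exists k, Q k by exists k.
  case: (ex_minnP exQ) => -[|m] Qm minm.
    by move: Qm; rewrite /Q expr0 mulr1 leNgt tV.
  have Qm' : t * Vn (2^-1 ^+ m) < U1 * 2^-1 ^+ m.
    by rewrite ltNge; apply/negP => /minm; rewrite ltnn.
  have y0 := y_gt0 m.+1; set y : R := 2^-1 ^+ m.+1 in y0 *.
  have VV : t * Vn y <= 4 * U1 * y.
    have h := ler_wpM2l t0 (Vn_half HPi (y_gt0 m)); rewrite -yS -/y in h.
    have e : 2^-1 ^+ m = 2 * y by rewrite /y yS mulrC divfK.
    rewrite {}e in Qm' h; lra.
  apply: le_trans (le_trans (drift_bound t0 y0 b0 ze0 (ltW sg0) Qm hs) _).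
    apply: delta0_le; rewrite mulrDr [t * (ze ^+ 2 * _)]mulrCA lerD2r.
    by rewrite mulrA ler_pdivrMr.
  apply: Pr_ge_mono => //.
  have : 0 <= t * Vn y by rewrite mulr_ge0// Vn_ge0.
  lra.
have [k hk] : exists k, 2^-1 ^+ k <= sg / 40.
  have h : 2^-1 ^+ n @[n --> \oo] --> (0 : R) by apply: cvg_expr; rewrite ger0_norm; lra.
  have sg4 : 0 < sg / 40 by rewrite divr_gt0.
  have [M _ hM] := near_le h sg4; exists M.
  by have := hM M (leqnn M); rewrite /= add0r.
have y0 := y_gt0 k; set y : R := 2^-1 ^+ k in y0 hk *.
have tVy : t * Vn y <= U1 * y.
  by apply/ltW; rewrite ltNge; apply/negP => h; apply: hn; exists k.
have h4 : 4 * y <= 2 * sg by lra.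
have h5 : t * (2 * y * Vn y + (1 + ze * b) * Sp b) <= (2 * sg) ^+ 2.
  exact: low_arith.
apply: le_trans (le_trans (lower_bound HX HPi Htr t0 y0 b0 ze0 h4 h5) _).
  apply: delta0_le; rewrite mulrDr [t * (ze ^+ 2 * _)]mulrCA lerD2r.
  rewrite mulrA ler_pdivrMr//; apply: (le_trans tVy); rewrite ler_wpM2r ?(ltW y0)//.
  by rewrite ler_peMl ?(ltW U1_gt0)// ler1n.
apply: Pr_ge_mono => //.
have : 0 <= t / 2 * Vn y by rewrite mulr_ge0 ?divr_ge0// Vn_ge0.
lra.
Qed.

End deviations.

(** * Almost sure bounds along the scales *)

Section limsup_estimates.
Context (R : realType) d (T : measurableType d) (P : probability T R)
  (X : R -> T -> R) (gamma : R) (Pi : {measure set (measurableTypeR R) -> \bar R}).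
Hypotheses (HX : levy_process P X) (HPi : levy_measure_on_unit Pi)
  (Htr : has_triplet P X gamma 0 Pi).
Variables (kappa rho : R).
Hypotheses (k0 : 0 < kappa) (rho0 : 0 < rho) (rho1 : rho < 1 / 4).
Hypothesis hk : forall n, tscale rho n `^ kappa = bscale rho n.

Local Notation Pr := (Pr P).
Local Notation Vn := (Vn Pi).
Local Notation tt := (tscale rho).
Local Notation bb := (bscale rho).
Local Notation pp := (jump_mass Pi rho).
Local Notation sig := (var_ratio Pi rho).
Local Notation ell := (mean_ratio Pi rho).
Local Notation Sp := (Sn Pi (@ppart R)).
Local Notation Lp := (Ln Pi (@ppart R)).
Local Notation cp := (@continuous_ppart R).
Local Notation bp := (@ppart_bound R).
Local Notation cn := (@continuous_npart R).
Local Notation bn := (@npart_bound R).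
Let mX s : 0 <= s -> measurable_fun setT (X s) := @levy_measurable _ _ _ _ _ HX s.
Let cip : cont_in_prob P X := levy_cont_in_prob HX HPi Htr.
Let tp n : 0 < tt n := tscale_gt0 rho0 n.
Let bpos n : 0 < bb n := bscale_gt0 rho0 n.

(** The drift, the truncated positive jumps and their overshoot act at scale [n] by at most a
    multiple of [c b_n]; the last condition is the one under which [low_deviation] applies. *)
Definition good c n := [/\ sig (@ppart R) n <= c ^+ 2, ell (@ppart R) n <= c,
  `|gamma| * tt n <= c * bb n & tt n * Vn 1 < U1 R].

Lemma eventually_expn (c K : R) : 0 < c -> exists n0, forall n, (n0 <= n)%N -> (1 / 2) ^+ n * K <= c.
Proof.
move=> c0; have h : (1 / 2) ^+ n @[n --> \oo] --> (0 : R) by apply: cvg_expr; rewrite ger0_norm; lra.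
have K1 : 0 < `|K| + 1 by have := normr_ge0 K; lra.
have [n0 _ hn] := near_le h (divr_gt0 c0 K1); exists n0 => n nn.
have := hn n nn; rewrite /= add0r ler_pdivlMr// => h1; apply: le_trans h1.
by rewrite ler_wpM2l ?exprn_ge0//; have := ler_norm K; lra.
Qed.

Lemma eventually_drift c : 0 < c -> exists n0, forall n, (n0 <= n)%N ->
  `|gamma| * tt n <= c * bb n /\ tt n * Vn 1 < U1 R.
Proof.
move=> c0; have [n1 h1] := eventually_expn `|gamma| c0.
have V1 : 0 < Vn 1 + 1 by have := Vn_ge0 Pi (@ltr01 R); lra.
have [n2 _ h2] := near_le (tscale_cvg rho0 rho1) (divr_gt0 (U1_gt0 R) V1).
exists (maxn n1 n2) => n; rewrite geq_max => /andP[k1 k2]; split.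
  rewrite bscale_tscale mulrA ler_pM2r//; have p2 : (0 : R) < 2 ^+ n by exact: exprn_gt0.
  by have := h1 n k1; rewrite div1r exprVn mulrC ler_pdivrMr.
have := h2 n k2; rewrite /= add0r ler_pdivlMr//; apply: lt_le_trans.
by rewrite ltr_pM2l// ltrDl.
Qed.

Lemma good_bounded n0 K : (forall n, (n0 <= n)%N -> pp (@ppart R) n <= K) ->
  exists2 c, 0 < c & exists n1, forall n, (n1 <= n)%N -> good c n.
Proof.
move=> hK; have h1 := var_ratio_le HPi rho0 rho1 cp bp hK.
have h2 := mean_ratio_le HPi rho0 rho1 cp bp hK.
have K0 : 0 <= K by apply: le_trans (hK n0 (leqnn _)); exact: jump_mass_ge0.
set A := K / (rho * (1 - 4 * rho)) in h1.
have r1 := rho1; have r0 := rho0.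
have A0 : 0 <= A by rewrite divr_ge0// mulr_ge0//; lra.
have B0 : 0 <= K / rho by rewrite divr_ge0// ltW.
have e0 := mean_ratio_ge0 Pi rho0 (@ppart R) n0.
pose c := 1 + A + ell (@ppart R) n0 + K / rho; have c0 : 0 < c by rewrite /c; lra.
exists c => //; have [n1 hn1] := eventually_drift c0.
exists (maxn n0 n1) => n; rewrite geq_max => /andP[k0' k1]; have [d1 d2] := hn1 n k1.
split => //.
  apply: (le_trans (h1 n k0')); rewrite expr2.
  apply: (@le_trans _ _ c); first by rewrite /c; lra.
  by rewrite ler_peMr// ?(ltW c0)// /c; lra.
have := h2 (n - n0)%N; rewrite subnKC// => h; apply: (le_trans h).
have : (1 / 2) ^+ (n - n0) * ell (@ppart R) n0 <= ell (@ppart R) n0.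
  by rewrite ler_piMl// exprn_ile1//; lra.
rewrite /c; lra.
Qed.

Lemma small_ratio (u : R -> R) e : continuous u -> (forall x, 0 <= u x <= `|x|) -> tails (pp u) -> 0 < e ->
  exists n1, forall n, (n1 <= n)%N -> sig u n <= e /\ ell u n <= e.
Proof.
move=> cu ub tpu e0; have r1 := rho1; have r0 := rho0.
pose K := e / 2 * (rho * (1 - 4 * rho)); have r4 : 0 < rho * (1 - 4 * rho).
  by rewrite mulr_gt0//; lra.
have K0 : 0 < K by rewrite mulr_gt0// divr_gt0.
have [n0 hK] := tails_small tpu K0.
have h1 := var_ratio_le HPi rho0 rho1 cu ub hK; have h2 := mean_ratio_le HPi rho0 rho1 cu ub hK.
have e20 : 0 < e / 2 by rewrite divr_gt0.
have [m hm] := eventually_expn (ell u n0) e20.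
exists (n0 + m)%N => n nn; have nn0 : (n0 <= n)%N by rewrite (leq_trans _ nn)// leq_addr.
split.
  by apply: (le_trans (h1 n nn0)); rewrite /K mulfK ?gt_eqF//; lra.
have := h2 (n - n0)%N; rewrite subnKC// => h; apply: (le_trans h).
have h3 := hm (n - n0)%N (_ : (m <= n - n0)%N).
have h4 : K / rho <= e / 2.
  rewrite ler_pdivrMr// /K ler_wpM2l ?(ltW e20)// ler_piMr ?(ltW rho0)//; lra.
rewrite leq_subRL// in h3; have := h3 nn; lra.
Qed.

Lemma good_small c : tails (pp (@ppart R)) -> 0 < c ->
  exists n1, forall n, (n1 <= n)%N -> good c n.
Proof.
move=> tpp c0; have c2 : 0 < Order.min c (c ^+ 2) by rewrite lt_min c0 exprn_gt0.
have [n1 h1] := small_ratio cp bp tpp c2; have [n2 h2] := eventually_drift c0.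
exists (maxn n1 n2) => n; rewrite geq_max => /andP[k1 k2].
have [] := h1 n k1; rewrite !le_min => /andP[_ a1] /andP[a2 _]; have [a3 a4] := h2 n k2.
by split.
Qed.

Lemma good_terms c n s : 0 < c -> good c n -> 0 <= s -> s <= tt n ->
  [/\ s * Sp (bb n) <= (c * bb n) ^+ 2, s * Lp (bb n) <= c * bb n &
      - (c * bb n) <= s * gamma].
Proof.
move=> c0 [g1 g2 g3 _] s0 st; split.
- apply: (@le_trans _ _ (tt n * Sp (bb n))); first by rewrite ler_wpM2r// Sn_ge0.
  by rewrite var_ratioE// exprMn ler_wpM2r ?sqr_ge0.
- apply: (@le_trans _ _ (tt n * Lp (bb n))); first by rewrite ler_wpM2r// Ln_ge0.
  by rewrite mean_ratioE// ler_wpM2r// ltW.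
rewrite lerNl; apply: le_trans g3; rewrite -mulrN mulrC.
apply: (@le_trans _ _ (`|gamma| * s)); last by rewrite ler_wpM2l.
by rewrite ler_wpM2r// -normrN ler_norm.
Qed.

(** [12 = 10 + 1 + 1]: ten from [low_deviation] with [sg = c b_n], one for the drift, one for the
    overshoot. *)
Lemma low_prob c n s : 0 < c -> good c n -> 0 <= s -> s <= tt n ->
  delta0 R <= Pr [set w | - (12 * c * bb n) <= X s w].
Proof.
move=> c0 g s0 st; have [h1 h2 h3] := good_terms c0 g s0 st.
have cb : 0 < c * bb n by rewrite mulr_gt0.
have sV : s * Vn 1 < U1 R.
  by case: g => _ _ _; apply: le_lt_trans; rewrite ler_wpM2r// Vn_ge0.
have h4 : s * ((1 + 0 * bb n) * Sp (bb n)) <= (c * bb n) ^+ 2 by rewrite mul0r addr0 mul1r.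
have := low_deviation HX HPi Htr s0 sV (bpos n) (lexx 0) cb h4.
rewrite expr0n mul0r oppr0 expR0 mulr1 !mul0r addr0 => h; apply: (le_trans h).
apply: (Pr_ge_mono HX) => //; lra.
Qed.

(** [7 = 5 + 1 + 1], with the same three losses but [drift_bound] in place of [low_deviation]. *)
Lemma drift_prob c n s y : 0 < c -> good c n -> 0 <= s -> s <= tt n -> 0 < y ->
  U1 R * y <= s * Vn y ->
  1 / 4 * expR (- (s * Vn y / y)) <= Pr [set w | s * Vn y / 3 - 7 * c * bb n <= X s w].
Proof.
move=> c0 g s0 st y0 hy; have [h1 h2 h3] := good_terms c0 g s0 st.
have cb : 0 <= c * bb n by rewrite mulr_ge0// ltW.
have h4 : s * ((1 + 0 * bb n) * Sp (bb n)) <= (c * bb n) ^+ 2 by rewrite mul0r addr0 mul1r.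
have h := drift_bound HX HPi Htr s0 y0 (bpos n) (lexx 0) cb hy h4.
have e : s * (Vn y / y + 0 ^+ 2 * Sp (bb n)) = s * Vn y / y by rewrite expr0n /= mul0r addr0 mulrA.
rewrite e in h; apply: (le_trans h); apply: (Pr_ge_mono HX) => //.
rewrite (_ : 0 / 2 * s * Sp (bb n) = 0); last by rewrite !mul0r.
lra.
Qed.

(** Jumps of size [b_n] are looked for in the later time block [n + j], where they exceed a
    prescribed multiple of [b_{n+j}]; the price is the factor [mu]. *)
Lemma shift_bound j : exists2 mu, 0 < mu & forall n, mu * pp (@ppart R) n <=
  (tt (n + j) - tt (n + j).+1) * Tg Pi (@ppart R) (bb n).
Proof.
have r1 := rho1; have r0 := rho0.
exists ((1 - rho) * rho ^+ j); first by rewrite mulr_gt0 ?exprn_gt0//; lra.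
move=> n; rewrite tscaleS tscaleD /pp le_eqVlt; apply/orP; left; apply/eqP.
by rewrite -[rho ^+ j]/(tt j); ring.
Qed.

(** Bounded jump masses keep the compensation of order [b_n], so jumps beyond [3 E b_n] survive with
    probabilities comparable to the shifted masses, whose sum diverges. *)
Lemma limsup_large_jumps K D : (forall n, pp (@ppart R) n <= K) -> diverges (pp (@ppart R)) ->
  {ae P, forall w, (D%:E <= limsup_at0 X kappa w)%E}.
Proof.
move=> hK dv; have r1 := rho1; have r0 := rho0.
have [c c0 [n1 hg]] := good_bounded (fun n (_ : (0 <= n)%N) => hK n).
(* [E / 2 >= 12 c] is what [jump_bound] asks through [low_prob], and [E] still exceeds [D + 1] after
   the loss [12 c b_{n+1} <= 6 c b_n]. *)
pose E := `|D| + 24 * c + 2; have E0 : 0 < E by rewrite /E; have := normr_ge0 D; lra.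
(* Since [(4 rho)^j <= 1], this makes [b_{n-j}] at least [3 E b_n]. *)
have [j hj] : exists j, 3 * E <= 2 ^+ j.
  have [j hj] := eventually_expn (3 * E) (@ltr01 R); exists j.
  have := hj j (leqnn j); have p2 : (0 : R) < 2 ^+ j by exact: exprn_gt0.
  by rewrite div1r exprVn mulrC ler_pdivrMr// mul1r.
have [mu mu0 hmu] := shift_bound j.
have K0 : 0 <= K by apply: le_trans (hK 0%N); exact: jump_mass_ge0.
pose C := delta0 R ^+ 4 * mu / (1 + mu * K).
have MK : 0 < 1 + mu * K by rewrite ltr_pwDl// mulr_ge0// ltW.
have C0 : 0 < C by rewrite divr_gt0// mulr_gt0// exprn_gt0// delta0_gt0.
pose a n := if (n < j)%N then 0 else C * pp (@ppart R) (n - j).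
have a0 n : 0 <= a n by rewrite /a; case: ifP => // _; rewrite mulr_ge0 ?jump_mass_ge0// ltW.
have da : diverges a.
  move=> M; have [N hN] := dv (M / C); exists (N + j)%N.
  rewrite (sum_cat a (leq0n j) (leq_addl _ _)) big_nat big1 ?add0r; last first.
    by move=> n /andP[_ nj]; rewrite /a nj.
  rewrite -{1}[j]add0n big_addn addnK.
  rewrite (eq_bigr (fun n => C * pp (@ppart R) n)); last first.
    by move=> n _; rewrite /a ltnNge leq_addl /= addnK.
  by rewrite -mulr_sumr mulrC -ler_pdivrMr.
have ratio_arith (p x y la Q : R) : 0 <= p -> 0 <= x -> x <= y -> 0 <= Q -> x <= la ->
    p * la <= (1 + la) * Q -> p * x / (1 + y) <= Q.
  move=> p0 x0 xy Q0 xl h; rewrite ler_pdivrMr; last by lra.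
  apply: (@le_trans _ _ (Q * (1 + x))); last by rewrite ler_wpM2l// lerD2l.
  have [pQ|pQ] := leP p Q.
    by apply: ler_pM => //; lra.
  have : x * (p - Q) <= la * (p - Q) by apply: ler_wpM2r; lra.
  lra.
apply: (@lower_criterion_series _ _ _ P X HX kappa (ltW k0) tt (fun n => E * bb n)
  (fun n => 12 * c * bb n.+1) a (D + 1) D (delta0 R) n1) => //.
- by move=> n; apply: tscale_decr.
- exact: tscale_cvg.
- exact: delta0_gt0.
- lra.
- by move=> n nn; apply: low_prob => //; [apply: hg; exact: leqW|exact: ltW].
- move=> n nn; rewrite /a; case: ifPn => [_|]; first exact: Pr_ge0.
  rewrite -leqNgt => jn.
  have t' : 0 < tt n - tt n.+1 by rewrite subr_gt0 tscaleS gtr_pMl//; lra.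
  have Eb : 0 < E * bb n by rewrite mulr_gt0.
  have low s : 0 <= s -> s <= tt n - tt n.+1 -> delta0 R <= Pr [set w | - (E * bb n / 2) <= X s w].
    move=> s0 st; apply: le_trans (low_prob c0 (hg n nn) s0 _) _.
      by apply: (le_trans st); rewrite gerBl ltW.
    apply: (Pr_ge_mono HX) => //; rewrite lerN2 [leRHS]mulrAC ler_pM2r// /E.
    by have := normr_ge0 D; lra.
  have := jump_bound HX HPi Htr t' Eb (ltW (delta0_gt0 R)) low.
  have T0 : 0 <= Tn Pi (3 * (E * bb n)) by rewrite Tn_Tg ?Tg_ge0// mulr_gt0.
  set la := _ * Tn _ _; set Q := Pr _ => hQ.
  have lam : mu * pp (@ppart R) (n - j) <= la.
    have := hmu (n - j)%N; rewrite subnK// => h; apply: (le_trans h).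
    rewrite /la Tn_Tg; last by rewrite mulr_gt0.
    rewrite ler_wpM2l ?(ltW t')//; apply: (Tg_anti HPi cp bp); first by rewrite mulr_gt0.
    have e4 : (4 * rho) ^+ j <= 1 by apply: exprn_ile1; lra.
    have e5 : (4 * rho) ^+ j = 2 ^+ j * bb j.
      by rewrite -exprMn; congr (_ ^+ _); ring.
    have e6 : bb n = bb (n - j) * bb j by rewrite -bscaleD subnK.
    rewrite e6 (_ : 3 * _ = bb (n - j) * (3 * E * bb j)); last by ring.
    rewrite ler_piMr ?(ltW (bpos _))//; apply: le_trans e4; rewrite e5.
    by rewrite ler_pM2r.
  rewrite /C (_ : _ * pp _ _ = delta0 R ^+ 4 * (mu * pp (@ppart R) (n - j)) / (1 + mu * K)); last by ring.
  apply: (ratio_arith _ _ _ _ _ _ _ _ (Pr_ge0 _ _) lam hQ) => //.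
  - exact: exprn_ge0 (ltW (delta0_gt0 R)).
  - by rewrite mulr_ge0 ?jump_mass_ge0// ltW.
  - by rewrite ler_wpM2l// ltW.
- move=> n nn; rewrite hk; have b2 := bscale_half rho0 rho1 n; have b0 := bpos n.
  have k1 : D * bb n <= `|D| * bb n by rewrite ler_wpM2r ?ler_norm// ltW.
  have k2 : c * bb n.+1 <= c * (bb n / 2) by rewrite ler_wpM2l// ltW.
  have k3 : 0 < c * bb n by rewrite mulr_gt0.
  rewrite /E; lra.
- by move=> n0; exact: diverges_tail.
Qed.

(** Let [n] be the first index whose jump mass [p] exceeds a large [K], and take the shorter time
    [s = t_n / p], by which one jump beyond [b_n] is expected. The positive jumps truncated at [b_n]
    then have second moment [r^2 >= b_n^2]; tilting them with [ze = M / r] gains [M r / 2] at the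
    fixed cost [M^2]. As [p] is large, [c s^kappa < b_n]; minimality of [n] bounds the overshoot
    term. *)
Lemma limsup_unbounded_jumps D : (forall K, exists n, K < pp (@ppart R) n) ->
  {ae P, forall w, (D%:E <= limsup_at0 X kappa w)%E}.
Proof.
move=> unb; pose c := `|D| + 1; have c0 : 0 < c by rewrite /c; have := normr_ge0 D; lra.
have Dc : D < c by rewrite /c; have := ler_norm D; lra.
have r0 := rho0; have ri : 0 < rho^-1 by rewrite invr_gt0.
(* [N^2 = 1 + M] makes [sg = N r] admissible. The gain [M r / 2] has to beat [10 N r] and the
   overshoot [(1 + 1 / rho) b_n], whence 40 and [1 / rho]. *)
pose N := 40 + rho^-1; pose M := N ^+ 2 - 1.
have [N40 M0] : 40 <= N /\ 0 <= M.
  by split; [rewrite /N; lra|rewrite /M expr2 /N; nra].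
pose del := delta0 R * expR (- M ^+ 2).
have del0 : 0 < del by rewrite mulr_gt0 ?expR_gt0 ?delta0_gt0.
apply: (lower_criterion HX (ltW k0) cip del0 Dc) => m.
have V0 : 0 <= Vn 1 by exact: Vn_ge0.
have l0 := mean_ratio_ge0 Pi rho0 (@ppart R) 0%N.
have ck0 : 0 <= c `^ kappa^-1 by exact: powR_ge0.
have p2 : (0 : R) < 2 ^+ m by exact: exprn_gt0.
(* One summand for each requirement: the drift, the condition on [Vn 1], the initial overshoot,
   [c s^kappa < b_n] and [s < 2^-m]. *)
pose K := 1 + `|gamma| + Vn 1 + ell (@ppart R) 0 + c `^ kappa^-1 + 2 ^+ m.
have g0 := normr_ge0 gamma.
case: (ex_minnP (unb K)) => n Kn minn.
set p := pp (@ppart R) n in Kn.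
have p0 : 0 < p by apply: lt_trans Kn; rewrite /K; lra.
have rec j : (j <= n)%N -> pp (@ppart R) j <= p.
  rewrite leq_eqVlt => /predU1P[->//|jn]; rewrite leNgt; apply/negP => h.
  by have := minn j (lt_trans Kn h); rewrite leqNgt jn.
have ellb j : (j <= n)%N -> ell (@ppart R) j <= ell (@ppart R) 0 + p / rho.
  elim: j => [_|j IH jn]; first by rewrite lerDl divr_ge0// ltW.
  have h1 := mean_ratio_rec HPi rho0 rho1 cp bp j; have h2 := IH (ltnW jn).
  have h3 : pp (@ppart R) j.+1 / (2 * rho) <= p / rho / 2.
    by rewrite invfM mulrCA [leRHS]mulrC ler_wpM2l// ler_wpM2r ?(ltW ri)// rec.
  lra.
pose s := tt n / p; have s0 : 0 < s by rewrite divr_gt0.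
have sp : s * p = tt n by rewrite /s divfK// gt_eqF.
have sK : s * K <= tt n by rewrite -sp ler_wpM2l// ltW.
have sKb x : 0 <= x -> x <= K -> s * x <= tt n.
  by move=> x0 xK; apply: le_trans sK; rewrite ler_wpM2l// ltW.
have t1 := tscale_le1 rho0 rho1 n.
set b := bb n; have b0 : 0 < b := bpos n.
have tb : tt n <= b by exact: tscale_le_bscale.
have s_lt : s < dy R m 1.
  have : s * (2 ^+ m) < 1.
    by apply: (@lt_le_trans _ _ (s * K)); [rewrite ltr_pM2l// /K; lra|exact: le_trans sK t1].
  by rewrite /dy -ltr_pdivlMr.
exists s; split => //; set v := s * Sp b.
have hv : b ^+ 2 <= v.
  have h := Sn_ge_Tg HPi cp bp b0; have := ler_wpM2l (ltW s0) h; apply: le_trans.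
  have -> : s * (b ^+ 2 * Tg Pi (@ppart R) b) = b ^+ 2 * (tt n * Tg Pi (@ppart R) b / p).
    by rewrite /s; ring.
  by rewrite -/(pp _ n) -/p divff ?mulr1// gt_eqF.
have v0 : 0 < v by apply: lt_le_trans hv; exact: exprn_gt0.
pose r := Num.sqrt v; have r2 : r ^+ 2 = v by rewrite sqr_sqrtr// ltW.
have rp : 0 < r by rewrite sqrtr_gt0.
have br : b <= r by rewrite -(@ler_pXn2r _ 2) ?nnegrE ?r2 ?(ltW b0) ?(ltW rp).
have ze0 : 0 <= M / r by rewrite divr_ge0// ltW.
have sg0 : 0 < N * r by rewrite mulr_gt0//; lra.
have sV : s * Vn 1 < U1 R.
  apply: (@le_lt_trans _ _ 1); last by rewrite U1E; lra.
  by apply: le_trans t1; apply: sKb => //; rewrite /K; lra.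
have hs : s * ((1 + M / r * b) * Sp b) <= (N * r) ^+ 2.
  rewrite mulrCA -/v exprMn r2 ler_wpM2r ?(ltW v0)//.
  have : M / r * b <= M by rewrite mulrAC ler_pdivrMr// ler_wpM2l.
  rewrite /M; lra.
have h := low_deviation HX HPi Htr (ltW s0) sV b0 ze0 sg0 hs.
rewrite -/v in h.
have e1 : (M / r) ^+ 2 * v = M ^+ 2.
  by rewrite expr_div_n r2 divfK// gt_eqF.
rewrite e1 in h; apply: (le_trans h).
have mXs := mX (ltW s0); apply: Pr_le; [exact: measurable_ge|exact: measurable_gt|].
move=> w /=; apply: lt_le_trans.
have e2 : M / r / 2 * s * Sp b = M * r / 2.
  rewrite -[X in X = _]mulrA -/v -r2; field; by rewrite gt_eqF.
rewrite e2.
have sg : - b <= s * gamma.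
  have h1 : s * `|gamma| <= tt n by apply: sKb => //; rewrite /K; lra.
  have h2 : s * - gamma <= s * `|gamma| by rewrite ler_wpM2l ?(ltW s0)// -normrN ler_norm.
  lra.
have sL : s * Lp b <= (1 + rho^-1) * b.
  have e3 : s * Lp b = ell (@ppart R) n * b / p.
    by rewrite -mean_ratioE// /s; ring.
  rewrite e3 mulrAC ler_wpM2r ?(ltW b0)// ler_pdivrMr//.
  apply: (le_trans (ellb n (leqnn n))); rewrite mulrDl mul1r [rho^-1 * p]mulrC lerD2r ltW//.
  by apply: le_lt_trans Kn; rewrite /K; lra.
have hb : c * s `^ kappa < b.
  have cp' : c < p `^ kappa.
    have h1 : c `^ kappa^-1 < p by apply: le_lt_trans Kn; rewrite /K; lra.
    have q1 : c `^ kappa^-1 \is Num.nneg by rewrite nnegrE.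
    have q2 : p \is Num.nneg by rewrite nnegrE ltW.
    by have := gt0_ltr_powR k0 q1 q2 h1; rewrite -powRrM mulVf ?gt_eqF// powRr1 ?(ltW c0).
  have e4 : b = p `^ kappa * s `^ kappa.
    by rewrite /b -hk -sp mulrC powRM ?(ltW s0) ?(ltW p0).
  by rewrite e4 ltr_pM2r// powR_gt0.
have k1 : rho^-1 * b <= rho^-1 * r by rewrite ler_wpM2l ?(ltW ri).
have k2 : 40 * r <= N * r by rewrite ler_wpM2r ?(ltW rp).
have k3 : 40 * (N * r) <= N * (N * r) by rewrite ler_wpM2r// ?(ltW sg0).
have k4 : M * r = N * (N * r) - r by rewrite /M; ring.
have k5 : N * r = 40 * r + rho^-1 * r by rewrite /N mulrDl.
rewrite k4; lra.
Qed.

Lemma tails_var_ratio (u : R -> R) : continuous u -> (forall x, 0 <= u x <= `|x|) -> tails (pp u) ->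
  tails (sig u).
Proof.
move=> cu ub tpu; have r0 := rho0; have r1 := rho1.
have tv : tails (fun n => rho^-1 * pp u n.+1).
  by apply: tailsZ; [rewrite invr_gt0|exact: tails_succ].
apply: (@tails_rec _ _ (sig u) (4 * rho) _ _ _ _ tv); [lra|lra|by move=> n; exact: var_ratio_ge0| |].
  by move=> n; rewrite [rho^-1 * _]mulrC; exact: var_ratio_rec.
move=> e e0; have [n1 h] := small_ratio cu ub tpu e0.
by exists n1 => n nn; have [] := h n nn.
Qed.

Lemma tail_half n : tt n * Tn Pi (bb n / 2) <= rho^-1 * pp (@ppart R) n.+1.
Proof.
have b2 : 0 < bb n / 2 by rewrite divr_gt0.
rewrite Tn_Tg// /pp tscaleS !mulrA mulVf ?mul1r ?gt_eqF// ler_wpM2l ?(ltW (tp n))//.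
by apply: (Tg_anti HPi cp bp) => //; exact: bscale_half.
Qed.

(** The bound of [upper_bound2] is summable here, because summability of the jump masses passes to
    [var_ratio] for both parts. *)
Lemma limsup_null_upper c : tails (pp (@ppart R)) -> tails (pp (@npart R)) -> 0 < c ->
  {ae P, forall w, (limsup_at0 X kappa w <= c%:E)%E}.
Proof.
move=> tpp tpn c0; have r0 := rho0; pose eps := c * rho / 7.
have e0 : 0 < eps by rewrite divr_gt0// mulr_gt0.
have e20 : 0 < eps / 2 by rewrite divr_gt0.
have [n1 g1] := good_small tpp e20.
have [n2 g2] := small_ratio cn bn tpn e20.
pose u n := rho^-1 * pp (@ppart R) n.+1 + 4 / eps ^+ 2 * (sig (@ppart R) n + sig (@npart R) n).
have tu : tails u.
  apply: tailsD; first by apply: tailsZ; [rewrite invr_gt0|exact: tails_succ].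
  apply: tailsZ; first by rewrite divr_gt0// exprn_gt0.
  by apply: tailsD; [exact: tails_var_ratio cp bp tpp|exact: tails_var_ratio cn bn tpn].
apply: (@upper_criterion _ _ _ P X HX kappa (ltW k0) tt (fun n => 2 * eps * bb n)
  (fun n => 12 * (eps / 2) * bb n) u c (delta0 R) (maxn n1 n2)) => //.
- exact: tscale_cvg.
- exact: ltW.
- exact: delta0_gt0.
- move=> n s; rewrite geq_max => /andP[h1 _] s0 st.
  by apply: (low_prob e20 (g1 n h1)).
- move=> n; rewrite geq_max => /andP[h1 h2]; have b0 := bpos n.
  have eb : 0 < eps * bb n by rewrite mulr_gt0.
  have := upper_bound2 HX HPi Htr (ltW (tp n)) eb b0; set Q := Pr _ => hQ.
  apply: (@le_trans _ _ Q).
    have mXn := mX (ltW (tp n)); apply: Pr_le; [exact: measurable_gt|exact: measurable_gt|].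
    move=> w /=; apply: le_lt_trans.
    have [_ _ k3 _] := g1 n h1; have [_ k4] := g2 n h2.
    have k5 : tt n * Ln Pi (@npart R) (bb n) <= eps / 2 * bb n.
      by rewrite mean_ratioE// ler_wpM2r ?(ltW b0).
    have k6 : tt n * gamma <= `|gamma| * tt n by rewrite mulrC ler_wpM2r ?ler_norm ?(ltW (tp n)).
    lra.
  apply: (le_trans hQ); apply: lerD; first exact: tail_half.
  rewrite mulrDr !var_ratioE// -mulrDl le_eqVlt; apply/orP; left; apply/eqP; field.
  by rewrite !gt_eqF.
- move=> n _; rewrite hk bscaleS /eps; have := mulr_gt0 (mulr_gt0 c0 r0) (bpos n); lra.
- move=> e ee; have [n0 h] := tu e ee; exists (maxn n0 (maxn n1 n2)); first exact: leq_maxr.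
  by move=> N; apply: h; exact: leq_maxl.
Qed.

(** The lower half of a zero limsup: with probability at least [delta0] the process falls by no more
    than a small multiple of [b_n], even if negative jumps are numerous. *)
Lemma limsup_ge_neg c : tails (pp (@ppart R)) -> 0 < c ->
  {ae P, forall w, ((- c)%:E <= limsup_at0 X kappa w)%E}.
Proof.
move=> tpp c0; have c4 : 0 < c / 48 by rewrite divr_gt0.
have [n1 g1] := good_small tpp c4.
have cc : - c < - (c / 2) by lra.
apply: (lower_criterion HX (ltW k0) cip (delta0_gt0 R) cc) => m.
have dm : 0 < dy R m 1 / 2 by rewrite divr_gt0// dy_gt0.
have [n2 _ h2] := near_le (tscale_cvg rho0 rho1) dm.
pose n := maxn n1 n2; exists (tt n); split => //.
  by have := h2 n (leq_maxr _ _); rewrite /= add0r => h; have := dy_gt0 R m (ltnSn 0); lra.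
apply: le_trans (low_prob c4 (g1 n (leq_maxl _ _)) (ltW (tp n)) (lexx _)) _.
have mXn := mX (ltW (tp n)); apply: Pr_le; [exact: measurable_ge|exact: measurable_gt|].
move=> w /=; apply: lt_le_trans; rewrite hk; have := mulr_gt0 c0 (bpos n); lra.
Qed.

Local Notation yy k := (2^-1 ^+ k : R).
Let yy0 k : 0 < yy k. Proof. exact: exprn_gt0. Qed.
Let yyS k : yy k.+1 = yy k / 2. Proof. by rewrite exprS mulrC. Qed.
Let yyV k : (yy k)^-1 = 2 ^+ k. Proof. by rewrite exprVn invrK. Qed.
Let Vmono j k : (j <= k)%N -> Vn (yy j) <= Vn (yy k).
Proof.
by move=> jk; apply: (Vn_anti HPi) => //; apply: ler_wiXn2l => //; rewrite invf_le1// ler1n.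
Qed.

(* With [k n] the last [k] such that [V_k <= A 2^n], the choice
   [theta = 1 / y_{k n}] makes the exponential term in [upper_bound] at most
   [exp (- A b_n / y_{k n})], and [k] is strictly increasing. *)
Lemma limsup_le_series (A : R) (h : nat -> R) : tails (pp (@ppart R)) ->
  (forall M, exists k, M < Vn (yy k)) -> 0 < A ->
  (forall k n, Vn (yy k) <= A * 2 ^+ n -> A * 2 ^+ n <= 2 * Vn (yy k) ->
     h k <= A * bb n * 2 ^+ k) ->
  tails (fun k => expR (- h k)) ->
  {ae P, forall w, (limsup_at0 X kappa w <= (3 * A / rho)%:E)%E}.
Proof.
move=> tpp Vunb A0 hh th; have r0 := rho0.
have [n2 hn2] : exists n2, forall n, (n2 <= n)%N -> Vn (yy 0) <= A * 2 ^+ n.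
  have [n2 h2] := eventually_expn (Vn (yy 0)) A0; exists n2 => n nn.
  have := h2 n nn; have p2 : (0 : R) < 2 ^+ n by exact: exprn_gt0.
  by rewrite div1r exprVn mulrC ler_pdivrMr.
have exk n : exists k, (n2 <= n)%N -> Vn (yy k) <= A * 2 ^+ n /\ A * 2 ^+ n < Vn (yy k.+1).
  have [nn|nn] := leqP n2 n; last by exists 0%N.
  case: (ex_minnP (Vunb (A * 2 ^+ n))) => -[|k] hk1 kmin.
    by have := hn2 n nn; rewrite leNgt hk1.
  exists k => _; split => //; rewrite leNgt; apply/negP => hk2.
  by have := kmin k hk2; rewrite ltnn.
have [k hkn] := choice exk.
(* From [y_j] to [y_{j+1}], [V] at most doubles, as the threshold does from [n] to [n + 1]. Hence
   distinct [n] give distinct [k], and a sum over [n] is part of a sum over [k]. *)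
have kS n : (n2 <= n)%N -> (k n < k n.+1)%N.
  move=> nn; have [a1 a2] := hkn n nn; have [b1 b2] := hkn n.+1 (leqW nn).
  rewrite ltnNge; apply/negP => kk.
  have h1 : Vn (yy (k n.+1).+1) <= Vn (yy (k n).+1) by apply: Vmono.
  have h2 : Vn (yy (k n).+1) <= 2 * Vn (yy (k n)) by rewrite yyS; exact: Vn_half.
  have e : (2 : R) ^+ n.+1 = 2 * 2 ^+ n by exact: exprS.
  move: b2; rewrite ltNge => /negP; apply; rewrite e mulrCA; apply: (le_trans h1); apply: (le_trans h2).
  by rewrite ler_wpM2l.
have kge n : (n2 <= n)%N -> (n - n2 <= k n)%N.
  move=> nn; rewrite -{2}(subnK nn); elim: (n - n2)%N => // m IH.
  by apply: (leq_ltn_trans IH); rewrite addSn; apply: kS; rewrite leq_addl.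
pose g n := expR (- (A * bb n * 2 ^+ k n)).
have gh n : (n2 <= n)%N -> g n <= expR (- h (k n)).
  move=> nn; have [a1 a2] := hkn n nn; rewrite ler_expR lerN2; apply: hh => //.
  by apply: (le_trans (ltW a2)); rewrite yyS; exact: Vn_half.
have sum_le n0 N : (n2 <= n0)%N -> (n0 <= N)%N ->
    \sum_(n0 <= n < N) g n <= \sum_(k n0 <= j < k N) expR (- h j).
  move=> nn; elim: N => [|N IH]; first by rewrite leqn0 => /eqP ->; rewrite !big_geq.
  rewrite leq_eqVlt => /predU1P[<-|]; first by rewrite !big_geq.
  rewrite ltnS => n0N; rewrite big_nat_recr//=.
  have kN := kS N (leq_trans nn n0N).
  have k0N : (k n0 <= k N)%N.
    elim: N n0N {IH kN} => [|N IH]; first by rewrite leqn0 => /eqP ->.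
    rewrite leq_eqVlt => /predU1P[->//|]; rewrite ltnS => n0N.
    by apply: (leq_trans (IH n0N)); apply: ltnW; apply: kS; exact: leq_trans n0N.
  rewrite (sum_cat (fun j => expR (- h j)) k0N (ltnW kN)); apply: lerD; first exact: IH.
  rewrite big_ltn//; apply: (le_trans (gh N (leq_trans nn n0N))).
  by rewrite lerDl; apply: sumr_ge0 => j _; exact: expR_ge0.
have tg : tails g.
  move=> e e0; have [k1 hk1] := th e e0; exists (n2 + k1)%N => n0 N nn.
  have nn2 : (n2 <= n0)%N by rewrite (leq_trans _ nn)// leq_addr.
  have [n0N|n0N] := leqP n0 N; last by rewrite big_geq ?ltW// ltnW.
  apply: (le_trans (sum_le n0 N nn2 n0N)); apply: hk1.
  by apply: leq_trans (kge n0 nn2); rewrite leq_subRL.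
(* Ottaviani's loss becomes [12 (A / 12) b_n = A b_n]; with the threshold [5 A b_n] the total is
   [6 A b_n = (3 A / rho) b_{n+1}]. *)
have A12 : 0 < A / 12 by rewrite divr_gt0.
have [n1 g1] := good_small tpp A12.
pose u n := rho^-1 * pp (@ppart R) n.+1 + 2 * g n + 4 / A ^+ 2 * sig (@ppart R) n.
have tu : tails u.
  apply: tailsD; last by apply: tailsZ; [rewrite divr_gt0// exprn_gt0|exact: tails_var_ratio cp bp tpp].
  apply: tailsD; last exact: tailsZ.
  by apply: tailsZ; [rewrite invr_gt0|exact: tails_succ].
apply: (@upper_criterion _ _ _ P X HX kappa (ltW k0) tt (fun n => 5 * A * bb n)
  (fun n => 12 * (A / 12) * bb n) u _ (delta0 R) (maxn n1 n2)) => //.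
- exact: tscale_cvg.
- by rewrite divr_ge0// ?(ltW r0)// mulr_ge0// ltW.
- exact: delta0_gt0.
- move=> n s; rewrite geq_max => /andP[h1 _] s0 st.
  by apply: (low_prob A12 (g1 n h1)).
- move=> n; rewrite geq_max => /andP[h1 h2]; have b0 := bpos n.
  have Ab : 0 < A * bb n by rewrite mulr_gt0.
  have p2 : (0 : R) < 2 ^+ k n by exact: exprn_gt0.
  have := upper_bound HX HPi Htr (4 * A * bb n) (ltW (tp n)) p2 b0 Ab.
  rewrite (_ : 4 * A * bb n + A * bb n = 5 * A * bb n); last by ring.
  move=> hQ; apply: (le_trans hQ); rewrite -exprVn; apply: lerD; first apply: lerD.
  + exact: tail_half.
  (* In units of [A b_n 2^k], the drift contributes 1, the term [2 t V] contributes 2, and the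
     threshold [- 4]: in total [- 1]. *)
  + rewrite ler_wpM2l// ler_expR.
    have [_ _ k3 _] := g1 n h1; have [k4 _] := hkn n h2.
    have k5 : tt n * Vn (yy (k n)) <= A * bb n.
      by rewrite bscale_tscale mulrA [leRHS]mulrC ler_wpM2l ?(ltW (tp n)).
    have k6 : tt n * gamma <= A * bb n.
      apply: (@le_trans _ _ (`|gamma| * tt n)); last by apply: (le_trans k3); lra.
      by rewrite mulrC ler_wpM2r ?ler_norm ?(ltW (tp n)).
    have k7 := ler_wpM2r (ltW p2) k5; have k8 := ler_wpM2r (ltW p2) k6; lra.
  + rewrite var_ratioE// le_eqVlt; apply/orP; left; apply/eqP; field.
    by rewrite !gt_eqF.
- move=> n _; rewrite hk bscaleS le_eqVlt; apply/orP; left; apply/eqP; field.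
  by rewrite gt_eqF.
- move=> e ee; have [n0 hn0] := tu e ee; exists (maxn n0 (maxn n1 n2)); first exact: leq_maxr.
  by move=> N; apply: hn0; exact: leq_maxl.
Qed.

(** * Lower bounds from the dyadic thresholds of [V] *)

Section thresholds.
Variables (A c1 : R) (k1 : nat) (n_ : nat -> nat).
Hypotheses (A0 : 0 < A) (cA : c1 < A / 6).
Hypothesis tpp : tails (pp (@ppart R)).
Hypothesis nk : forall k, (k1 <= k)%N -> A * 2 ^+ n_ k <= Vn (yy k) /\ Vn (yy k) < A * (2 * 2 ^+ n_ k).

Let eps := A / 200.
Let eps0 : 0 < eps. Proof. by rewrite divr_gt0. Qed.

Lemma threshold_mono k k' : (k1 <= k)%N -> (k <= k')%N -> (n_ k <= n_ k')%N.
Proof.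
move=> kk kk'; rewrite leqNgt; apply/negP => h.
have [a1 _] := nk kk; have [_ b2] := nk (leq_trans kk kk').
have := Vmono kk'; apply/negP; rewrite -ltNge; apply: (lt_le_trans b2); apply: le_trans a1.
by rewrite ler_wpM2l ?(ltW A0)// -exprS ler_weXn2l// ler1n.
Qed.

(* If [A b_n / y_k] stays bounded along a subsequence, a smaller index [m]
   makes [t_m V_k / y_k] of order one, with [t_m V_k >= A b_m]. *)
Lemma limsup_lower_bounded : (forall K, exists2 k, (K <= k)%N & A * bb (n_ k) * 2 ^+ k < 80 * 30) ->
  {ae P, forall w, (c1%:E <= limsup_at0 X kappa w)%E}.
Proof.
(* Twice the bound on [A b_n 2^k], so that [t_n W < U2] at [n = n_ k] and the index [M] below is
   smaller than [n_ k]. *)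
move=> hinf; have r0 := rho0; pose U2 : R := 160 * 30.
have U20 : 0 < U2 by rewrite mulr_gt0.
have UU : U1 R <= U2 by rewrite U1E /U2; lra.
have [n1 g1] := good_small tpp eps0.
pose del := 1 / 4 * expR (- (U2 / rho)).
have del0 : 0 < del by rewrite mulr_gt0 ?expR_gt0.
apply: (lower_criterion HX (ltW k0) cip del0 cA) => m.
pose q := Order.min (tt n1) (dy R m 1); have q0 : 0 < q by rewrite lt_min tp dy_gt0.
pose Z := U2 / rho / q + U2; have Z0 : 0 < Z by rewrite addr_gt0// !divr_gt0.
have [K hK] := eventually_expn Z A0.
have [k kk hk1] := hinf (maxn k1 K); move: kk; rewrite geq_max => /andP[kk kK].
have [a1 a2] := nk kk; set V := Vn (yy k) in a1 a2 *; pose W := 2 ^+ k * V.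
have p2 : (0 : R) < 2 ^+ k by exact: exprn_gt0.
have pn : (1 : R) <= 2 ^+ n_ k by rewrite exprn_ege1// ler1n.
have AV : A <= V by apply: le_trans a1; rewrite ler_peMr// ltW.
have ZW : Z <= W.
  have := hK k kK; rewrite div1r exprVn mulrC ler_pdivrMr// => h; apply: (le_trans h).
  by rewrite mulrC ler_wpM2l// ltW.
have W0 : 0 < W by exact: lt_le_trans ZW.
(* The last [M] with [t_M W >= U2]. One step later the inequality fails, so [t_M W < U2 / rho],
   which bounds the cost. *)
have [M MU Mmin] : exists2 M, tt M.+1 * W < U2 & U2 <= tt M * W.
  have UW : 0 < U2 / W / 2 by rewrite !divr_gt0.
  have [M0 _ hM0] := near_le (tscale_cvg rho0 rho1) UW.
  have exM : exists M, tt M.+1 * W < U2.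
    exists M0; have := hM0 M0.+1 (leqnSn _); rewrite /= add0r => h.
    have := ler_wpM2r (ltW W0) h; rewrite (_ : U2 / W / 2 * W = U2 / 2); last by field; rewrite gt_eqF.
    by move=> h'; apply: (le_lt_trans h'); rewrite ltr_pdivrMr// ltr_pMr// ltr1n.
  case: (ex_minnP exM) => -[|M] hM Mmin; [exists 0%N => //|exists M.+1 => //].
    by rewrite /tt expr0 mul1r (le_trans _ ZW)// /Z lerDr !divr_ge0// ltW.
  by rewrite leNgt; apply/negP => /Mmin; rewrite ltnn.
have MW : tt M * W < U2 / rho.
  by rewrite ltr_pdivlMr// mulrC mulrA -tscaleS.
have ttq : tt M < q.
  rewrite -(ltr_pM2r W0); apply: (lt_le_trans MW).
  have : q * Z <= q * W by rewrite ler_wpM2l// ltW.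
  have e : q * (U2 / rho / q) = U2 / rho by field; rewrite !gt_eqF.
  have := mulr_gt0 q0 U20; rewrite /Z mulrDr e; lra.
move: ttq; rewrite lt_min => /andP[tn td].
have nM : (n1 <= M)%N.
  by rewrite leqNgt; apply/negP => h; move: tn; rewrite ltNge tscale_decr// ltnW.
have Mn : (M < n_ k)%N.
  rewrite ltnNge; apply/negP => h; have := tscale_decr rho0 rho1 h => h1.
  have h2 := ler_wpM2r (ltW W0) h1.
  have h3 : tt (n_ k) * W <= 2 * (A * bb (n_ k) * 2 ^+ k).
    rewrite /W bscale_tscale (_ : 2 * _ = tt (n_ k) * (2 ^+ k * (A * (2 * 2 ^+ n_ k)))); last by ring.
    by rewrite !ler_wpM2l// ?(ltW p2) ?(ltW (tp _)) ?(ltW a2).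
  move: (le_trans Mmin (le_trans h2 h3)); rewrite /U2; lra.
have AM : A * 2 ^+ M <= V.
  apply: le_trans a1; rewrite ler_wpM2l ?(ltW A0)// ler_weXn2l ?ler1n//; exact: ltnW.
have y0 := yy0 k; have eW : tt M * V / yy k = tt M * W by rewrite yyV /W; ring.
exists (tt M); split => //.
have hy : U1 R * yy k <= tt M * V.
  by rewrite -ler_pdivlMr// eW (le_trans UU).
have := drift_prob eps0 (g1 M nM) (ltW (tp M)) (lexx _) y0 hy.
rewrite -/V eW => h; apply: le_trans (le_trans h _).
  by rewrite /del ler_wpM2l ?divr_ge0// ler_expR lerN2 ltW.
have mXM := mX (ltW (tp M)); apply: Pr_le; [exact: measurable_ge|exact: measurable_gt|].
move=> w /=; apply: lt_le_trans; rewrite hk.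
have b0 := bpos M; have hb : A * bb M <= tt M * V.
  by rewrite bscale_tscale mulrA mulrC ler_wpM2l// ltW.
have := mulr_gt0 A0 b0; rewrite /eps; lra.
Qed.

(** A move of order [A b_n] in block [n = n_ k] has probability at least [g k / 4]. When [k] and
    [k + 1] share the same [n], [g (k + 1) = g k ^ 2 <= g k / 2], so a group sums to at most twice
    its first term and divergence over [k] becomes divergence over [n]. *)
Lemma limsup_lower_unbounded (h : nat -> R) (K : nat) : (k1 <= K)%N ->
  (forall k, (K <= k)%N -> 80 * 30 <= A * bb (n_ k) * 2 ^+ k) ->
  (forall N, exists k, (k1 <= k)%N /\ (N <= n_ k)%N) ->
  (forall k, (K <= k)%N -> 2 * (A * bb (n_ k) * 2 ^+ k) <= h k) ->
  diverges (fun k => expR (- h k)) ->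
  {ae P, forall w, (c1%:E <= limsup_at0 X kappa w)%E}.
Proof.
move=> kK hlow hunb hh dv; have r0 := rho0; have r1 := rho1.
have [n1 g1] := good_small tpp eps0.
pose x n := A / 5 * bb n; pose a n := Pr [set w | x n <= X (tt n - tt n.+1) w].
have t' n : 0 < tt n - tt n.+1 by rewrite subr_gt0 tscaleS gtr_pMl//; lra.
have a0 n : 0 <= a n by exact: Pr_ge0.
pose v k := A * bb (n_ k) * 2 ^+ k; pose g k := expR (- (2 * v k)).
have [k2 [K2 nk2]] : exists k2, (K <= k2)%N /\ forall k, (k2 <= k)%N -> (n1 <= n_ k)%N.
  have [k3 [h3 h4]] := hunb n1; exists (maxn K k3); split; first exact: leq_maxl.
  move=> k; rewrite geq_max => /andP[_ hk3]; apply: (leq_trans h4); exact: threshold_mono.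
have kk k : (k2 <= k)%N -> (k1 <= k)%N by move=> hk2; rewrite (leq_trans kK)// (leq_trans K2).
have ag k : (k2 <= k)%N -> g k <= 4 * a (n_ k).
  move=> hk2; have [a1 a2] := nk (kk k hk2); have hv := hlow k (leq_trans K2 hk2).
  set n := n_ k in a1 a2 hv *; set V := Vn (yy k) in a1 a2 *.
  have y0 := yy0 k; have p2 : (0 : R) < 2 ^+ k by exact: exprn_gt0.
  set s := tt n - tt n.+1; have s0 : 0 < s by exact: t'.
  have sE : s = (1 - rho) * tt n by rewrite /s tscaleS; ring.
  have AV : A * bb n <= tt n * V.
    by rewrite bscale_tscale mulrA mulrC ler_wpM2l// ltW.
  (* A block has length [(1 - rho) t_n >= 3 t_n / 4], and [3/4 * 80 = 60] yields the condition with
     [U1]. *)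
  have sV : 3 / 4 * (A * bb n) <= s * V.
    rewrite sE -[leRHS]mulrA; apply: (@le_trans _ _ (3 / 4 * (tt n * V))); first by rewrite ler_wpM2l.
    by apply: ler_wpM2r; [apply: le_trans AV; rewrite mulr_ge0 ?ltW|lra].
  have e : s * V / yy k = s * V * 2 ^+ k by rewrite yyV.
  have hy : U1 R * yy k <= s * V.
    rewrite -ler_pdivlMr// e U1E; have := ler_wpM2r (ltW p2) sV; lra.
  have st : s <= tt n by rewrite /s gerBl ltW.
  have := drift_prob eps0 (g1 n (nk2 k hk2)) (ltW s0) st y0 hy.
  rewrite -/V e => h1.
  have h2 : Pr [set w | s * V / 3 - 7 * eps * bb n <= X s w] <= a n.
    apply: (Pr_ge_mono HX); first exact: ltW.
    by rewrite /x /eps; have := mulr_gt0 A0 (bpos n); lra.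
  have h3 : g k <= expR (- (s * V * 2 ^+ k)).
    rewrite ler_expR lerN2 /v -/n mulrA ler_wpM2r ?(ltW p2)//.
    apply: (@le_trans _ _ (tt n * V)); first by rewrite ler_wpM2r// (le_trans (ltW A0))// (le_trans _ a1)// ler_peMr ?(ltW A0)// exprn_ege1// ler1n.
    by rewrite bscale_tscale (_ : 2 * _ = tt n * (A * (2 * 2 ^+ n))); [rewrite ler_wpM2l ?ltW|ring].
  have := le_trans h1 h2; lra.
have gS k : (k2 <= k)%N -> n_ k.+1 = n_ k -> 2 * g k.+1 <= g k.
  move=> hk2 e; have hv := hlow k (leq_trans K2 hk2); rewrite -/(v k) in hv.
  have vE : v k.+1 = 2 * v k by rewrite /v e exprS; ring.
  have gE : g k.+1 = g k * g k by rewrite /g -expRD vE; congr expR; ring.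
  have g12 : 2 * g k <= 1.
    have := expR_ge1Dx (2 * v k); rewrite /g expRN => h1.
    by rewrite ler_pdivrMr ?expR_gt0// mul1r; apply: le_trans h1; lra.
  by rewrite gE mulrA ler_piMl// expR_ge0.
(* The extra [g (k2 + j)] on the left is a reserve: it pays for the next term and the next reserve
   when [n_] does not change. *)
have main j : \sum_(k2 <= k < (k2 + j).+1) g k + g (k2 + j)%N <=
    8 * \sum_(0 <= n < (n_ (k2 + j)%N).+1) a n.
  elim: j => [|j IH].
    rewrite addn0 big_nat1; have := ag k2 (leqnn _).
    by have := sum_cat a (leq0n (n_ k2)) (leqnSn _); rewrite big_nat1 => ->; have := sum_tail_ge0 0 (n_ k2) a0; lra.
  rewrite addnS big_nat_recr /=; last by rewrite (leq_trans (leq_addr j k2))// leqnSn.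
  have kj : (k2 <= k2 + j)%N by exact: leq_addr.
  have := threshold_mono (kk _ kj) (leqnSn _); rewrite leq_eqVlt => /predU1P[e|lt].
    have := gS _ kj (esym e); rewrite -e; lra.
  have lt' : ((n_ (k2 + j)%N).+1 <= n_ (k2 + j).+1)%N by [].
  have w1 := sum_tail_widen 0 a0 lt'.
  have := ag (k2 + j).+1 (leq_trans kj (leqnSn _)).
  have := sum_cat a (leq0n (n_ (k2 + j).+1)) (leqnSn _); rewrite big_nat1.
  have := expR_ge0 (- (2 * v (k2 + j)%N)); rewrite -/(g _); lra.
have da : diverges a.
  move=> M; have [N hN] := dv (8 * M + \sum_(0 <= k < k2) expR (- h k)).
  have e0 k : 0 <= expR (- h k) by exact: expR_ge0.
  pose j := (N - k2)%N; exists (n_ (k2 + j)%N).+1.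
  have Nj : (N <= (k2 + j).+1)%N by rewrite leqW// -leq_subLR.
  have h1 := sum_tail_widen 0 e0 Nj.
  have h2 := sum_cat (fun k => expR (- h k)) (leq0n k2) (leq_trans (leq_addr j k2) (leqnSn _)).
  have h3 : \sum_(k2 <= k < (k2 + j).+1) expR (- h k) <= \sum_(k2 <= k < (k2 + j).+1) g k.
    apply: ler_sum_nat => k /andP[hk2 _]; rewrite ler_expR lerN2; apply: hh.
    exact: leq_trans hk2.
  have := main j; have := expR_ge0 (- (2 * v (k2 + j)%N)); rewrite -/(g _); lra.
apply: (@lower_criterion_series _ _ _ P X HX kappa (ltW k0) tt x
  (fun n => 12 * eps * bb n.+1) a (A / 6) c1 (delta0 R) n1) => //.
- by move=> n; apply: tscale_decr.
- exact: tscale_cvg.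
- exact: delta0_gt0.
- by move=> n nn; apply: (low_prob eps0 (g1 n.+1 (leqW nn))) => //; exact: ltW.
- move=> n nn; rewrite hk /x; have b2 := bscale_half rho0 rho1 n.
  have k3 : A * bb n.+1 <= A * (bb n / 2) by rewrite ler_wpM2l// ltW.
  have := mulr_gt0 A0 (bpos n); rewrite /eps; lra.
- by move=> n0; exact: diverges_tail.
Qed.

End thresholds.

(** Either [A b_n 2^k] at [n = n_ k] is below [80 * 30] along a subsequence, and single times
    suffice, or it is eventually above, and the divergent series drives a Borel-Cantelli
    argument. *)
Lemma limsup_ge_series (A c1 : R) (h : nat -> R) : tails (pp (@ppart R)) ->
  (forall M, exists k, M < Vn (yy k)) -> 0 < A -> c1 < A / 6 ->
  (forall k n, A * 2 ^+ n <= Vn (yy k) -> Vn (yy k) <= 2 * (A * 2 ^+ n) ->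
     2 * (A * bb n * 2 ^+ k) <= h k) ->
  diverges (fun k => expR (- h k)) ->
  {ae P, forall w, (c1%:E <= limsup_at0 X kappa w)%E}.
Proof.
move=> tpp Vunb A0 cA hh dv; have [k1 hk1] := Vunb A.
have exn k : exists n, (k1 <= k)%N -> A * 2 ^+ n <= Vn (yy k) /\ Vn (yy k) < A * (2 * 2 ^+ n).
  have [kk|kk] := leqP k1 k; last by exists 0%N.
  have ex : exists n, Vn (yy k) < A * (2 * 2 ^+ n).
    have [n hn] := eventually_expn (Vn (yy k)) A0; exists n.
    have := hn n (leqnn n); have p2 : (0 : R) < 2 ^+ n by exact: exprn_gt0.
    rewrite div1r exprVn mulrC ler_pdivrMr// => h1; apply: (le_lt_trans h1).
    by rewrite ltr_pM2l// ltr_pMl// ltr1n.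
  case: (ex_minnP ex) => -[|n] hn nmin; [exists 0%N => _; split => //|exists n.+1 => _; split => //].
    by rewrite expr0 mulr1 (le_trans (ltW hk1))// Vmono.
  by rewrite leNgt; apply/negP => h1; have := nmin n; rewrite ltnn exprS in h1 *; move=> /(_ h1).
have [n_ nk] := choice exn.
have [hinf|hfin] := pselect (forall K, exists2 k, (K <= k)%N & A * bb (n_ k) * 2 ^+ k < 80 * 30).
  exact: (limsup_lower_bounded A0 cA tpp nk hinf).
have [K hK] : exists K, ~ exists2 k, (K <= k)%N & A * bb (n_ k) * 2 ^+ k < 80 * 30.
  by apply: contra_notP hfin => hfin K; apply: contra_notP hfin => hfin; exists K.
apply: (limsup_lower_unbounded A0 cA tpp nk (leq_maxl k1 K) _ _ _ dv).
- move=> k; rewrite geq_max => /andP[_ kk]; rewrite leNgt; apply/negP => hlt.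
  by apply: hK; exists k.
- move=> N; have [k hVk] := Vunb (A * (2 * 2 ^+ N)); exists (maxn k k1).
  rewrite leq_maxr; split => //; rewrite leqNgt; apply/negP => lt.
  have [_ b2] := nk _ (leq_maxr k k1).
  have := lt_le_trans hVk (Vmono (leq_maxl k k1)); apply/negP; rewrite -leNgt.
  apply: (le_trans (ltW b2)); rewrite ler_wpM2l ?(ltW A0)// ler_wpM2l// ler_weXn2l ?ler1n//.
  exact: ltnW.
- move=> k; rewrite geq_max => /andP[kk _]; have [b1 b2] := nk k kk; apply: hh => //.
  by apply: (le_trans (ltW b2)); rewrite mulrCA.
Qed.

End limsup_estimates.

(** * The integral tests *)

Section geometric_blocks.
Context (R : realType).
Local Notation leb := (@lebesgue_measure R).

(** The integral of a nonnegative function is a supremum over simple functions below it, hence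
    monotone for arbitrary integrands; those of the tests can thus be compared with step functions
    directly. *)
Lemma le_integral_ge0 d (T : measurableType d) (mu : {measure set T -> \bar R})
    (D : set T) (f g : T -> \bar R) :
  (forall x, D x -> 0 <= f x)%E -> (forall x, D x -> f x <= g x)%E ->
  (\int[mu]_(x in D) f x <= \int[mu]_(x in D) g x)%E.
Proof.
move=> f0 fg; have g0 x : D x -> (0 <= g x)%E by move=> Dx; exact: le_trans (f0 x Dx) (fg x Dx).
rewrite !ge0_integralE//; apply: le_ereal_sup => _ [h hf <-]; exists h => // x.
apply: (le_trans (hf x)); rewrite !patchE; case: ifPn => // xD.
by apply: fg; rewrite inE in xD.
Qed.

Variables (r : R) (a : nat -> R).
Hypotheses (r0 : 0 < r) (r1 : r < 1) (a0 : forall n, 0 <= a n).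

(** Open on the left, so that the blocks partition []0, 1]]. *)
Definition block n : set R := [set` `]r ^+ n.+1, r ^+ n] ].

Lemma block_unit n : block n `<=` [set` `]0%R, 1%R] ].
Proof.
move=> x; rewrite /block /= !in_itv /= => /andP[h1 h2]; apply/andP; split.
  by apply: lt_trans h1; exact: exprn_gt0.
by apply: (le_trans h2); rewrite exprn_ile1// ltW.
Qed.

Lemma block_inj n m x : block n x -> block m x -> n = m.
Proof.
have key i j : (i < j)%N -> block i x -> block j x -> False.
  move=> ij; rewrite /block /= !in_itv /= => /andP[h1 _] /andP[_ h2].
  have := lt_le_trans h1 h2; apply/negP; rewrite -leNgt.
  by apply: ler_wiXn2l => //; exact: ltW.
move=> h1 h2; case: (ltngtP n m) => // h; exfalso.
  exact: key h h1 h2.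
exact: key h h2 h1.
Qed.

Lemma block_cover x : 0 < x -> x <= 1 -> exists n, block n x.
Proof.
move=> x0 x1; have h : r ^+ n @[n --> \oo] --> (0 : R) by apply: cvg_expr; rewrite gtr0_norm.
have x2 : 0 < x / 2 by rewrite divr_gt0.
have [N _ hN] := near_le h x2.
have ex : exists n, r ^+ n.+1 < x.
  exists N; have := hN N.+1 (leqnSn _); rewrite /= add0r => h1; apply: (le_lt_trans h1).
  by rewrite ltr_pdivrMr// ltr_pMr// ltr1n.
case: (ex_minnP ex) => n hn nmin; exists n; rewrite /block /= in_itv /= hn /=.
case: n hn nmin => [|n] hn nmin; first by rewrite expr0.
by rewrite leNgt; apply/negP => /nmin; rewrite ltnn.
Qed.

Lemma block_measure n : leb (block n) = (r ^+ n - r ^+ n.+1)%:E.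
Proof.
rewrite /block lebesgue_measure_itv /= lte_fin EFinB ifT//.
by rewrite exprS gtr_pMl// exprn_gt0.
Qed.

Let mblock n : measurable (block n : set (measurableTypeR R)).
Proof. exact: measurable_itv. Qed.
Let munit : measurable ([set` `]0%R, 1%R] ] : set (measurableTypeR R)).
Proof. exact: measurable_itv. Qed.

Definition bterm n (x : measurableTypeR R) : \bar R := (a n * \1_(block n) x)%:E.

Let mbterm n : measurable_fun setT (bterm n).
Proof.
by apply/measurable_EFinP; apply: measurable_funM => //; exact: measurable_indic.
Qed.

Let bterm0 n x : (0 <= bterm n x)%E.
Proof. by rewrite lee_fin mulr_ge0// indicE. Qed.

Lemma bterm_integral n : (\int[leb]_(x in `]0%R, 1%R]) bterm n x = (a n * (r ^+ n - r ^+ n.+1))%:E)%E.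
Proof.
rewrite /bterm; under eq_integral do rewrite EFinM.
rewrite ge0_integralZl//=; last 2 first.
- by apply/measurable_EFinP; exact: measurable_indic.
- by rewrite lee_fin.
rewrite integral_indic// (_ : _ `&` _ = block n).
  by rewrite EFinM; congr (_ * _)%E; exact: block_measure.
apply/seteqP; split => x; first by case.
by move=> h; split => //; exact: (block_unit h).
Qed.

Lemma block_lower (f : R -> \bar R) N : (forall n x, block n x -> (a n)%:E <= f x)%E ->
  ((\sum_(0 <= n < N) a n * (r ^+ n - r ^+ n.+1))%:E <= \int[leb]_(x in `]0%R, 1%R]) f x)%E.
Proof.
move=> hf; have -> : (\sum_(0 <= n < N) a n * (r ^+ n - r ^+ n.+1))%:E =
    (\int[leb]_(x in `]0%R, 1%R]) \sum_(0 <= n < N) bterm n x)%E.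
  rewrite ge0_integral_sum//; last by move=> n; exact: measurable_funTS.
  by rewrite -sumEFin; apply: eq_bigr => n _; rewrite bterm_integral.
apply: le_integral_ge0 => x; rewrite /= in_itv /= => /andP[x0 x1].
  by apply: sume_ge0 => n _; exact: bterm0.
have [m hm] := block_cover x0 x1.
have z n : n != m -> bterm n x = 0%E.
  move=> nm; rewrite /bterm indicE memNset ?mulr0// => hn.
  by move: nm; rewrite (block_inj hn hm) eqxx.
have bm : bterm m x = (a m)%:E by rewrite /bterm indicE mem_set// mulr1.
apply: le_trans (hf m x hm); rewrite -bm.
have [mN|mN] := ltnP m N.
  rewrite big_mkord (bigD1 (Ordinal mN))//= big1 ?adde0// => i im.
  by apply: z; apply: contra im => /eqP im; apply/eqP/val_inj.
rewrite big_nat big1 ?bterm0// => i /andP[_ iN]; apply: z.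
by rewrite ltn_eqF// (leq_trans iN).
Qed.

Lemma block_upper (f : R -> \bar R) M : (forall x : R, 0 < x -> x <= 1 -> (0 <= f x)%E) ->
  (forall n x, block n x -> f x <= (a n)%:E)%E ->
  (forall N, \sum_(0 <= n < N) a n * (r ^+ n - r ^+ n.+1) <= M) ->
  (\int[leb]_(x in `]0%R, 1%R]) f x <= M%:E)%E.
Proof.
move=> f0 hf hM.
apply: (@le_trans _ _ (\int[leb]_(x in `]0%R, 1%R]) (\sum_(n <oo) bterm n x))%E).
  apply: le_integral_ge0 => x; rewrite /= in_itv /= => /andP[x0 x1]; first exact: f0.
  have [m hm] := block_cover x0 x1.
  have bm : bterm m x = (a m)%:E by rewrite /bterm indicE mem_set// mulr1.
  apply: (le_trans (hf m x hm)); rewrite -bm.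
  apply: le_trans (nneseries_lim_ge m.+1 _); last by move=> k _ _; exact: bterm0.
  by rewrite big_nat_recr//= leeDr// sume_ge0.
rewrite integral_nneseries//; last by move=> n; exact: measurable_funTS.
apply: lime_le; first by apply: is_cvg_nneseries => n _ _; apply: integral_ge0.
apply: nearW => N; under eq_bigr do rewrite bterm_integral.
by rewrite sumEFin lee_fin.
Qed.

End geometric_blocks.

(** * The double integral [W] *)

Section doubly_truncated_mean.
Context (R : realType) (Pi : {measure set (measurableTypeR R) -> \bar R}).
Hypothesis HPi : levy_measure_on_unit Pi.
Local Notation leb := (@lebesgue_measure R).
Local Notation M := (measurableTypeR R).

Lemma mem_setb (S : Type) (b : S -> bool) z : (z \in [set z | b z]) = b z.
Proof. by apply/idP/idP; rewrite inE. Qed.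

Lemma Pi_Tg (u : R -> R) b : continuous u -> (forall x, 0 <= u x <= `|x|) -> 0 < b ->
  Pi [set x : M | b < u x] = (Tg Pi u b)%:E.
Proof.
move=> cu ub b0; have ms : measurable ([set x : M | b < u x] : set M).
  by have := continuous_measurable_fun cu measurableT (measurable_ray_gt b); rewrite setTI.
have := ItE (itg_Tg HPi cu ub b0); rewrite /Tg => <-.
by rewrite integral_indic// setIT.
Qed.

Lemma Pi_off_unit (A : set M) : measurable A -> A `<=` ~` ([set` `[(-1)%R, 1%R] ] `\ 0%R) -> Pi A = 0%E.
Proof.
move=> mA h; apply/eqP; rewrite -measure_le0 -HPi.1; apply: le_measure => //; rewrite inE//.
by apply: measurableC; apply: measurableD => //; exact: measurable_set1.
Qed.

(** For the exchange of integrals in [W]: [Pi] may be infinite near 0, but the sets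
    [|x| > 1 / (n + 1)] have finite mass and the point 0 has none. *)
Lemma levy_sigma_finite : sigma_finite [set: M] Pi.
Proof.
have i1 n : 0 < (n.+1%:R^-1 : R) by rewrite invr_gt0.
exists (fun n => [set 0] `|` [set x : M | n.+1%:R^-1 < `|x|]).
  apply/seteqP; split => // x _; have [->|x0] := eqVneq x 0; first by exists 0%N => //; left.
  have x1 : 0 < `|x| by rewrite normr_gt0.
  exists (Num.truncn `|x|^-1) => //; right => /=.
  by rewrite invf_plt ?posrE// truncnS_gt.
move=> n; have ms : measurable ([set x : M | n.+1%:R^-1 < `|x|] : set M).
  by have := continuous_measurable_fun (@continuous_abs R) measurableT (measurable_ray_gt n.+1%:R^-1); rewrite setTI.
have m0 : measurable ([set 0] : set M) by exact: measurable_set1.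
split; first exact: measurableU.
rewrite (@le_lt_trans _ _ (Pi ([set (0 : R)%R] : set M) + Pi [set x : M | (n.+1%:R^-1 < `|x|)%R])%E)//.
  exact: measureU2.
rewrite (Pi_off_unit m0) ?add0e.
  by rewrite (Pi_Tg (@continuous_abs R) (@abs_bound R) (i1 n)) ltry.
by move=> x -> [_ h]; exact: h.
Qed.

Lemma levy_fubini_tonelli (f : M * M -> \bar R) : measurable_fun setT f ->
  (forall z, (0 <= f z)%E) ->
  (\int[leb]_x \int[Pi]_z f (x, z) = \int[Pi]_z \int[leb]_x f (x, z))%E.
Proof.
move=> mf f0.
(* [Pi] is only declared as a measure, so its sigma-finite structure is built locally. *)
pose H2 := isSFinite.Build _ _ _ _ (sfinite_measure_sigma_finite levy_sigma_finite).
pose H3 := isSigmaFinite.Build _ _ _ _ levy_sigma_finite.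
pose m := HB.pack_for (SigmaFiniteMeasure.type M R) (Measure.sort Pi) H2 H3.
exact: (@fubini_tonelli _ _ M M R leb m f mf f0).
Qed.

Lemma neg_part_integral (x : R) : 0 < x ->
  (\int[neg_part Pi]_(z in `]x, 1%R]) z%:E =
   \int[Pi]_z (npart z * \1_[set z | x < npart z] z)%:E)%E.
Proof.
move=> x0; rewrite /neg_part ge0_integral_pushforward/=; last 4 first.
- exact: oppr_measurable.
- exact: measurable_itv.
- exact/measurable_EFinP.
- move=> z; rewrite inE /= in_itv /= => /andP[h _].
  by rewrite lee_fin ltW// (lt_trans x0).
rewrite (_ : -%R @^-1` _ = [set` `[(-1)%R, (- x)%R[ ]); last first.
  apply/seteqP; split => z; rewrite /= !in_itv /= => /andP[h1 h2]; apply/andP; split; lra.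
rewrite (eq_measure_integral Pi); last first.
  move=> A mA hA; rewrite /= /mrestr; congr (Pi _); apply/seteqP; split => z; first by case.
  move=> Az; split => //; have := hA z Az; rewrite /= !in_itv /= => /andP[_ h]; lra.
have mt : measurable ([set z | x < npart z] : set M).
  by have := continuous_measurable_fun (@continuous_npart R) measurableT (measurable_ray_gt x); rewrite setTI.
have mI : measurable ([set` `[(-1)%R, (- x)%R[ ] : set M) by exact: measurable_itv.
rewrite integral_mkcond; apply: ge0_ae_eq_integral => //=.
- apply/(measurable_restrictT _ mI); apply/measurable_EFinP; apply: measurable_funTS; exact: oppr_measurable.
- apply/measurable_EFinP; apply: measurable_funM; last exact: measurable_indic.
  exact: continuous_measurable_fun (@continuous_npart R).
- move=> z _; rewrite patchE; case: ifPn => //; rewrite inE /= in_itv /= lee_fin => /andP[_ h]; lra.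
- move=> z _; rewrite lee_fin mulr_ge0 ?indicE//; by case/andP: (npart_bound z).
exists (~` ([set` `[(-1)%R, 1%R] ] `\ 0%R)); split.
- by apply: measurableC; apply: measurableD => //; exact: measurable_set1.
- exact: HPi.1.
move=> z /= hz hz'; apply: hz => _; case: hz'; rewrite /= in_itv /= => /andP[z1 z2] z0.
rewrite patchE indicE !mem_setb in_itv /= /npart.
move: (z : R) z1 {z2 z0} => u u1; rewrite ?u1 /=.
clear - x0 u1; have [h|h] := ltP u (- x).
  have h1 : x < - u by rewrite ltrNr.
  by rewrite max_r ?h1 ?mulr1// ltW// (lt_trans x0).
by rewrite ltNge ge_max (ltW x0) lerNl h mulr0.
Qed.

(** After the exchange, the inner integral is [z * min (y, z) = y * min (z^2 / y, z)], with [z] the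
    size of the negative jump. *)
Lemma W_Vn y : 0 < y -> y <= 1 -> W Pi y = (y * Vn Pi y)%:E.
Proof.
move=> y0 y1; rewrite /W.
have mn : measurable_fun setT (@npart R) by exact: continuous_measurable_fun (@continuous_npart R).
pose f (p : M * M) : \bar R := (\1_([set` `]0%R, y] ] : set R) p.1 *
  (npart p.2 * \1_[set q : M * M | 0 < npart q.2 - q.1] p))%:E.
have E x z : f (x, z) = (\1_([set` `]0%R, y] ] : set R) x * (npart z * \1_[set z | x < npart z] z))%:E.
  rewrite /f /= !indicE; congr EFin; do 2 congr (_ * _); congr (_%:R); congr nat_of_bool; by rewrite !mem_setb subr_gt0.
rewrite integral_mkcond.
transitivity (\int[leb]_x \int[Pi]_z f (x, z))%E.
  apply: eq_integral => x _; rewrite patchE; under [RHS]eq_integral do rewrite E.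
  case: ifPn => [xy|xy]; last first.
    by rewrite indicE (negbTE xy); under eq_integral do rewrite mul0r; rewrite integral0.
  rewrite indicE xy; under [RHS]eq_integral do rewrite mul1r.
  by apply: neg_part_integral; move: xy; rewrite inE /= in_itv /= => /andP[].
rewrite levy_fubini_tonelli; last 2 first.
- apply/measurable_EFinP; apply: measurable_funM.
    by apply: measurableT_comp => //; exact: measurable_indic.
  apply: measurable_funM; first exact: measurableT_comp.
  apply: measurable_indic.
  have mg : measurable_fun setT (fun q : M * M => npart q.2 - q.1).
    by apply: measurable_funB => //; exact: measurableT_comp.
  by have := mg measurableT _ (measurable_ray_gt 0); rewrite setTI.
- by move=> z; rewrite lee_fin !mulr_ge0 ?indicE//; case/andP: (npart_bound z.2).
transitivity (\int[Pi]_z (y * vfun y z)%:E)%E.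
  apply: eq_integral => z _.
  have n0 : 0 <= npart z by case/andP: (npart_bound z).
  transitivity (\int[leb]_x ((npart z)%:E * (\1_([set` `]0%R, y] ] `&` [set x | x < npart z]) x)%:E))%E.
    by apply: eq_integral => x _; rewrite E -EFinM mulrCA indicI /=; congr (_ * (_ * _))%:E; rewrite !indicE.
  have mA : measurable ([set` `]0%R, y] ] `&` [set x : M | x < npart z] : set M).
    apply: measurableI; first exact: measurable_itv.
    by rewrite -set_itvNyo; exact: measurable_itv.
  rewrite ge0_integralZl//; last by apply/measurable_EFinP; exact: measurable_indic.
  rewrite integral_indic// setIT.
  have [h|h] := ltP y (npart z).
    rewrite (_ : _ `&` _ = [set` `]0%R, y] ]).
      rewrite -[X in (_ * X)%E]/(leb [set` `]0%R, y] ]) lebesgue_measure_itv /= lte_fin y0 oppr0 adde0 -EFinM /vfun; congr EFin.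
      rewrite min_r; last by rewrite expr2 -mulrA ler_peMr// ler_pdivlMr// mul1r ltW.
      by rewrite mulrC.
    by apply/seteqP; split => x /=; [case|rewrite in_itv /= => /andP[-> h2]; split => //; exact: le_lt_trans h].
  rewrite (_ : _ `&` _ = [set` `]0%R, (npart z)[ ]).
    rewrite -[X in (_ * X)%E]/(leb [set` `]0%R, (npart z)[ ]) lebesgue_measure_itv /= lte_fin /vfun min_l; last first.
      by rewrite expr2 -mulrA ler_piMr// ler_pdivrMr// mul1r.
    rewrite mulrCA divff ?gt_eqF// mulr1; case: ifPn => [_|hn]; last first.
      by have -> : npart z = 0 by [lra|]; rewrite expr0n mule0.
    by rewrite oppr0 adde0 -EFinM expr2.
  apply/seteqP; split => x /=; rewrite !in_itv /=.
    by case=> /andP[-> _] ->.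
  by move=> /andP[-> h2]; rewrite h2; split => //=; rewrite (le_trans (ltW h2)).
by rewrite (ItE (itgZ _ (itg_vfun HPi y0))) ItZ//; exact: itg_vfun.
Qed.

End doubly_truncated_mean.

(** * Series equivalent to the integrals *)

Section integral_tests.
Context (R : realType) (Pi : {measure set (measurableTypeR R) -> \bar R}).
Hypothesis HPi : levy_measure_on_unit Pi.
Variable kappa : R.
Hypotheses (kappa_gt : 1 / 2 < kappa) (kappa_lt : kappa < 1).
Local Notation leb := (@lebesgue_measure R).

(* The ratio for which [rate ^ kappa = 2 * rate]. *)
Definition rate : R := 2 `^ (- (1 - kappa)^-1).
Definition qexp : R := kappa / (1 - kappa).

Let k1 : 0 < 1 - kappa. Proof. by rewrite subr_gt0. Qed.
Let k0 : 0 < kappa. Proof. by have := kappa_gt; lra. Qed.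

Lemma qexp_gt0 : 0 < qexp. Proof. exact: divr_gt0. Qed.

Lemma le_inv_pos (x y : R) : 0 < x -> x <= y -> y^-1 <= x^-1.
Proof. by move=> x0 xy; rewrite lef_pV2 ?posrE// (lt_le_trans x0). Qed.

Lemma le_powRq x y : 0 <= x -> x <= y -> x `^ qexp <= y `^ qexp.
Proof. by move=> x0 xy; apply: ge0_ler_powR; rewrite ?nnegrE ?(ltW qexp_gt0)// (le_trans x0). Qed.

Lemma rate_gt0 : 0 < rate. Proof. exact: powR_gt0. Qed.

(** Equivalent to [1 / (1 - kappa) > 2], that is to [kappa > 1/2]. *)
Lemma rate_lt : rate < 1 / 4.
Proof.
have h : 2 < (1 - kappa)^-1 by rewrite -[2]invrK ltf_pV2 ?posrE ?invr_gt0//; have := kappa_gt; lra.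
rewrite /rate powRN div1r ltf_pV2 ?posrE ?powR_gt0//.
rewrite (_ : 4 = 2 `^ 2); last by rewrite (@powR_mulrn _ 2 2)// expr2 -natrM.
rewrite lt_neqAle ler_powR ?ler1n ?(ltW h)// andbT.
apply/eqP => /(congr1 (@ln R)); rewrite !ln_powR => /eqP; rewrite -subr_eq0 -mulrBl mulf_eq0.
have l2 : 0 < ln (2 : R) by rewrite ln_gt0// ltr1n.
by rewrite (gt_eqF l2) orbF => /eqP; lra.
Qed.

Lemma rate_powR : rate `^ kappa = 2 * rate.
Proof.
have k2 := k1; rewrite /rate -powRrM -{2}[2](@powRr1 _ 2)// -powRD; last by apply/implyP => _; rewrite pnatr_eq0.
by congr powR; field; rewrite gt_eqF.
Qed.

Lemma tscale_powR n : tscale rate n `^ kappa = bscale rate n.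
Proof. by rewrite /tscale /bscale -powR_mulrn ?(ltW rate_gt0)// powRAC rate_powR powR_mulrn// mulr_ge0// ltW// rate_gt0. Qed.

(** Expresses [b_n] through the threshold [2^n] of [V]; the exponent [qexp] is the outer one in
    [J]. *)
Lemma bscale_powR n : bscale rate n = (2 ^+ n) `^ (- qexp).
Proof.
have k2 := k1; have e : (2 : R) ^+ n = 2 `^ n%:R by rewrite powR_mulrn.
rewrite /bscale -rate_powR -(powR_mulrn n (powR_ge0 _ _)) e /rate -!powRrM; congr (2 `^ _).
by rewrite /qexp; field; rewrite gt_eqF.
Qed.

Section tail_integral.
Variables (u : R -> R) (tl : R -> \bar R).
Hypotheses (cu : continuous u) (ub : forall x, 0 <= u x <= `|x|).
Hypothesis tlE : forall b, 0 < b -> tl b = (Tg Pi u b)%:E.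
Local Notation I := (\int[leb]_(x in `]0%R, 1%R]) tl (x `^ kappa))%E.

Let r0 := rate_gt0.
Let r1 : rate < 1. Proof. by have := rate_lt; lra. Qed.
Let b0 n : 0 < bscale rate n := bscale_gt0 r0 n.

Let blockP n x : block rate n x -> [/\ 0 < x `^ kappa, bscale rate n.+1 <= x `^ kappa & x `^ kappa <= bscale rate n].
Proof.
rewrite /block /= in_itv /= -!/(tscale _ _) => /andP[h1 h2].
have x0 : 0 < x by apply: lt_trans h1; exact: tscale_gt0.
split; first exact: powR_gt0.
  by rewrite -tscale_powR; apply: ge0_ler_powR; rewrite ?nnegrE ?(ltW k0) ?(ltW x0) ?(ltW (tscale_gt0 r0 _)) ?(ltW h1).
by rewrite -tscale_powR; apply: ge0_ler_powR; rewrite ?nnegrE ?(ltW k0) ?(ltW x0) ?(ltW (tscale_gt0 r0 _)).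
Qed.

(** On block [n], [x ^ kappa] lies between [b_{n+1}] and [b_n], and the block has length
    [(1 - rho) t_n]; the tail being monotone, integral and series are comparable. *)
Lemma tail_integral_finite : (I < +oo)%E -> tails (jump_mass Pi rate u).
Proof.
move=> If; have p0 n : 0 <= jump_mass Pi rate u n by exact: jump_mass_ge0.
have h N := @block_lower _ rate (fun n => Tg Pi u (bscale rate n)) r0 r1 (fun n => Tg_ge0 _ _ _)
  (fun x => tl (x `^ kappa)) N.
have I0 : (0 <= I)%E.
  by have := h 0%N; rewrite big_geq//; apply => n x /blockP[x0 _ hx]; rewrite tlE// lee_fin; apply: Tg_anti.
move: If I0 h; case: I => // M _ _ h.
have r2 : 0 < 1 - rate by rewrite subr_gt0.
apply: (@tails_of_bounded _ _ (M / (1 - rate))) => // N.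
rewrite ler_pdivlMr// mulr_suml -lee_fin; apply: le_trans (h N _).
  rewrite lee_fin; apply: ler_sum => n _; rewrite /jump_mass /tscale [_ ^+ n.+1]exprS.
  by rewrite le_eqVlt; apply/orP; left; apply/eqP; ring.
by move=> n x /blockP[x0 _ hx]; rewrite tlE// lee_fin; exact: Tg_anti.
Qed.

Lemma tail_integral_infinite : I = +oo%E -> diverges (jump_mass Pi rate u).
Proof.
move=> Ii M0; have p0 n : 0 <= jump_mass Pi rate u n by exact: jump_mass_ge0.
apply: contrapT => hM.
have hS N : \sum_(0 <= n < N) jump_mass Pi rate u n <= M0.
  by rewrite leNgt; apply/negP => h; apply: hM; exists N; exact: ltW.
have r2 : 0 < 1 - rate by rewrite subr_gt0.
have := @block_upper _ rate (fun n => Tg Pi u (bscale rate n.+1)) r0 r1 (fun n => Tg_ge0 _ _ _)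
  (fun x => tl (x `^ kappa)) (rate^-1 * M0).
rewrite Ii => h; suff : (+oo <= (rate^-1 * M0)%:E :> \bar R)%E by [].
apply: h.
- by move=> x x0 _; rewrite tlE ?powR_gt0// lee_fin Tg_ge0.
- move=> n x /blockP[x0 hx _]; rewrite tlE// lee_fin; exact: Tg_anti.
move=> N; apply: (@le_trans _ _ (rate^-1 * \sum_(0 <= n < N) jump_mass Pi rate u n.+1)); last first.
  rewrite ler_pM2l ?invr_gt0//; apply: le_trans (hS N.+1).
  by rewrite [leRHS]big_nat_recl//= big_mkord -(big_mkord xpredT (fun i => jump_mass Pi rate u i.+1)) lerDr.
rewrite mulr_sumr; apply: ler_sum => n _.
rewrite /jump_mass /tscale [_ ^+ n.+1]exprS !mulrA mulVf ?gt_eqF// mul1r mulrC.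
have t0 : 0 <= rate ^+ n by rewrite exprn_ge0// ltW.
by rewrite ler_wpM2r ?Tg_ge0// gerBl mulr_ge0// ltW.
Qed.

End tail_integral.

Lemma tail_pos_Tg b : 0 < b -> tail_pos Pi b = (Tg Pi (@ppart R) b)%:E.
Proof.
move=> b0; rewrite /tail_pos -(Pi_Tg HPi (@continuous_ppart R) (@ppart_bound R) b0).
congr (Pi _); apply/seteqP; split => x; rewrite /= in_itv /= ?andbT /ppart lt_max.
  by move=> ->; exact: orbT.
by case/orP => //; rewrite ltNge (ltW b0).
Qed.

Lemma tail_neg_Tg b : 0 < b -> tail_neg Pi b = (Tg Pi (@npart R) b)%:E.
Proof.
move=> b0; rewrite /tail_neg -(Pi_Tg HPi (@continuous_npart R) (@npart_bound R) b0).
congr (Pi _); apply/seteqP; split => x; rewrite /= in_itv /= /npart lt_max ltrNr.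
  by move=> ->; exact: orbT.
by case/orP => //; rewrite ltNge (ltW b0).
Qed.

Local Notation yy k := (2^-1 ^+ k : R).
Local Notation V := (Vn Pi).

Let h0 : 0 < (2^-1 : R). Proof. by rewrite invr_gt0. Qed.
Let h1 : (2^-1 : R) < 1. Proof. by rewrite invf_lt1// ltr1n. Qed.
Let yy0 k : 0 < yy k. Proof. exact: exprn_gt0. Qed.

(** If [V] stayed below [M], [b Tg(b) <= V(b)] would give [jump_mass n <= M t_n / b_n = M 2^-n], a
    summable bound. *)
Lemma Vn_unbounded : diverges (jump_mass Pi rate (@npart R)) -> forall M, exists k, M < V (yy k).
Proof.
move=> dv M; apply: contrapT => hM.
have hV n : V (bscale rate n) <= M.
  have b0 : 0 < bscale rate n by apply: bscale_gt0; exact: rate_gt0.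
  have [k hk] : exists k, yy k <= bscale rate n.
    have [k hk] := eventually_expn 1 b0; exists k; have := hk k (leqnn _).
    by rewrite mulr1 div1r.
  apply: (le_trans (Vn_anti HPi (yy0 k) hk)).
  by rewrite leNgt; apply/negP => h; apply: hM; exists k.
have M0 : 0 <= M by apply: le_trans (hV 0%N); apply: Vn_ge0; apply: bscale_gt0; exact: rate_gt0.
have [N hN] := dv (2 * M + 1).
suff : \sum_(0 <= n < N) jump_mass Pi rate (@npart R) n <= 2 * M - 2 * M * yy N.
  by have : 0 <= M * yy N by [rewrite mulr_ge0// ltW|]; lra.
elim: N {hN} => [|N ih]; first by rewrite big_geq// expr0 mulr1 subrr.
rewrite big_nat_recr//= exprS.
suff : jump_mass Pi rate (@npart R) N <= M * yy N by lra.
have r0 := rate_gt0; have b0 := bscale_gt0 r0 N.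
have := le_trans (Tg_npart_le HPi b0) (hV N).
rewrite /jump_mass bscale_tscale -mulrA [X in _ -> _ <= X]mulrC exprVn [X in _ -> _ <= X]mulrC ler_pdivlMr ?exprn_gt0//.
by move=> h; rewrite mulrC.
Qed.

Section exponential_integral.
Hypothesis Vunb : forall M, exists k, M < V (yy k).

(** [V (2^-k) <= 2^k V 1], so unboundedness forces positivity. *)
Let V1 : 0 < V 1.
Proof.
have hk k : V (yy k) <= 2 ^+ k * V 1.
  elim: k => [|k ih]; first by rewrite !expr0 mul1r.
  rewrite [yy _]exprS mulrC exprS -mulrA; apply: (le_trans (Vn_half HPi (yy0 k))).
  by rewrite ler_pM2l.
have [k h] := Vunb 0; have := lt_le_trans h (hk k).
by rewrite pmulr_rgt0// exprn_gt0.
Qed.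

Let V0 y : 0 < y -> y <= 1 -> 0 < V y.
Proof. by move=> y0 y1; apply: (lt_le_trans V1); exact: Vn_anti. Qed.

Let yy1 k : yy k <= 1. Proof. by apply: exprn_ile1; exact: ltW. Qed.

(** The exponent in [J] at [y = 2^-k], up to the factor [lambda]. *)
Definition rate_f k : R := 2 ^+ k / V (yy k) `^ qexp.

Let integrand la y : \bar R := (expeR (- (la%:E *
       poweR ((y `^ ((2 * kappa - 1) / kappa))%:E / W Pi y)
             (kappa / (1 - kappa)))) * (y^-1)%:E)%E.

(** [W y = y V(y)] and [(2 kappa - 1) / kappa - 1 = - 1 / qexp], so the ratio raised to [qexp] is
    [1 / (y V(y)^qexp)]. Since [V > 0], the conventional value at [W = 0] does not occur. *)
Let integrandE la y : 0 < y -> y <= 1 ->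
  integrand la y = (expR (- (la * (y^-1 / V y `^ qexp))) * y^-1)%:E.
Proof.
move=> y0 y1; have v0 := V0 y0 y1; rewrite /integrand W_Vn// inver mulf_eq0 !gt_eqF//= -/qexp.
have -> : y `^ ((2 * kappa - 1) / kappa) / (y * V y) = y `^ (- qexp^-1) / V y.
  rewrite invfM mulrA -[y^-1]powR_inv1 ?ltW// -powRD; last by apply/implyP => _; rewrite gt_eqF.
  by congr (powR _ _ / _); have k2 := k1; have k3 := k0; rewrite /qexp; field; rewrite !gt_eqF.
rewrite powRM ?powR_ge0 ?invr_ge0 ?ltW// -powRrM mulNr mulVf ?gt_eqF ?qexp_gt0// powR_inv1 ?ltW//.
by rewrite -EFinM -[(V y)^-1]powR_inv1 ?ltW// -powRrM mulN1r powRN.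
Qed.

(** On a dyadic block [1 / y] and [V] vary by at most a factor 2; this is the origin of the factors
    2 and [2^qexp] in [J_finite] and [J_infinite]. *)
Let blockP n y : block 2^-1 n y -> [/\ 0 < y, y <= 1,
  rate_f n / 2 `^ qexp <= y^-1 / V y `^ qexp, y^-1 / V y `^ qexp <= 2 * rate_f n &
  2 ^+ n <= y^-1 /\ y^-1 <= 2 ^+ n.+1].
Proof.
move=> hb; have /andP[y0 y1] : 0 < y <= 1 by have := block_unit h0 h1 hb; rewrite /= in_itv.
move: hb; rewrite /block /= in_itv /= => /andP[a1 a2].
have yyV k : (yy k)^-1 = 2 ^+ k by rewrite exprVn invrK.
have e1 : 2 ^+ n <= y^-1 by rewrite -yyV lef_pV2 ?posrE.
have e2 : y^-1 <= 2 ^+ n.+1 by rewrite -yyV lef_pV2 ?posrE// ltW.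
have q0 := qexp_gt0; have v0 := V0 y0 y1; have vn := V0 (yy0 n) (yy1 n).
have b1 : V (yy n) <= V y by apply: Vn_anti.
have b2 : V y <= 2 * V (yy n).
  by apply: le_trans (Vn_half HPi (yy0 n)); apply: Vn_anti => //; rewrite ?divr_gt0// mulrC -exprS ltW.
have c1 : V (yy n) `^ qexp <= V y `^ qexp by apply: ge0_ler_powR => //; rewrite ?nnegrE ltW.
have c2 : V y `^ qexp <= 2 `^ qexp * V (yy n) `^ qexp.
  by rewrite -powRM ?(ltW vn)//; apply: le_powRq => //; exact: ltW.
have p1 : 0 < V (yy n) `^ qexp by exact: powR_gt0.
have p2 : 0 < V y `^ qexp by exact: powR_gt0.
have p3 : 0 < 2 `^ qexp :> R by exact: powR_gt0.
split => //.
  rewrite /rate_f -mulrA -invfM.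
  apply: ler_pM; [exact: exprn_ge0|by rewrite invr_ge0 mulr_ge0 ?(ltW p1) ?(ltW p3)|exact: e1|].
  by apply: (le_inv_pos p2); rewrite mulrC.
rewrite /rate_f mulrA -exprS; apply: ler_pM; [by rewrite invr_ge0 ltW|by rewrite invr_ge0 ltW|exact: e2|].
exact: le_inv_pos p1 c1.
Qed.

Lemma J_finite la : 0 < la -> (J Pi kappa la < +oo)%E ->
  tails (fun k => expR (- (2 * la * rate_f k))).
Proof.
move=> la0; rewrite /J -/(integrand la); move=> Jf.
pose a n := expR (- (2 * la * rate_f n)) * 2 ^+ n.
have a0 n : 0 <= a n by rewrite mulr_ge0 ?expR_ge0 ?exprn_ge0.
have h N : ((\sum_(0 <= n < N) a n * (2^-1 ^+ n - 2^-1 ^+ n.+1))%:E <=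
    \int[leb]_(y in `]0%R, 1%R]) integrand la y)%E.
  apply: block_lower => // n y /blockP[y0 y1 _ b2 [e1 _]].
  rewrite (integrandE la y0 y1) lee_fin; apply: ler_pM; [exact: expR_ge0|exact: exprn_ge0| |exact: e1].
  by rewrite ler_expR lerN2 [2 * la]mulrC -[leRHS]mulrA ler_pM2l.
have I0 : (0 <= \int[leb]_(y in `]0%R, 1%R]) integrand la y)%E by have := h 0%N; rewrite big_geq.
move: Jf I0 h; rewrite -/(integrand la); case: (\int[leb]_(y in _) _)%E => // M _ _ h.
apply: (@tails_of_bounded _ _ (2 * M)) => [n|N]; first exact: expR_ge0.
rewrite -ler_pdivrMl// mulr_sumr -lee_fin; apply: le_trans (h N).
rewrite lee_fin; apply: ler_sum => n _; rewrite /a [yy n.+1]exprS.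
have : yy n * 2 ^+ n = 1 by rewrite -exprMn mulVf ?expr1n.
set e := expR _; set z := yy n; set t := 2 ^+ n => zt.
have -> : e * t * (z - 2^-1 * z) = 2^-1 * e * (z * t) by field.
by rewrite zt mulr1.
Qed.

Lemma J_infinite la : 0 < la -> J Pi kappa la = +oo%E ->
  diverges (fun k => expR (- (la / 2 `^ qexp * rate_f k))).
Proof.
move=> la0 Ji M; apply: contrapT => hM.
pose a n := expR (- (la / 2 `^ qexp * rate_f n)) * 2 ^+ n.+1.
have a0 n : 0 <= a n by rewrite mulr_ge0 ?expR_ge0 ?exprn_ge0.
suff : (J Pi kappa la <= M%:E)%E by rewrite Ji.
apply: (@block_upper _ 2^-1 a) => //.
- by move=> y y0 y1; rewrite -/(integrand la y) (integrandE la y0 y1) lee_fin mulr_ge0 ?expR_ge0// invr_ge0 ltW.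
- move=> n y /blockP[y0 y1 b1 _ [_ e2]]; rewrite -/(integrand la y) (integrandE la y0 y1) lee_fin.
  apply: ler_pM; [exact: expR_ge0|by rewrite invr_ge0 ltW| |exact: e2].
  by rewrite ler_expR lerN2 mulrAC -[leLHS]mulrA ler_pM2l.
move=> N; rewrite leNgt; apply/negP => hN; apply: hM; exists N; apply: (le_trans (ltW hN)).
apply: ler_sum => n _; rewrite /a.
have : yy n * 2 ^+ n = 1 by rewrite -exprMn mulVf ?expr1n.
rewrite [yy n.+1]exprS [2 ^+ n.+1]exprS.
set e := expR _; set z := yy n; set t := 2 ^+ n => zt.
have -> : e * (2 * t) * (z - 2^-1 * z) = e * (z * t) by field.
by rewrite zt mulr1.
Qed.

(** With [A 2^n] comparable to [V_k], [A b_n 2^k = A (2^n)^(- qexp) 2^k] is comparable to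
    [A^(1 + qexp) * rate_f k]; the condition on [A] and [la] says this. [rate_f_ge] is the converse
    comparison. *)
Lemma rate_f_le A la k n : 0 < A -> 0 <= la -> la * 2 `^ qexp <= A * A `^ qexp ->
  V (yy k) <= A * 2 ^+ n -> A * 2 ^+ n <= 2 * V (yy k) -> la * rate_f k <= A * bscale rate n * 2 ^+ k.
Proof.
move=> A0 la0 hA _ h; have v := V0 (yy0 k) (yy1 k); have q0 := qexp_gt0.
have t0 : 0 < (2 ^+ n : R) by exact: exprn_gt0.
rewrite bscale_powR powRN /rate_f [2 ^+ k / _]mulrC mulrA ler_pM2r ?exprn_gt0// ler_pdivrMr ?powR_gt0//.
rewrite mulrAC ler_pdivlMr ?powR_gt0//.
have h2 : A `^ qexp * (2 ^+ n) `^ qexp <= 2 `^ qexp * V (yy k) `^ qexp.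
  by rewrite -!powRM ?(ltW A0) ?(ltW v) ?(ltW t0)//; apply: le_powRq => //; rewrite mulr_ge0// ltW.
have p2 : 0 < 2 `^ qexp :> R by exact: powR_gt0.
rewrite -(ler_pM2l p2) mulrA [2 `^ qexp * la]mulrC.
apply: (@le_trans _ _ (A * A `^ qexp * (2 ^+ n) `^ qexp)); first by rewrite ler_wpM2r ?powR_ge0.
by rewrite -mulrA [leRHS]mulrCA ler_pM2l.
Qed.

Lemma rate_f_ge A la k n : 0 < A -> 2 * A * (2 * A) `^ qexp <= la ->
  A * 2 ^+ n <= V (yy k) -> V (yy k) <= 2 * (A * 2 ^+ n) -> 2 * (A * bscale rate n * 2 ^+ k) <= la * rate_f k.
Proof.
move=> A0 hA _ h; have v := V0 (yy0 k) (yy1 k); have q0 := qexp_gt0.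
have t0 : 0 < (2 ^+ n : R) by exact: exprn_gt0.
rewrite bscale_powR powRN /rate_f [2 ^+ k / _]mulrC !mulrA ler_pM2r ?exprn_gt0// ler_pdivlMr ?powR_gt0//.
rewrite mulrAC ler_pdivrMr ?powR_gt0//.
have h2 : V (yy k) `^ qexp <= (2 * A) `^ qexp * (2 ^+ n) `^ qexp.
  by rewrite -!powRM ?mulr_ge0 ?(ltW A0) ?(ltW t0)// -mulrA; apply: le_powRq => //; exact: ltW.
have A2 : 0 < 2 * A by rewrite mulr_gt0.
apply: (@le_trans _ _ (2 * A * ((2 * A) `^ qexp * (2 ^+ n) `^ qexp))); first by rewrite ler_pM2l.
by rewrite mulrA ler_wpM2r ?powR_ge0.
Qed.

End exponential_integral.
End integral_tests.

(** * The almost sure value of the limsup *)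

Section limsup_law.
Context (R : realType) d (T : measurableType d) (P : probability T R)
  (X : R -> T -> R) (gamma : R) (Pi : {measure set (measurableTypeR R) -> \bar R}).
Hypotheses (HX : levy_process P X) (HPi : levy_measure_on_unit Pi)
  (Htr : has_triplet P X gamma 0 Pi).
Variable kappa : R.
Hypotheses (kappa_gt : 1 / 2 < kappa) (kappa_lt : kappa < 1).
Local Notation rho := (rate kappa).
Local Notation q := (qexp kappa).
Local Notation L w := (limsup_at0 X kappa w).
Local Notation Ipos := (\int[lebesgue_measure]_(x in `]0%R, 1%R]) tail_pos Pi (x `^ kappa))%E.
Local Notation Ineg := (\int[lebesgue_measure]_(x in `]0%R, 1%R]) tail_neg Pi (x `^ kappa))%E.
Local Notation Iboth := (\int[lebesgue_measure]_(x in `]0%R, 1%R]) tail Pi (x `^ kappa))%E.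

Let k0 : 0 < kappa. Proof. by have := kappa_gt; lra. Qed.
Let rho0 : 0 < rho := rate_gt0 kappa.
Let rho1 : rho < 1 / 4 := rate_lt kappa_gt kappa_lt.
Let hk n : tscale rho n `^ kappa = bscale rho n := tscale_powR kappa_lt n.
Let p2 : 0 < 2 `^ q :> R. Proof. exact: powR_gt0. Qed.

Let cp := @continuous_ppart R.
Let bp := @ppart_bound R.
Let cn := @continuous_npart R.
Let bn := @npart_bound R.

(** Two incompatible almost sure bounds on the limsup are confronted at a single point, which exists
    because the whole space is not negligible. *)
Lemma ae_exists (Q : T -> Prop) : {ae P, forall w, Q w} -> exists w, Q w.
Proof.
move=> aeQ; apply: contrapT => nQ.
have : P.-negligible [set: T].
  by apply: negligibleS aeQ => w _ Qw; apply: nQ; exists w.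
move=> /negligibleP -/(_ measurableT) /=; rewrite probability_setT => /eqP.
by rewrite onee_eq0.
Qed.

Lemma limsup_top : (forall D : R, {ae P, forall w, (D%:E <= L w)%E}) -> {ae P, forall w, L w = +oo%E}.
Proof.
move=> h; have := ae_foralln (fun n : nat => h n%:R); apply: filterS => w hw.
by apply/eqyP => r r0; apply: le_trans (hw (Num.truncn r).+1); rewrite lee_fin ltW// truncnS_gt.
Qed.

Lemma limsup_const (c : R) :
  (forall e : R, 0 < e -> {ae P, forall w, (L w <= (c + e)%:E)%E}) ->
  (forall e : R, 0 < e -> {ae P, forall w, ((c - e)%:E <= L w)%E}) ->
  {ae P, forall w, L w = c%:E}.
Proof.
move=> hu hl; have e0 n : 0 < (n.+1%:R^-1 : R) by rewrite invr_gt0.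
have := ae_foralln (fun n : nat => hl _ (e0 n)).
apply: filterS2 (ae_foralln (fun n : nat => hu _ (e0 n))) => w hw hw'.
apply/eqP; rewrite eq_le; apply/andP; split; apply/lee_addgt0Pr => e ep.
  have [n hn] : exists n : nat, n.+1%:R^-1 <= e.
    by exists (Num.truncn e^-1); rewrite invf_ple ?posrE// ltW// truncnS_gt.
  by apply: le_trans (hw n) _; rewrite -EFinD lee_fin lerD2l.
have [n hn] : exists n : nat, n.+1%:R^-1 <= e.
  by exists (Num.truncn e^-1); rewrite invf_ple ?posrE// ltW// truncnS_gt.
by rewrite -leeBlDr//; apply: le_trans (hw' n); rewrite -EFinB lee_fin lerD2l lerN2.
Qed.

Lemma limsup_top_large_jumps (D : R) : Ipos = +oo%E -> {ae P, forall w, (D%:E <= L w)%E}.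
Proof.
move=> Ip; have dv := tail_integral_infinite HPi kappa_gt kappa_lt cp bp (tail_pos_Tg HPi) Ip.
have [[K hK]|hK] := pselect (exists K, forall n, jump_mass Pi rho (@ppart R) n <= K).
  exact: (limsup_large_jumps HX HPi Htr k0 rho0 rho1 hk D hK dv).
apply: (limsup_unbounded_jumps HX HPi Htr k0 rho0 rho1 hk D) => K.
apply: contrapT => h; apply: hK; exists K => n; rewrite leNgt; apply/negP => hn; apply: h.
by exists n.
Qed.

Lemma tails_pos : (Ipos < +oo)%E -> tails (jump_mass Pi rho (@ppart R)).
Proof. exact: (tail_integral_finite HPi kappa_gt kappa_lt cp bp (tail_pos_Tg HPi)). Qed.

Lemma tails_neg : (Ineg < +oo)%E -> tails (jump_mass Pi rho (@npart R)).
Proof. exact: (tail_integral_finite HPi kappa_gt kappa_lt cn bn (tail_neg_Tg HPi)). Qed.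

Lemma Vn_infinite : Ineg = +oo%E -> forall M, exists k, M < Vn Pi (2^-1 ^+ k).
Proof.
move=> In; apply: (Vn_unbounded HPi).
exact: (tail_integral_infinite HPi kappa_gt kappa_lt cn bn (tail_neg_Tg HPi) In).
Qed.

(** As [la] tends to 0, so can [A] and the bound: this gives the value 0 when [lambdaJ] is 0, and a
    finite bound as soon as [J] is finite somewhere. *)
Lemma limsup_le_J (A la : R) : (Ipos < +oo)%E -> Ineg = +oo%E -> 0 < la -> (J Pi kappa la < +oo)%E ->
  0 < A -> 2 * la * 2 `^ q <= A * A `^ q -> {ae P, forall w, (L w <= (3 * A / rho)%:E)%E}.
Proof.
move=> Ip In la0 Jf A0 hA; have vu := Vn_infinite In.
apply: (limsup_le_series HX HPi Htr k0 rho0 rho1 hk (tails_pos Ip) vu A0 _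
  (J_finite HPi kappa_gt kappa_lt vu la0 Jf)) => k n.
by apply: rate_f_le => //; rewrite mulr_ge0// ltW.
Qed.

Lemma limsup_ge_J (A la c : R) : (Ipos < +oo)%E -> Ineg = +oo%E -> 0 < la -> J Pi kappa la = +oo%E ->
  0 < A -> 2 * A * (2 * A) `^ q <= la / 2 `^ q -> c < A / 6 -> {ae P, forall w, (c%:E <= L w)%E}.
Proof.
move=> Ip In la0 Ji A0 hA cA; have vu := Vn_infinite In.
apply: (limsup_ge_series HX HPi Htr k0 rho0 rho1 hk (tails_pos Ip) vu A0 cA _
  (J_infinite HPi kappa_gt kappa_lt vu la0 Ji)) => k n.
exact: rate_f_ge.
Qed.

Lemma lambdaJ_lt (c : \bar R) : (lambdaJ Pi kappa < c)%E ->
  exists l : R, [/\ 0 < l, (J Pi kappa l < +oo)%E & (l%:E < c)%E].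
Proof. by move=> /ereal_inf_lt[_ [l [l0 Jl] <-] lc]; exists l. Qed.

Lemma J_below_lambdaJ (l : R) : 0 < l -> (l%:E < lambdaJ Pi kappa)%E -> J Pi kappa l = +oo%E.
Proof.
move=> l0 ll; apply/eqP; rewrite -leye_eq leNgt; apply/negP => Jl; move: ll.
by apply/negP; rewrite -leNgt; apply: ereal_inf_lbound; exists l.
Qed.

Lemma limsup_bounded_J (la : R) : (Ipos < +oo)%E -> Ineg = +oo%E -> 0 < la -> (J Pi kappa la < +oo)%E ->
  exists C : R, {ae P, forall w, (L w <= C%:E)%E}.
Proof.
move=> Ip In la0 Jf; pose A := Order.max 1 (2 * la * 2 `^ q).
have A1 : 1 <= A by rewrite le_max lexx.
have A0 : 0 < A by exact: lt_le_trans A1.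
exists (3 * A / rho); apply: (limsup_le_J Ip In la0 Jf A0).
apply: (@le_trans _ _ A); first by rewrite le_max lexx orbT.
have h : 1 <= A `^ q by rewrite -[leLHS](congr1 (fun f => f q) (@powR1 R)); exact: le_powRq.
by rewrite ler_peMr// ltW.
Qed.

Lemma limsup_top_J (D : R) : (Ipos < +oo)%E -> Ineg = +oo%E -> lambdaJ Pi kappa = +oo%E ->
  {ae P, forall w, (D%:E <= L w)%E}.
Proof.
move=> Ip In lJ; pose A := 6 * `|D| + 6.
have A0 : 0 < A by have := normr_ge0 D; rewrite /A; lra.
pose la := 2 * A * (2 * A) `^ q * 2 `^ q.
have la0 : 0 < la by rewrite !mulr_gt0 ?powR_gt0 ?mulr_gt0.
apply: (limsup_ge_J Ip In la0 _ A0) => //.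
- by apply: J_below_lambdaJ => //; rewrite lJ ltry.
- by rewrite /la mulfK// gt_eqF.
by have := ler_norm D; rewrite /A; lra.
Qed.

Lemma limsup_null_J : (Ipos < +oo)%E -> Ineg = +oo%E -> lambdaJ Pi kappa = 0%E ->
  {ae P, forall w, L w = 0%E}.
Proof.
move=> Ip In lJ; apply: limsup_const => e e0; rewrite ?add0r ?sub0r; last first.
  exact: (limsup_ge_neg HX HPi Htr k0 rho0 rho1 hk (tails_pos Ip) e0).
pose A := e * rho / 3.
have A0 : 0 < A by rewrite divr_gt0// mulr_gt0.
have c0 : 0 < A * A `^ q / (2 * 2 `^ q) by rewrite divr_gt0 ?mulr_gt0 ?powR_gt0.
have [l [l0 Jl lc]] : exists l : R, [/\ 0 < l, (J Pi kappa l < +oo)%E & (l%:E < (A * A `^ q / (2 * 2 `^ q))%:E)%E].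
  by apply: lambdaJ_lt; rewrite lJ lte_fin.
have -> : e = 3 * A / rho by rewrite /A mulrCA divff// mulr1 mulfK// gt_eqF.
apply: (limsup_le_J Ip In l0 Jl A0).
by move: lc; rewrite lte_fin ltr_pdivlMr ?mulr_gt0// => /ltW; rewrite mulrCA mulrA.
Qed.

Lemma limsup_null_both : (Ipos < +oo)%E -> (Ineg < +oo)%E -> {ae P, forall w, L w = 0%E}.
Proof.
move=> Ip In; apply: limsup_const => e e0; rewrite ?add0r ?sub0r.
  exact: (limsup_null_upper HX HPi Htr k0 rho0 rho1 hk (tails_pos Ip) (tails_neg In) e0).
exact: (limsup_ge_neg HX HPi Htr k0 rho0 rho1 hk (tails_pos Ip) e0).
Qed.

(** The constant is the supremum of the almost sure lower bounds, positive by [limsup_ge_J] and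
    finite by [limsup_bounded_J]. Its definition excludes the second alternative of the dichotomy at
    level [sup S + e], which leaves the upper bound. *)
Lemma limsup_positive_J : (Ipos < +oo)%E -> Ineg = +oo%E -> (0 < lambdaJ Pi kappa < +oo)%E ->
  exists c : R, 0 < c /\ {ae P, forall w, L w = c%:E}.
Proof.
move=> Ip In /andP[lJ0 lJy].
have [l1 [l10 Jl1 _]] := lambdaJ_lt lJy; have [C hC] := limsup_bounded_J Ip In l10 Jl1.
have [l l0 ll] : exists2 l : R, 0 < l & (l%:E < lambdaJ Pi kappa)%E.
  move: lJ0 lJy; case: (lambdaJ Pi kappa) => // r; rewrite lte_fin => r0 _.
  by exists (r / 2); rewrite ?lte_fin; lra.
have [c0 c00 hc0] : exists2 c0 : R, 0 < c0 & {ae P, forall w, (c0%:E <= L w)%E}.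
  (* [2 A <= 1], hence [(2 A)^(1 + q) <= 2 A <= l / 2^q]. *)
  pose A := Order.min 1 (l / 2 `^ q) / 2.
  have m0 : 0 < l / 2 `^ q by rewrite divr_gt0.
  have A0 : 0 < A by rewrite divr_gt0// lt_min ltr01 m0.
  exists (A / 12); first by rewrite divr_gt0.
  apply: (limsup_ge_J Ip In l0 (J_below_lambdaJ l0 ll) A0); last by lra.
  have e : 2 * A = Order.min 1 (l / 2 `^ q) by rewrite /A mulrCA divff// mulr1.
  rewrite e; apply: (@le_trans _ _ (Order.min 1 (l / 2 `^ q))); last by rewrite ge_min lexx orbT.
  rewrite ler_piMr//; first by rewrite le_min ler01 ltW.
  rewrite -[leRHS](congr1 (fun f => f q) (@powR1 R)); apply: (le_powRq kappa_gt kappa_lt).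
    by rewrite le_min ler01 ltW.
  by rewrite ge_min lexx.
pose S := [set c : R | {ae P, forall w, (c%:E <= L w)%E}].
have hS : has_sup S.
  split; first by exists c0.
  exists C => c hc; have [w []] := ae_exists (filterI hc hC).
  by move=> h1 h2; rewrite -lee_fin; exact: le_trans h2.
exists (sup S); split; first by apply: (lt_le_trans c00); apply: ub_le_sup => //; case: hS.
apply: limsup_const => e e0; last first.
  have [c hc ce] := sup_adherent e0 hS; apply: filterS hc => w; apply: le_trans.
  by rewrite lee_fin ltW.
have [//|h] := limsup_dichotomy HX (ltW k0) (sup S + e) (levy_cont_in_prob HX HPi Htr).
have he : sup S + e / 2 < sup S + e by lra.
have : sup S + e / 2 <= sup S by apply: ub_le_sup; [case: hS|exact: h he].
by lra.
Qed.

Lemma tail_integrals_finite : (Iboth < +oo)%E -> (Ipos < +oo)%E /\ (Ineg < +oo)%E.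
Proof.
move=> If; split; apply: le_lt_trans If; apply: le_integral_ge0 => x _;
  by rewrite ?measure_ge0// /tail ?leeDl ?leeDr.
Qed.

End limsup_law.

Theorem theorem3p1 (R : realType) (d : measure_display) (T : measurableType d)
    (P : probability T R) (X : R -> T -> R) (gamma : R)
    (Pi : {measure set (measurableTypeR R) -> \bar R}) (kappa : R) :
  levy_process P X -> levy_measure_on_unit Pi -> has_triplet P X gamma 0 Pi ->
  1 / 2 < kappa -> kappa < 1 ->
  let Ipos := (\int[lebesgue_measure]_(x in `]0%R, 1%R])
                 tail_pos Pi (x `^ kappa))%E in
  let Ineg := (\int[lebesgue_measure]_(x in `]0%R, 1%R])
                 tail_neg Pi (x `^ kappa))%E in
  let Iboth := (\int[lebesgue_measure]_(x in `]0%R, 1%R])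
                  tail Pi (x `^ kappa))%E in
  let cond_i := Ipos = +oo%E in
  let cond_ii :=
    [/\ (Ipos < +oo)%E, Ineg = +oo%E & lambdaJ Pi kappa = +oo%E] in
  let cond_iii := (Iboth < +oo)%E in
  let cond_iv := [/\ (Ipos < +oo)%E, Ineg = +oo%E & lambdaJ Pi kappa = 0%E] in
  let cond_v :=
    [/\ (Ipos < +oo)%E, Ineg = +oo%E & (0 < lambdaJ Pi kappa < +oo)%E] in
  [/\ {ae P, forall w, limsup_at0 X kappa w = +oo%E} <-> cond_i \/ cond_ii,
      cond_iii \/ cond_iv -> {ae P, forall w, limsup_at0 X kappa w = 0%E}
    & cond_v -> exists c : R,
        0 < c /\ {ae P, forall w, limsup_at0 X kappa w = c%:E}].
Proof.
move=> HX HPi Htr k1 k2 Ipos Ineg Iboth ci cii ciii civ cv; split.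
- split=> [Ltop|[Ip|[Ip In lJ]]]; last 2 first.
  + by apply: limsup_top => D; apply: (limsup_top_large_jumps HX HPi Htr).
  + by apply: limsup_top => D; apply: (limsup_top_J HX HPi Htr).
  (* For the converse, any finite almost sure bound contradicts an infinite limsup, and each case
     other than (i) and (ii) provides one. *)
  have unb (C : R) : ~ {ae P, forall w, (limsup_at0 X kappa w <= C%:E)%E}.
    by move=> hC; have [w [-> //]] := ae_exists (filterI Ltop hC).
  have [Ip|Ip] := eqVneq Ipos +oo%E; [by left|right].
  have {}Ip : (Ipos < +oo)%E by rewrite ltey.
  have [In|In] := eqVneq Ineg +oo%E; last first.
    have {}In : (Ineg < +oo)%E by rewrite ltey.
    exfalso; apply: (unb 0); apply: filterS (limsup_null_both HX HPi Htr k1 k2 Ip In) => w ->.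
    exact: lexx.
  split => //; apply/eqP/negPn/negP; rewrite -ltey => /lambdaJ_lt[l [l0 Jl _]].
  by have [C /unb] := limsup_bounded_J HX HPi Htr k1 k2 Ip In l0 Jl.
- case=> [If|[Ip In lJ]]; last exact: (limsup_null_J HX HPi Htr k1 k2 Ip In lJ).
  by have [Ip In] := tail_integrals_finite If; exact: (limsup_null_both HX HPi Htr k1 k2 Ip In).
- by case=> Ip In lJ; exact: (limsup_positive_J HX HPi Htr k1 k2 Ip In lJ).
Qed.
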